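(* Consider the unforced Burgers setting described in the context, fix $(\mathbf{x}_\ast,t_\ast)$ with $t_\ast>0$ and let $w(\mathbf{a})=\varphi_0(\mathbf{a})+|\mathbf{a}-\mathbf{x}_\ast|^2/(2t_\ast)$. (i) If $d\in\{1,2,3\}$ and $w\in A_1$, then $\mathbf{x}_\ast\notin S_{t_\ast}$. (ii) If $d\in\{1,2,3\}$ and $w\in A_1^2$, then $\mathbf{x}_\ast$ is a smooth point $A_1^2$ of $S_{t_\ast}$. (iii) If $d\in\{2,3\}$, $w\in A_1^3$ and the three minimum points do not lie on one straight line, then $\mathbf{x}_\ast$ is a singularity $A_1^3$ of $S_{t_\ast}$. (iv) If $d=3$, $w\in A_1^4$ and the four minimum points do not lie in one plane, then $\mathbf{x}_\ast$ is a singularity $A_1^4$ of $S_{t_\ast}$. (v) If $d\in\{2,3\}$, $w\in A_3$ with $\mathbf{C}\neq0$, then $\mathbf{x}_\ast$ is a singularity $A_3$ of $S_{t_\ast}$. (vi) If $d=3$, $w\in A_1A_3$, at the minimum $A_3$ one has $\mathbf{C}\ne0$, and the kernel plane of the minimum $A_3$ does not contain the minimum point $A_1$, then $\mathbf{x}_\ast$ is a singularity $A_1A_3$ of $S_{t_\ast}$.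
   Context: Unforced setting: $\varphi_0$ smooth on $\mathbb{R}^d$; the limit as $\nu\to0$ of the potential solution of $\mathbf{v}_t+(\mathbf{v}\cdot\nabla)\mathbf{v}=\nu\Delta\mathbf{v}$, $\mathbf{v}=\nabla\psi$, $\psi(\cdot,0)=\varphi_0$, is $\varphi(\mathbf{x},t)=\min_{\mathbf{a}}\bigl(\varphi_0(\mathbf{a})+|\mathbf{a}-\mathbf{x}|^2/(2t)\bigr)$. The instant shock $S_t$ is the set of $\mathbf{x}$ near which $\varphi$ (as a function on space-time) is not smooth. Minima: a local minimum of a smooth function on $\mathbb{R}^d$ is of type $A_{2j-1}$ ($j\ge1$) if in some local smooth coordinates the function is $u_1^{2j}+u_2^2+\dots+u_d^2+\mathrm{const}$. The notation $w\in A_1^kA_3^l\cdots$ means that the set of global minimum points of $w$ is finite and consists of $k$ minima of type $A_1$, $l$ of type $A_3$, etc. At an $A_3$ minimum, $w$ can be written in some orthonormal coordinates $(a,\mathbf{b})\in\mathbb{R}\times\mathbb{R}^{d-1}$ centered at the minimum point as $Ka^4+\omega(\mathbf{z})+O_{>4}(a,\mathbf{z})+\mathrm{const}$, where $\mathbf{z}=\mathbf{b}-\mathbf{C}a^2$, $\mathbf{C}\in\mathbb{R}^{d-1}$, $\omega(\mathbf{z})=\sum\omega_iz_i^2$, $K,\omega_i>0$, and $O_{>4}$ denotes terms of weighted order $>4$ with $\deg a=1,\deg\mathbf{z}=2$. If $\mathbf{C}\ne0$, the kernel plane is the plane through the minimum point consisting of the points $(a,s\,\mathbf{C}/|\mathbf{C}|)$,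 $(a,s)\in\mathbb{R}^2$. Singularity types of the instant shock: $\mathbf{x}_\ast$ is a point of type $X$ of $S_{t_\ast}$ if there are smooth local coordinates $(\alpha,\beta,\gamma,\dots)$ on $\mathbb{R}^d$ centered at $\mathbf{x}_\ast$ in which $\varphi(\cdot,t_\ast)$ equals, up to adding a smooth function, the normal form: $A_1^2$: $\min\{\alpha,0\}$; $A_1^3$: $\min\{\alpha,\beta,0\}$; $A_1^4$: $\min\{\alpha,\beta,\gamma,0\}$; $A_3$: $\min_u(u^4+\alpha u^2+\beta u)$; $A_1A_3$: $\min\{\alpha,\min_u(u^4+\beta u^2+\gamma u)\}$. *)

(* Defs.v *)
(* Space R^d is 'rV[R]_(n.+1), d = n+1. *)
From HB Require Import structures.
From mathcomp Require Import all_boot all_order all_algebra.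
From mathcomp Require Import all_classical all_reals all_analysis.
Set Implicit Arguments. Unset Strict Implicit. Unset Printing Implicit Defensive.
Import Order.TTheory GRing.Theory Num.Theory.
Import numFieldNormedType.Exports.
Local Open Scope classical_set_scope.
Local Open Scope ring_scope.

Fixpoint iterD (R : realType) (V W : normedModType R) (vs : seq V) (f : V -> W)
  : V -> W :=
  match vs with
  | [::] => f
  | v :: vs' => fun x => 'D_v (iterD vs' f) x
  end.

Definition smooth_on (R : realType) (V W : normedModType R) (U : set V) (f : V -> W) :=
  open U /\
  forall vs : seq V, forall x, U x ->
    {for x, continuous (iterD vs f)} /\ (forall v, derivable (iterD vs f) x v).

Definition smooth_at (R : realType) (V W : normedModType R) (x : V) (f : V -> W) :=
  exists U : set V, U x /\ smooth_on U f.

Definition local_coords (R : realType) (V : normedModType R) (h : V -> V) (x0 : V) :=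
  exists (U W : set V) (g : V -> V),
    U x0 /\ h x0 = 0 /\ smooth_on U h /\ smooth_on W g /\
    (forall x, U x -> W (h x) /\ g (h x) = x) /\
    (forall y, W y -> U (g y) /\ h (g y) = y).

Definition sqdist (R : realType) (n : nat) (a x : 'rV[R]_n.+1) : R :=
  \sum_(i < n.+1) (a ord0 i - x ord0 i) ^+ 2.

Definition orthogonal_mx (R : realType) (n : nat) (Q : 'M[R]_n.+1) :=
  Q *m Q^T = 1%:M.

Definition burgers_phi (R : realType) (n : nat) (phi0 : 'rV[R]_n.+1 -> R)
  (x : 'rV[R]_n.+1) (t : R) : R :=
  inf [set phi0 a + sqdist a x / (2 * t) | a in [set: 'rV[R]_n.+1]].

Definition in_shock (R : realType) (n : nat) (phi0 : 'rV[R]_n.+1 -> R)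
  (x : 'rV[R]_n.+1) (t : R) : Prop :=
  ~ smooth_at (x, t) (fun p : 'rV[R]_n.+1 * R => burgers_phi phi0 p.1 p.2).

Definition glob_minset (R : realType) (n : nat) (w : 'rV[R]_n.+1 -> R) :=
  [set a | forall b, w a <= w b].

(* p is a minimum of type A_{2j-1}: in local smooth coordinates u centered at
   p, w = u_1^{2j} + u_2^2 + ... + u_d^2 + const near p. *)
Definition min_type_A (R : realType) (n : nat) (j : nat) (w : 'rV[R]_n.+1 -> R)
  (p : 'rV[R]_n.+1) :=
  exists h : 'rV[R]_n.+1 -> 'rV[R]_n.+1, local_coords h p /\
    \forall a \near p,
      w a = (h a ord0 ord0) ^+ (2 * j) +
            \sum_(i < n.+1 | i != ord0) (h a ord0 i) ^+ 2 + w p.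

(* The A_3 normal expansion in orthonormal coordinates (a, b) centered at p:
   (a, b) = (x - p) *m Q (first entry a, remaining entries b),
   z = b - C a^2 (C has zero first entry),
   w = K a^4 + sum_i om_i z_i^2 + O_{>4}(a,z) + w p,
   where O_{>4} (weights deg a = 1, deg z = 2) is expressed by the bound
   |O| <= M' (|a|^5 + |z|^{5/2}), written polynomially as
   O^4 <= M (a^20 + |z|^10). *)
Definition A3_form (R : realType) (n : nat) (w : 'rV[R]_n.+1 -> R)
  (p : 'rV[R]_n.+1) (Q : 'M[R]_n.+1) (C : 'rV[R]_n.+1) :=
  orthogonal_mx Q /\ C ord0 ord0 = 0 /\
  exists (K : R) (om : 'rV[R]_n.+1) (M : R),
    0 < K /\ (forall i : 'I_n.+1, i != ord0 -> 0 < om ord0 i) /\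
    \forall x \near p,
      let y := (x - p) *m Q in
      let a := y ord0 ord0 in
      let z := fun i : 'I_n.+1 => y ord0 i - C ord0 i * a ^+ 2 in
      let O := w x - (K * a ^+ 4 + \sum_(i < n.+1 | i != ord0) om ord0 i * z i ^+ 2
                      + w p) in
      O ^+ 4 <= M * (a ^+ 20 + (\sum_(i < n.+1 | i != ord0) z i ^+ 2) ^+ 5).

Definition kernel_plane (R : realType) (n : nat) (p : 'rV[R]_n.+1)
  (Q : 'M[R]_n.+1) (C : 'rV[R]_n.+1) : set 'rV[R]_n.+1 :=
  [set x | exists l m : R,
     x = p + (l *: (\row_(i < n.+1) (i == ord0)%:R) + m *: C) *m Q^T].

Definition not_collinear (R : realType) (n : nat) (p1 p2 p3 : 'rV[R]_n.+1) :=
  forall l m : R, l *: (p2 - p1) + m *: (p3 - p1) = 0 -> l = 0 /\ m = 0.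

Definition not_coplanar (R : realType) (n : nat) (p1 p2 p3 p4 : 'rV[R]_n.+1) :=
  forall l m k : R,
    l *: (p2 - p1) + m *: (p3 - p1) + k *: (p4 - p1) = 0 -> [/\ l = 0, m = 0 & k = 0].

Definition qmin (R : realType) (al be : R) : R :=
  inf [set u ^+ 4 + al * u ^+ 2 + be * u | u in [set: R]].

Definition rcoord (R : realType) (n : nat) (y : 'rV[R]_n.+1) (k : nat) : R :=
  y ord0 (inord k).

Definition shock_point_type (R : realType) (n : nat) (phi0 : 'rV[R]_n.+1 -> R)
  (N : 'rV[R]_n.+1 -> R) (x0 : 'rV[R]_n.+1) (t : R) :=
  exists (h : 'rV[R]_n.+1 -> 'rV[R]_n.+1) (s : 'rV[R]_n.+1 -> R),
    local_coords h x0 /\ smooth_at x0 s /\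
    \forall x \near x0, burgers_phi phi0 x t = N (h x) + s x.

Definition NF_A1_2 (R : realType) (n : nat) (y : 'rV[R]_n.+1) : R :=
  Num.min (rcoord y 0) 0.
Definition NF_A1_3 (R : realType) (n : nat) (y : 'rV[R]_n.+1) : R :=
  Num.min (rcoord y 0) (Num.min (rcoord y 1) 0).
Definition NF_A1_4 (R : realType) (n : nat) (y : 'rV[R]_n.+1) : R :=
  Num.min (rcoord y 0) (Num.min (rcoord y 1) (Num.min (rcoord y 2) 0)).
Definition NF_A3 (R : realType) (n : nat) (y : 'rV[R]_n.+1) : R :=
  qmin (rcoord y 0) (rcoord y 1).
Definition NF_A1A3 (R : realType) (n : nat) (y : 'rV[R]_n.+1) : R :=
  Num.min (rcoord y 0) (qmin (rcoord y 1) (rcoord y 2)).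

(* Main.v *)
Require Import Defs.
From HB Require Import structures.
From mathcomp Require Import all_boot all_order all_algebra.
From mathcomp Require Import all_classical all_reals all_analysis.
From mathcomp Require Import ring lra.
Import Order.TTheory GRing.Theory Num.Theory.
Import numFieldNormedType.Exports.
Local Open Scope classical_set_scope.
Local Open Scope ring_scope.

(* Near an A_1 minimum of w the implicit function theorem follows the minimizer of the action smoothly in (x, t),
   and the differential of its value in x is -(p - x)/t; phi is the least of these smooth branches, and the
   hypotheses on the position of the minimum points make the differences of the branches independent functions.

   At an A_3 minimum, eliminating the quadratic coordinates leaves a germ G(a, y) of one variable a with
   G(a, 0) = a^4, which a shift and a dilation of a bring to a^4 h(a, y)^4 + y_1 a^2 + y_2 a with h = 1 at a = 0.
   Modulo every power of the ideal (y_1, y_2) this is U^4 + al U^2 + be U + s for suitable series U, al, be, s,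
   which a Borel summation turns into smooth functions.  In the weighted blow-up y_1 = r^2 P, y_2 = r^3 Q
   the minimizers over each half line depend smoothly on (r, P, Q), so the value functions differ from those of
   the quartic by functions flat at r = 0.  A flat change of be balances the two minima near the Maxwell sector, after
   which the minimal values differ by a flat smooth function, absorbed into s; flat smooth functions
   upstairs come from smooth functions downstairs.  Finally the expansion of w along the quartic coordinate curve
   t |-> p + t g_1 + t^2 e(t) forces g_1 to be the kernel direction and e(0) to have transversal part r^2 C, so that
   C <> 0 makes d al and d be independent, and the kernel plane condition says that the A_1 branch is
   independent of them. *)

(** A preparation theorem would put the germ itself in normal form. Less is needed, since only
    minimal values enter the conclusion: the coordinate U is therefore never summed, a different one
    is used at each finite order, and what it misses shows up as a flat error of the value. The
    obstacle is the Maxwell set, close to the half line y_2 = 0, y_1 < 0, where both value functions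
    have a corner. Two such functions may be flat-close and still have a non-smooth difference when
    their corners lie at different places, so the corners are first brought together by changing be,
    and only then is the difference moved into s. The weights 2 and 3 make a^4 + y_1 a^2 + y_2 a
    quasi-homogeneous: at r = 0 the rescaled problem is an exact quartic whose parameters run over a
    compact curve. The two competing minima are separated by the sign of a, which is why minima over
    half lines are studied. A derivative downstairs costs powers of 1/r, and flatness pays for any
    number of them. *)

Set Implicit Arguments. Unset Strict Implicit. Unset Printing Implicit Defensive.

(** * Smooth functions in coordinates *)

Section Near.
Variable T : topologicalType.
Implicit Types x : T.

Lemma near_open x (P : T -> Prop) :
  (\forall y \near x, P y) -> exists U, [/\ open U, U x & forall y, U y -> P y].
Proof. by rewrite -nbhs_nearE nbhsE => -[U [oU Ux] UP]; exists U. Qed.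

Lemma near_all x (I : finType) (P : I -> T -> Prop) :
  (forall i, \forall y \near x, P i y) -> \forall y \near x, forall i, P i y.
Proof. by move=> H; apply: (@filter_forall _ _ P (nbhs x) _ H). Qed.

Lemma near_preim (S : topologicalType) (f : T -> S) x (P : S -> Prop) :
  {for x, continuous f} -> (\forall z \near f x, P z) -> \forall y \near x, P (f y).
Proof. by move=> cf; exact: cf. Qed.

Lemma open_near (U : set T) x : open U -> U x -> \forall y \near x, U y.
Proof. by move=> oU Ux; exact: open_nbhs_nbhs. Qed.

Lemma near_and x (P Q : T -> Prop) : (\forall y \near x, P y) -> (\forall y \near x, Q y) ->
  \forall y \near x, P y /\ Q y.
Proof. exact: filterI. Qed.

Lemma near_cts (S : topologicalType) (f g : T -> S) x :
  {near x, f =1 g} -> {for x, continuous f} -> {for x, continuous g}.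
Proof.
move=> fg cf; rewrite /prop_for /continuous_at -(nbhs_singleton fg).
apply: cvg_trans cf.
exact: (@near_eq_cvg _ _ (nbhs x) _ f g fg).
Qed.

End Near.

Section Partials.
Variables (R : realType) (m : nat).
Implicit Types (f g : 'rV[R]_m -> R) (x y : 'rV[R]_m).

Definition ev (i : 'I_m) : 'rV[R]_m := delta_mx ord0 i.
Definition pd (i : 'I_m) f : 'rV[R]_m -> R := fun x => 'D_(ev i) f x.
Definition pds (s : seq 'I_m) f : 'rV[R]_m -> R := foldr pd f s.

Definition regular_at f y := forall s,
  {for y, continuous (pds s f)} /\ forall i, derivable (pds s f) y (ev i).
(* An inductive wrapper, so that unification never unfolds it. *)
Variant sm x f : Prop := Sm of (\forall y \near x, regular_at f y).

Lemma smE x f : sm x f <-> \forall y \near x, regular_at f y.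
Proof. by split=> [[]|/Sm]. Qed.

Lemma ev_coord i j : ev i ord0 j = (j == i)%:R.
Proof. by rewrite /ev mxE eqxx. Qed.

Lemma pds_cat s1 s2 f : pds (s1 ++ s2) f = pds s1 (pds s2 f).
Proof. by rewrite /pds foldr_cat. Qed.

Lemma sm_near x f : sm x f -> \forall y \near x, sm y f.
Proof. by case=> /nbhs_interior; apply: filterS => y /Sm. Qed.

Lemma sm_self x f : sm x f -> regular_at f x.
Proof. by case=> /nbhs_singleton. Qed.

Lemma sm_pds x f s : sm x f -> sm x (pds s f).
Proof.
by case=> fx; apply: Sm; move: fx; apply: filterS => y fy s'; rewrite -pds_cat; exact: fy.
Qed.

Lemma sm_pd x f i : sm x f -> sm x (pd i f).
Proof. exact: (@sm_pds _ _ [:: i]). Qed.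

Lemma sm_cts x f : sm x f -> {for x, continuous f}.
Proof. by move=> /sm_self /(_ [::]) []. Qed.

Lemma sm_derive x f i : sm x f -> is_derive x (ev i) f (pd i f x).
Proof. by move=> /sm_self /(_ [::]) [_ fx]; split. Qed.

Lemma near_pds x f g s : {near x, f =1 g} -> {near x, pds s f =1 pds s g}.
Proof.
move=> fg; elim: s => //= i s IH.
by move/nbhs_interior : IH; apply: filterS => y fgy; exact: near_eq_derive.
Qed.

Lemma sm_ext x f g : {near x, f =1 g} -> sm x f -> sm x g.
Proof.
move=> fg [fx]; apply: Sm; near=> y.
have fgy : {near y, f =1 g} by near: y; exact: nbhs_interior.
have fy : regular_at f y by near: y.
move=> s; have [cf df] := fy s; have h := near_pds s fgy; split=> [|i].
  exact: near_cts h cf.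
exact: near_eq_derivable (df i).
Unshelve. all: by end_near. Qed.

(** A family of continuous functions closed under partial derivatives certifies the smoothness of
    all its members: by induction every iterated partial agrees on U with a member. Most smoothness
    proofs below consist in exhibiting such a family. *)
Lemma sm_coind (U : set 'rV[R]_m) (F : ('rV[R]_m -> R) -> Prop) :
  open U -> (forall f, F f -> forall x, U x -> {for x, continuous f}) ->
  (forall f i, F f -> exists2 g, F g & forall x, U x -> is_derive x (ev i) f (g x)) ->
  forall f x, F f -> U x -> sm x f.
Proof.
move=> oU cF dF f x Ff Ux.
have key s : exists2 g, F g & forall y, U y -> pds s f y = g y.
  elim: s => [|i s [g Fg gE]]; first by exists f.
  have [g' Fg' g'E] := dF g i Fg; exists g' => // y Uy /=.
  have [_ <-] := g'E y Uy.
  by apply: near_eq_derive; near=> z; apply: gE; near: z; exact: open_nbhs_nbhs.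
apply: Sm; near=> y; have Uy : U y by near: y; exact: open_nbhs_nbhs.
move=> s; have [g Fg gE] := key s.
have h : {near y, g =1 pds s f}.
  by near=> z; apply/esym/gE; near: z; exact: open_nbhs_nbhs.
split=> [|i].
  exact: near_cts h (cF _ Fg _ Uy).
have [g' Fg' g'E] := dF g i Fg.
by apply: near_eq_derivable h _; have [] := g'E y Uy.
Unshelve. all: by end_near. Qed.

Inductive alg (G : ('rV[R]_m -> R) -> Prop) : ('rV[R]_m -> R) -> Prop :=
| alg_gen f : G f -> alg G f
| alg_cst c : alg G (fun=> c)
| alg_add f g : alg G f -> alg G g -> alg G (fun x => f x + g x)
| alg_mul f g : alg G f -> alg G g -> alg G (fun x => f x * g x).

Lemma alg_sum (G : ('rV[R]_m -> R) -> Prop) (I : Type) (r : seq I) (P : pred I) (F : I -> 'rV[R]_m -> R) :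
  (forall i, P i -> alg G (F i)) -> alg G (fun x => \sum_(i <- r | P i) F i x).
Proof.
move=> GF; elim: r => [|i r IH].
  by under eq_fun do rewrite big_nil; exact: alg_cst.
have [Pi|/negPf Pi] := boolP (P i); under eq_fun do rewrite big_cons Pi; last exact: IH.
exact: alg_add (GF _ Pi) IH.
Qed.

Lemma is_deriveDf x v f g (df dg : R) : is_derive x v f df -> is_derive x v g dg ->
  is_derive x v (fun y => f y + g y) (df + dg).
Proof. by move=> hf hg; exact: is_deriveD. Qed.

Lemma is_derive_cstf x v (c : R) : is_derive x v (fun=> c) 0.
Proof. exact: is_derive_cst. Qed.

Lemma is_deriveMf x v f g (df dg : R) : is_derive x v f df -> is_derive x v g dg ->
  is_derive x v (fun y => f y * g y) (f x * dg + g x * df).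
Proof. by move=> hf hg; exact: is_deriveM. Qed.

(** Chain and product rules yield sums of products of known functions, so the closed family is the
    algebra spanned by G. By Leibniz only the generators have to be differentiated. *)
Lemma sm_alg (U : set 'rV[R]_m) (G : ('rV[R]_m -> R) -> Prop) :
  open U -> (forall f, G f -> forall x, U x -> {for x, continuous f}) ->
  (forall f i, G f -> exists2 g, alg G g & forall x, U x -> is_derive x (ev i) f (g x)) ->
  forall f x, alg G f -> U x -> sm x f.
Proof.
move=> oU cG dG; apply: sm_coind => // [f|f i].
  elim => {f} [f Gf|c|f g _ IHf _ IHg|f g _ IHf _ IHg] x Ux.
  - exact: cG.
  - exact: cst_continuous.
  - by apply: (@continuousD _ _ _ f g); [exact: IHf|exact: IHg].
  - by apply: (@continuousM _ _ f g); [exact: IHf|exact: IHg].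
elim => {f} [f Gf|c|f g _ [f' Gf' hf] Gg [g' Gg' hg]|f g Gf [f' Gf' hf] Gg [g' Gg' hg]].
- exact: dG.
- by exists (fun=> 0); [exact: alg_cst|move=> x _; exact: is_derive_cst].
- exists (fun x => f' x + g' x); first exact: alg_add.
  by move=> x Ux; apply: is_deriveDf; [exact: hf|exact: hg].
- exists (fun x => f x * g' x + g x * f' x).
    by apply: alg_add; exact: alg_mul.
  by move=> x Ux; apply: is_deriveMf; [exact: hf|exact: hg].
Qed.

Lemma sm_open x f : sm x f -> exists U, [/\ open U, U x & forall y, U y -> sm y f].
Proof.
move=> fx; have := sm_near fx; rewrite -nbhs_nearE nbhsE /= => -[U [oU Ux] Uf].
by exists U.
Qed.

Lemma sm_cst x (c : R) : sm x (fun=> c).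
Proof.
apply: (@sm_alg setT (fun=> False)) => //; first exact: openT.
exact: alg_cst.
Qed.

Lemma sm_arith x f g : sm x f -> sm x g -> sm x (fun y => f y + g y) /\ sm x (fun y => f y * g y).
Proof.
move=> /sm_open[U [oU Ux Uf]] /sm_open[V [oV Vx Vg]].
have H : forall h z, alg (fun k => exists s, k = pds s f \/ k = pds s g) h -> (U `&` V) z -> sm z h.
  apply: sm_alg; first exact: openI.
    by move=> _ [s [->|->]] z [Uz Vz]; apply/sm_cts/sm_pds; [exact: Uf|exact: Vg].
  move=> _ i [s [->|->]].
    exists (pds (i :: s) f); first by apply: alg_gen; exists (i :: s); left.
    by move=> z [Uz Vz]; apply/sm_derive/sm_pds; exact: Uf.
  exists (pds (i :: s) g); first by apply: alg_gen; exists (i :: s); right.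
  by move=> z [Uz Vz]; apply/sm_derive/sm_pds; exact: Vg.
have Gf : alg (fun k => exists s, k = pds s f \/ k = pds s g) f by apply: alg_gen; exists [::]; left.
have Gg : alg (fun k => exists s, k = pds s f \/ k = pds s g) g by apply: alg_gen; exists [::]; right.
by split; apply: H => //; [exact: alg_add|exact: alg_mul].
Qed.

Lemma smD x f g : sm x f -> sm x g -> sm x (fun y => f y + g y).
Proof. by move=> fx gx; have [] := sm_arith fx gx. Qed.

Lemma smM x f g : sm x f -> sm x g -> sm x (fun y => f y * g y).
Proof. by move=> fx gx; have [] := sm_arith fx gx. Qed.

Lemma smN x f : sm x f -> sm x (fun y => - f y).
Proof.
move=> fx; apply: sm_ext (smM (sm_cst x (-1)) fx).
by near=> y; rewrite mulN1r.
Unshelve. all: by end_near. Qed.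

Lemma smB x f g : sm x f -> sm x g -> sm x (fun y => f y - g y).
Proof. by move=> fx gx; exact: (smD fx (smN gx)). Qed.

Lemma pd_near i x f g : {near x, f =1 g} -> pd i f x = pd i g x.
Proof. by move=> fg; exact: near_eq_derive. Qed.

Lemma pdD i x f g : sm x f -> sm x g -> pd i (fun y => f y + g y) x = pd i f x + pd i g x.
Proof. by move=> fx gx; case: (is_deriveDf (sm_derive i fx) (sm_derive i gx)). Qed.

Lemma pdM i x f g : sm x f -> sm x g ->
  pd i (fun y => f y * g y) x = f x * pd i g x + g x * pd i f x.
Proof. by move=> fx gx; case: (is_deriveMf (sm_derive i fx) (sm_derive i gx)). Qed.

Lemma pd_cst i x (c : R) : pd i (fun=> c) x = 0.
Proof. by case: (is_derive_cstf x (ev i) c). Qed.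

Lemma pdZ i x f (c : R) : sm x f -> pd i (fun y => c * f y) x = c * pd i f x.
Proof. by move=> fx; rewrite pdM ?pd_cst ?mulr0 ?addr0//; exact: sm_cst. Qed.

Lemma pdN i x f : sm x f -> pd i (fun y => - f y) x = - pd i f x.
Proof.
move=> fx; have -> : (fun y => - f y) = (fun y => -1 * f y).
  by apply/funext => y; rewrite mulN1r.
by rewrite pdZ// mulN1r.
Qed.

Lemma pdB i x f g : sm x f -> sm x g -> pd i (fun y => f y - g y) x = pd i f x - pd i g x.
Proof. by move=> fx gx; rewrite (pdD i fx (smN gx)) pdN. Qed.

Lemma smX x f k : sm x f -> sm x (fun y => f y ^+ k).
Proof.
move=> fx; elim: k => [|k IH]; first exact: sm_cst.
by under eq_fun do rewrite exprS; exact: smM.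
Qed.

Lemma sm_sum x (I : Type) (r : seq I) (P : pred I) (F : I -> 'rV[R]_m -> R) :
  (forall i, P i -> sm x (F i)) -> sm x (fun y => \sum_(i <- r | P i) F i y).
Proof.
move=> GF; elim: r => [|i r IH].
  by under eq_fun do rewrite big_nil; exact: sm_cst.
have [Pi|/negPf Pi] := boolP (P i); under eq_fun do rewrite big_cons Pi; last exact: IH.
exact: smD (GF _ Pi) IH.
Qed.

Lemma pd_sum i x (I : Type) (r : seq I) (P : pred I) (F : I -> 'rV[R]_m -> R) :
  (forall k, P k -> sm x (F k)) ->
  pd i (fun y => \sum_(k <- r | P k) F k y) x = \sum_(k <- r | P k) pd i (F k) x.
Proof.
move=> GF; elim: r => [|k r IH].
  by under eq_fun do rewrite big_nil; rewrite big_nil pd_cst.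
have [Pk|/negPf Pk] := boolP (P k); rewrite big_cons Pk; under eq_fun do rewrite big_cons Pk.
  by rewrite pdD; [rewrite IH|exact: GF|exact: sm_sum].
exact: IH.
Qed.

Lemma sm_prod x (I : Type) (r : seq I) (P : pred I) (F : I -> 'rV[R]_m -> R) :
  (forall i, P i -> sm x (F i)) -> sm x (fun y => \prod_(i <- r | P i) F i y).
Proof.
move=> GF; elim: r => [|i r IH].
  by under eq_fun do rewrite big_nil; exact: sm_cst.
have [Pi|/negPf Pi] := boolP (P i); under eq_fun do rewrite big_cons Pi; last exact: IH.
exact: smM (GF _ Pi) IH.
Qed.

Lemma coord_derive x v i : is_derive x v (fun y : 'rV[R]_m => y ord0 i) (v ord0 i).
Proof.
apply: DeriveDef.
  exact/diff_derivable/differentiable_coord.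
have /derive_mx /(congr1 (fun M : 'rV[R]_m => M ord0 i)) : derivable (@id 'rV[R]_m) x v by exact: derivable_id.
by rewrite derive_id mxE.
Qed.

Lemma pd_coord i x j : pd i (fun y : 'rV[R]_m => y ord0 j) x = (j == i)%:R.
Proof. by rewrite -ev_coord; case: (coord_derive x (ev i) j). Qed.

Lemma sm_coord x i : sm x (fun y => y ord0 i).
Proof.
apply: (@sm_alg setT (fun k => k = fun y => y ord0 i)) => //; first exact: openT.
- by move=> _ -> y _; exact: coord_continuous.
- move=> _ j ->; exists (fun=> (i == j)%:R); first exact: alg_cst.
  by move=> y _; rewrite -ev_coord; exact: coord_derive.
- exact: alg_gen.
Qed.

(* The mean value theorem turns a bound on the derivative along the segment from 0 to s
   into a bound on the increment, whatever the sign of s. *)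
Lemma mvt_increment (phi dphi : R -> R) (s c e : R) :
  (forall t : R, `|t| <= `|s| -> is_derive t 1 phi (dphi t) /\ `|dphi t - c| <= e) ->
  `|phi s - phi 0 - s * c| <= e * `|s|.
Proof.
move=> H.
have e0 : 0 <= e by have [_] := H 0 (ltac:(by rewrite normr0)); exact: le_trans.
have cphi t : `|t| <= `|s| -> {for t, continuous phi}.
  by move=> /H[[d _] _]; exact/differentiable_continuous/derivable1_diffP.
have aux a b : a < b -> (forall t, a <= t <= b -> `|t| <= `|s|) ->
    `|phi b - phi a - (b - a) * c| <= e * (b - a).
  move=> ab Hab.
  have [||t tab ->] := @MVT _ phi dphi a b ab.
  - by move=> t; rewrite in_itv/= => /andP[/ltW at_ /ltW tb]; have [] := H t (Hab t _); rewrite ?at_ ?tb.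
  - apply: continuous_in_subspaceT => t; rewrite inE/= in_itv/= => /Hab; exact: cphi.
  - have ba0 : 0 <= b - a by rewrite subr_ge0 ltW.
    rewrite [(b - a) * c]mulrC -mulrBl normrM (ger0_norm ba0) ler_wpM2r//.
    have [] := H t (Hab t _) => //.
    by move: tab; rewrite in_itv/= => /andP[/ltW -> /ltW ->].
have [s0|s0|->] := ltgtP s 0.
- have := aux s 0 s0 _; rewrite !sub0r ltr0_norm//.
  have -> : phi 0 - phi s - - s * c = - (phi s - phi 0 - s * c) by ring.
  rewrite normrN; apply=> t /andP[st t0].
  by rewrite ler_norml opprK st (le_trans t0)// oppr_ge0 ltW.
- have := aux 0 s s0 _; rewrite !subr0 gtr0_norm//; apply=> t /andP[t0 ts].
  by rewrite ger0_norm.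
- by rewrite !subrr mul0r subr0 normr0 mulr0.
Qed.

Lemma coord_le x i : `|x ord0 i| <= `|x|.
Proof.
rewrite [leRHS]/Num.Def.normr /= mx_normrE.
exact: (le_bigmax _ (fun ij : 'I_1 * 'I_m => `|x ij.1 ij.2|) (ord0, i)).
Qed.

Lemma norm_le_coord x (e : R) : 0 <= e -> (forall i, `|x ord0 i| <= e) -> `|x| <= e.
Proof.
move=> e0 H; rewrite [leLHS]/Num.Def.normr /= mx_normrE.
by apply: bigmax_le => //= -[i j] _ /=; rewrite ord1.
Qed.

Lemma norm_lt_coord x (e : R) : 0 < e -> (forall i, `|x ord0 i| < e) -> `|x| < e.
Proof.
move=> e0 H; rewrite [ltLHS]/Num.Def.normr /= mx_normrE.
by apply: bigmax_lt => //= -[i j] _ /=; rewrite ord1.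
Qed.

Definition dirsum f x (v : 'rV[R]_m) : R := \sum_i v ord0 i * pd i f x.

Lemma dirsum_linear f x : linear (dirsum f x).
Proof.
move=> a u v; rewrite /dirsum scaler_sumr -big_split/=.
by apply: eq_bigr => i _; rewrite !mxE mulrDl scalerAl.
Qed.

HB.instance Definition _ f x := GRing.isLinear.Build R 'rV[R]_m R _ (dirsum f x) (dirsum_linear f x).

Lemma dirsum_cts f x : continuous (dirsum f x).
Proof.
move=> v; apply/sm_cts/sm_sum => i _; apply: smM; [exact: sm_coord|exact: sm_cst].
Qed.

Lemma line_derive f x v (t : R) (d : R) : is_derive (x + t *: v) v f d ->
  is_derive t 1 (fun s : R => f (x + s *: v)) d.
Proof.
have E : (fun h : R => h^-1 *: (((fun s : R => f (x + s *: v)) \o shift t) (h *: 1) - f (x + t *: v)))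
  = (fun h => h^-1 *: ((f \o shift (x + t *: v)) (h *: v) - f (x + t *: v))).
  apply/funext => h /=; congr (_ *: (f _ - _)).
  by rewrite [h *: 1]mulr1 scalerDl addrCA.
by move=> [d1 d2]; split; [rewrite /derivable E|rewrite /derive E].
Qed.

(** The increment is telescoped over the points [u k], which share the first k coordinates of v:
    every edge is parallel to an axis, where the mean value theorem needs a partial derivative only.
    The tolerance is split evenly among the coordinates. *)
Lemma c1_expand f x : (\forall y \near x, forall i, derivable f y (ev i)) ->
  (forall i, {for x, continuous (pd i f)}) ->
  forall e : R, 0 < e -> \forall v \near (0 : 'rV[R]_m),
   `|f (x + v) - f x - dirsum f x v| <= e * `|v|.
Proof.
move=> dfx cfx e e0.
pose e' := e / m.+1%:R.
have e'0 : 0 < e' by rewrite divr_gt0.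
have H : \forall y \near x, forall i, derivable f y (ev i) /\ `|pd i f y - pd i f x| <= e'.
  suff : forall i, \forall y \near x, derivable f y (ev i) /\ `|pd i f y - pd i f x| <= e'.
    by move=> h; apply: (@filter_forall _ _ (fun i y => derivable f y (ev i) /\ `|pd i f y - pd i f x| <= e') (nbhs x) _ h).
  move=> i.
  have ci : \forall y \near x, `|pd i f x - pd i f y| <= e'.
    by have /cvgrPdist_le /(_ _ e'0) := cfx i.
  move: dfx ci; apply: filterS2 => y dy cy; split; first exact: dy.
  by rewrite distrC.
have /nbhs_ballP[r /= r0 Hr] := H.
apply/nbhs_ballP; exists r => //= v; rewrite -ball_normE/= sub0r normrN => vr.
pose u k : 'rV[R]_m := \row_j (if (j < k)%N then v ord0 j else 0).
have u0 : u 0%N = 0 by apply/rowP => j; rewrite !mxE.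
have um : u m = v by apply/rowP => j; rewrite !mxE ltn_ord.
have uS (i : 'I_m) : u i.+1 = u i + v ord0 i *: ev i.
  apply/rowP => j; rewrite !mxE eqxx/= ltnS leq_eqVlt.
  have [->|ji] := eqVneq j i; first by rewrite eqxx/= ltnn mulr1 add0r.
  by rewrite (negPf (ji : (j : nat) != i)) /= mulr0 addr0.
have step (i : 'I_m) : `|f (x + u i.+1) - f (x + u i) - v ord0 i * pd i f x| <= e' * `|v|.
  rewrite uS addrA.
  apply: (@le_trans _ _ (e' * `|v ord0 i|)); last by apply: ler_wpM2l; [exact: ltW|exact: coord_le].
  have := @mvt_increment (fun t => f (x + u i + t *: ev i)) (fun t => pd i f (x + u i + t *: ev i)) (v ord0 i) (pd i f x) e'.
  rewrite scale0r addr0; apply=> t tv.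
  have /Hr/(_ i)[d b] : ball x r (x + u i + t *: ev i).
    rewrite -ball_normE/= -addrA opprD addrA subrr add0r normrN.
    apply: (le_lt_trans _ vr); apply: norm_le_coord => // j; rewrite !mxE eqxx/=.
    have [->|ji] := eqVneq j i.
      by rewrite ltnn add0r mulr1 (le_trans tv)// coord_le.
    by rewrite mulr0 addr0; case: ifP => _; rewrite ?normr0 ?coord_le.
  by split; [exact/line_derive/derivableP|exact: b].
have -> : f (x + v) - f x = \sum_(i < m) (f (x + u i.+1) - f (x + u i)).
  rewrite -(big_mkord xpredT (fun i => f (x + u i.+1) - f (x + u i))).
  by rewrite telescope_sumr// um u0 addr0.
rewrite /dirsum -sumrB (le_trans (ler_norm_sum _ _ _))//.
apply: (@le_trans _ _ (\sum_(i < m) e' * `|v|)); first exact: ler_sum.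
rewrite sumr_const card_ord -mulr_natl mulrA ler_wpM2r// /e' mulrCA ger_pMr//.
by rewrite ler_pdivrMr// mul1r ler_nat.
Qed.

Lemma c1_differentiable f x : (\forall y \near x, forall i, derivable f y (ev i)) ->
  (forall i, {for x, continuous (pd i f)}) ->
  differentiable f x /\ 'd f x = dirsum f x :> ('rV[R]_m -> R).
Proof.
move=> dfx cfx.
have E : f \o shift x = cst (f x) + dirsum f x +o_ (0 : 'rV[R]_m) id.
  apply/eqaddoP => e e0; near=> v.
  rewrite [X in `|X|](_ : _ = f (x + v) - f x - dirsum f x v).
    by near: v; exact: c1_expand.
  by rewrite /= !fctE/= opprD [v + x]addrC addrA.
have dE := diff_unique (@dirsum_cts f x) E.
split=> //; apply/diff_locallyP; rewrite dE; split=> //; exact: dirsum_cts.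
Unshelve. all: by end_near. Qed.

Lemma sm_diff x f : sm x f -> differentiable f x /\ 'd f x = dirsum f x :> ('rV[R]_m -> R).
Proof.
move=> fx; apply: c1_differentiable.
  by case: fx; apply: filterS => y /(_ [::])[].
by move=> i; exact/sm_cts/sm_pd.
Qed.

Lemma sm_dir x f v : sm x f -> is_derive x v f (dirsum f x v).
Proof.
move=> /sm_diff[d dE]; split; first exact: diff_derivable.
by rewrite deriveE// dE.
Qed.

End Partials.

(** * Composition and reciprocals of smooth functions *)

Section Composition.
Variable R : realType.

Lemma row_cts (V : normedModType R) k (h : V -> 'rV[R]_k) (x : V) :
  (forall j, {for x, continuous (fun y => h y ord0 j)}) -> {for x, continuous h}.
Proof.
move=> ch; apply/cvgrPdist_lt => e e0.
have H j : \forall y \near x, `|h x ord0 j - h y ord0 j| < e.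
  by have /cvgrPdist_lt /(_ _ e0) := ch j.
move: (near_all H); apply: filterS => y Hy; apply: norm_lt_coord => // j.
by rewrite !mxE; exact: Hy.
Qed.

Lemma cts_dist (V W : normedModType R) (f : V -> W) (x : V) :
  (forall e : R, 0 < e -> \forall y \near x, `|f x - f y| <= e) -> {for x, continuous f}.
Proof. by move=> H; apply/cvgrPdist_le. Qed.

Lemma dist_cts (V W : normedModType R) (f : V -> W) (x : V) (e : R) :
  {for x, continuous f} -> 0 < e -> \forall y \near x, `|f x - f y| <= e.
Proof. by move=> /cvgrPdist_le H e0; exact: H. Qed.

Lemma line_is_derive (V W : normedModType R) (f : V -> W) (x v : V) (d : W) :
  is_derive x v f d <-> is_derive (0 : R) 1 (fun t : R => f (t *: v + x)) d.
Proof.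
have E : (fun h : R => h^-1 *: (((fun s : R => f (s *: v + x)) \o shift 0) (h *: 1) - f (0 *: v + x)))
  = (fun h => h^-1 *: ((f \o shift x) (h *: v) - f x)).
  by apply/funext => h /=; rewrite addr0 scale0r add0r [h *: 1]mulr1.
by split=> -[d1 d2]; split; move: d1 d2; rewrite /derivable /derive E.
Qed.

(** The inner map has a derivative in the direction v only. Restricted to the line through x it
    becomes a curve, for which derivable and differentiable mean the same, and the usual chain rule
    applies there. *)
Lemma chain_derive (V : normedModType R) k (h : V -> 'rV[R]_k) (x v : V)
    (dh : 'I_k -> R) (f : 'rV[R]_k -> R) :
  (forall j, is_derive x v (fun y => h y ord0 j) (dh j)) -> sm (h x) f ->
  is_derive x v (f \o h) (\sum_j dh j * pd j f (h x)).
Proof.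
move=> hj fh.
have dh0 : derivable h x v by apply/derivable_mxP => i j; rewrite ord1; have [] := hj j.
have hE : 'D_v h x = \row_j dh j.
  by rewrite derive_mx//; apply/rowP => j; rewrite !mxE; have [_ <-] := hj j.
have /line_is_derive[c1 c2] : is_derive x v h (\row_j dh j) by split.
have [df dfE] := sm_diff fh.
apply/line_is_derive; have /derivable1_diffP c1' := c1.
have h0 : h (0 *: v + x) = h x by rewrite scale0r add0r.
have dd : differentiable (f \o (fun t : R => h (t *: v + x))) 0.
  by apply: differentiable_comp; [exact: c1'|rewrite h0; exact: df].
split; first by apply/derivable1_diffP; exact: dd.
rewrite deriveE; last exact: dd.
rewrite [X in X 1](@diff_comp _ _ _ _ (fun t : R => h (t *: v + x)) f 0); first last.
- by rewrite h0; exact: df.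
- exact: c1'.
rewrite /= h0 dfE -deriveE; last exact: c1'.
by rewrite c2 /dirsum; apply: eq_bigr => j _; rewrite mxE.
Qed.

Lemma sm_comp m k (h : 'rV[R]_m -> 'rV[R]_k) (x : 'rV[R]_m) (f : 'rV[R]_k -> R) :
  (forall j, sm x (fun y => h y ord0 j)) -> sm (h x) f -> sm x (f \o h).
Proof.
move=> hj /sm_open[W [oW Wx Wf]].
have H2 : \forall y \near x, forall j, sm y (fun y => h y ord0 j).
  by apply: near_all => j; exact: sm_near.
have hc : {for x, continuous h} by apply: row_cts => j; exact: sm_cts.
have H1 : \forall y \near x, W (h y) by apply: near_preim hc _; exact: open_near.
have [U [oU Ux HU]] := near_open (near_and H1 H2).
pose G g := (exists s, g = pds s f \o h) \/ exists s j, g = pds s (fun y => h y ord0 j).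
apply: (@sm_alg _ _ U G) => //; last by apply: alg_gen; left; exists [::].
- move=> g [[s ->]|[s [j ->]]] y /HU[Wy hy]; last exact/sm_cts/sm_pds.
  apply: continuous_comp; last by apply/sm_cts/sm_pds; exact: Wf.
  by apply: row_cts => j; exact: sm_cts.
- move=> g i [[s ->]|[s [j ->]]].
  + exists (fun y => \sum_j pds [:: i] (fun y => h y ord0 j) y * (pds (j :: s) f \o h) y).
      apply: alg_sum => j _; apply: alg_mul; apply: alg_gen; first by right; exists [:: i], j.
      by left; exists (j :: s).
    move=> y /HU[Wy hy]; apply: chain_derive; last by apply: sm_pds; exact: Wf.
    by move=> j; apply: sm_derive.
  + exists (pds (i :: s) (fun y => h y ord0 j)); first by apply: alg_gen; right; exists (i :: s), j.
    by move=> y /HU[Wy hy]; apply/sm_derive/sm_pds.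
Qed.

Lemma pd_comp m k (h : 'rV[R]_m -> 'rV[R]_k) (x : 'rV[R]_m) (f : 'rV[R]_k -> R) i :
  (forall j, sm x (fun y => h y ord0 j)) -> sm (h x) f ->
  pd i (f \o h) x = \sum_j pd i (fun y => h y ord0 j) x * pd j f (h x).
Proof.
by move=> hj fh; case: (chain_derive (fun j => sm_derive i (hj j)) fh).
Qed.

(** A smooth function of one real variable is given here by the sequence of its successive
    derivatives. *)
Lemma sm_seq m (x : 'rV[R]_m) (f : 'rV[R]_m -> R) (W : set R) (g : nat -> R -> R) :
  open W -> W (f x) -> (forall k y, W y -> is_derive y 1 (g k) (g k.+1 y)) ->
  sm x f -> sm x (g 0%N \o f).
Proof.
move=> oW Wx dg fx; have [V [oV Vx Vf]] := sm_open fx.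
have H1 : \forall y \near x, W (f y) by apply: near_preim (sm_cts fx) _; exact: open_near.
have [U [oU Ux HU]] := near_open (near_and (open_near oV Vx) H1).
pose G h := (exists s, h = pds s f) \/ exists k, h = g k \o f.
have cg k y : W y -> {for y, continuous (g k)}.
  by move=> Wy; apply/differentiable_continuous/derivable1_diffP; have [] := dg k y Wy.
apply: (@sm_alg _ _ U G) => //; last by apply: alg_gen; right; exists 0%N.
- move=> h [[s ->]|[k ->]] y /HU[Vy Wy]; first by apply/sm_cts/sm_pds; exact: Vf.
  by apply: continuous_comp; [apply: sm_cts; exact: Vf|exact: cg].
- move=> h i [[s ->]|[k ->]].
    exists (pds (i :: s) f); first by apply: alg_gen; left; exists (i :: s).
    by move=> y /HU[Vy Wy]; apply/sm_derive/sm_pds; exact: Vf.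
  exists (fun y => pds [:: i] f y * (g k.+1 \o f) y).
    by apply: alg_mul; apply: alg_gen; [left; exists [:: i]|right; exists k.+1].
  move=> y /HU[Vy Wy]; have /line_is_derive[c1 c2] := sm_derive i (Vf _ Vy).
  have f0 : f (0 *: ev R i + y) = f y by rewrite scale0r add0r.
  have /= [g1 g2] := dg k _ Wy.
  apply/line_is_derive; split.
    apply/derivable1_diffP; apply: (@differentiable_comp _ _ _ _ (fun t : R => f (t *: ev R i + y)) (g k)); first exact/derivable1_diffP.
    by rewrite f0; exact/derivable1_diffP.
  have g1' : derivable (g k) (f (0 *: ev R i + y)) 1 by rewrite f0.
  have := derive1_comp c1 g1'; rewrite !derive1E c2 f0 g2 => ->.
  by rewrite mulrC.
Qed.

Lemma sm_neq0 m (x : 'rV[R]_m) (f : 'rV[R]_m -> R) : sm x f -> f x != 0 -> \forall y \near x, f y != 0.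
Proof.
move=> fx cf; apply: (@near_preim _ _ f x (fun y => y != 0) (sm_cts fx)).
by apply: (@open_near _ [set y | y != 0]); first exact: open_neq.
Qed.

Lemma smV m (x : 'rV[R]_m) (f : 'rV[R]_m -> R) : f x != 0 -> sm x f -> sm x (fun y => (f y)^-1).
Proof.
move=> f0 fx; have [V [oV Vx Vf]] := sm_open fx.
have H1 := sm_neq0 fx f0.
have [U [oU Ux HU]] := near_open (near_and (open_near oV Vx) H1).
pose G h := (exists s, h = pds s f) \/ h = fun y => (f y)^-1.
apply: (@sm_alg _ _ U G) => //; last by apply: alg_gen; right.
- move=> h [[s ->]|->] y /HU[Vy Wy]; first by apply/sm_cts/sm_pds; exact: Vf.
  exact: (cvgV Wy (sm_cts (Vf _ Vy))).
- move=> h i [[s ->]|->].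
    exists (pds (i :: s) f); first by apply: alg_gen; left; exists (i :: s).
    by move=> y /HU[Vy Wy]; apply/sm_derive/sm_pds; exact: Vf.
  exists (fun y => (-1) * ((f y)^-1 * (f y)^-1) * pds [:: i] f y).
    apply: alg_mul; last by apply: alg_gen; left; exists [:: i].
    apply: alg_mul; first exact: alg_cst.
    by apply: alg_mul; apply: alg_gen; right.
  move=> y /HU[Vy Wy]; have [d1 d2] := sm_derive i (Vf _ Vy).
  split; first exact: (derivableV Wy d1).
  by rewrite (deriveV Wy d1) -[_ *: _]/(_ * _) d2 /= expr2 invfM mulN1r.
Qed.

Lemma sm_gt m (x : 'rV[R]_m) (f : 'rV[R]_m -> R) c : sm x f -> c < f x -> \forall y \near x, c < f y.
Proof.
move=> fx cf; apply: (@near_preim _ _ f x (fun y => c < y) (sm_cts fx)).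
by apply: (@open_near _ [set y | c < y]); first exact: open_gt.
Qed.

Lemma sm_lt m (x : 'rV[R]_m) (f : 'rV[R]_m -> R) c : sm x f -> f x < c -> \forall y \near x, f y < c.
Proof.
move=> fx cf; apply: (@near_preim _ _ f x (fun y => y < c) (sm_cts fx)).
by apply: (@open_near _ [set y | y < c]); first exact: open_lt.
Qed.

End Composition.

(** * Inverse and implicit functions *)

Section InverseFunction.
Variables (R : realType).

Lemma mulmx_bound m k (A : 'M[R]_(m, k)) : exists2 C : R, 0 < C &
  forall v : 'rV[R]_m, `|v *m A| <= C * `|v|.
Proof.
exists (\sum_i \sum_j `|A i j| + 1).
  by rewrite ltr_wpDl// sumr_ge0// => i _; rewrite sumr_ge0.
move=> v; apply: norm_le_coord => [|j].
  by rewrite mulr_ge0// addr_ge0// sumr_ge0// => i _; rewrite sumr_ge0.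
rewrite mxE (le_trans (ler_norm_sum _ _ _))// mulrDl mul1r -[leLHS]addr0 lerD//.
rewrite mulr_suml; apply: ler_sum => i _; rewrite normrM mulrC.
apply: ler_pM => //; last exact: coord_le.
by rewrite (bigD1 j)//= lerDl sumr_ge0.
Qed.

Definition smv m k (x : 'rV[R]_m) (h : 'rV[R]_m -> 'rV[R]_k) :=
  forall j, sm x (fun y => h y ord0 j).

Definition jac m k (h : 'rV[R]_m -> 'rV[R]_k) (x : 'rV[R]_m) : 'M[R]_(m, k) :=
  \matrix_(i, j) pd i (fun y => h y ord0 j) x.

Lemma smv_near m k x (h : 'rV[R]_m -> 'rV[R]_k) : smv x h -> \forall y \near x, smv y h.
Proof. by move=> hx; apply: near_all => j; exact: sm_near. Qed.

Lemma smv_cts m k x (h : 'rV[R]_m -> 'rV[R]_k) : smv x h -> {for x, continuous h}.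
Proof. by move=> hx; apply: row_cts => j; exact: sm_cts. Qed.

Lemma smv_expand m k x (h : 'rV[R]_m -> 'rV[R]_k) : smv x h ->
  forall e, 0 < e -> \forall v \near (0 : 'rV[R]_m), `|h (x + v) - h x - v *m jac h x| <= e * `|v|.
Proof.
move=> hx e e0.
have H : \forall v \near (0 : 'rV[R]_m), forall j,
    `|h (x + v) ord0 j - h x ord0 j - dirsum (fun y => h y ord0 j) x v| <= e * `|v|.
  apply: near_all => j; apply: (@c1_expand _ _ (fun y => h y ord0 j)) => //.
    by have /smE := hx j; apply: filterS => y /(_ [::])[].
  by move=> i; exact/sm_cts/sm_pd.
move: H; apply: filterS => v Hv; apply: norm_le_coord => [|j]; first by rewrite mulr_ge0// ltW.
have := Hv j; rewrite !mxE; congr (`|_ - _| <= _).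
by apply: eq_bigr => i _; rewrite mxE.
Qed.

Lemma lip_of_partials m k (psi : 'rV[R]_m -> 'rV[R]_k) (x0 : 'rV[R]_m) (r e : R) :
  0 <= e ->
  (forall x, `|x - x0| <= r -> smv x psi /\ forall i j, `|pd i (fun y => psi y ord0 j) x| <= e) ->
  forall x y, `|x - x0| <= r -> `|y - x0| <= r -> `|psi x - psi y| <= m%:R * e * `|x - y|.
Proof.
move=> e0 H x y xr yr; apply: norm_le_coord => [|j]; first by rewrite !mulr_ge0.
rewrite !mxE.
pose f y := psi y ord0 j.
have seg (t : R) : 0 <= t <= 1 -> `|y + t *: (x - y) - x0| <= r.
  move=> /andP[t0 t1]; have -> : y + t *: (x - y) - x0 = t *: (x - x0) + (1 - t) *: (y - x0).
    by apply/rowP => i; rewrite !mxE; ring.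
  rewrite (le_trans (ler_normD _ _))// !normrZ (ger0_norm t0) ger0_norm ?subr_ge0//.
  have -> : r = t * r + (1 - t) * r by ring.
  by rewrite lerD// ler_wpM2l// subr_ge0.
have [||t tab] := @MVT_segment _ (fun t : R => f (y + t *: (x - y)))
    (fun t => dirsum f (y + t *: (x - y)) (x - y)) 0 1 ler01.
- move=> t; rewrite in_itv/= => /andP[/ltW t0 /ltW t1].
  have t01 : 0 <= t <= 1 by rewrite t0 t1.
  by have [hs _] := H _ (seg t t01); apply: line_derive; apply: sm_dir; exact: hs.
- apply: continuous_in_subspaceT => t; rewrite inE/= in_itv/= => /seg /H[hs _].
  apply/differentiable_continuous/derivable1_diffP.
  by have [] := line_derive (sm_dir (x - y) (hs j)).
rewrite scale1r scale0r addr0 subr0 mulr1 [y + (x - y)]addrC subrK /f => ->.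
have /seg /H [_ b] : 0 <= t <= 1 by move: tab; rewrite in_itv.
rewrite /dirsum (le_trans (ler_norm_sum _ _ _))//.
apply: (@le_trans _ _ (\sum_(i < m) e * `|x - y|)).
  apply: ler_sum => i _; rewrite normrM mulrC ler_pM//; exact: coord_le.
by rewrite sumr_const card_ord -[leLHS]mulr_natl mulrA.
Qed.

Lemma sm_det m k (x : 'rV[R]_m) (M : 'rV[R]_m -> 'M[R]_k) :
  (forall i j, sm x (fun y => M y i j)) -> sm x (fun y => \det (M y)).
Proof.
move=> GM; rewrite /determinant; apply: sm_sum => s _; apply: smM; first exact: sm_cst.
by apply: sm_prod => i _; exact: GM.
Qed.

Lemma smv_jac m k (x : 'rV[R]_m) (h : 'rV[R]_m -> 'rV[R]_k) i j :
  smv x h -> sm x (fun y => jac h y i j).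
Proof. by move=> hx; under eq_fun do rewrite mxE; apply: sm_pd; exact: hx. Qed.

Section Local.
Variables (m : nat) (h : 'rV[R]_m -> 'rV[R]_m) (x0 : 'rV[R]_m).
Hypotheses (hx0 : smv x0 h) (J0 : jac h x0 \in unitmx).

Let A := invmx (jac h x0).
Let psi x := x - h x *m A.

Let psi_pd i j x : smv x h -> sm x (fun y => psi y ord0 j) /\
  pd i (fun y => psi y ord0 j) x = (i == j)%:R - (jac h x *m A) i j.
Proof.
move=> hx.
have E : (fun y => psi y ord0 j) = (fun y => y ord0 j - \sum_l A l j * h y ord0 l).
  apply/funext => y; rewrite !mxE; congr (_ - _).
  by apply: eq_bigr => l _; rewrite mulrC.
have s l : sm x (fun y => A l j * h y ord0 l) by apply: smM; [exact: sm_cst|exact: hx].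
rewrite E; split.
  by apply: smB; [exact: sm_coord|apply: sm_sum => l _; exact: s].
rewrite pdB; [|exact: sm_coord|by apply: sm_sum => l _; exact: s].
rewrite pd_coord eq_sym pd_sum; last by move=> l _; exact: s.
congr (_ - _); rewrite mxE; apply: eq_bigr => l _.
by rewrite pdZ ?mxE 1?mulrC//; exact: hx.
Qed.

(** The map [psi] has zero derivative at x0, hence is a contraction of ratio 1/2 on a small ball;
    the bound e = 1/(2(m+1)) on each partial is chosen for this. Then x - y = (psi x - psi y) + (h x
    - h y) A gives injectivity with a Lipschitz inverse, and solving h x = y means finding a fixed
    point of psi + y A. *)
Lemma inverse_setup : exists r C : R, [/\ 0 < r, 0 < C,
  (forall x, `|x - x0| <= r -> smv x h /\ jac h x \in unitmx),
  (forall x y, `|x - x0| <= r -> `|y - x0| <= r -> `|x - y| <= C * `|h x - h y|) &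
  (forall y, C * `|y - h x0| < r -> exists2 x, `|x - x0| <= r & h x = y)].
Proof.
pose e : R := (2 * m.+1%:R)^-1.
have e0 : 0 < e by rewrite invr_gt0 mulr_gt0.
have H1 : \forall x \near x0, forall ij : 'I_m * 'I_m, `|pd ij.1 (fun y => psi y ord0 ij.2) x| <= e.
  apply: near_all => -[i j] /=.
  have [s E] := psi_pd i j hx0.
  have c : \forall x \near x0, `|pd i (fun y => psi y ord0 j) x0 - pd i (fun y => psi y ord0 j) x| <= e.
    by have /cvgrPdist_le /(_ _ e0) := sm_cts (sm_pd i s).
  move: c; apply: filterS => x; rewrite E mulmxV// mxE subrr sub0r normrN.
  by [].
have H2 : \forall x \near x0, \det (jac h x) != 0.
  have := @sm_det _ _ x0 (jac h) (fun i j => smv_jac i j hx0) => /sm_cts c.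
  apply: (@near_preim _ _ _ _ (fun z => z != 0) c).
  apply: (@open_near _ [set z | z != 0]); first exact: open_neq.
  by rewrite /= -unitfE; move: J0; rewrite unitmxE.
have /nbhs_ballP[r0 /= r00 Hr0] := near_and (smv_near hx0) (near_and H1 H2).
pose r := r0 / 2.
have r0' : 0 < r by rewrite divr_gt0.
have Hr x : `|x - x0| <= r -> [/\ smv x h, (forall i j, `|pd i (fun y => psi y ord0 j) x| <= e)
    & jac h x \in unitmx].
  move=> xr; have /Hr0[a [b c]] : ball x0 r0 x.
    by rewrite -ball_normE/= distrC (le_lt_trans xr)// /r ltr_pdivrMr// ltr_pMr// ltr1n.
  split=> //; last by rewrite unitmxE unitfE.
  by move=> i j; exact: (b (i, j)).
have psi_lip x y : `|x - x0| <= r -> `|y - x0| <= r -> `|psi x - psi y| <= 2^-1 * `|x - y|.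
  move=> xr yr; apply: (@le_trans _ _ (m%:R * e * `|x - y|)).
    apply: (@lip_of_partials _ _ _ x0 r e (ltW e0) _ x y xr yr).
    move=> z /Hr[hz b _]; split; last exact: b.
    by move=> j; have [] := psi_pd j j hz.
  rewrite ler_wpM2r// /e invfM mulrCA ger_pMr ?invr_gt0//.
  by rewrite ler_pdivrMr// mul1r ler_nat.
have [C0 C00 HC0] := mulmx_bound A.
exists r, (2 * C0); split=> //.
- by rewrite mulr_gt0.
- by move=> x /Hr[].
- move=> x y xr yr.
  have := psi_lip x y xr yr.
  have -> : psi x - psi y = (x - y) - (h x - h y) *m A.
    by rewrite /psi mulmxBl; apply/rowP => j; rewrite !mxE; ring.
  move=> /(le_trans (lerB_dist _ _)); have := HC0 (h x - h y); lra.
move=> y yr.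
pose B := [set x | `|x - x0| <= r].
pose T x := psi x + y *m A.
have TB : {homo T : x / B x >-> B x}.
  move=> x; rewrite /B/= => xr.
  have -> : T x - x0 = (psi x - psi x0) + (y - h x0) *m A.
    rewrite /T /psi mulmxBl; apply/rowP => j; rewrite !mxE; ring.
  have x0r : `|x0 - x0| <= r by rewrite subrr normr0 ltW.
  have := psi_lip x x0 xr x0r; have := HC0 (y - h x0).
  have := ler_normD (psi x - psi x0) ((y - h x0) *m A); lra.
have Tlip a b : `|a - x0| <= r -> `|b - x0| <= r -> `|T a - T b| <= 2^-1 * `|a - b|.
  by move=> ar br; rewrite /T opprD addrACA subrr addr0; exact: psi_lip.
have BE : B = closed_ball x0 r.
  by rewrite closed_ballE//; apply/seteqP; split=> z; rewrite /B /closed_ball_/= distrC.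
have cB : compact B.
  apply: bounded_closed_compact; last by rewrite BE; exact: closed_ball_closed.
  exists (`|x0| + r); split; first exact: num_real.
  move=> M Mr z; rewrite /B/= => zr.
  by have := ler_normD (z - x0) x0; rewrite subrK; lra.
have B0 : B !=set0 by exists x0; rewrite /B/= subrr normr0 ltW.
have cT : {within B, continuous (fun x => `|x - T x|)}.
  apply: continuous_in_subspaceT => x; rewrite inE => Bx.
  have hT : smv x (fun z => z - T z).
    move=> j; have [hs _ _] := Hr x Bx.
    have [s _] := psi_pd j j hs.
    have -> : (fun z => (z - T z) ord0 j) = (fun z => z ord0 j - (psi z ord0 j + (y *m A) ord0 j)).
      by apply/funext => z; rewrite !mxE.
    by apply: smB; [exact: sm_coord|apply: smD; [exact: s|exact: sm_cst]].
  apply: continuous_comp; [exact: smv_cts hT|exact: norm_continuous].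
(* a point minimizing the distance to its image under a contraction is fixed *)
have [x Bx xmin] := EVT_min_rV B0 cB cT.
move: Bx; rewrite inE => Bx.
have xT : x = T x.
  have TBx := TB _ Bx.
  have TBx' : T x \in B by rewrite inE.
  have := xmin _ TBx'; have := Tlip _ _ Bx TBx => le1 le2.
  have n0 : `|x - T x| <= 0 by lra.
  by apply/eqP; rewrite -subr_eq0 -normr_le0.
exists x; first exact: Bx.
have E : (h x - y) *m A = 0.
  have -> : (h x - y) *m A = x - T x by rewrite /T /psi mulmxBl; apply/rowP => j; rewrite !mxE; ring.
  by rewrite {1}xT subrr.
apply/eqP; rewrite -subr_eq0; apply/eqP.
move: E => /(congr1 (mulmx^~ (jac h x0))) /=; rewrite mulmxKV ?J0// mul0mx.
exact.
Qed.

Lemma norm_ev (i : 'I_m) : `|ev R i| <= 1.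
Proof.
apply: norm_le_coord => // j; rewrite ev_coord.
by case: (j == i); rewrite ?normr1 ?normr0.
Qed.

(** The local inverse is Lipschitz by the setup, differentiable because h has a first order
    expansion with invertible linear part, and smooth because its derivative is a smooth function of
    its own value. *)
Theorem inverse_function : exists (U W : set 'rV[R]_m) (g : 'rV[R]_m -> 'rV[R]_m),
  [/\ open U, open W, U x0, (forall x, U x -> smv x h) & (forall y, W y -> smv y g)] /\
  (forall x, U x -> W (h x) /\ g (h x) = x) /\ (forall y, W y -> U (g y) /\ h (g y) = y).
Proof.
have [r [C [r0 C0 Hr inj surj]]] := inverse_setup.
pose W := [set y | C * `|y - h x0| < r].
have : forall y, exists x, W y -> `|x - x0| < r /\ h x = y.
  move=> y; have [Wy|nWy] := pselect (W y); last by exists x0.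
  have [x xr hx] := surj y Wy; exists x => _; split=> //.
  have x0r : `|x0 - x0| <= r by rewrite subrr normr0 ltW.
  by have := inj x x0 xr x0r; rewrite hx => /le_lt_trans; apply.
move=> /choice[g Hg].
pose U := [set x | `|x - x0| < r /\ W (h x)].
have gh x : U x -> W (h x) /\ g (h x) = x.
  move=> [xr Whx]; split=> //; have [gr hg] := Hg _ Whx.
  have := inj (g (h x)) x (ltW gr) (ltW xr).
  by rewrite hg subrr normr0 mulr0 normr_le0 subr_eq0 => /eqP.
have hg y : W y -> U (g y) /\ h (g y) = y.
  by move=> Wy; have [gr hg] := Hg _ Wy; rewrite /U/= hg.
have WE y : W y = ball (h x0) (r / C) y.
  by rewrite -ball_normE/= ltr_pdivlMr// mulrC distrC.
have oW : open W.
  have -> : W = ball (h x0) (r / C) by apply/funext => y; exact: WE.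
  by apply: ball_open; exact: divr_gt0.
have oU : open U.
  rewrite openE => x [xr Whx].
  have hc : {for x, continuous h} by apply: smv_cts; have [] := Hr x (ltW xr).
  have n1 : \forall y \near x, W (h y) by apply: near_preim hc _; exact: open_near.
  have n2 : \forall y \near x, `|y - x0| < r.
    have : \forall y \near x, ball x0 r y.
      by apply: open_near; [exact: ball_open|rewrite -ball_normE/= distrC].
    by apply: filterS => y; rewrite -ball_normE/= distrC.
  by move: n2 n1; apply: filterS2.
have glip y y' : W y -> W y' -> `|g y - g y'| <= C * `|y - y'|.
  move=> Wy Wy'; have [a b] := Hg _ Wy; have [a' b'] := Hg _ Wy'.
  by have := inj _ _ (ltW a) (ltW a'); rewrite b b'.
have gd y i j : W y -> is_derive y (ev R i) (fun z => g z ord0 j) (invmx (jac h (g y)) i j).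
  move=> Wy; have [[xr _] hgy] := hg _ Wy.
  set x := g y in xr hgy *; have [hx Jx] := Hr x (ltW xr).
  set B := invmx _; have [CB CB0 HB] := mulmx_bound B.
  suff cv : (fun t : R => t^-1 *: (((fun z => g z ord0 j) \o shift y) (t *: ev R i) - x ord0 j)) @ 0^' --> B i j.
    by split; [apply/cvg_ex; exists (B i j)|apply: cvg_lim].
  apply/cvgrPdist_le => eps eps0.
  (* C is the Lipschitz constant of g and CB the norm of the inverse Jacobian: an error e |k| in the
     expansion of h becomes at most CB e C |t| = eps |t| for g. *)
  pose e := eps / (CB * C).
  have e0 : 0 < e by rewrite divr_gt0// mulr_gt0.
  have /nbhs_ballP[rho /= rho0 Hrho] := smv_expand hx e0.
  have nW : \forall t \near (0 : R)^', W (t *: ev R i + y).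
    have cl : {for (0 : R), continuous (fun t : R => t *: ev R i + y)}.
      apply: row_cts => l.
      have -> : (fun t : R => (t *: ev R i + y) ord0 l) = (fun t => t * ev R i ord0 l + y ord0 l).
        by apply/funext => t; rewrite !mxE.
      by apply: cvgD; [apply: cvgMl; exact: cvg_id|exact: cvg_cst].
    apply: nbhs_dnbhs; apply: (near_preim cl).
    by rewrite scale0r add0r; exact: open_near.
  near=> t.
  have t0 : t != 0 by near: t; exact: nbhs_dnbhs_neq.
  have tW : W (t *: ev R i + y) by near: t.
  have trho : `|t| < rho / C.
    by near: t; apply: dnbhs0_lt; exact: divr_gt0.
  set k := g (t *: ev R i + y) - x.
  have kt : `|k| <= C * `|t|.
    rewrite /k (le_trans (glip _ _ tW Wy))// addrK normrZ ler_pM2l//.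
    by rewrite -[leRHS]mulr1 ler_wpM2l// norm_ev.
  have krho : ball 0 rho k.
    rewrite -ball_normE/= sub0r normrN (le_lt_trans kt)//.
    by rewrite -ltr_pdivlMl// mulrC.
  have := Hrho _ krho.
  have -> : x + k = g (t *: ev R i + y) by rewrite /k addrC subrK.
  have [_ ->] := hg _ tW; rewrite hgy addrK => H.
  have H2 : `|(t *: ev R i - k *m jac h x) *m B| <= eps * `|t|.
    apply: (le_trans (HB _)); apply: (@le_trans _ _ (CB * (e * (C * `|t|)))).
      rewrite ler_pM2l//; apply: (le_trans H); rewrite ler_pM2l//.
    rewrite le_eqVlt; apply/orP; left; apply/eqP; rewrite /e; field.
    by rewrite !gt_eqF.
  have := le_trans (coord_le _ j) H2.
  rewrite mulmxBl mulmxK// -scalemxAl -rowE.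
    have E : (t *: row i B - k) ord0 j = t * B i j - k ord0 j by rewrite !mxE.
  rewrite E => H3.
  have -> : B i j - t^-1 *: (((fun z => g z ord0 j) \o shift y) (t *: ev R i) - x ord0 j)
    = t^-1 * (t * B i j - k ord0 j).
    by rewrite /k /= !mxE mulrBr mulKf.
  by rewrite normrM normfV ler_pdivrMl ?normr_gt0// [leRHS]mulrC.
exists U, W, g; split; last by split.
split=> //.
- by split; [rewrite subrr normr0|rewrite /W/= subrr normr0 mulr0].
- by move=> x [xr _]; have [] := Hr x (ltW xr).
move=> y Wy j.
have gcts z : W z -> {for z, continuous g}.
  move=> Wz; apply: row_cts => l; apply: cts_dist => e e0.
  have n2 : \forall z' \near z, `|z - z'| < e / C.
    have : \forall z' \near z, ball z (e / C) z' by apply: nbhsx_ballx; exact: divr_gt0.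
    by apply: filterS => z'; rewrite -ball_normE.
  move: n2 (open_near oW Wz); apply: filterS2 => z' z'e Wz'.
  have := coord_le (g z - g z') l; rewrite !mxE => /le_trans; apply.
  rewrite (le_trans (glip _ _ Wz Wz'))// -ler_pdivlMl// mulrC; exact: ltW.
have Us z : W z -> smv (g z) h /\ jac h (g z) \in unitmx.
  by move=> Wz; have [[xr _] _] := hg _ Wz; exact: Hr _ (ltW xr).
(* Cramer's rule makes the entries of the inverse Jacobian smooth functions K, so a partial of g is
   some [K \o g], and the family of the [L \o g] with L smooth is closed up to algebra. *)
pose K i l x := (\det (jac h x))^-1 * (\adj (jac h x)) i l.
have KE z i l : W z -> invmx (jac h (g z)) i l = K i l (g z).
  by move=> /Us[_ Jz]; rewrite /invmx Jz mxE.
have Ks z i l : W z -> sm (g z) (K i l).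
  move=> /Us[hz]; rewrite unitmxE unitfE => Jz; apply: smM.
    by apply: smV; [exact: Jz|apply: sm_det => a b; exact: smv_jac].
  under eq_fun do rewrite mxE /cofactor.
  apply: smM; first exact: sm_cst.
  by apply: sm_det => a b; under eq_fun do rewrite !mxE; exact: sm_pd.
pose G f := (exists l, f = fun z => g z ord0 l) \/
  exists2 L, (forall z, W z -> sm (g z) L) & f = L \o g.
apply: (@sm_alg _ _ W G) Wy; first exact: oW.
- move=> f [[l ->]|[L Ls ->]] z Wz.
  + apply: (@continuous_comp _ _ _ g (fun v => v ord0 l)); first exact: gcts.
    exact: coord_continuous.
  + by apply: continuous_comp; [exact: gcts|apply: sm_cts; exact: Ls].
- move=> f i [[l ->]|[L Ls ->]].
  + exists (K i l \o g); first by apply: alg_gen; right; exists (K i l) => // z; exact: Ks.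
    by move=> z Wz /=; rewrite -KE//; exact: gd.
  + exists (fun z => \sum_a (K i a \o g) z * (pd a L \o g) z).
      apply: alg_sum => a _; apply: alg_mul; apply: alg_gen; right.
        by exists (K i a) => // z; exact: Ks.
      by exists (pd a L) => // z Wz; apply: sm_pd; exact: Ls.
    move=> z Wz; apply: chain_derive; last exact: Ls.
    by move=> a /=; rewrite -KE//; exact: gd.
- by apply: alg_gen; left; exists j.
Unshelve. all: by end_near. Qed.

End Local.

Lemma smv_row m k l x (f : 'rV[R]_m -> 'rV[R]_k) (g : 'rV[R]_m -> 'rV[R]_l) :
  smv x f -> smv x g -> smv x (fun y => row_mx (f y) (g y)).
Proof.
move=> fx gx j; case: (splitP j) => i ij.
  have -> : j = lshift l i by exact: val_inj.
  by under eq_fun do rewrite row_mxEl; exact: fx.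
have -> : j = rshift k i by exact: val_inj.
by under eq_fun do rewrite row_mxEr; exact: gx.
Qed.

Lemma smv_id m (x : 'rV[R]_m) : smv x id.
Proof. by move=> j; exact: sm_coord. Qed.

Lemma smv_cst m k (x : 'rV[R]_m) (c : 'rV[R]_k) : smv x (fun=> c).
Proof. by move=> j; exact: sm_cst. Qed.

Lemma smv_lsub m k (z : 'rV[R]_(m + k)) : smv z lsubmx.
Proof. by move=> j; under eq_fun do rewrite mxE; exact: sm_coord. Qed.

Lemma smv_rsub m k (z : 'rV[R]_(m + k)) : smv z rsubmx.
Proof. by move=> j; under eq_fun do rewrite mxE; exact: sm_coord. Qed.

Lemma smv_comp m k l x (f : 'rV[R]_k -> 'rV[R]_l) (g : 'rV[R]_m -> 'rV[R]_k) :
  smv x g -> smv (g x) f -> smv x (f \o g).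
Proof. by move=> gx fx j; apply: (@sm_comp _ _ _ g x (fun y => f y ord0 j) gx). Qed.

(** Inverse function theorem for (a, t) |-> (E(a, t), t), whose Jacobian is block triangular with an
    identity block. Injectivity gives the local uniqueness in the last clause. *)
Theorem implicit_function m k (E : 'rV[R]_(m + k) -> 'rV[R]_m) (a0 : 'rV[R]_m) (t0 : 'rV[R]_k) :
  smv (row_mx a0 t0) E -> E (row_mx a0 t0) = 0 ->
  (\matrix_(i, j) pd (lshift k i) (fun z => E z ord0 j) (row_mx a0 t0)) \in unitmx ->
  exists A : 'rV[R]_k -> 'rV[R]_m, [/\ smv t0 A, A t0 = a0,
    (\forall t \near t0, E (row_mx (A t) t) = 0) &
    \forall z \near row_mx a0 t0, E z = 0 -> lsubmx z = A (rsubmx z)].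
Proof.
set z0 := row_mx a0 t0 => Es E0 J0.
pose h z := row_mx (E z) (rsubmx z).
have hs : smv z0 h by apply: smv_row; [exact: Es|exact: smv_rsub].
have Jh : jac h z0 \in unitmx.
  have -> : jac h z0 = block_mx (\matrix_(i, j) pd (lshift k i) (fun z => E z ord0 j) z0) 0
      (\matrix_(i, j) pd (rshift m i) (fun z => E z ord0 j) z0) 1%:M.
    rewrite -[LHS]submxK; congr block_mx; apply/matrixP => i j; rewrite !mxE.
    - by under eq_fun do rewrite row_mxEl.
    - under eq_fun do rewrite row_mxEr mxE.
      by rewrite pd_coord eq_rlshift.
    - by under eq_fun do rewrite row_mxEl.
    - under eq_fun do rewrite row_mxEr mxE.
      by rewrite pd_coord eq_rshift eq_sym.
  by rewrite unitmxE det_lblock det1 mulr1 -unitmxE.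
have [U [W [g [[oU oW Uz Us Ws] [gh hg]]]]] := inverse_function hs Jh.
have h0 : h z0 = row_mx 0 t0 by rewrite /h E0 row_mxKr.
have Wt : W (row_mx 0 t0) by rewrite -h0; have [] := gh _ Uz.
have inj0 t : smv t (fun t : 'rV[R]_k => row_mx (0 : 'rV[R]_m) t).
  by apply: smv_row; [exact: smv_cst|exact: smv_id].
exists (fun t => lsubmx (g (row_mx 0 t))); split.
- apply: (@smv_comp _ _ _ _ (fun z => lsubmx (g z)) (fun t => row_mx 0 t)); first exact: inj0.
  apply: (@smv_comp _ _ _ _ lsubmx g); [exact: Ws|exact: smv_lsub].
- by rewrite -h0; have [_ ->] := gh _ Uz; rewrite row_mxKl.
- have : \forall t \near t0, W (row_mx 0 t).
    by apply: near_preim (smv_cts (inj0 t0)) _; exact: open_near.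
  apply: filterS => t /hg[Ug hE]; move: hE; rewrite /h.
  set G := g _ => /eq_row_mx[hE1 hE2].
  by rewrite -hE2 hsubmxK.
- move: (open_near oU Uz); apply: filterS => z Uz' Ez.
  by have [_ e] := gh _ Uz'; rewrite /h Ez in e; rewrite e.
Qed.

End InverseFunction.

(** * From iterated directional derivatives to coordinate partials and back; critical branches *)

Section SmoothOn.
Variable R : realType.

Lemma pds_iterD m (s : seq 'I_m) (f : 'rV[R]_m -> R) : pds s f = Defs.iterD (map (@ev R m) s) f.
Proof. by elim: s => //= i s ->. Qed.

Lemma smooth_on_sm m (U : set 'rV[R]_m) (f : 'rV[R]_m -> R) x : smooth_on U f -> U x -> sm x f.
Proof.
move=> [oU fU] Ux; apply: Sm; move: (open_near oU Ux); apply: filterS => y Uy s.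
by rewrite pds_iterD; have [c d] := fU (map (@ev R m) s) y Uy; split=> // i; exact: d.
Qed.

(** A directional derivative sees only one line, so functions on different spaces can be compared
    when they agree along corresponding lines. Partials in blocks of variables and at shifted or
    rescaled arguments are all identified in this way. *)
Lemma derive_quot (V V' W : normedModType R) (f : V -> W) (g : V' -> W) x v x' v' :
  (forall h : R, f (h *: v + x) = g (h *: v' + x')) ->
  'D_v f x = 'D_v' g x' /\ (derivable f x v <-> derivable g x' v').
Proof.
move=> H; have H0 : f x = g x' by have := H 0; rewrite !scale0r !add0r.
have E : (fun h : R => h^-1 *: ((f \o shift x) (h *: v) - f x)) =
         (fun h => h^-1 *: ((g \o shift x') (h *: v') - g x')).
  by apply/funext => h /=; rewrite H H0.
by rewrite /derive /derivable E.
Qed.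

(** Meant for the linear identification of space-time, a product, with row vectors: derivatives
    along v upstairs are derivatives along L v of a function on rows. *)
Lemma iterD_sm (V : normedModType R) m (L : V -> 'rV[R]_m) (W : set 'rV[R]_m) (f : 'rV[R]_m -> R) :
  (forall (h : R) v x, L (h *: v + x) = h *: L v + L x) -> (forall x, {for x, continuous L}) ->
  open W -> (forall y, W y -> sm y f) ->
  forall vs, exists2 g : 'rV[R]_m -> R, (forall y, W y -> sm y g) &
    forall x, W (L x) -> Defs.iterD vs (f \o L) x = g (L x).
Proof.
move=> Ll Lc oW Wf; elim=> [|v vs [g gs gE]]; first by exists f.
exists (fun y => dirsum g y (L v)).
  move=> y Wy; rewrite /dirsum; apply: sm_sum => i _; apply: smM; first exact: sm_cst.
  by apply: sm_pd; exact: gs.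
move=> x Wx; have [_ <-] := sm_dir (L v) (gs _ Wx).
rewrite /=.
have n : {near x, Defs.iterD vs (f \o L) =1 g \o L}.
  have : \forall y \near x, W (L y) by apply: near_preim (Lc x) (open_near oW Wx).
  by apply: filterS => y /gE.
rewrite (near_eq_derive _ n).
by have [] := @derive_quot _ _ _ (g \o L) g x v (L x) (L v) (fun h => congr1 g (Ll h v x)).
Qed.

Lemma sm_smooth_on_lin (V : normedModType R) m (L : V -> 'rV[R]_m) (W : set 'rV[R]_m) (f : 'rV[R]_m -> R) :
  (forall (h : R) v x, L (h *: v + x) = h *: L v + L x) -> (forall x, {for x, continuous L}) ->
  open W -> (forall y, W y -> sm y f) -> smooth_on (L @^-1` W) (f \o L).
Proof.
move=> Ll Lc oW Wf; have oLW : open (L @^-1` W).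
  apply: open_comp => // x _; exact: Lc.
split=> // vs x Wx; have [g gs gE] := iterD_sm Ll Lc oW Wf vs.
have n : {near x, g \o L =1 Defs.iterD vs (f \o L)}.
  by move: (open_near oLW Wx); apply: filterS => y /gE.
split=> [|v].
  rewrite /prop_for /continuous_at -(nbhs_singleton n).
  apply: cvg_trans (@continuous_comp _ _ _ L g x (Lc x) (sm_cts (gs _ Wx))).
  exact: near_eq_cvg.
apply: near_eq_derivable n _.
have [_ [_]] := @derive_quot _ _ _ (g \o L) g x v (L x) (L v) (fun h => congr1 g (Ll h v x)).
by apply; have [] := sm_dir (L v) (gs _ Wx).
Qed.

Lemma sm_smooth_on m (U : set 'rV[R]_m) (f : 'rV[R]_m -> R) :
  open U -> (forall x, U x -> sm x f) -> smooth_on U f.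
Proof.
move=> oU Uf.
exact: (@sm_smooth_on_lin _ _ id U f (fun h v x => erefl) (fun x => @cvg_id _ _) oU Uf).
Qed.

Lemma sm_smooth_at m x (f : 'rV[R]_m -> R) : sm x f -> smooth_at x f.
Proof.
by move=> /sm_open[U [oU Ux Uf]]; exists U; split=> //; exact: sm_smooth_on.
Qed.

Lemma smv_smooth_on m k (U : set 'rV[R]_m) (h : 'rV[R]_m -> 'rV[R]_k) :
  open U -> (forall x, U x -> smv x h) -> smooth_on U h.
Proof.
move=> oU Uh; split=> //.
have S j : smooth_on U (fun x => h x ord0 j) by apply: sm_smooth_on => // x Ux; exact: Uh.
have key vs x : U x -> Defs.iterD vs h x = \row_j Defs.iterD vs (fun x => h x ord0 j) x.
  elim: vs x => [|v vs IH] x Ux /=; first by apply/rowP => j; rewrite mxE.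
  have n : {near x, Defs.iterD vs h =1 fun x => \row_j Defs.iterD vs (fun x => h x ord0 j) x}.
    by move: (open_near oU Ux); apply: filterS => y /IH.
  rewrite (near_eq_derive _ n) derive_mx.
    apply/rowP => j; rewrite !mxE.
    by under eq_fun do rewrite mxE.
  apply/derivable_mxP => i j; under eq_fun do rewrite mxE.
  by have [_ /(_ vs x Ux)[_]] := S j; apply.
move=> vs x Ux.
have n : {near x, (fun x => \row_j Defs.iterD vs (fun x => h x ord0 j) x) =1 Defs.iterD vs h}.
  by move: (open_near oU Ux); apply: filterS => y /key.
split=> [|v].
  have c : {for x, continuous (fun x => \row_j Defs.iterD vs (fun x => h x ord0 j) x)}.
    apply: row_cts => j.
    have -> : (fun y => (\row_j Defs.iterD vs (fun x => h x ord0 j) y) ord0 j) = Defs.iterD vs (fun x => h x ord0 j).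
      by apply/funext => y; rewrite mxE.
    by have [_ /(_ vs x Ux)[]] := S j.
  exact: near_cts n c.
apply: near_eq_derivable n _.
apply/derivable_mxP => i j; under eq_fun do rewrite mxE.
by have [_ /(_ vs x Ux)[_]] := S j; apply.
Qed.

Lemma smooth_on_smv m k (U : set 'rV[R]_m) (h : 'rV[R]_m -> 'rV[R]_k) x :
  smooth_on U h -> U x -> smv x h.
Proof.
move=> [oU hU] Ux j.
have key s y : U y -> pds s (fun x => h x ord0 j) y = Defs.iterD (map (@ev R m) s) h y ord0 j.
  elim: s y => [|i s IH] y Uy //=.
  have n : {near y, pds s (fun x => h x ord0 j) =1 fun x => Defs.iterD (map (@ev R m) s) h x ord0 j}.
    by move: (open_near oU Uy); apply: filterS => z /IH.
  rewrite (pd_near i n) derive_mx ?mxE//.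
  by have [_] := hU (map (@ev R m) s) y Uy; apply.
apply: Sm; move: (open_near oU Ux); apply: filterS => y Uy s.
have n : {near y, (fun x => Defs.iterD (map (@ev R m) s) h x ord0 j) =1 pds s (fun x => h x ord0 j)}.
  by move: (open_near oU Uy); apply: filterS => z /key.
have [c d] := hU (map (@ev R m) s) y Uy; split=> [|i].
  apply: near_cts n _.
  apply: (@continuous_comp _ _ _ (Defs.iterD (map (@ev R m) s) h) (fun v => v ord0 j)) => //.
  exact: coord_continuous.
apply: near_eq_derivable n _.
by have /derivable_mxP/(_ ord0 j) := d (ev R i).
Qed.

Lemma local_coords_inv m (h : 'rV[R]_m -> 'rV[R]_m) x0 :
  smv x0 h -> h x0 = 0 -> jac h x0 \in unitmx -> local_coords h x0.
Proof.
move=> hs h0 J; have [U [W [g [[oU oW Ux Us Ws] [gh hg]]]]] := inverse_function hs J.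
exists U, W, g; split; first exact: Ux.
split; first exact: h0.
by split; [exact: smv_smooth_on|split; [exact: smv_smooth_on|split]].
Qed.

Lemma jac_comp m k l (f : 'rV[R]_k -> 'rV[R]_l) (g : 'rV[R]_m -> 'rV[R]_k) x :
  smv x g -> smv (g x) f -> jac (f \o g) x = jac g x *m jac f (g x).
Proof.
move=> gx fx; apply/matrixP => i j; rewrite !mxE.
rewrite (@pd_comp _ _ _ g x (fun y => f y ord0 j) i gx (fx j)).
by apply: eq_bigr => a _; rewrite !mxE.
Qed.

Lemma local_coords_jac m (h : 'rV[R]_m -> 'rV[R]_m) x0 :
  local_coords h x0 -> [/\ smv x0 h, h x0 = 0 & jac h x0 \in unitmx].
Proof.
move=> [U [W [g [Ux [h0 [hs [gs [gh hg]]]]]]]].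
have hx := smooth_on_smv hs Ux; have [Wh _] := gh _ Ux.
have gx := smooth_on_smv gs Wh.
split=> //.
have : jac (g \o h) x0 = 1%:M.
  apply/matrixP => i j; rewrite !mxE.
  have n : {near x0, (fun y => (g \o h) y ord0 j) =1 fun y => y ord0 j}.
    have [oU _] := hs; move: (open_near oU Ux); apply: filterS => y /gh[_ e] /=.
    by rewrite e.
  by rewrite (pd_near i n) pd_coord eq_sym.
by rewrite jac_comp// => /mulmx1_unit[].
Qed.

Lemma pd_min m (f : 'rV[R]_m -> R) x i : sm x f -> (\forall y \near x, f x <= f y) -> pd i f x = 0.
Proof.
move=> fx fm; have := near_and (sm_near fx) fm => /nbhs_ballP[r /= r0 Hr].
have bx (t : R) : `|t| < r -> ball x r (x + t *: ev R i).
  move=> tr; rewrite -ball_normE/= opprD addrA subrr add0r normrN normrZ.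
  by rewrite (le_lt_trans _ tr)// -[leRHS]mulr1 ler_wpM2l// norm_ev.
have H := @derive1_at_min _ (fun t : R => f (x + t *: ev R i)) (- r) r 0.
have [||||_ d] := H.
- by lra.
- move=> t; rewrite in_itv/= -ltr_norml => /bx /Hr[s _].
  by have [] := line_derive (sm_derive i s).
- by rewrite in_itv/= oppr_lt0 r0.
- move=> t; rewrite in_itv/= -ltr_norml => /bx /Hr[_].
  by rewrite scale0r addr0.
have := @line_derive _ _ f x (ev R i) 0 (pd i f x); rewrite scale0r addr0.
by move=> /(_ (sm_derive i fx))[_ <-].
Qed.

Lemma near_row m k (P : 'rV[R]_(m + k) -> Prop) (a0 : 'rV[R]_m) (t0 : 'rV[R]_k) :
  (\forall z \near row_mx a0 t0, P z) -> exists2 e : R, 0 < e &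
    forall a t, `|a - a0| < e -> `|t - t0| < e -> P (row_mx a t).
Proof.
move=> /nbhs_ballP[e /= e0 He]; exists e => // a t ae te; apply: He.
rewrite -ball_normE/= opp_row_mx add_row_mx; apply: norm_lt_coord => // j.
case: (splitP j) => i ij.
  have -> : j = lshift k i by exact: val_inj.
  by rewrite row_mxEl (le_lt_trans (coord_le _ i))// distrC.
have -> : j = rshift m i by exact: val_inj.
by rewrite row_mxEr (le_lt_trans (coord_le _ i))// distrC.
Qed.

Lemma near_normlt m (x : 'rV[R]_m) (e : R) : 0 < e -> \forall y \near x, `|y - x| < e.
Proof.
by move=> e0; apply/nbhs_ballP; exists e => //= y; rewrite -ball_normE/= distrC.
Qed.

Lemma pds_lrow m k (F : 'rV[R]_(m + k) -> R) (c : 'rV[R]_k) s :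
  pds s (fun a => F (row_mx a c)) = fun a => pds (map (lshift k) s) F (row_mx a c).
Proof.
elim: s => //= i s ->; apply/funext => a; rewrite /pd.
have [//|-> //] := @derive_quot _ _ _ (fun a => pds [seq lshift k i | i <- s] F (row_mx a c))
  (pds [seq lshift k i | i <- s] F) a (ev R i) (row_mx a c) (ev R (lshift k i)).
move=> h; congr (pds _ F _); apply/rowP => j; rewrite !mxE eqxx/=; case: (splitP j) => l jl.
  have -> : j = lshift k l by exact: val_inj.
  by rewrite !mxE/= eq_lshift.
have -> : j = rshift m l by exact: val_inj.
by rewrite eq_rlshift mulr0 add0r.
Qed.

Lemma pds_rrow m k (F : 'rV[R]_(m + k) -> R) (c : 'rV[R]_m) s :
  pds s (fun a => F (row_mx c a)) = fun a => pds (map (@rshift m k) s) F (row_mx c a).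
Proof.
elim: s => //= i s ->; apply/funext => a; rewrite /pd.
have [//|-> //] := @derive_quot _ _ _ (fun a => pds [seq rshift m i | i <- s] F (row_mx c a))
  (pds [seq rshift m i | i <- s] F) a (ev R i) (row_mx c a) (ev R (rshift m i)).
move=> h; congr (pds _ F _); apply/rowP => j; rewrite !mxE eqxx/=; case: (splitP j) => l jl.
  have -> : j = lshift k l by exact: val_inj.
  by rewrite eq_lrshift mulr0 add0r.
have -> : j = rshift m l by exact: val_inj.
by rewrite !mxE/= eq_rshift.
Qed.

Lemma critical_branch m k (F : 'rV[R]_(m + k) -> R) (a0 : 'rV[R]_m) (t0 : 'rV[R]_k) :
  sm (row_mx a0 t0) F -> (forall i, pd (lshift k i) F (row_mx a0 t0) = 0) ->
  (\matrix_(i, j) pd (lshift k i) (pd (lshift k j) F) (row_mx a0 t0)) \in unitmx ->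
  exists A : 'rV[R]_k -> 'rV[R]_m, [/\ smv t0 A, A t0 = a0,
    (\forall t \near t0, forall i, pd (lshift k i) F (row_mx (A t) t) = 0) &
    \forall z \near row_mx a0 t0, (forall i, pd (lshift k i) F z = 0) -> lsubmx z = A (rsubmx z)].
Proof.
move=> Fs F0 FH.
pose E z := \row_j pd (lshift k j) F z.
have [||| A [As A0 AE Au]] := @implicit_function _ _ _ E a0 t0.
- by move=> j; under eq_fun do rewrite mxE; exact: sm_pd.
- by apply/rowP => j; rewrite !mxE.
- have <- : \matrix_(i, j) pd (lshift k i) (pd (lshift k j) F) (row_mx a0 t0) =
      \matrix_(i, j) pd (lshift k i) (fun z => E z ord0 j) (row_mx a0 t0).
    apply/matrixP => i j; rewrite !mxE; congr (pd _ _ _).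
    by apply/funext => z; rewrite mxE.
  exact: FH.
exists A; split=> //.
- by move: AE; apply: filterS => t /rowP e i; have := e i; rewrite !mxE.
- by move: Au; apply: filterS => z e H; apply: e; apply/rowP => j; rewrite !mxE.
Qed.

(** The terms passing through A carry the factor pd F in the first block, which vanishes at a
    critical point. *)
Lemma pd_envelope m k (F : 'rV[R]_(m + k) -> R) (A : 'rV[R]_k -> 'rV[R]_m) t0 i :
  sm (row_mx (A t0) t0) F -> smv t0 A -> (forall i, pd (lshift k i) F (row_mx (A t0) t0) = 0) ->
  pd i (fun t => F (row_mx (A t) t)) t0 = pd (rshift m i) F (row_mx (A t0) t0).
Proof.
move=> Fs As F0.
have hs : smv t0 (fun t => row_mx (A t) t) by apply: smv_row => //; exact: smv_id.
rewrite (@pd_comp _ _ _ (fun t => row_mx (A t) t) t0 F i hs Fs).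
rewrite big_split_ord/= big1 ?add0r; last by move=> j _; rewrite F0 mulr0.
rewrite (bigD1 i)//= big1 ?addr0.
  under eq_fun do rewrite row_mxEr.
  by rewrite pd_coord eqxx mul1r.
move=> j ji; under eq_fun do rewrite row_mxEr.
by rewrite pd_coord (negPf ji) mul0r.
Qed.

End SmoothOn.

(** * Value functions of the action *)

Section CompleteCoordinates.
Variable R : realType.

(** The dimension is a variable d tied to k + r by an equation, so that [subst] turns the cast into
    the identity. *)
Lemma cast_rows_unit k r d (E : d = (k + r)%N) (M : 'M[R]_(k, d)) (B : 'M[R]_(r, d)) :
  row_free (col_mx M B) -> (\matrix_(i < d, j < d) col_mx M B (cast_ord E i) j) \in unitmx.
Proof.
subst d; rewrite row_free_unit.
suff -> : \matrix_(i < k + r, j < k + r) col_mx M B (cast_ord (erefl _) i) j = col_mx M B by [].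
by apply/matrixP => i j; rewrite mxE cast_ord_id.
Qed.

Lemma complete_rows k d (M : 'M[R]_(k, d)) : row_free M ->
  exists2 P : 'M[R]_d, P \in unitmx & forall (i : 'I_d) (j : 'I_k) l, i = j :> nat -> P i l = M j l.
Proof.
move=> fM; pose B := row_base (M^C)%MS.
have rM : \rank M = k by apply/eqP.
have E : d = (k + \rank (M^C)%MS)%N.
  by rewrite mxrank_compl rM subnKC// -rM rank_leq_col.
exists (\matrix_(i, j) col_mx M B (cast_ord E i) j).
  apply: cast_rows_unit; rewrite /row_free -addsmxE.
  have -> : \rank (M + B)%MS = \rank (M + M^C)%MS.
    by rewrite (adds_eqmx (eqmx_refl M) (eq_row_base (M^C)%MS)).
  by have /eqP -> := addsmx_compl_full M; rewrite -E.
move=> i j l ij; rewrite mxE.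
have -> : cast_ord E i = lshift _ j by apply: val_inj.
by rewrite col_mxEu.
Qed.

(** The free differentials are completed to a basis; the missing coordinates are the linear forms of
    the added rows, so the Jacobian at x0 is the transpose of the completed matrix. *)
Lemma complete_coords n k (al : nat -> 'rV[R]_n.+1 -> R) (x0 : 'rV[R]_n.+1) :
  (forall i, (i < k)%N -> sm x0 (al i) /\ al i x0 = 0) ->
  row_free (\matrix_(i < k, j < n.+1) pd j (al i) x0) ->
  exists2 h : 'rV[R]_n.+1 -> 'rV[R]_n.+1, local_coords h x0 &
    forall x i, (i < k)%N -> rcoord (h x) i = al i x.
Proof.
set M := \matrix_(i, j) _ => als fM.
have kn : (k <= n.+1)%N by have /eqP <- := fM; exact: rank_leq_col.
have [P Pu PM] := complete_rows fM.
pose h x : 'rV[R]_n.+1 := \row_j (if (j < k)%N then al j x else \sum_l P j l * (x ord0 l - x0 ord0 l)).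
have hE j : (fun x => h x ord0 j) = if (j < k)%N then al j else fun x => \sum_l P j l * (x ord0 l - x0 ord0 l).
  by apply/funext => x; rewrite mxE; case: ifP.
have sl l : sm x0 (fun x : 'rV[R]_n.+1 => x ord0 l - x0 ord0 l).
  by apply: smB; [exact: sm_coord|exact: sm_cst].
have sPl j l : sm x0 (fun x : 'rV[R]_n.+1 => P j l * (x ord0 l - x0 ord0 l)).
  by apply: smM; [exact: sm_cst|exact: sl].
exists h.
  apply: local_coords_inv.
  - move=> j; rewrite hE; case: ifPn => [jk|_]; first by have [] := als _ jk.
    by apply: sm_sum => l _; exact: sPl.
  - apply/rowP => j; rewrite !mxE; case: ifPn => [jk|_]; first by have [] := als _ jk.
    by apply: big1 => l _; rewrite subrr mulr0.
  - suff -> : jac h x0 = P^T by rewrite unitmx_tr.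
    apply/matrixP => i j; rewrite !mxE hE; case: ifPn => [jk|_].
      by rewrite (PM j (Ordinal jk) i)// mxE.
    rewrite pd_sum; last by move=> l _; exact: sPl.
    rewrite (bigD1 i)//= big1 ?addr0.
      by rewrite (pdZ i (P j i) (sl i)) pdB ?pd_coord ?pd_cst ?eqxx ?subr0 ?mulr1//; [exact: sm_coord|exact: sm_cst].
    move=> l li; rewrite (pdZ i (P j l) (sl l)) pdB ?pd_coord ?pd_cst; [|exact: sm_coord|exact: sm_cst].
    by rewrite (negPf li) subr0 mulr0.
(* [rcoord] reads its index through [inord], faithful only below n.+1; freeness of the k rows
   supplies k <= n.+1. *)
move=> x i ik; rewrite /rcoord mxE inordK ?ik//.
exact: leq_trans ik kn.
Qed.

End CompleteCoordinates.

(** * The action, its minimizers and the branches of its value *)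

Section Burgers.
Variables (R : realType) (n : nat) (phi0 : 'rV[R]_n.+1 -> R) (xs : 'rV[R]_n.+1) (ts : R).
Hypothesis phi0_smooth : smooth_on [set: 'rV[R]_n.+1] phi0.
Hypothesis attained : forall (x : 'rV[R]_n.+1) (t : R), 0 < t ->
  exists a, forall b, phi0 a + sqdist a x / (2 * t) <= phi0 b + sqdist b x / (2 * t).
Hypothesis ts0 : 0 < ts.

Definition act (z : 'rV[R]_(n.+1 + (n.+1 + 1))) : R :=
  phi0 (lsubmx z) + sqdist (lsubmx z) (lsubmx (rsubmx z)) / (2 * rsubmx (rsubmx z) ord0 ord0).

Definition stime (x : 'rV[R]_n.+1) (t : R) : 'rV[R]_(n.+1 + 1) := row_mx x t%:M.

Definition minimizer (th : 'rV[R]_(n.+1 + 1)) a :=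
  forall b, act (row_mx a th) <= act (row_mx b th).

Let w a := phi0 a + sqdist a xs / (2 * ts).
Let ths := stime xs ts.

Lemma actE a x t : act (row_mx a (stime x t)) = phi0 a + sqdist a x / (2 * t).
Proof. by rewrite /act /stime !row_mxKl !row_mxKr row_mxKl mxE eqxx mulr1n. Qed.

Lemma stimeE th : th = stime (lsubmx th) (rsubmx th ord0 ord0).
Proof.
rewrite /stime -[LHS]hsubmxK; congr row_mx; apply/rowP => j.
by rewrite !ord1 [RHS]mxE eqxx mulr1n.
Qed.

Lemma phi0_sm a : sm a phi0.
Proof. exact: smooth_on_sm phi0_smooth _. Qed.

Lemma act_sm z : rsubmx (rsubmx z) ord0 ord0 != 0 -> sm z act.
Proof.
move=> t0; apply: smD; first exact: (sm_comp (@smv_lsub _ _ _ z) (phi0_sm _)).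
have st : sm z (fun z : 'rV[R]_(n.+1 + (n.+1 + 1)) => rsubmx (rsubmx z) ord0 ord0).
  by under eq_fun do rewrite !mxE; exact: sm_coord.
apply: smM.
  apply: sm_sum => i _; apply: smX; apply: smB; under eq_fun do rewrite !mxE; exact: sm_coord.
by apply: smV; [rewrite mulf_neq0|apply: smM; [exact: sm_cst|exact: st]].
Qed.

Lemma burgers_phiE x t a : minimizer (stime x t) a ->
  burgers_phi phi0 x t = act (row_mx a (stime x t)).
Proof.
move=> ma; rewrite actE; apply/eqP; rewrite eq_le; apply/andP; split.
  apply: ge_inf; last by exists a.
  by exists (phi0 a + sqdist a x / (2 * t)) => _ [b _ <-]; have := ma b; rewrite !actE.
apply: lb_le_inf; first by exists (phi0 a + sqdist a x / (2 * t)); exists a.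
by move=> _ [b _ <-]; have := ma b; rewrite !actE.
Qed.

Lemma minimizer_ex x t : 0 < t -> exists a, minimizer (stime x t) a.
Proof.
by move=> /(attained x)[a H]; exists a => b; rewrite !actE; exact: H.
Qed.

Lemma sqdist_ge (a x : 'rV[R]_n.+1) : `|a - x| ^+ 2 <= sqdist a x.
Proof.
have S0 : 0 <= sqdist a x by apply: sumr_ge0 => i _; exact: sqr_ge0.
rewrite -[leRHS]sqr_sqrtr// ler_sqr ?nnegrE ?sqrtr_ge0//.
apply: norm_le_coord; first exact: sqrtr_ge0.
move=> i; rewrite -sqrtr_sqr ler_sqrt//  !mxE /sqdist (bigD1 i)//= lerDl.
by apply: sumr_ge0 => j _; exact: sqr_ge0.
Qed.

(** Coordinatewise, with u = a - y and v = x - y, the difference of the two sides is (u - 5 v)^2 /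
    5. *)
Lemma sqdist_shift (a x y : 'rV[R]_n.+1) : 4 / 5 * sqdist a y - 4 * sqdist x y <= sqdist a x.
Proof.
rewrite /sqdist !mulr_sumr -sumrB; apply: ler_sum => i _.
have := sqr_ge0 ((a ord0 i - y ord0 i) - 5 * (x ord0 i - y ord0 i)); nra.
Qed.

Lemma act_ths_sm a : sm (row_mx a ths) act.
Proof. by apply: act_sm; rewrite /ths /stime !row_mxKr mxE eqxx mulr1n gt_eqF. Qed.

Lemma row_cts2 (a : 'rV[R]_n.+1) th : smv th (fun th : 'rV[R]_(n.+1 + 1) => row_mx a th).
Proof. by apply: smv_row; [exact: smv_cst|exact: smv_id]. Qed.

Lemma time_near (e : R) : 0 < e -> \forall th \near ths, `|rsubmx th ord0 ord0 - ts| < e.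
Proof.
move=> e0; move: (near_normlt ths e0); apply: filterS => th H.
have := le_lt_trans (coord_le _ (rshift n.+1 ord0)) H.
by rewrite mxE [(- ths) _ _]mxE /ths /stime row_mxEr mxE eqxx mulr1n [rsubmx th _ _]mxE.
Qed.

(** Attainment at the later time 2 ts bounds phi0 from below by m0 - D/(4 ts), where D = sqdist a
    xs. For t < 5/4 ts and x near xs the quadratic term is at least (4/5 D - 4)/(5/2 ts), which
    leaves (7/100 D - 8/5)/ts. Hence the factor 100/7 in [r2]; the case D <= 5 is treated apart, so
    that 4/5 D - 4 is nonnegative in the other. *)
Lemma minimizer_bounded : exists r, \forall th \near ths, 0 < rsubmx th ord0 ord0 /\
  forall a, minimizer th a -> `|a - xs| <= r.
Proof.
have [p pm] := attained xs ts0.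
have [a1 a1m] := attained xs (mulr_gt0 (ltr0n R 2) ts0).
pose m0 := phi0 a1 + sqdist a1 xs / (2 * (2 * ts)).
pose r2 := 5 + (`|w p + 1 - m0| * ts + 2) * (100 / 7).
have r20 : 1 <= r2.
  have : 0 <= `|w p + 1 - m0| * ts by rewrite mulr_ge0// ltW.
  by rewrite /r2; lra.
exists (r2).
have c1 : \forall th \near ths, act (row_mx p th) <= w p + 1.
  have c : {for ths, continuous (fun th => act (row_mx p th))}.
    by apply: sm_cts; apply: (sm_comp (row_cts2 p ths)); exact: act_ths_sm.
  move: (dist_cts c ltr01); apply: filterS => th; rewrite distrC actE.
  by rewrite ler_norml => /andP[_]; rewrite lerBlDl.
have c2 : \forall th \near ths, sqdist (lsubmx th) xs <= 1.
  have s : sm ths (fun th => sqdist (lsubmx th) xs).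
    apply: sm_sum => i _; apply: smX; apply: smB; last exact: sm_cst.
    by under eq_fun do rewrite mxE; exact: sm_coord.
  move: (dist_cts (sm_cts s) ltr01); apply: filterS => th.
  rewrite {1}/ths /stime row_mxKl {1}/sqdist big1 ?sub0r ?normrN; last by move=> i _; rewrite subrr expr0n.
  by apply: le_trans; exact: ler_norm.
have c3 := time_near (divr_gt0 ts0 (ltr0n R 4)).
move: (near_and c1 (near_and c2 c3)); apply: filterS => th [h1 [h2]].
rewrite ltr_norml => h3.
have t0 : 0 < rsubmx th ord0 ord0 by lra.
split=> // a ma.
have := le_trans (ma p) h1; rewrite {1}(stimeE th) actE.
set t := rsubmx th ord0 ord0 in h3 t0 *; set x := lsubmx th in h2 *.
have := a1m a; rewrite -/m0 => e1.
set D := sqdist a xs in e1 *.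
have D0 : 0 <= D by apply: sumr_ge0 => i _; exact: sqr_ge0.
have := sqdist_shift a x xs; rewrite -/D => e2 e3.
suff Dr : D <= r2.
  have := le_trans (sqdist_ge a xs) Dr => H.
  have [//|lt] := leP `|a - xs| r2.
  have : r2 * 1 < `|a - xs| * `|a - xs| by apply: ltr_pM; lra.
  by move: H; rewrite expr2; lra.
have [D5|D5] := leP D 5.
  have : 0 <= `|w p + 1 - m0| * ts by apply: mulr_ge0; [exact: normr_ge0|exact: ltW].
  by rewrite /r2; lra.
have e4 : (4 / 5 * D - 4) / (2 * (5 / 4 * ts)) <= sqdist a x / (2 * t).
  apply: (@le_trans _ _ ((4 / 5 * D - 4) / (2 * t))).
    rewrite ler_pM2l; last lra.
    by rewrite lef_pV2 ?posrE; lra.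
  by rewrite ler_pM2r ?invr_gt0; lra.
have e5 : (4 / 5 * D - 4) / (2 * (5 / 4 * ts)) - D / (2 * (2 * ts)) <= w p + 1 - m0 by lra.
have e6 : (4 / 5 * D - 4) / (2 * (5 / 4 * ts)) - D / (2 * (2 * ts)) = (7 / 100 * D - 8 / 5) / ts.
  by field; rewrite gt_eqF.
have e7 : (7 / 100 * D - 8 / 5) / ts <= `|w p + 1 - m0|.
  by rewrite -e6; apply: (le_trans e5); exact: ler_norm.
move: e7; rewrite ler_pdivrMr// /r2; lra.
Qed.

(* Minimizers for nearby (x, t) accumulate only at the minimum points of w. *)
Lemma minimizer_localized (e : R) : 0 < e -> \forall th \near ths, 0 < rsubmx th ord0 ord0 /\
  forall a, minimizer th a -> exists2 q, glob_minset w q & `|a - q| < e.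
Proof.
move=> e0; have [r Hr] := minimizer_bounded.
have [p pm] := attained xs ts0.
pose K := [set a : 'rV[R]_n.+1 | `|a - xs| <= r].
have cK : compact K.
  apply: bounded_closed_compact.
    exists (`|xs| + r); split; first exact: num_real.
    move=> M Mr z; rewrite /K/= => zr.
    by have := ler_normD (z - xs) xs; rewrite subrK; lra.
  have -> : K = (fun a => `|a - xs|) @^-1` [set y : R | y <= r] by [].
  apply: closed_comp; last exact: closed_le.
  move=> a _; apply: cts_dist => eps eps0; move: (near_normlt a eps0); apply: filterS => b.
  rewrite distrC => ab; apply: le_trans (ltW ab).
  by apply: (le_trans (ler_dist_dist _ _)); rewrite opprB addrA subrK.
pose P th a := (exists2 q, glob_minset w q & `|a - q| < e) \/ act (row_mx p th) < act (row_mx a th).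
have cov : \forall th \near ths, K `<=` P th.
  have [/(_ cK) cov _] := @compact_near_coveringP _ K.
  apply: (cov _ (nbhs ths) P) => a0 _.
  have [a0m|a0n] := pselect (glob_minset w a0).
    exists ([set a | `|a - a0| < e], setT); first by split; [exact: near_normlt|exact: filterT].
    by move=> [a th] [/= ae _]; left; exists a0.
  have lt0 : act (row_mx p ths) < act (row_mx a0 ths).
    rewrite !actE ltNge; apply/negP => le0; apply: a0n => b.
    exact: le_trans le0 (pm b).
  pose G z := act z - act (row_mx p (rsubmx z)).
  have Gs : sm (row_mx a0 ths) G.
    apply: smB; first exact: act_ths_sm.
    apply: (@sm_comp _ _ _ (fun z => row_mx p (rsubmx z))).
      by apply: smv_row; [exact: smv_cst|exact: smv_rsub].
    by rewrite row_mxKr; exact: act_ths_sm.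
  have : \forall z \near row_mx a0 ths, 0 < G z.
    apply: (sm_gt Gs).
    by rewrite /G/= row_mxKr subr_gt0.
  move=> /near_row[e' e'0 He'].
  exists ([set a | `|a - a0| < e'], [set th | `|th - ths| < e']).
    by split; exact: near_normlt.
  move=> [a th] [/= ae te]; right.
  by have := He' _ _ ae te; rewrite /G row_mxKr subr_gt0.
move: (near_and Hr cov); apply: filterS => th [[t0 Ha] HK]; split=> // a ma.
have [//|] := HK a (Ha a ma).
by rewrite ltNge ma.
Qed.

Lemma minimizer_critical th a : rsubmx th ord0 ord0 != 0 -> minimizer th a ->
  forall i, pd (lshift _ i) act (row_mx a th) = 0.
Proof.
move=> t0 ma i.
have := @pd_min _ _ (fun a => act (row_mx a th)) a i.
have -> : pd i (fun a => act (row_mx a th)) a = pd (lshift _ i) act (row_mx a th).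
  by rewrite -[LHS]/(pds [:: i] _ a) pds_lrow.
apply; last by apply: filterE => b; exact: ma.
apply: (@sm_comp _ _ _ (fun a => row_mx a th)).
  by apply: smv_row; [exact: smv_id|exact: smv_cst].
by apply: act_sm; rewrite row_mxKr.
Qed.

(* At an A_1 minimum w - w p = \sum_i h_i^2, so the Hessian is 2 J J^T. *)
Lemma A1_hessian p : min_type_A 1 w p -> (\matrix_(i, j) pd i (pd j w) p) \in unitmx.
Proof.
move=> [h [lc hw]]; have [hs h0 Ju] := local_coords_jac lc.
have hw' : {near p, (fun a => \sum_i h a ord0 i * h a ord0 i + w p) =1 w}.
  move: hw; apply: filterS => a E; transitivity (\sum_i h a ord0 i ^+ 2 + w p).
    by congr (_ + w p); apply: eq_bigr => i _; rewrite expr2.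
  by rewrite E (bigD1 ord0).
have E j : {near p, (fun a => 2 * \sum_l h a ord0 l * pd j (fun a => h a ord0 l) a) =1 pd j w}.
  have := near_and (smv_near hs) (near_pds [:: j] hw'); apply: filterS => a [ha /= <-].
  rewrite pdD; [|by apply: sm_sum => i _; apply: smM; exact: ha|exact: sm_cst].
  rewrite pd_cst addr0 pd_sum; last by move=> i _; apply: smM; exact: ha.
  rewrite mulr_sumr; apply: eq_bigr => i _; rewrite pdM; [ring|exact: ha|exact: ha].
have -> : \matrix_(i, j) pd i (pd j w) p = 2 *: (jac h p *m (jac h p)^T).
  apply/matrixP => i j; rewrite !mxE -(pd_near i (E j)).
  have ss l : sm p (fun a => h a ord0 l * pd j (fun a => h a ord0 l) a).
    by apply: smM; [exact: hs|apply: sm_pd; exact: hs].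
  rewrite pdZ; last by apply: sm_sum => l _; exact: ss.
  congr (_ * _); rewrite pd_sum; last by move=> l _; exact: ss.
  apply: eq_bigr => l _; rewrite pdM; [|exact: hs|apply: sm_pd; exact: hs].
  by rewrite h0 !mxE mul0r add0r mulrC.
rewrite unitmxE detZ det_mulmx det_tr unitfE !mulf_neq0 ?expf_neq0//.
all: by rewrite -unitfE -unitmxE.
Qed.

(* v is the local value function of the action near the minimum point p. *)
Definition branch (p : 'rV[R]_n.+1) (v : 'rV[R]_(n.+1 + 1) -> R) :=
  exists2 e : R, 0 < e & \forall th \near ths, (exists a, act (row_mx a th) = v th) /\
    forall a, `|a - p| < e -> minimizer th a -> act (row_mx a th) = v th.

Lemma act_gradx a x t i : t != 0 ->
  pd (rshift n.+1 (lshift 1 i)) act (row_mx a (stime x t)) = (x ord0 i - a ord0 i) / t.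
Proof.
move=> t0.
have -> : pd (rshift n.+1 (lshift 1 i)) act (row_mx a (stime x t)) =
    pd i (fun x => act (row_mx a (row_mx x t%:M))) x.
  rewrite -[RHS]/(pds [:: i] _ x).
  rewrite (pds_lrow (fun th => act (row_mx a th)) t%:M [:: i]) /=.
  by rewrite -[RHS]/(pds [:: _] _ _) pds_rrow.
have -> : (fun x => act (row_mx a (row_mx x t%:M))) = 
    (fun x => phi0 a + (2 * t)^-1 * \sum_l (x ord0 l - a ord0 l) ^+ 2).
  apply/funext => y; rewrite -[row_mx y _]/(stime y t) actE mulrC; congr (_ + _ * _).
  by apply: eq_bigr => l _; rewrite -sqrrN opprB.
have sl l : sm x (fun x : 'rV[R]_n.+1 => x ord0 l - a ord0 l).
  by apply: smB; [exact: sm_coord|exact: sm_cst].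
have ss : sm x (fun x => \sum_l (x ord0 l - a ord0 l) ^+ 2).
  by apply: sm_sum => l _; apply: smX; exact: sl.
rewrite pdD; [|exact: sm_cst|by apply: smM; [exact: sm_cst|exact: ss]].
rewrite pd_cst add0r pdZ// pd_sum; last by move=> l _; apply: smX; exact: sl.
rewrite (bigD1 i)//= big1 ?addr0.
  under eq_fun do rewrite expr2.
  rewrite pdM// pdB; [|exact: sm_coord|exact: sm_cst].
  by rewrite pd_coord pd_cst eqxx subr0 mulr1; field.
move=> l li; under eq_fun do rewrite expr2.
rewrite pdM// pdB; [|exact: sm_coord|exact: sm_cst].
by rewrite pd_coord pd_cst (negPf li) subr0 mulr0 addr0.
Qed.

Lemma A1_branch p : glob_minset w p -> min_type_A 1 w p -> exists v, [/\ branch p v, sm ths v,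
  v ths = w p & forall i, pd (lshift 1 i) v ths = (xs ord0 i - p ord0 i) / ts].
Proof.
move=> pm pA; have wE : w = fun a => act (row_mx a ths) by apply/funext => a; rewrite actE.
have pmin : minimizer ths p by move=> b; rewrite !actE; exact: pm.
have tn0 : rsubmx ths ord0 ord0 != 0 by rewrite /ths /stime row_mxKr mxE eqxx mulr1n gt_eqF.
have crit := minimizer_critical tn0 pmin.
have [|A [As A0 Ac Au]] := critical_branch (act_ths_sm p) crit.
  suff -> : \matrix_(i, j) pd (lshift (n.+1 + 1) i) (pd (lshift (n.+1 + 1) j) act) (row_mx p ths)
     = \matrix_(i, j) pd i (pd j w) p by exact: A1_hessian.
  apply/matrixP => i j; rewrite [LHS]mxE [RHS]mxE.
  by apply/esym; rewrite wE -[LHS]/(pds [:: i; j] _ p) pds_lrow.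
exists (fun th => act (row_mx (A th) th)).
have rs : smv ths (fun th => row_mx (A th) th) by apply: smv_row => //; exact: smv_id.
split.
- have [e e0 He] := near_row Au; exists e => //.
  have c := time_near ts0.
  move: (near_and c (near_normlt ths e0)); apply: filterS => th [ct te]; split; first by exists (A th).
  move=> a ae ma.
  have tt0 : rsubmx th ord0 ord0 != 0 by move: ct; rewrite ltr_norml => ct; rewrite gt_eqF//; lra.
  have := He _ _ ae te (minimizer_critical tt0 ma).
  by rewrite row_mxKl row_mxKr => ->.
- by apply: (sm_comp rs); rewrite A0; exact: act_ths_sm.
- by rewrite A0 wE.
- move=> i; rewrite pd_envelope; [|by rewrite A0; exact: act_ths_sm|exact: As|by rewrite A0].
  by rewrite A0 act_gradx// gt_eqF.
Qed.

Lemma in_ths_cvg (P : 'rV[R]_(n.+1 + 1) -> Prop) : (\forall th \near ths, P th) ->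
  \forall x \near xs, P (stime x ts).
Proof.
have c : {for xs, continuous (fun x => stime x ts)}.
  by apply: smv_cts; apply: smv_row; [exact: smv_id|exact: smv_cst].
by move=> H; apply: (near_preim c).
Qed.

Lemma stime_smv x : smv x (fun x => stime x ts).
Proof. by apply: smv_row; [exact: smv_id|exact: smv_cst]. Qed.

Definition branch_at (p : 'rV[R]_n.+1) (v : 'rV[R]_n.+1 -> R) :=
  exists2 e : R, 0 < e & \forall x \near xs, (exists a, act (row_mx a (stime x ts)) = v x) /\
    forall a, `|a - p| < e -> minimizer (stime x ts) a -> act (row_mx a (stime x ts)) = v x.

Lemma A1_branch_at p : glob_minset w p -> min_type_A 1 w p -> exists v, [/\ branch_at p v, sm xs v,
  v xs = w p & forall i, pd i v xs = (xs ord0 i - p ord0 i) / ts].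
Proof.
move=> pm pA; have [v [[e e0 He] vs v0 vd]] := A1_branch pm pA.
exists (fun x => v (stime x ts)); split=> //.
- by exists e => //; exact: in_ths_cvg He.
- exact: (sm_comp (stime_smv xs) vs).
- move=> i; rewrite -vd -[LHS]/(pds [:: i] _ xs).
  by rewrite (pds_lrow v (ts%:M) [:: i]).
Qed.

(** A branch value is taken by the action somewhere, so it bounds phi from above; a minimizer exists
    and lies near one of the minimum points, so phi equals one of the branches. Together, phi is the
    minimum of the list. *)
Lemma burgers_branches (s : seq ('rV[R]_n.+1 * ('rV[R]_n.+1 -> R))) :
  (forall q, glob_minset w q -> exists2 pv, List.In pv s & pv.1 = q) ->
  (forall pv, List.In pv s -> branch_at pv.1 pv.2) ->
  \forall x \near xs, (forall pv, List.In pv s -> burgers_phi phi0 x ts <= pv.2 x) /\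
    exists2 pv, List.In pv s & burgers_phi phi0 x ts = pv.2 x.
Proof.
move=> cov br.
have [e e0 He] : exists2 e : R, 0 < e & \forall x \near xs, forall pv, List.In pv s ->
    (exists a, act (row_mx a (stime x ts)) = pv.2 x) /\
    forall a, `|a - pv.1| < e -> minimizer (stime x ts) a -> act (row_mx a (stime x ts)) = pv.2 x.
  elim: s br {cov} => [|pv s IH] br; first by exists 1 => //; apply: filterE.
  have [e1 e10 H1] := IH (fun pv h => br pv (or_intror h)).
  have [e2 e20 H2] := br pv (or_introl erefl).
  exists (Num.min e1 e2); first by rewrite lt_min e10.
  move: H1 H2; apply: filterS2 => x H1 [H2 H3] qv [<-|qs].
    by split=> // a; rewrite lt_min => /andP[_]; exact: H3.
  have [h1 h2] := H1 _ qs.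
  by split=> // a; rewrite lt_min => /andP[+ _]; exact: h2.
have Hm := in_ths_cvg (minimizer_localized e0).
move: (near_and He Hm); apply: filterS => x [H1 [_ H2]].
have [a am] := minimizer_ex x ts0; rewrite (burgers_phiE am); split.
  by move=> pv /H1[[b <-] _]; exact: am.
have [q qm aq] := H2 _ am; have [pv pvs pq] := cov _ qm.
exists pv => //; have [_] := H1 _ pvs; apply=> //; by rewrite pq.
Qed.

(** [Nk] is the normal form read on sequences, of which only the first k terms count, so that one
    statement serves all the types. *)
Lemma shock_of (k : nat) (al : nat -> 'rV[R]_n.+1 -> R) (s : 'rV[R]_n.+1 -> R)
    (N : 'rV[R]_n.+1 -> R) (Nk : (nat -> R) -> R) :
  (forall y z : nat -> R, (forall i, (i < k)%N -> y i = z i) -> Nk y = Nk z) ->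
  (forall y, N y = Nk (rcoord y)) ->
  (forall i, (i < k)%N -> sm xs (al i) /\ al i xs = 0) -> sm xs s ->
  row_free (\matrix_(i < k, j < n.+1) pd j (al i) xs) ->
  (\forall x \near xs, burgers_phi phi0 x ts = Nk (al^~ x) + s x) ->
  shock_point_type phi0 N xs ts.
Proof.
move=> Nkext NE als ss fM H; have [h lc hE] := complete_coords als fM.
exists h, s; split=> //; split; first exact: sm_smooth_at.
move: H; apply: filterS => x ->; rewrite NE; congr (_ + _); apply: Nkext => i ik.
by rewrite hE.
Qed.

Lemma linear_comb_free k (M : 'M[R]_(k, n.+1)) :
  (forall c : 'I_k -> R, \sum_i c i *: row i M = 0 -> forall i, c i = 0) -> row_free M.
Proof.
move=> H; apply: inj_row_free => v vM; apply/rowP => i; rewrite mxE.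
by apply: (H (fun i => v ord0 i)); rewrite -mulmx_sum_row.
Qed.

End Burgers.

(** * Nondegenerate minima: from one to four points of type A_1 *)

Section MorseMinima.
Variables (R : realType) (n : nat) (phi0 : 'rV[R]_n.+1 -> R) (xs : 'rV[R]_n.+1) (ts : R).
Hypothesis phi0_smooth : smooth_on [set: 'rV[R]_n.+1] phi0.
Hypothesis attained : forall (x : 'rV[R]_n.+1) (t : R), 0 < t ->
  exists a, forall b, phi0 a + sqdist a x / (2 * t) <= phi0 b + sqdist b x / (2 * t).
Hypothesis ts0 : 0 < ts.

Let w a := phi0 a + sqdist a xs / (2 * ts).
Let ths := stime xs ts.

Lemma A1_regular p : glob_minset w = [set p]%classic -> min_type_A 1 w p -> ~ in_shock phi0 xs ts.
Proof.
move=> pm pA; have pmin : glob_minset w p by rewrite pm.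
have [v [[e e0 He] vs _ _]] := A1_branch phi0_smooth ts0 pmin pA.
pose f (th : 'rV[R]_(n.+1 + 1)) := burgers_phi phi0 (lsubmx th) (rsubmx th ord0 ord0).
have fs : sm ths f.
  apply: sm_ext vs.
  move: (near_and He (@minimizer_localized R n phi0 xs ts phi0_smooth attained ts0 e e0)).
  apply: filterS => th [[_ H1] [t0 H2]].
  have [a am] := minimizer_ex attained (lsubmx th) t0.
  rewrite /f (burgers_phiE am) -!stimeE; rewrite -stimeE in am.
  apply/esym/H1 => //; have [q qm] := H2 _ am.
  by have -> : q = p by move: qm; rewrite pm.
have [W [oW Wx Wf]] := sm_open fs.
(* The shock is defined through smoothness on a product, while the branch is smooth on rows; L is
   linear and continuous and carries one to the other. *)
pose L (p : 'rV[R]_n.+1 * R) := stime p.1 p.2.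
have Ll (h : R) v' x : L (h *: v' + x) = h *: L v' + L x.
  rewrite /L /stime scale_row_mx add_row_mx; congr row_mx.
  by apply/rowP => j; rewrite !ord1 !mxE eqxx !mulr1n.
have Lc p0 : {for p0, continuous L}.
  apply: row_cts => j; case: (splitP j) => i ij.
    have -> : j = lshift 1 i by exact: val_inj.
    have -> : (fun y => L y ord0 (lshift 1 i)) = (fun v : 'rV[R]_n.+1 => v ord0 i) \o fst.
      by apply/funext => y; rewrite /L /stime row_mxEl.
    by apply: continuous_comp; [exact: cvg_fst|exact: coord_continuous].
  have -> : j = rshift n.+1 i by exact: val_inj.
  have -> : (fun y => L y ord0 (rshift n.+1 i)) = snd.
    by apply/funext => y; rewrite /L /stime row_mxEr mxE !ord1 eqxx mulr1n.
  exact: cvg_snd.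
apply; exists (L @^-1` W); split=> //.
have -> : (fun p : 'rV[R]_n.+1 * R => burgers_phi phi0 p.1 p.2) = f \o L.
  by apply/funext => y; rewrite /f /L /= row_mxKl row_mxKr mxE eqxx mulr1n.
exact: sm_smooth_on_lin.
Qed.

Let grad_free k (al : nat -> 'rV[R]_n.+1 -> R) (d : 'I_k -> 'rV[R]_n.+1) :
  (forall (i : 'I_k) j, pd j (al i) xs = - d i ord0 j / ts) ->
  (forall c : 'I_k -> R, \sum_i c i *: d i = 0 -> forall i, c i = 0) ->
  row_free (\matrix_(i < k, j < n.+1) pd j (al i) xs).
Proof.
move=> gE H; apply: linear_comb_free => c cE; apply: H.
have : (- ts) *: \sum_i c i *: row i (\matrix_(i < k, j < n.+1) pd j (al i) xs) = 0.
  by rewrite cE scaler0.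
move=> H0; apply: (etrans _ H0); rewrite scaler_sumr; apply: eq_bigr => i _; apply/rowP => j.
by rewrite !mxE gE; field; rewrite gt_eqF.
Qed.

Let A1b p := @A1_branch_at R n phi0 xs ts phi0_smooth ts0 p.

Let diff_facts p q (v u : 'rV[R]_n.+1 -> R) : glob_minset w p -> glob_minset w q ->
  sm xs v -> sm xs u -> v xs = w p -> u xs = w q ->
  (forall i, pd i v xs = (xs ord0 i - p ord0 i) / ts) ->
  (forall i, pd i u xs = (xs ord0 i - q ord0 i) / ts) ->
  (sm xs (fun x => v x - u x) /\ v xs - u xs = 0) /\
  forall i, pd i (fun x => v x - u x) xs = - (p - q) ord0 i / ts.
Proof.
move=> pm qm vs us v0 u0 vd ud; split; first split; first exact: smB.
  by rewrite v0 u0; apply/eqP; rewrite subr_eq0 eq_le; apply/andP; split; [exact: pm|exact: qm].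
by move=> i; rewrite pdB// vd ud !mxE; field; rewrite gt_eqF.
Qed.

Lemma A1_2_shock p1 p2 : p1 <> p2 -> glob_minset w = [set p1; p2]%classic ->
  min_type_A 1 w p1 -> min_type_A 1 w p2 -> shock_point_type phi0 (@NF_A1_2 R n) xs ts.
Proof.
move=> p12 pm A1 A2.
have m1 : glob_minset w p1 by rewrite pm; left.
have m2 : glob_minset w p2 by rewrite pm; right.
have [v1 [b1 s1 e1 d1]] := A1b m1 A1; have [v2 [b2 s2 e2 d2]] := A1b m2 A2.
have [f2 g2] := diff_facts m2 m1 s2 s1 e2 e1 d2 d1.
apply: (@shock_of R n phi0 xs ts 1 (fun i x => v2 x - v1 x) v1 _ (fun y => Num.min (y 0%N) 0)).
- by move=> y z yz; rewrite yz.
- by [].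
- by move=> i _.
- exact: s1.
- apply: (@grad_free 1 (fun i x => v2 x - v1 x) (fun=> p2 - p1)); first by move=> i j; exact: g2.
  move=> c; rewrite big_ord1 => /eqP; rewrite scaler_eq0 subr_eq0 => /orP[/eqP c0 i|/eqP/esym//].
  by rewrite ord1.
pose l := [:: (p1, v1); (p2, v2)].
have cov : forall q, glob_minset w q -> exists2 pv, List.In pv l & pv.1 = q.
  by move=> q; rewrite pm => -[->|->]; [exists (p1, v1)|exists (p2, v2)] => //=; auto.
have br : forall pv, List.In pv l -> branch_at phi0 xs ts pv.1 pv.2.
  by move=> pv [<-|[<-|[]]].
move: (@burgers_branches R n phi0 xs ts phi0_smooth attained ts0 l cov br).
apply: filterS => x [lb [pv pvs E]].
have l1 := lb (p1, v1) (or_introl erefl); have l2 := lb (p2, v2) (or_intror (or_introl erefl)).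
move: pvs E l1 l2 => /= [<-|[<-|[]]] /= ->.
- by move=> _ H; rewrite min_r ?add0r// subr_ge0.
- by move=> H _; rewrite min_l ?subrK// subr_le0.
Qed.

Lemma A1_3_shock p1 p2 p3 : glob_minset w = [set p1; p2; p3]%classic ->
  [/\ min_type_A 1 w p1, min_type_A 1 w p2 & min_type_A 1 w p3] -> not_collinear p1 p2 p3 ->
  shock_point_type phi0 (@NF_A1_3 R n) xs ts.
Proof.
move=> pm [A1 A2 A3] nc.
have m1 : glob_minset w p1 by rewrite pm; left; left.
have m2 : glob_minset w p2 by rewrite pm; left; right.
have m3 : glob_minset w p3 by rewrite pm; right.
have [v1 [b1 s1 e1 d1]] := A1b m1 A1; have [v2 [b2 s2 e2 d2]] := A1b m2 A2.
have [v3 [b3 s3 e3 d3]] := A1b m3 A3.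
have [f2 g2] := diff_facts m2 m1 s2 s1 e2 e1 d2 d1.
have [f3 g3] := diff_facts m3 m1 s3 s1 e3 e1 d3 d1.
pose al i x := (if i == 0%N then v2 x else v3 x) - v1 x.
pose d (i : 'I_2) := (if i == 0%N :> nat then p2 else p3) - p1.
apply: (@shock_of R n phi0 xs ts 2 al v1 _ (fun y => Num.min (y 0%N) (Num.min (y 1%N) 0))).
- by move=> y z yz; rewrite !yz.
- by [].
- by move=> [|[|i]] // _.
- exact: s1.
- apply: (@grad_free 2 al d); first by move=> [[|[|i]] // i2].
  move=> c; rewrite big_ord_recl big_ord1 /d /= => /nc[c0 c1] [[|[|i]]//= i2].
  + by rewrite -c0; congr c; exact: val_inj.
  + by rewrite -c1; congr c; exact: val_inj.
pose l := [:: (p1, v1); (p2, v2); (p3, v3)].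
have cov : forall q, glob_minset w q -> exists2 pv, List.In pv l & pv.1 = q.
  by move=> q; rewrite pm => -[[->|->]|->]; [exists (p1, v1)|exists (p2, v2)|exists (p3, v3)] => //=; auto.
have br : forall pv, List.In pv l -> branch_at phi0 xs ts pv.1 pv.2.
  by move=> pv [<-|[<-|[<-|[]]]].
move: (@burgers_branches R n phi0 xs ts phi0_smooth attained ts0 l cov br).
apply: filterS => x [lb [pv pvs E]].
have := lb (p1, v1); have := lb (p2, v2); have := lb (p3, v3); move: pvs E => /= pvs E l3 l2 l1.
have {}l1 := l1 (or_introl erefl); have {}l2 := l2 (or_intror (or_introl erefl)).
have {}l3 := l3 (or_intror (or_intror (or_introl erefl))).
rewrite /al /=; case: pvs E => [<-|[<-|[<-|[]]]] /= E; rewrite E in l1 l2 l3 *.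
- by rewrite !(min_r, subr_ge0)// add0r.
- by rewrite min_l ?subrK// le_min subr_le0 l1 lerD2r l3.
- by rewrite [Num.min (v3 x - _) _]min_l ?subr_le0// min_r ?subrK// lerD2r.
Qed.

Lemma A1_4_shock p1 p2 p3 p4 : glob_minset w = [set p1; p2; p3; p4]%classic ->
  [/\ min_type_A 1 w p1, min_type_A 1 w p2, min_type_A 1 w p3 & min_type_A 1 w p4] ->
  not_coplanar p1 p2 p3 p4 -> shock_point_type phi0 (@NF_A1_4 R n) xs ts.
Proof.
move=> pm [A1 A2 A3 A4] nc.
have m1 : glob_minset w p1 by rewrite pm; left; left; left.
have m2 : glob_minset w p2 by rewrite pm; left; left; right.
have m3 : glob_minset w p3 by rewrite pm; left; right.
have m4 : glob_minset w p4 by rewrite pm; right.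
have [v1 [b1 s1 e1 d1]] := A1b m1 A1; have [v2 [b2 s2 e2 d2]] := A1b m2 A2.
have [v3 [b3 s3 e3 d3]] := A1b m3 A3; have [v4 [b4 s4 e4 d4]] := A1b m4 A4.
have [f2 g2] := diff_facts m2 m1 s2 s1 e2 e1 d2 d1.
have [f3 g3] := diff_facts m3 m1 s3 s1 e3 e1 d3 d1.
have [f4 g4] := diff_facts m4 m1 s4 s1 e4 e1 d4 d1.
pose al i x := (if i == 0%N then v2 x else if i == 1%N then v3 x else v4 x) - v1 x.
pose d (i : 'I_3) := (if i == 0%N :> nat then p2 else if i == 1%N :> nat then p3 else p4) - p1.
apply: (@shock_of R n phi0 xs ts 3 al v1 _
  (fun y => Num.min (y 0%N) (Num.min (y 1%N) (Num.min (y 2%N) 0)))).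
- by move=> y z yz; rewrite !yz.
- by [].
- by move=> [|[|[|i]]] // _.
- exact: s1.
- apply: (@grad_free 3 al d).
    by move=> [[|[|[|i]]] // i2].
  move=> c; rewrite !big_ord_recl big_ord0 addr0 addrA /d /= => /nc[c0 c1 c2] [[|[|[|i]]]//= i2].
  + by rewrite -c0; congr c; exact: val_inj.
  + by rewrite -c1; congr c; exact: val_inj.
  + by rewrite -c2; congr c; exact: val_inj.
pose l := [:: (p1, v1); (p2, v2); (p3, v3); (p4, v4)].
have cov : forall q, glob_minset w q -> exists2 pv, List.In pv l & pv.1 = q.
  move=> q; rewrite pm => -[[[->|->]|->]|->].
  + by exists (p1, v1) => //=; auto.
  + by exists (p2, v2) => //=; auto.
  + by exists (p3, v3) => //=; auto.
  + by exists (p4, v4) => //=; auto.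
have br : forall pv, List.In pv l -> branch_at phi0 xs ts pv.1 pv.2.
  by move=> pv [<-|[<-|[<-|[<-|[]]]]].
move: (@burgers_branches R n phi0 xs ts phi0_smooth attained ts0 l cov br).
apply: filterS => x [lb [pv pvs E]].
have := lb (p1, v1); have := lb (p2, v2); have := lb (p3, v3); have := lb (p4, v4).
move: pvs E => /= pvs E l4 l3 l2 l1.
have {}l1 := l1 (or_introl erefl); have {}l2 := l2 (or_intror (or_introl erefl)).
have {}l3 := l3 (or_intror (or_intror (or_introl erefl))).
have {}l4 := l4 (or_intror (or_intror (or_intror (or_introl erefl)))).
rewrite /al /=; case: pvs E => [<-|[<-|[<-|[<-|[]]]]] /= E; rewrite E in l1 l2 l3 l4 *.
- by rewrite !(min_r, subr_ge0)// add0r.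
- by rewrite min_l ?subrK// !le_min subr_le0 l1 !lerD2r l3 l4.
- rewrite [Num.min (v3 x - _) _]min_l; last by rewrite le_min subr_le0 l1 lerD2r l4.
  by rewrite min_r ?subrK// lerD2r.
- rewrite [Num.min (v4 x - _) _]min_l ?subr_le0//.
  rewrite [Num.min (v3 x - _) _]min_r ?lerD2r//.
  by rewrite min_r ?subrK// lerD2r.
Qed.

End MorseMinima.

(** * Hadamard's lemma *)

Section Schwarz.
Variables (R : realType) (m : nat).
Implicit Types (f g : 'rV[R]_m -> R) (x y : 'rV[R]_m).

Lemma norm_step x (i : 'I_m) (t : R) : `|t *: ev R i| <= `|t|.
Proof. by rewrite normrZ -[leRHS]mulr1 ler_wpM2l// norm_ev. Qed.

Lemma mvt_dir f y (i : 'I_m) (s c e : R) :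
  (forall t : R, `|t| <= `|s| -> sm (y + t *: ev R i) f /\ `|pd i f (y + t *: ev R i) - c| <= e) ->
  `|f (y + s *: ev R i) - f y - s * c| <= e * `|s|.
Proof.
move=> H.
have := @mvt_increment R (fun t => f (y + t *: ev R i)) (fun t => pd i f (y + t *: ev R i)) s c e.
rewrite scale0r addr0; apply=> t /H[st bt]; split; last exact: bt.
by apply: line_derive; exact: sm_derive.
Qed.

(** Two mean value estimates: in direction i for y |-> f (y + t e_j) - f y, and inside it in
    direction j for [pd i f]. *)
Lemma schwarz_half f x i j (e : R) : sm x f -> 0 < e -> exists2 r : R, 0 < r &
  forall s t : R, `|s| < r -> `|t| < r ->
  `|f (x + t *: ev R j + s *: ev R i) - f (x + s *: ev R i) - (f (x + t *: ev R j) - f x)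
     - s * t * pd j (pd i f) x| <= e * `|t| * `|s|.
Proof.
move=> fx e0; set c := pd j (pd i f) x.
have n2 := dist_cts (sm_cts (sm_pd j (sm_pd i fx))) e0.
have /nbhs_ballP[r /= r0 Hr] := near_and (sm_near fx) n2.
exists (r / 2); first exact: divr_gt0.
move=> s t sr tr.
have near2 (a b : R) : `|a| <= `|s| -> `|b| <= `|t| ->
    sm (x + b *: ev R j + a *: ev R i) f /\ `|pd j (pd i f) (x + b *: ev R j + a *: ev R i) - c| <= e.
  move=> a_s b_t.
  have /Hr[h1 h2] : ball x r (x + b *: ev R j + a *: ev R i).
    rewrite -ball_normE/= -addrA opprD addrA subrr sub0r normrN.
    rewrite (le_lt_trans (ler_normD _ _))// (splitr r) ltrD//.
    - exact: le_lt_trans (norm_step x _ _) (le_lt_trans b_t tr).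
    - exact: le_lt_trans (norm_step x _ _) (le_lt_trans a_s sr).
  by split; [exact: h1|rewrite distrC].
pose g y := f (y + t *: ev R j) - f y.
have gE y : (fun y => f (y + t *: ev R j)) = f \o (fun y => y + t *: ev R j) by [].
have sh y : smv y (fun y : 'rV[R]_m => y + t *: ev R j).
  move=> l; under eq_fun do rewrite mxE.
  by apply: smD; [exact: sm_coord|exact: sm_cst].
have shift_sm y : sm (y + t *: ev R j) f -> sm y (fun y => f (y + t *: ev R j)).
  by move=> h; exact: (sm_comp (sh y) h).
have shift_pd y : sm (y + t *: ev R j) f ->
    pd i (fun y => f (y + t *: ev R j)) y = pd i f (y + t *: ev R j).
  move=> h; have [] := @derive_quot _ _ _ _ (fun y => f (y + t *: ev R j)) f y (ev R i) (y + t *: ev R j) (ev R i).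
    by move=> a; rewrite addrA.
  by rewrite /pd => ->.
have := @mvt_dir g x i s (t * c) (e * `|t|).
have -> : g (x + s *: ev R i) = f (x + t *: ev R j + s *: ev R i) - f (x + s *: ev R i).
  by rewrite /g addrAC.
rewrite /g mulrA; apply=> a a_s.
have z0 : `|0 : R| <= `|t| by rewrite normr0.
have [s1 _] := near2 a t a_s (lexx _); have [s2 _] := near2 a 0 a_s z0.
rewrite scale0r addr0 in s2; rewrite addrAC in s1.
split; first by apply: smB; [exact: shift_sm|exact: s2].
rewrite pdB ?shift_pd//; last exact: shift_sm.
apply: mvt_dir => b b_t; have [h1 h2] := near2 a b a_s b_t.
by rewrite addrAC; split; [exact: sm_pd|exact: h2].
Qed.

Lemma second_diff_cmp (X A B F c c' t e : R) : 0 < t ->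
  `|X - A - (B - F) - t * t * c| <= e / 2 * t * t ->
  `|X - B - (A - F) - t * t * c'| <= e / 2 * t * t -> `|c - c'| <= e.
Proof.
move=> t0; rewrite !ler_norml => /andP[a1 a2] /andP[b1 b2].
have tt : 0 < t * t by rewrite mulr_gt0.
apply/andP; split; rewrite -(ler_pM2l tt); nra.
Qed.

(* Both mixed partials approximate the same second difference. *)
Lemma schwarz f x i j : sm x f -> pd i (pd j f) x = pd j (pd i f) x.
Proof.
move=> fx; apply/eqP; rewrite -subr_eq0 -normr_le0; apply/ler_addgt0Pl => e e0.
rewrite addr0.
have e20 : 0 < e / 2 by exact: divr_gt0.
have [r1 r10 H1] := schwarz_half j i fx e20; have [r2 r20 H2] := schwarz_half i j fx e20.
pose t := Num.min r1 r2 / 2.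
have t0 : 0 < t by rewrite divr_gt0// lt_min r10.
have t1 : `|t| < r1.
  by rewrite (gtr0_norm t0) /t ltr_pdivrMr// gt_min; apply/orP; left; lra.
have t2 : `|t| < r2.
  by rewrite (gtr0_norm t0) /t ltr_pdivrMr// gt_min; apply/orP; right; lra.
have h1 := H1 _ _ t1 t1; have h2 := H2 _ _ t2 t2.
rewrite (addrAC x) in h1.
set X := f (x + t *: ev R j + t *: ev R i) in h1 h2.
rewrite !(gtr0_norm t0) in h1 h2.
exact: (second_diff_cmp t0 h1 h2).
Qed.

End Schwarz.

Section Hadamard.
Variables (R : realType) (m : nat) (i : 'I_m).
Implicit Types (f g : 'rV[R]_m -> R) (x y : 'rV[R]_m).

Lemma pdX j x f k : sm x f -> pd j (fun y => f y ^+ k.+1) x = k.+1%:R * f x ^+ k * pd j f x.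
Proof.
move=> fx; elim: k => [|k IH].
  by under eq_fun do rewrite expr1; rewrite expr0 !mul1r.
under eq_fun do rewrite exprS; rewrite pdM//; last exact: smX.
by rewrite IH -[k.+2]addn1 natrD exprS; ring.
Qed.

Definition zc x : 'rV[R]_m := x - x ord0 i *: ev R i.

Lemma zcE x j : zc x ord0 j = if j == i then 0 else x ord0 j.
Proof.
by rewrite !mxE eqxx /=; case: eqP => [->|_]; rewrite ?mulr1 ?subrr ?mulr0 ?subr0.
Qed.

Lemma zc_add x : x = zc x + x ord0 i *: ev R i.
Proof. by rewrite /zc subrK. Qed.

Lemma zc_id x : x ord0 i = 0 -> zc x = x.
Proof. by rewrite /zc => ->; rewrite scale0r subr0. Qed.

Lemma zc_smv x : smv x zc.
Proof.
move=> j; under eq_fun do rewrite zcE.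
by case: eqP => _; [exact: sm_cst|exact: sm_coord].
Qed.

Let pdi k f := iter k (pd i) f.

Let pdi_sm k f x : sm x f -> sm x (pdi k f).
Proof. by move=> fx; elim: k => //= k; exact: sm_pd. Qed.

Let pdi_swap k l f x : sm x f -> pdi k (pd l f) x = pd l (pdi k f) x.
Proof.
elim: k f x => [//|k IH] f x fx /=.
rewrite -schwarz; last exact: pdi_sm.
apply: pd_near; move: (sm_near fx); apply: filterS => y fy; exact: IH.
Qed.

Let vanish (U : set 'rV[R]_m) k f :=
  forall j x, (j < k)%N -> U x -> x ord0 i = 0 -> pdi j f x = 0.

(** The quotient f / x_i^k, completed on x_i = 0 by the Taylor coefficient. All k occur although k =
    1 is the aim, since the x_i-derivative of f / x_i^k is (x_i f' - k f) / x_i^(k+1). *)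
Definition hquot k f x : R :=
  if x ord0 i == 0 then iter k (pd i) f x / k`!%:R else f x / x ord0 i ^+ k.

Let taylor_flat (x0 : 'rV[R]_m) r k f c e : x0 ord0 i = 0 ->
  (forall x, `|x - x0| < r -> sm x f) ->
  (forall j x, (j < k)%N -> `|x - x0| < r -> x ord0 i = 0 -> pdi j f x = 0) ->
  (forall x, `|x - x0| < r -> `|pdi k f x - c| <= e) ->
  forall j x, (j <= k)%N -> `|x - x0| < r ->
    `|pdi (k - j) f x - c * (x ord0 i ^+ j / j`!%:R)| <= e * `|x ord0 i| ^+ j.
Proof.
move=> x00 fs fv fc; elim=> [|j IH] x jk xr.
  by rewrite subn0 !expr0 divr1 !mulr1; exact: fc.
have seg (t : R) : `|t| <= `|x ord0 i| -> `|zc x + t *: ev R i - x0| < r.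
  move=> tx; apply: norm_lt_coord; first by rewrite (le_lt_trans _ xr).
  move=> l; rewrite !mxE eqxx/=; have := le_lt_trans (coord_le _ l) xr; rewrite !mxE.
  case: eqP => [->|_]; last by rewrite !mulr0 subr0 addr0.
  rewrite x00 !subr0 !mulr1 subrr add0r; exact: le_lt_trans.
have sE (t : R) : (zc x + t *: ev R i) ord0 i = t by rewrite mxE zcE eqxx add0r mxE ev_coord eqxx mulr1.
pose psi y := pdi (k - j.+1) f y - c * (y ord0 i ^+ j.+1 / j.+1`!%:R).
have kj : (k - j = (k - j.+1).+1)%N by rewrite subnSK.
have sX y : sm y (fun y : 'rV[R]_m => c * (y ord0 i ^+ j.+1 / j.+1`!%:R)).
  apply: smM; first exact: sm_cst.
  by apply: smM; [apply: smX; exact: sm_coord|exact: sm_cst].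
have := @mvt_dir _ _ psi (zc x) i (x ord0 i) 0 (e * `|x ord0 i| ^+ j).
rewrite -zc_add mulr0 subr0.
have -> : psi (zc x) = 0.
  have z0 : zc x ord0 i = 0 by rewrite zcE eqxx.
  rewrite /psi z0 exprS mul0r !mul0r mulr0 subr0.
  have := seg 0; rewrite scale0r addr0 normr0 => /(_ (normr_ge0 _)) zr.
  by apply: fv => //; rewrite ltn_subrL/= (leq_trans _ jk).
rewrite subr0 => H.
have : `|psi x| <= e * `|x ord0 i| ^+ j * `|x ord0 i|; last by rewrite -mulrA -exprSr.
apply: H => t tx.
have zr := seg t tx; have fz := fs _ zr.
split; first by apply: smB; [exact: pdi_sm|exact: sX].
rewrite subr0 /psi pdB; [|exact: pdi_sm|exact: sX].
rewrite pdZ; last by apply: smM; [apply: smX; exact: sm_coord|exact: sm_cst].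
have -> : pd i (fun y : 'rV[R]_m => y ord0 i ^+ j.+1 / j.+1`!%:R) (zc x + t *: ev R i)
    = t ^+ j / j`!%:R.
  under eq_fun do rewrite mulrC.
  rewrite pdZ; last by apply: smX; exact: sm_coord.
  rewrite pdX; last exact: sm_coord.
  have n1 : j.+1%:R != 0 :> R by rewrite pnatr_eq0.
  have n2 : j`!%:R != 0 :> R by rewrite pnatr_eq0 -lt0n fact_gt0.
  by rewrite pd_coord eqxx sE mulr1 factS natrM invfM mulrCA !mulrA divff// mul1r mulrC.
have := IH _ (ltnW jk) zr; rewrite sE kj => /le_trans; apply.
apply: ler_wpM2l; last by rewrite lerXn2r ?nnegrE.
by have := fc _ zr; exact: le_trans.
Qed.

Let off_sm k f x : sm x f -> x ord0 i != 0 -> sm x (hquot k f) /\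
  forall l, pd l (hquot k f) x =
    if l == i then hquot k.+1 (fun y => y ord0 i * pd i f y - k%:R * f y) x else hquot k (pd l f) x.
Proof.
move=> fx x0; have ci := sm_coord x i.
have n : {near x, (fun y => f y * (y ord0 i ^+ k)^-1) =1 hquot k f}.
  by move: (sm_neq0 ci x0); apply: filterS => y y0; rewrite /hquot (negPf y0).
have q : sm x (hquot k f).
  apply: sm_ext n _; apply: smM; first exact: fx.
  by apply: smV; [rewrite expf_neq0|exact: smX].
split; first exact: q.
move=> l; have n2 : {near x, (fun y => hquot k f y * y ord0 i ^+ k) =1 f}.
  by move: (sm_neq0 ci x0); apply: filterS => y y0; rewrite /hquot (negPf y0) divfK// expf_neq0.
have := pd_near l n2; rewrite pdM//; last exact: smX.
rewrite {1}/hquot (negPf x0).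
have -> : pd l (fun y : 'rV[R]_m => y ord0 i ^+ k) x = k%:R * x ord0 i ^+ k.-1 * (i == l)%:R.
  case: k {n q n2} => [|k]; last by rewrite pdX// pd_coord.
  by under eq_fun do rewrite expr0; rewrite pd_cst !mul0r.
move=> E.
have -> : pd l (hquot k f) x = (pd l f x - f x / x ord0 i ^+ k * (k%:R * x ord0 i ^+ k.-1 * (i == l)%:R)) / x ord0 i ^+ k.
  by rewrite -E; field; rewrite expf_neq0.
rewrite /hquot (negPf x0); have [->|li] := eqVneq l i; last by rewrite !mulr0 subr0.
rewrite mulr1 exprS; case: k {n q n2 E} => [|k]; first by rewrite !mul0r mulr0 expr0 !subr0; field.
by rewrite /= exprS; field; rewrite !(expf_neq0, x0).
Qed.

Let hquot_cts0 (U : set 'rV[R]_m) k f x0 : open U -> (forall x, U x -> sm x f) -> vanish U k f ->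
  U x0 -> x0 ord0 i = 0 -> {for x0, continuous (hquot k f)}.
Proof.
move=> oU fs fv Ux x00; apply: cts_dist => e e0.
have c1 := dist_cts (sm_cts (pdi_sm k (fs _ Ux))) e0.
have /nbhs_ballP[r /= r0 Hr] := near_and (open_near oU Ux) c1.
apply/nbhs_ballP; exists r => //= y yr.
have toball z : `|z - x0| < r -> ball x0 r z by rewrite -ball_normE/= distrC.
have yr' : `|y - x0| < r by rewrite -normrN opprB; move: yr; rewrite -ball_normE.
have fk : 0 < k`!%:R :> R by rewrite ltr0n fact_gt0.
have [_ cy] := Hr _ yr.
rewrite {1}/hquot x00 eqxx /hquot; case: ifPn => y0.
  rewrite -mulrBl normrM (gtr0_norm (_ : 0 < k`!%:R^-1)) ?invr_gt0//.
  by rewrite ler_pdivrMr//; apply: (le_trans cy); rewrite ler_peMr ?(ltW e0)// ler1n fact_gt0.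
have := @taylor_flat x0 r k f (pdi k f x0) e x00.
move=> /(_ _ _ _ k y (leqnn k) yr'); rewrite subnn /=; set c := iter k (pd i) f x0 => H.
have yk : 0 < `|y ord0 i| ^+ k by rewrite exprn_gt0// normr_gt0.
rewrite distrC -(ler_pM2r yk) -normrX -normrM.
have -> : (f y / y ord0 i ^+ k - c / k`!%:R) * y ord0 i ^+ k = f y - c * (y ord0 i ^+ k / k`!%:R).
  by field; rewrite expf_neq0//= gt_eqF.
rewrite normrX; apply: H.
- by move=> z /toball /Hr[Uz _]; exact: fs.
- by move=> j z jk /toball /Hr[Uz _]; exact: fv.
- by move=> z /toball /Hr[_]; rewrite distrC.
Qed.

Let hquot_cts (U : set 'rV[R]_m) k f x : open U -> (forall x, U x -> sm x f) -> vanish U k f ->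
  U x -> {for x, continuous (hquot k f)}.
Proof.
move=> oU fs fv Ux; have [x0|x0] := eqVneq (x ord0 i) 0; first exact: (hquot_cts0 oU fs fv Ux x0).
by have [/sm_cts] := off_sm k (fs _ Ux) x0.
Qed.

Let vanish_pd (U : set 'rV[R]_m) k f l : open U -> (forall x, U x -> sm x f) -> vanish U k f ->
  l != i -> vanish U k (pd l f).
Proof.
move=> oU fs fv li j x jk Ux x0; rewrite pdi_swap; last exact: fs.
suff [_ d] : is_derive x (ev R l) (pdi j f) 0 by exact: d.
apply/line_is_derive.
have n : {near (0 : R), (fun=> 0 : R) =1 (fun t : R => pdi j f (t *: ev R l + x))}.
  have : \forall t \near (0 : R), U (t *: ev R l + x).
    apply: (@near_preim _ _ (fun t : R => t *: ev R l + x) 0 U); last first.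
      by rewrite scale0r add0r; exact: open_near.
    apply: row_cts => a.
    have -> : (fun t : R => (t *: ev R l + x) ord0 a) = (fun t => t * ev R l ord0 a + x ord0 a).
      by apply/funext => t; rewrite !mxE.
    by apply: cvgD; [apply: cvgMl; exact: cvg_id|exact: cvg_cst].
  apply: filterS => t Ut; apply/esym/fv => //.
  by rewrite !mxE eqxx/= [i == l]eq_sym (negPf li) mulr0 x0 addr0.
by apply: near_eq_is_derive n _; exact: is_derive_cst.
Qed.

(** The j-th derivative of x f' - k f is x f^(j+1) + (j - k) f^(j). On x_i = 0 it vanishes for j < k
    by hypothesis and for j = k because of its coefficient. *)
Let vanish_succ (U : set 'rV[R]_m) k f : open U -> (forall x, U x -> sm x f) -> vanish U k f ->
  vanish U k.+1 (fun y => y ord0 i * pd i f y - k%:R * f y).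
Proof.
move=> oU fs fv.
have E j x : U x -> pdi j (fun y => y ord0 i * pd i f y - k%:R * f y) x =
    x ord0 i * pdi j.+1 f x + (j%:R - k%:R) * pdi j f x.
  elim: j x => [|j IH] x Ux; first by rewrite /=; ring.
  have n : {near x, pdi j (fun y => y ord0 i * pd i f y - k%:R * f y) =1
     (fun x => x ord0 i * pdi j.+1 f x + (j%:R - k%:R) * pdi j f x)}.
    by move: (open_near oU Ux); apply: filterS => y; exact: IH.
  rewrite [LHS](pd_near i n).
  have s a : sm x (pdi a f) by apply: pdi_sm; exact: fs.
  rewrite pdD; [|by apply: smM; [exact: sm_coord|exact: s]|by apply: smM; [exact: sm_cst|exact: s]].
  rewrite pdZ; last exact: s.
  rewrite pdM; [|exact: sm_coord|exact: s].
  rewrite pd_coord eqxx mulr1 -[pd i (pdi j f) x]/(pdi j.+1 f x) -[pd i (pdi j.+1 f) x]/(pdi j.+2 f x).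
  by move: (pdi j.+1 f x) (pdi j.+2 f x) => u v; rewrite -natr1; ring.
move=> j x jk Ux x0; rewrite E// x0 mul0r add0r.
move: jk; rewrite ltnS leq_eqVlt => /orP[/eqP ->|jk]; first by rewrite subrr mul0r.
by rewrite fv// mulr0.
Qed.

(** By the mean value theorem the difference quotient at 0 is a value of g at a nearby point. This
    carries the derivative of [hquot] across the hyperplane x_i = 0. *)
Lemma is_derive_removable (phi g : R -> R) (d : R) : 0 < d ->
  (forall t : R, `|t| < d -> t != 0 -> is_derive t 1 phi (g t)) ->
  {for 0, continuous phi} -> {for 0, continuous g} -> is_derive (0 : R) 1 phi (g 0).
Proof.
move=> d0 dphi cphi cg.
have cts t : `|t| < d -> {for t, continuous phi}.
  move=> td; have [->//|t0] := eqVneq t 0.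
  by have [dd _] := dphi t td t0; exact/differentiable_continuous/derivable1_diffP.
have mv t : `|t| < d -> t != 0 -> exists2 c, `|c| <= `|t| & phi t - phi 0 = g c * t.
  move=> td t0; have [tl|tg|te] := ltgtP t 0; last by rewrite te eqxx in t0.
  - have [||c ct E] := @MVT _ phi g t 0 tl.
    + move=> x; rewrite in_itv/= => /andP[x1 x2].
      by apply: dphi; [rewrite ltr0_norm//; move: td; rewrite ltr0_norm//; lra|rewrite lt_eqF].
    + apply: continuous_in_subspaceT => x; rewrite inE/= in_itv/= => /andP[x1 x2].
      by apply: cts; rewrite ler0_norm//; move: td; rewrite ltr0_norm//; lra.
    move: ct; rewrite in_itv/= => /andP[x1 x2]; exists c; first by rewrite !ltr0_norm//; lra.
    by rewrite -[LHS]opprB E sub0r mulrN opprK.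
  - have [||c ct E] := @MVT _ phi g 0 t tg.
    + move=> x; rewrite in_itv/= => /andP[x1 x2].
      by apply: dphi; [rewrite gtr0_norm//; move: td; rewrite gtr0_norm//; lra|rewrite gt_eqF].
    + apply: continuous_in_subspaceT => x; rewrite inE/= in_itv/= => /andP[x1 x2].
      by apply: cts; rewrite ger0_norm//; move: td; rewrite gtr0_norm//; lra.
    move: ct; rewrite in_itv/= => /andP[x1 x2]; exists c; first by rewrite !gtr0_norm//; lra.
    by rewrite E subr0.
suff cv : (fun t : R => t^-1 *: ((phi \o shift 0) (t *: 1) - phi 0)) @ 0^' --> g 0.
  by split; [apply/cvg_ex; exists (g 0)|apply: cvg_lim].
apply/cvgrPdist_le => e e0.
have := dist_cts cg e0 => /nbhs_ballP[r /= r0 Hr].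
near=> t.
have t0 : t != 0 by near: t; exact: nbhs_dnbhs_neq.
have td : `|t| < Num.min r d by near: t; apply: dnbhs0_lt; rewrite lt_min r0.
move: td; rewrite lt_min => /andP[tr td].
have [c ct E] := mv t td t0.
rewrite /= addr0 [t *: 1]mulr1 E -[_ *: _]/(_ * _) mulrCA mulVf// mulr1.
by apply: Hr; rewrite -ball_normE/= sub0r normrN; exact: le_lt_trans tr.
Unshelve. all: by end_near. Qed.

(** The closed family consists of all [hquot k f] with f vanishing to order k: a derivative along
    another axis keeps k, the derivative along axis i raises it by one. *)
Lemma hquot_sm (U : set 'rV[R]_m) f x : open U -> (forall x, U x -> sm x f) ->
  (forall x, U x -> x ord0 i = 0 -> f x = 0) -> U x -> sm x (hquot 1 f).
Proof.
move=> oU fs f0 Ux.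
pose F h := exists k f, [/\ forall x, U x -> sm x f, vanish U k f & h = hquot k f].
apply: (@sm_coind _ _ U F) Ux; first exact: oU; last first.
- exists 1%N, f; split; [exact: fs| |by []].
  by move=> j y; rewrite ltnS leqn0 => /eqP -> Uy y0; exact: f0.
- move=> _ l [k [g [gs gv ->]]]; have [->|li] := eqVneq l i; last first.
    exists (hquot k (pd l g)).
      exists k, (pd l g); split=> //; first by move=> y Uy; apply: sm_pd; exact: gs.
      exact: vanish_pd.
    move=> y Uy; have [y0|y0] := eqVneq (y ord0 i) 0; last first.
      have [s E] := off_sm k (gs _ Uy) y0.
      by have := E l; rewrite (negPf li) => <-; exact: sm_derive.
    have s : sm y (fun y => k`!%:R^-1 * pdi k g y).
      by apply: smM; [exact: sm_cst|apply: pdi_sm; exact: gs].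
    have E : hquot k (pd l g) y = pd l (fun y => k`!%:R^-1 * pdi k g y) y.
      rewrite /hquot y0 eqxx pdZ; last by apply: pdi_sm; exact: gs.
      by rewrite mulrC -/(pdi _ _) pdi_swap//; exact: gs.
    rewrite E; apply/line_is_derive.
    have := sm_derive l s => /line_is_derive; congr (is_derive _ _ _ _).
    apply/funext => t; rewrite /hquot !mxE eqxx/= [i == l]eq_sym (negPf li) mulr0 add0r y0 eqxx.
    by rewrite mulrC.
  pose g' y := y ord0 i * pd i g y - k%:R * g y.
  have gs' y : U y -> sm y g'.
    move=> Uy; apply: smB; apply: smM; [exact: sm_coord|apply: sm_pd; exact: gs|exact: sm_cst|exact: gs].
  have gv' : vanish U k.+1 g' by exact: vanish_succ.
  exists (hquot k.+1 g'); first by exists k.+1, g'.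
  move=> y Uy; have [y0|y0] := eqVneq (y ord0 i) 0; last first.
    have [s E] := off_sm k (gs _ Uy) y0.
    by have := E i; rewrite eqxx => <-; exact: sm_derive.
  apply/line_is_derive.
  have lc : {for (0 : R), continuous (fun t : R => t *: ev R i + y)}.
    apply: row_cts => a.
    have -> : (fun t : R => (t *: ev R i + y) ord0 a) = (fun t => t * ev R i ord0 a + y ord0 a).
      by apply/funext => t; rewrite !mxE.
    by apply: cvgD; [apply: cvgMl; exact: cvg_id|exact: cvg_cst].
  have l0 : 0 *: ev R i + y = y by rewrite scale0r add0r.
  have /nbhs_ballP[r /= r0 Hr] := open_near oU Uy.
  have := @is_derive_removable (fun t : R => hquot k g (t *: ev R i + y))
    (fun t : R => hquot k.+1 g' (t *: ev R i + y)) r r0; rewrite l0; apply.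
  + move=> t tr t0.
    have Ut : U (y + t *: ev R i).
      apply: Hr; rewrite -ball_normE/= opprD addrA subrr add0r normrN.
      by apply: le_lt_trans tr; exact: norm_step.
    have ti : (y + t *: ev R i) ord0 i != 0 by rewrite !mxE !eqxx mulr1 y0 add0r.
    have [s E] := off_sm k (gs _ Ut) ti.
    have := E i; rewrite eqxx [t *: ev R i + y]addrC => <-.
    under eq_fun do rewrite addrC.
    by apply: line_derive; exact: sm_derive.
  + apply: (@continuous_comp _ _ _ (fun t : R => t *: ev R i + y) (hquot k g)) => //.
    by rewrite l0; exact: (hquot_cts oU gs gv Uy).
  + apply: (@continuous_comp _ _ _ (fun t : R => t *: ev R i + y) (hquot k.+1 g')) => //.
    by rewrite l0; exact: (hquot_cts oU gs' gv' Uy).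
- by move=> _ [k [g [gs gv ->]]] y Uy; exact: (hquot_cts oU gs gv Uy).
Qed.

Lemma hadamard (U : set 'rV[R]_m) f : open U -> (forall x, U x -> sm x f) ->
  (forall x, U x -> x ord0 i = 0 -> f x = 0) ->
  exists2 g, (forall x, U x -> sm x g) & forall x, U x -> f x = x ord0 i * g x.
Proof.
move=> oU fs f0; exists (hquot 1 f); first by move=> x; exact: hquot_sm.
move=> x Ux; rewrite /hquot; case: eqP => [x0|/eqP x0]; first by rewrite f0// x0 mul0r.
by rewrite expr1 mulrC divfK.
Qed.

End Hadamard.

(** * Formal normal form *)

Module Ideals.
Section Ideals.
Variables (R : realType) (m : nat) (ia i1 i2 : 'I_m) (r0 : R).
Hypothesis r0gt0 : 0 < r0.
Implicit Types (f g h : 'rV[R]_m -> R) (x y : 'rV[R]_m) (k : nat).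

Definition dom : set 'rV[R]_m := [set x | `|x| < r0].

Definition smU f := forall x, dom x -> sm x f.

Lemma dom_open : open dom.
Proof.
rewrite openE => x xr; apply/nbhs_ballP; exists (r0 - `|x|); first by rewrite /= subr_gt0.
move=> y; rewrite -ball_normE/= => yx; rewrite /dom/= -(subrK x y).
rewrite (le_lt_trans (ler_normD _ _))//.
have -> : `|y - x| = `|x - y| by rewrite distrC.
by move: yx; rewrite ltrBrDr.
Qed.

Lemma dom_zc j x : dom x -> dom (zc j x).
Proof.
move=> dx; apply: norm_lt_coord => // l; rewrite zcE.
case: eqP => _; first by rewrite normr0.
exact: le_lt_trans (coord_le _ _) dx.
Qed.

Lemma smU_ext f g : smU f -> (forall x, dom x -> g x = f x) -> smU g.
Proof.
move=> fs fg x dx; apply: sm_ext (fs _ dx).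
by move: (open_near dom_open dx); apply: filterS => y /fg ->.
Qed.

Lemma smU_D f g : smU f -> smU g -> smU (fun x => f x + g x).
Proof. by move=> fs gs x dx; apply: smD; [exact: fs|exact: gs]. Qed.

Lemma smU_M f g : smU f -> smU g -> smU (fun x => f x * g x).
Proof. by move=> fs gs x dx; apply: smM; [exact: fs|exact: gs]. Qed.

Lemma smU_cst c : smU (fun=> c).
Proof. by move=> x dx; exact: sm_cst. Qed.

Lemma smU_coord j : smU (fun x => x ord0 j).
Proof. by move=> x dx; exact: sm_coord. Qed.

Lemma smU_X f k : smU f -> smU (fun x => f x ^+ k).
Proof. by move=> fs x dx; apply: smX; exact: fs. Qed.

Lemma smU_zc j f : smU f -> smU (fun x => f (zc j x)).
Proof. by move=> fs x dx; apply: (sm_comp (zc_smv j x)); apply/fs/dom_zc. Qed.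

Lemma smU_V f : smU f -> (forall x, dom x -> f x != 0) -> smU (fun x => (f x)^-1).
Proof. by move=> fs f0 x dx; apply: smV; [exact: f0|exact: fs]. Qed.

Lemma hadamardU j f : smU f -> exists2 g, smU g & forall x, dom x -> f x = f (zc j x) + x ord0 j * g x.
Proof.
move=> fs; have [||g gs E] := @hadamard _ _ j dom (fun x => f x - f (zc j x)) dom_open.
- by move=> x dx; apply: smB; [exact: fs|exact: (smU_zc j fs)].
- by move=> x dx x0; rewrite (zc_id x0) subrr.
- by exists g => [x|x dx]; [exact: gs|rewrite -E// addrC subrK].
Qed.

(** Forms of degree k in the two variables i1, i2 with coefficients in P. For smooth coefficients
    this is the k-th power of the ideal they generate; coefficients in [cf] do not involve i1, i2,
    which makes the form homogeneous, and those in [cfa] do not involve ia either. *)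
Fixpoint hmg (P : ('rV[R]_m -> R) -> Prop) k f : Prop :=
  if k is k'.+1 then exists g1 g2, [/\ hmg P k' g1, hmg P k' g2 &
    forall x, dom x -> f x = x ord0 i1 * g1 x + x ord0 i2 * g2 x]
  else exists2 g, P g & forall x, dom x -> f x = g x.

Lemma hom_ext P k f g : hmg P k f -> (forall x, dom x -> g x = f x) -> hmg P k g.
Proof.
case: k => [[h Ph E] fg|k [g1 [g2 [h1 h2 E]]] fg].
  by exists h => // x dx; rewrite fg// E.
by exists g1, g2; split=> // x dx; rewrite fg// E.
Qed.

Lemma hom_mono (P Q : ('rV[R]_m -> R) -> Prop) k f : (forall g, P g -> Q g) -> hmg P k f -> hmg Q k f.
Proof.
move=> PQ; elim: k f => [|k IH] f; first by move=> [g /PQ]; exists g.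
by move=> [g1 [g2 [/IH h1 /IH h2 E]]]; exists g1, g2.
Qed.

Lemma hom_mul (P : ('rV[R]_m -> R) -> Prop) (u : 'rV[R]_m -> R) k f :
  (forall g, P g -> P (fun x => u x * g x)) -> hmg P k f -> hmg P k (fun x => u x * f x).
Proof.
move=> Pu; elim: k f => [|k IH] f.
  by move=> [g /Pu Pg E]; exists (fun x => u x * g x) => // x dx; rewrite E.
move=> [g1 [g2 [/IH h1 /IH h2 E]]].
exists (fun x => u x * g1 x), (fun x => u x * g2 x); split=> // x dx.
by rewrite E//; ring.
Qed.

Lemma homD (P : ('rV[R]_m -> R) -> Prop) k f g :
  (forall f g, P f -> P g -> P (fun x => f x + g x)) -> hmg P k f -> hmg P k g ->
  hmg P k (fun x => f x + g x).
Proof.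
move=> PD; elim: k f g => [|k IH] f g.
  move=> [f' Pf Ef] [g' Pg Eg]; exists (fun x => f' x + g' x); first exact: PD.
  by move=> x dx; rewrite Ef// Eg.
move=> [f1 [f2 [h1 h2 E]]] [g1 [g2 [h1' h2' E']]].
exists (fun x => f1 x + g1 x), (fun x => f2 x + g2 x).
by split; [exact: IH|exact: IH|move=> x dx; rewrite E// E'//; ring].
Qed.

Notation mI := (hmg smU).

Lemma mI_D k f g : mI k f -> mI k g -> mI k (fun x => f x + g x).
Proof. by apply: homD => *; exact: smU_D. Qed.

Lemma mI_mul u k f : smU u -> mI k f -> mI k (fun x => u x * f x).
Proof. by move=> us; apply: hom_mul => g gs; exact: smU_M. Qed.

Lemma mI_mulr u k f : smU u -> mI k f -> mI k (fun x => f x * u x).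
Proof.
by move=> us fk; apply: (hom_ext (mI_mul us fk)) => x _; rewrite mulrC.
Qed.

Lemma mI_N k f : mI k f -> mI k (fun x => - f x).
Proof.
by move=> h; apply: (hom_ext (mI_mul (smU_cst (-1)) h)) => x _; rewrite mulN1r.
Qed.

Lemma mI_B k f g : mI k f -> mI k g -> mI k (fun x => f x - g x).
Proof. by move=> h1 /mI_N h2; exact: mI_D. Qed.

Lemma mI_sm k f : mI k f -> smU f.
Proof.
elim: k f => [|k IH] f; first by move=> [g gs E]; exact: (smU_ext gs).
move=> [g1 [g2 [/IH h1 /IH h2 E]]].
apply: (smU_ext (smU_D (smU_M (smU_coord i1) h1) (smU_M (smU_coord i2) h2))) => x dx; exact: E.
Qed.

Lemma mI_0 f : smU f -> mI 0 f.
Proof. by move=> fs; exists f. Qed.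

Lemma mI_S k f : mI k.+1 f -> mI k f.
Proof.
move=> [g1 [g2 [h1 h2 E]]].
exact: (hom_ext (mI_D (mI_mul (smU_coord i1) h1) (mI_mul (smU_coord i2) h2)) E).
Qed.

Lemma mI_le j k f : (j <= k)%N -> mI k f -> mI j f.
Proof. by move=> jk; rewrite -(subnK jk); elim: (k - j)%N => // d IH /mI_S. Qed.

Lemma mI_M j k f g : mI j f -> mI k g -> mI (j + k) (fun x => f x * g x).
Proof.
elim: j f => [|j IH] f; first by move=> /mI_sm fs gk; exact: mI_mul.
move=> [g1 [g2 [h1 h2 E]]] gk; rewrite addSn.
exists (fun x => g1 x * g x), (fun x => g2 x * g x).
by split; [exact: IH|exact: IH|move=> x dx; rewrite E//; ring].
Qed.

Lemma mI_1 : mI 1 (fun x => x ord0 i1) /\ mI 1 (fun x => x ord0 i2).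
Proof.
split.
  exists (fun=> 1), (fun=> 0); split; [exact/mI_0/smU_cst|exact/mI_0/smU_cst|].
  by move=> x _; rewrite mulr1 mulr0 addr0.
exists (fun=> 0), (fun=> 1); split; [exact/mI_0/smU_cst|exact/mI_0/smU_cst|].
by move=> x _; rewrite mulr1 mulr0 add0r.
Qed.

Definition rho x : R := Num.max `|x ord0 i1| `|x ord0 i2|.

Lemma rho_ge0 x : 0 <= rho x.
Proof. by rewrite le_max normr_ge0. Qed.

Lemma rho_i1 x : `|x ord0 i1| <= rho x.
Proof. by rewrite le_max lexx. Qed.

Lemma rho_i2 x : `|x ord0 i2| <= rho x.
Proof. by rewrite le_max lexx orbT. Qed.

Lemma ball_bound f (r1 : R) : r1 < r0 -> smU f -> exists2 C : R, 0 < C & forall x, `|x| <= r1 -> `|f x| <= C.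
Proof.
move=> r10 fs.
have cK : compact [set x : 'rV[R]_m | `|x| <= r1].
  apply: bounded_closed_compact.
    exists r1; split; first exact: num_real.
    by move=> M r1M x /= xr; exact: le_trans xr (ltW r1M).
  apply: (@closed_comp _ _ (fun x : 'rV[R]_m => `|x|) [set t | t <= r1]); last exact: closed_le.
  by move=> x _; exact: norm_continuous.
have cf : {within [set x : 'rV[R]_m | `|x| <= r1], continuous f}.
  apply: continuous_in_subspaceT => x; rewrite inE/= => xr.
  exact: (sm_cts (fs _ (le_lt_trans xr r10))).
have [M [Mr HM]] := compact_bounded (continuous_compact cf cK).
exists (Num.max M 0 + 1); first by rewrite ltr_wpDl// le_max lexx orbT.
move=> x xr; apply: HM; last by exists x.
by rewrite (@le_lt_trans _ _ (Num.max M 0))// ?le_max ?lexx// ltrDl.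
Qed.

Lemma mI_bound k f (r1 : R) : r1 < r0 -> mI k f ->
  exists2 C : R, 0 < C & forall x, `|x| <= r1 -> `|f x| <= C * rho x ^+ k.
Proof.
move=> r10; elim: k f => [|k IH] f.
  move=> /mI_sm /(ball_bound r10)[C C0 H]; exists C => // x /H; by rewrite expr0 mulr1.
move=> [g1 [g2 [/IH[C1 C10 H1] /IH[C2 C20 H2] E]]]; exists (C1 + C2); first exact: addr_gt0.
move=> x xr; rewrite E; last exact: le_lt_trans xr r10.
rewrite (le_trans (ler_normD _ _))// !normrM exprS mulrDl.
by rewrite lerD// mulrCA ler_pM// ?H1 ?H2// ?rho_i1 ?rho_i2.
Qed.

Hypotheses (a1 : ia != i1) (a2 : ia != i2).

Lemma zcC i j x : zc i (zc j x) = zc j (zc i x).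
Proof. by apply/rowP => l; rewrite !zcE; do 2!case: ifP. Qed.

Lemma zc_zc i x : zc i (zc i x) = zc i x.
Proof. by apply: zc_id; rewrite zcE eqxx. Qed.

Definition indep j f := forall x, dom x -> f (zc j x) = f x.
Definition cf f := [/\ smU f, indep i1 f & indep i2 f].
Definition cfa f := cf f /\ indep ia f.

Definition lead f : 'rV[R]_m -> R := fun x => f (zc i1 (zc i2 x)).

Lemma lead_cf f : smU f -> cf (lead f).
Proof.
move=> fs; split.
- exact: (smU_zc i2 (smU_zc i1 fs)).
- by move=> x dx; rewrite /lead zcC zc_zc zcC.
- by move=> x dx; rewrite /lead zc_zc.
Qed.

Lemma lead_id f x : cf f -> dom x -> lead f x = f x.
Proof. by move=> [_ v1 v2] dx; rewrite /lead v1 ?v2//; exact: dom_zc. Qed.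

Lemma lead_sub f : smU f -> mI 1 (fun x => f x - lead f x).
Proof.
move=> fs; have [q2 q2s E2] := hadamardU i2 fs.
have [q1 q1s E1] := hadamardU i1 (smU_zc i2 fs).
exists q1, q2; split; [exact: mI_0|exact: mI_0|] => x dx.
by rewrite E2// E1// /lead [zc i2 (zc i1 _)]zcC; ring.
Qed.

(** The coefficients are frozen at zero values of the variables i1, i2; what is lost lies in the
    ideal, by Hadamard. *)
Lemma leading k f : mI k f -> exists2 h, hmg cf k h & mI k.+1 (fun x => f x - h x).
Proof.
elim: k f => [|k IH] f.
  move=> /mI_sm fs; exists (lead f); last exact: lead_sub.
  by exists (lead f) => //; exact: lead_cf.
move=> [g1 [g2 [/IH[h1 c1 l1] /IH[h2 c2 l2] E]]].
exists (fun x => x ord0 i1 * h1 x + x ord0 i2 * h2 x); first by exists h1, h2.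
exists (fun x => g1 x - h1 x), (fun x => g2 x - h2 x); split=> // x dx.
by rewrite E//; ring.
Qed.

Section Division.
Variable h0 : 'rV[R]_m -> R.
Hypotheses (h0cf : cf h0) (h0n : forall x, dom x -> h0 x != 0).
Let U0 x := x ord0 ia * h0 x.

Lemma divide1 c : cf c -> exists S c', [/\ cfa S, cf c' & forall x, dom x -> c x = S x + U0 x * c' x].
Proof.
move=> cc; have [cs _ _] := cc; have [h0s h01 h02] := h0cf.
have [q qs E] := hadamardU ia cs.
exists (fun x => c (zc ia x)), (fun x => lead q x * (h0 x)^-1); split.
- split; last by move=> x dx; rewrite zc_zc.
  have [_ v1 v2] := cc.
  by split=> [|x dx|x dx]; [exact: smU_zc|rewrite zcC v1//; exact: dom_zc|rewrite zcC v2//; exact: dom_zc].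
- have [l0 l1 l2] := lead_cf qs.
  split=> [|x dx|x dx]; first by apply: smU_M => //; exact: smU_V.
  + by rewrite l1// h01.
  + by rewrite l2// h02.
- move=> x dx; rewrite -(lead_id cc dx) /lead E; last exact/dom_zc/dom_zc.
  rewrite 2!(zcC ia) -[X in X + _]/(lead c (zc ia x)) (lead_id cc (dom_zc _ dx)); congr (_ + _).
  by rewrite !zcE (negPf a1) (negPf a2) /U0 -/(lead q x); field; exact: h0n.
Qed.

(** Infinitesimal versality of the quartic: three divisions of each coefficient by U0 leave a
    remainder of degree at most 2 in U0, and the multiple of U0^3 is written 4 U0^3 xi because that
    is the first order effect on U^4 of replacing U by U + xi. *)
Lemma division k h : hmg cf k h -> exists xi A B S,
  [/\ hmg cf k xi, hmg cfa k A, hmg cfa k B, hmg cfa k S &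
   forall x, dom x -> h x = 4 * U0 x ^+ 3 * xi x + A x * U0 x ^+ 2 + B x * U0 x + S x].
Proof.
elim: k h => [|k IH] h.
  move=> [c cc E]; have [S [c1 [Sc /divide1[B [c2 [Bc /divide1[A [c3 [Ac c3c E3]]] E2]]] E1]]] := divide1 cc.
  exists (fun x => c3 x / 4), A, B, S; split; [|by exists A|by exists B|by exists S|].
    exists (fun x => c3 x / 4) => //; have [s v1 v2] := c3c.
    split=> [|x dx|x dx]; [|by rewrite v1|by rewrite v2].
    by apply: smU_M => //; exact: smU_cst.
  by move=> x dx; rewrite E// E1// E2// E3//; field.
move=> [g1 [g2 [/IH[x1 [A1 [B1 [S1 [xh1 Ah1 Bh1 Sh1 E1]]]]] /IH[x2 [A2 [B2 [S2 [xh2 Ah2 Bh2 Sh2 E2]]]]] E]]].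
pose c g g' := fun x : 'rV[R]_m => x ord0 i1 * g x + x ord0 i2 * g' x : R.
exists (c x1 x2), (c A1 A2), (c B1 B2), (c S1 S2); split.
- by exists x1, x2.
- by exists A1, A2.
- by exists B1, B2.
- by exists S1, S2.
- by move=> x dx; rewrite E// E1// E2// /c; ring.
Qed.

End Division.

Lemma cfa_sm k f : hmg cfa k f -> mI k f.
Proof. by apply: hom_mono => g [[]]. Qed.

Lemma cf_sm k f : hmg cf k f -> mI k f.
Proof. by apply: hom_mono => g []. Qed.

Lemma hom_inv k f : hmg cfa k f -> indep ia f.
Proof.
elim: k f => [|k IH] f.
  by move=> [g [_ gi] E] x dx; rewrite !E ?gi//; exact: dom_zc.
move=> [g1 [g2 [/IH v1 /IH v2 E]]] x dx; rewrite !E//; last exact: dom_zc.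
by rewrite !zcE v1// v2// eq_sym (negPf a1) eq_sym (negPf a2).
Qed.

(* [A'], [B'], [S'] are any modifications of the coefficients A, B, S of the division of the
   leading part, of higher order: this leaves room for Borel summation. *)
Lemma normal_step k (G U U0 al be s h xi A B S A' B' S' : 'rV[R]_m -> R) : (0 < k)%N ->
  smU U -> smU U0 -> mI 1 (fun x => U x - U0 x) -> mI 1 al -> mI 1 be ->
  mI k.+1 (fun x => G x - (U x ^+ 4 + al x * U x ^+ 2 + be x * U x) - s x - h x) ->
  mI k xi -> mI k A -> mI k B -> mI k A' -> mI k B' ->
  mI k.+1 (fun x => A' x - A x) -> mI k.+1 (fun x => B' x - B x) -> mI k.+1 (fun x => S' x - S x) ->
  (forall x, dom x -> h x = 4 * U0 x ^+ 3 * xi x + A x * U0 x ^+ 2 + B x * U0 x + S x) ->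
  mI k.+1 (fun x => G x - ((U x + xi x) ^+ 4 + (al x + A' x) * (U x + xi x) ^+ 2
     + (be x + B' x) * (U x + xi x)) - (s x + S' x)).
Proof.
move=> k0 Us U0s UU al1 be1 Rk xk Ak Bk Ak' Bk' dA dB dS hE.
have one f : mI k f -> mI 1 f by exact: mI_le.
have xs := mI_sm xk.
(* xi w collects every term divisible by xi in the change of the quartic, except 4 U0^3 xi. Each
   summand of w contains a factor from the ideal, so xi w has order k + 1. *)
pose w x := (U x - U0 x) * (4 * (U x ^+ 2 + U x * U0 x + U0 x ^+ 2)) +
  xi x * (6 * U x ^+ 2 + 4 * U x * xi x + xi x ^+ 2) + al x * (2 * U x + xi x) + be x +
  A' x * (2 * U x + xi x) + B' x.
have s2 : smU (fun x => 2 * U x + xi x) by apply: smU_D => //; apply: smU_M => //; exact: smU_cst.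
have w1 : mI 1 w.
  apply: mI_D; last exact: one.
  apply: mI_D; last by apply: mI_mulr; [exact: s2|exact: one].
  apply: mI_D; last exact: be1.
  apply: mI_D; last by apply: mI_mulr; [exact: s2|exact: al1].
  apply: mI_D; apply: mI_mulr; [|exact: UU| |exact: one].
    apply: smU_M; first exact: smU_cst.
    by apply: smU_D; [apply: smU_D; [exact: smU_X|exact: smU_M]|exact: smU_X].
  apply: smU_D; last exact: smU_X.
  by apply: smU_D; apply: smU_M => //; [exact: smU_cst|exact: smU_X|apply: smU_M => //; exact: smU_cst].
have wx : mI k.+1 (fun x => xi x * w x) by rewrite -addn1; exact: mI_M.
have v : mI k.+1 (fun x => (A x * (U x + U0 x) + B x) * (U x - U0 x)).
  rewrite -addn1; apply: mI_M; last exact: UU.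
  by apply: mI_D; [apply: mI_mulr; [exact: smU_D|exact: Ak]|exact: Bk].
have dA' := mI_mulr (smU_X 2 Us) dA; have dB' := mI_mulr Us dB.
apply: (hom_ext (mI_B (mI_B (mI_B (mI_B (mI_B Rk wx) dA') dB') dS) v)) => x dx.
by rewrite hE// /w; ring.
Qed.

End Ideals.
End Ideals.
Import Ideals.

Section Compose1.
Variable R : realType.

Lemma comp1_derive m (f : 'rV[R]_m -> R) (g : R -> R) x v (df dg : R) :
  is_derive x v f df -> is_derive (f x) 1 g dg -> is_derive x v (g \o f) (dg * df).
Proof.
move=> /line_is_derive[c1 c2] [g1 g2].
have f0 : f (0 *: v + x) = f x by rewrite scale0r add0r.
apply/line_is_derive; split.
  apply/derivable1_diffP; apply: (@differentiable_comp _ _ _ _ (fun t : R => f (t *: v + x)) g); first exact/derivable1_diffP.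
  by rewrite f0; exact/derivable1_diffP.
have g1' : derivable g (f (0 *: v + x)) 1 by rewrite f0.
have := derive1_comp c1 g1'; rewrite !derive1E c2 f0 g2 => ->.
by [].
Qed.

Lemma sm_sin_shift m (f : 'rV[R]_m -> R) x k : sm x f -> sm x (fun y => sin (f y + (pi / 2) *+ k)).
Proof.
move=> fx; pose g j t := sin (t + (pi / 2) *+ (k + j)) : R.
have -> : (fun y => sin (f y + (pi / 2) *+ k)) = g 0%N \o f by apply/funext => y; rewrite /g /= addn0.
apply: (@sm_seq _ _ x f setT g _ _ _ fx); [exact: openT|by []|].
move=> j y _.
have d := is_derive_sin (y + (pi / 2) *+ (k + j)).
have h : is_derive y (1 : R) (fun t : R => t + (pi / 2) *+ (k + j)) 1.
  by rewrite -[1 in X in is_derive _ _ _ X]addr0; exact: is_deriveD.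
have := @is_derive1_comp _ sin (fun t => t + (pi / 2) *+ (k + j)) y _ 1 d h.
have -> : g j.+1 y = cos (y + (pi / 2) *+ (k + j)) by rewrite /g addnS mulrSr addrA sinDpihalf.
by rewrite mulr1.
Qed.

Lemma sm_sin m (f : 'rV[R]_m -> R) x : sm x f -> sm x (fun y => sin (f y)).
Proof. by move=> /(sm_sin_shift 0); under eq_fun do rewrite mulr0n addr0. Qed.

Lemma sm_cos m (f : 'rV[R]_m -> R) x : sm x f -> sm x (fun y => cos (f y)).
Proof. by move=> /(sm_sin_shift 1); under eq_fun do rewrite mulr1n sinDpihalf. Qed.

Lemma pd_comp1 m (f : 'rV[R]_m -> R) (g : R -> R) x i (dg : R) :
  sm x f -> is_derive (f x) 1 g dg -> pd i (fun y => g (f y)) x = dg * pd i f x.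
Proof. by move=> fx gd; have [_] := comp1_derive (sm_derive i fx) gd. Qed.

Lemma abs_sin_le (t : R) : `|sin t| <= `|t|.
Proof.
have := @mvt_increment R sin cos t 0 1; rewrite sin0 mulr0 !subr0 mul1r; apply=> u _.
by rewrite subr0 cos_max; split=> //; exact: is_derive_sin.
Qed.

End Compose1.

Section Increment.
Variables (R : realType) (m : nat).
Implicit Types (x v : 'rV[R]_m).

Lemma near_radius x (P : 'rV[R]_m -> Prop) : (\forall y \near x, P y) ->
  exists2 r : R, 0 < r & forall y, `|y - x| < r -> P y.
Proof.
move=> /nbhs_ballP[r /= r0 Hr]; exists r => // y yr; apply: Hr.
by rewrite -ball_normE/= distrC.
Qed.

Lemma increment_derive (f : 'rV[R]_m -> R) x v (d : R) :
  (forall e : R, 0 < e -> exists2 r : R, 0 < r &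
     forall t : R, `|t| < r -> `|f (x + t *: v) - f x - t * d| <= e * `|t|) ->
  is_derive x v f d.
Proof.
move=> H.
suff cv : (fun t : R => t^-1 *: ((f \o shift x) (t *: v) - f x)) @ 0^' --> d.
  by split; [apply/cvg_ex; exists d|apply: cvg_lim].
apply/cvgrPdist_le => e e0; have [r r0 Hr] := H e e0.
near=> t.
have t0 : t != 0 by near: t; exact: nbhs_dnbhs_neq.
have tr : `|t| < r by near: t; exact: dnbhs0_lt.
have := Hr t tr; rewrite /= [t *: v + x]addrC -[t^-1 *: _]/(t^-1 * _).
set A := f (x + t *: v) - f x => h.
have -> : d - t^-1 * A = - (t^-1 * (A - t * d)) by field.
by rewrite normrN normrM normfV ler_pdivrMl ?normr_gt0// [leRHS]mulrC.
Unshelve. all: by end_near. Qed.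

End Increment.

(** * Sums of series of smooth functions *)

Section UniformLimit.
Variables (R : realType) (m : nat) (U : set 'rV[R]_m) (D : nat -> 'rV[R]_m -> R).
Hypotheses (oU : open U) (Ds : forall k x, U x -> sm x (D k)).
Hypothesis Db : forall s, exists n0, forall k x, (n0 <= k)%N -> U x -> `|pds s (D k) x| <= 2^-1 ^+ k.

Let S s n x := \sum_(k < n) pds s (D k) x.
Let L s x := lim (S s ^~ x @ \oo).

Let geo n (j : nat) : \sum_(n <= k < n + j) 2^-1 ^+ k <= 2 * 2^-1 ^+ n :> R.
Proof.
have -> : \sum_(n <= k < n + j) 2^-1 ^+ k = 2 * 2^-1 ^+ n - 2 * 2^-1 ^+ (n + j) :> R.
  elim: j => [|j IH]; first by rewrite addn0 big_geq// subrr.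
  by rewrite addnS big_nat_recr ?leq_addr//= IH [2^-1 ^+ _.+1]exprS; field.
by rewrite lerBlDr lerDl mulr_ge0// exprn_ge0.
Qed.

Let S_tail s : exists n0, forall n j x, (n0 <= n)%N -> U x -> `|S s (n + j) x - S s n x| <= 2 * 2^-1 ^+ n.
Proof.
have [n0 H] := Db s; exists n0 => n j x nn Ux.
have -> : S s (n + j) x - S s n x = \sum_(n <= k < n + j) pds s (D k) x.
  rewrite /S -!(big_mkord xpredT (fun k => pds s (D k) x)).
  by rewrite (@big_cat_nat _ _ _ n 0 (n + j))//= ?leq_addr// addrAC subrr add0r.
apply: (le_trans (ler_norm_sum _ _ _)); apply: le_trans (geo n j).
apply: ler_sum_nat => k /andP[nk _].
by apply: H => //; exact: leq_trans nk.
Qed.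

Let half_small (e : R) : 0 < e -> exists n, 2 * 2^-1 ^+ n <= e.
Proof.
move=> e0.
have c : (fun n => 2 * 2^-1 ^+ n : R) @ \oo --> (2 * 0 : R).
  by apply: cvgMr; apply: cvg_expr; rewrite ger0_norm//; lra.
move: c; rewrite mulr0 => /cvgr0Pnorm_le /(_ e e0) [n _ H].
exists n; apply: le_trans (H n (leqnn n)); exact: ler_norm.
Qed.

Let S_cvg s x : U x -> S s ^~ x @ \oo --> L s x.
Proof.
move=> Ux; apply: cauchy_cvg; apply/cauchy_ballP => e e0.
have [n0 H] := S_tail s; have [n1 h1] := @half_small (e / 4) (divr_gt0 e0 (ltr0Sn _ _)).
pose n := maxn n0 n1.
have P : \forall k \near \oo, `|S s k x - S s n x| <= e / 4.
  exists n => // k /= nk; rewrite -(subnKC nk) (le_trans (H n (k - n)%N x (leq_maxl _ _) Ux))//.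
  apply: le_trans h1; rewrite ler_pM2l// ler_iXn2l ?leq_maxr//; lra.
exists (S s ^~ x @` [set k | `|S s k x - S s n x| <= e / 4], S s ^~ x @` [set k | `|S s k x - S s n x| <= e / 4]).
  by split; apply: filterS P => k kP; exists k.
move=> [u v] /= [[k kP <-] [l lP <-]]; rewrite -ball_normE/=.
have -> : S s k x - S s l x = (S s k x - S s n x) - (S s l x - S s n x) by ring.
rewrite (le_lt_trans (ler_normB _ _))//; lra.
Qed.

Let L_tail s : exists n0, forall n x, (n0 <= n)%N -> U x -> `|L s x - S s n x| <= 2 * 2^-1 ^+ n.
Proof.
have [n0 H] := S_tail s; exists n0 => n x nn Ux.
have c : (fun j => `|S s j x - S s n x|) @ \oo --> `|L s x - S s n x|.
  by apply: cvg_norm; apply: cvgB; [exact: S_cvg|exact: cvg_cst].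
rewrite -(cvg_lim _ c)//; apply: limr_le; first by apply/cvg_ex; exists `|L s x - S s n x|.
by exists n => // j /= nj; rewrite -(subnKC nj); exact: H.
Qed.

Let Ss s n x : U x -> sm x (S s n).
Proof. by move=> Ux; apply: sm_sum => k _; apply: sm_pds; exact: Ds. Qed.

Let L_cts s x : U x -> {for x, continuous (L s)}.
Proof.
move=> Ux; apply: cts_dist => e e0; have e3 : 0 < e / 3 by exact: divr_gt0.
have [n0 H] := L_tail s; have [n1 h1] := half_small e3.
pose n := maxn n0 n1.
have h2 : 2 * 2^-1 ^+ n <= e / 3.
  by apply: le_trans h1; rewrite ler_pM2l// ler_iXn2l ?leq_maxr//; lra.
have := near_and (open_near oU Ux) (dist_cts (sm_cts (Ss s n Ux)) e3).
apply: filterS => y [Uy yx].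
have a := le_trans (H n x (leq_maxl _ _) Ux) h2; have b := le_trans (H n y (leq_maxl _ _) Uy) h2.
have -> : L s x - L s y = (L s x - S s n x) + (S s n x - S s n y) - (L s y - S s n y) by ring.
apply: (le_trans (ler_normB _ _)); rewrite (splitr e).
have := ler_normD (L s x - S s n x) (S s n x - S s n y); lra.
Qed.

Let L_derive s i x : U x -> is_derive x (ev R i) (L s) (L (i :: s) x).
Proof.
move=> Ux; apply: increment_derive => e e0; have e2 : 0 < e / 2 by exact: divr_gt0.
have [r r0 Hr] := near_radius (near_and (open_near oU Ux) (dist_cts (L_cts (s := i :: s) Ux) e2)).
exists r => // t tr.
have seg (u : R) : `|u| <= `|t| -> `|x + u *: ev R i - x| < r.
  by move=> ut; rewrite addrC addKr; apply: (le_lt_trans (norm_step _ _ _)) => //; exact: le_lt_trans tr.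
have Ut : U (x + t *: ev R i) by have [] := Hr _ (seg t (lexx _)).
have [n0 H] := L_tail (i :: s); have [n1 h1] := half_small e2.
have c : (fun n => `|S s n (x + t *: ev R i) - S s n x - t * L (i :: s) x|) @ \oo -->
    `|L s (x + t *: ev R i) - L s x - t * L (i :: s) x|.
  apply: cvg_norm; apply: cvgB; last exact: cvg_cst.
  by apply: cvgB; exact: S_cvg.
rewrite -(cvg_lim _ c)//; apply: limr_le.
  by apply/cvg_ex; exists `|L s (x + t *: ev R i) - L s x - t * L (i :: s) x|.
exists (maxn n0 n1) => // n /=; rewrite geq_max => /andP[nn0 nn1].
apply: mvt_dir => u ut; have [Uu cu] := Hr _ (seg u ut).
split; first exact: Ss.
have -> : pd i (S s n) (x + u *: ev R i) = S (i :: s) n (x + u *: ev R i).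
  by rewrite /S pd_sum// => k _; apply: sm_pds; exact: Ds.
have a := H n _ nn0 Uu.
have h2 : 2 * 2^-1 ^+ n <= e / 2.
  by apply: le_trans h1; rewrite ler_pM2l// ler_iXn2l//; lra.
rewrite distrC in a; rewrite distrC in cu.
have -> : S (i :: s) n (x + u *: ev R i) - L (i :: s) x =
  (S (i :: s) n (x + u *: ev R i) - L (i :: s) (x + u *: ev R i)) + (L (i :: s) (x + u *: ev R i) - L (i :: s) x) by ring.
by apply: (le_trans (ler_normD _ _)); rewrite [leRHS](splitr e); apply: lerD; [exact: le_trans h2|exact: cu].
Qed.

(** The index from which 2^-k dominates may depend on the derivative, exactly what a Borel choice of
    scales can offer. The limits [L s] of the differentiated series form the closed family; each is
    derived by the mean value estimate on partial sums, passed to the limit. *)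
Lemma uniform_limit : exists2 f, (forall x, U x -> sm x f) &
  forall x, U x -> (fun n => \sum_(k < n) D k x) @ \oo --> f x.
Proof.
exists (L [::]); last by move=> x Ux; exact: (@S_cvg [::] x Ux).
pose F g := exists s, g = L s.
move=> x; apply: (@sm_coind _ _ U F) => //; last by exists [::].
- by move=> _ [s ->] y Uy; exact: L_cts.
- by move=> _ i [s ->]; exists (L (i :: s)); [exists (i :: s)|move=> y Uy; exact: L_derive].
Qed.

End UniformLimit.

(** * Borel's construction with sines in place of cutoffs *)

Section Tame.
Variables (R : realType) (m : nat) (ia i1 i2 : 'I_m) (r0 r1 : R).
Hypotheses (r0gt0 : 0 < r0) (r10 : r1 < r0) (a1 : ia != i1) (a2 : ia != i2).
Implicit Types (f g h : 'rV[R]_m -> R) (x y : 'rV[R]_m) (k : nat).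
Local Notation dom := (@dom R m r0).
Local Notation smU := (@smU R m r0).
Local Notation hmg := (@hmg R m i1 i2 r0).
Local Notation cfa := (@cfa R m ia i1 i2 r0).
Local Notation rho := (@rho R m i1 i2).

(* Families whose derivatives lose at most one power of the scale each. *)
Inductive tame : (R -> 'rV[R]_m -> R) -> Prop :=
| tame_smooth c : smU c -> tame (fun _ => c)
| tame_scale : tame (fun e _ => e)
| tame_sin j : tame (fun e x => sin (x ord0 j / e))
| tame_cos j : tame (fun e x => cos (x ord0 j / e))
| tame_add F G : tame F -> tame G -> tame (fun e x => F e x + G e x)
| tame_mul F G : tame F -> tame G -> tame (fun e x => F e x * G e x).

Let sme x j e : sm x (fun x : 'rV[R]_m => x ord0 j / e).
Proof. by apply: smM; [exact: sm_coord|exact: sm_cst]. Qed.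

Lemma tame_sm F e : tame F -> smU (F e).
Proof.
elim=> {F} [c cs|  |j|j|F G _ IF _ IG|F G _ IF _ IG] x dx.
- exact: cs.
- exact: sm_cst.
- by apply: sm_sin; exact: sme.
- by apply: sm_cos; exact: sme.
- by apply: smD; [exact: IF|exact: IG].
- by apply: smM; [exact: IF|exact: IG].
Qed.

Lemma tame_bound F : tame F -> exists2 C : R, 0 < C &
  forall e x, 0 < e -> e <= 1 -> `|x| <= r1 -> `|F e x| <= C.
Proof.
elim=> {F} [c cs|  |j|j|F G _ [C C0 HC] _ [D D0 HD]|F G _ [C C0 HC] _ [D D0 HD]].
- by have [C C0 H] := ball_bound r10 cs; exists C => // e x _ _; exact: H.
- by exists 1 => // e x e0 e1 _; rewrite gtr0_norm.
- exists 1 => // e x _ _ _; exact: sin_max.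
- exists 1 => // e x _ _ _; exact: cos_max.
- exists (C + D); first exact: addr_gt0.
  by move=> e x e0 e1 xr; rewrite (le_trans (ler_normD _ _))// lerD ?HC ?HD.
- exists (C * D); first exact: mulr_gt0.
  by move=> e x e0 e1 xr; rewrite normrM ler_pM// ?HC ?HD.
Qed.

Lemma tame_pd i F : tame F -> exists2 G, tame G &
  forall e x, 0 < e -> dom x -> e * pd i (F e) x = G e x.
Proof.
elim=> {F} [c cs|  |j|j|F G tF [F' tF' EF] tG [G' tG' EG]|F G tF [F' tF' EF] tG [G' tG' EG]].
- exists (fun e x => e * pd i c x) => //.
  apply: tame_mul; first exact: tame_scale.
  by apply: (@tame_smooth (pd i c)) => x dx; apply: sm_pd; exact: cs.
- exists (fun _ _ => 0); first by apply: (@tame_smooth (fun=> 0)); exact: smU_cst.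
  by move=> e x _ _; rewrite pd_cst mulr0.
- exists (fun e x => (j == i)%:R * cos (x ord0 j / e)).
    apply: tame_mul; last exact: tame_cos.
    by apply: (@tame_smooth (fun=> (j == i)%:R)); exact: smU_cst.
  move=> e x e0 _; rewrite (pd_comp1 _ (sme x j e) (is_derive_sin _)).
  under eq_fun do rewrite mulrC.
  by rewrite pdZ ?pd_coord; [field; rewrite gt_eqF|exact: sm_coord].
- exists (fun e x => (- (j == i)%:R) * sin (x ord0 j / e)).
    apply: tame_mul; last exact: tame_sin.
    by apply: (@tame_smooth (fun=> - (j == i)%:R)); exact: smU_cst.
  move=> e x e0 _; rewrite (pd_comp1 _ (sme x j e) (is_derive_cos _)).
  under eq_fun do rewrite mulrC.
  by rewrite pdZ ?pd_coord; [field; rewrite gt_eqF|exact: sm_coord].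
- exists (fun e x => F' e x + G' e x); first exact: tame_add.
  by move=> e x e0 dx; rewrite pdD ?mulrDr ?EF ?EG//; exact: tame_sm.
- exists (fun e x => F e x * G' e x + G e x * F' e x).
    by apply: tame_add; exact: tame_mul.
  by move=> e x e0 dx; rewrite pdM ?mulrDr ?[e * (_ * _)]mulrCA ?EF ?EG//; exact: tame_sm.
Qed.

(** For fixed e, e sin(x_j / e) equals x_j modulo the square of the ideal, while its modulus is at
    most e. A form of degree k thus becomes of size e^k, each derivative costing one factor 1/e, and
    nothing changes to lowest order. *)
Definition soft (e : R) x : 'rV[R]_m :=
  \row_j if (j == i1) || (j == i2) then e * sin (x ord0 j / e) else x ord0 j.

Lemma softE e x j : soft e x ord0 j =
  if (j == i1) || (j == i2) then e * sin (x ord0 j / e) else x ord0 j.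
Proof. by rewrite mxE. Qed.

Lemma soft_le e x j : 0 < e -> `|soft e x ord0 j| <= `|x ord0 j|.
Proof.
move=> e0; rewrite softE; case: ifP => // _; rewrite normrM.
apply: (le_trans (ler_wpM2l (normr_ge0 _) (abs_sin_le _))).
by rewrite normrM normfV mulrCA divff ?mulr1// normr_eq0 gt_eqF.
Qed.

Lemma soft_norm e x : 0 < e -> `|soft e x| <= `|x|.
Proof.
move=> e0; apply: norm_le_coord => // j; exact: le_trans (soft_le _ _ e0) (coord_le _ _).
Qed.

Lemma soft_dom e x : 0 < e -> dom x -> dom (soft e x).
Proof. by move=> e0; apply: le_lt_trans; exact: soft_norm. Qed.

Lemma cfa_soft c e x : 0 < e -> cfa c -> dom x -> c (soft e x) = c x.
Proof.
move=> e0 [[cs v1 v2] _] dx; rewrite -[RHS](lead_id r0gt0 (And3 cs v1 v2) dx).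
rewrite -[LHS](lead_id r0gt0 (And3 cs v1 v2) (soft_dom e0 dx)) /lead; congr c.
by apply/rowP => j; rewrite !zcE softE; case: (j == i1) => //; case: (j == i2).
Qed.

Lemma hom_soft k A : hmg cfa k A -> exists2 F, tame F &
  forall e x, 0 < e -> dom x -> A (soft e x) = e ^+ k * F e x.
Proof.
elim: k A => [|k IH] A.
  move=> [c cc E]; exists (fun _ => c); first by apply: tame_smooth; case: cc => -[].
  by move=> e x e0 dx; rewrite expr0 mul1r E ?cfa_soft//; exact: soft_dom.
move=> [A1 [A2 [/IH[F1 t1 E1] /IH[F2 t2 E2] E]]].
exists (fun e x => sin (x ord0 i1 / e) * F1 e x + sin (x ord0 i2 / e) * F2 e x).
  by apply: tame_add; apply: tame_mul => //; exact: tame_sin.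
move=> e x e0 dx; rewrite E; last exact: soft_dom.
by rewrite !softE !eqxx orbT/= E1// E2// exprS; ring.
Qed.

Lemma tame_pds B k F s : tame F -> (forall e x, 0 < e -> dom x -> B e x = e ^+ k * F e x) ->
  exists2 G, tame G & forall e x, 0 < e -> dom x -> e ^+ size s * pds s (B e) x = e ^+ k * G e x.
Proof.
move=> tF E; elim: s => [|i s [G tG EG]]; first by exists F => // e x e0 dx; rewrite mul1r; exact: E.
have [G' tG' EG'] := tame_pd i tG; exists G' => // e x e0 dx.
have n : {near x, pds s (B e) =1 (fun x => e ^+ k / e ^+ size s * G e x)}.
  move: (open_near (@dom_open R m r0) dx); apply: filterS => y dy.
  by apply: (@mulfI _ (e ^+ size s)); rewrite ?EG// ?expf_neq0 ?gt_eqF//; field; rewrite expf_neq0 ?gt_eqF.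
rewrite /= (pd_near i n) pdZ; last exact: tame_sm.
by rewrite -EG'// exprS; field; rewrite expf_neq0 ?gt_eqF.
Qed.

Lemma soft_coord e j : 0 < e -> (j == i1) || (j == i2) -> exists2 g, hmg smU 1 g &
  forall x, dom x -> soft e x ord0 j = x ord0 j * (1 + g x).
Proof.
move=> e0 jj; pose f x : R := e * sin (x ord0 j / e).
have fs : smU f.
  by move=> x dx; apply: smM; [exact: sm_cst|apply: sm_sin; exact: sme].
have [q qs E] := hadamardU r0gt0 j fs; have [q' qs' E'] := hadamardU r0gt0 j qs.
have f0 x : f (zc j x) = 0 by rewrite /f zcE eqxx mul0r sin0 mulr0.
have q0 x : dom x -> q (zc j x) = 1.
  move=> dx; have dz := dom_zc r0gt0 j dx; have qz := qs _ dz.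
  have n : {near zc j x, f =1 (fun x => x ord0 j * q x)}.
    by move: (open_near (@dom_open R m r0) dz); apply: filterS => y dy; rewrite E// f0 add0r.
  have := pd_near j n; rewrite pdM ?pd_coord//; last exact: sm_coord.
  rewrite eqxx mulr1 zcE eqxx mul0r add0r => <-.
  rewrite pdZ; last by apply: sm_sin; exact: sme.
  rewrite (pd_comp1 _ (sme _ j e) (is_derive_sin _)) zcE eqxx mul0r cos0 mul1r.
  under eq_fun do rewrite mulrC.
  by rewrite pdZ ?pd_coord ?eqxx ?mulr1 ?mulfV// ?gt_eqF//; exact: sm_coord.
exists (fun x => x ord0 j * q' x).
  have c0 : hmg smU 0 (fun=> 0) by apply/mI_0/smU_cst.
  case/orP: jj => /eqP ->; [exists q', (fun=> 0)|exists (fun=> 0), q'];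
    split=> //; first [exact: mI_0|by move=> x dx; rewrite mulr0 ?addr0 ?add0r].
move=> x dx; rewrite softE jj -/(f x) E// f0 add0r E'// q0//.
Qed.

Lemma soft_hom e k A : 0 < e -> hmg cfa k A -> hmg smU k (fun x => A (soft e x)) /\
  hmg smU k.+1 (fun x => A (soft e x) - A x).
Proof.
move=> e0; elim: k A => [|k IH] A.
  move=> [c cc E]; have [[cs _ _] _] := cc.
  have E' x : dom x -> A (soft e x) = c x by move=> dx; rewrite E ?cfa_soft//; exact: soft_dom.
  split; first by exists c.
  have c0 : hmg smU 0 (fun=> 0) by apply/mI_0/smU_cst.
  by exists (fun=> 0), (fun=> 0); split=> // x dx; rewrite E' ?E//; ring.
move=> [A1 [A2 [/IH[h1 d1] /IH[h2 d2] E]]].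
have [g1 G1 S1] := @soft_coord e i1 e0 (introT orP (or_introl (eqxx i1))).
have [g2 G2 S2] := @soft_coord e i2 e0 (introT orP (or_intror (eqxx i2))).
have ES x : dom x -> A (soft e x) = x ord0 i1 * ((1 + g1 x) * A1 (soft e x)) + x ord0 i2 * ((1 + g2 x) * A2 (soft e x)).
  by move=> dx; rewrite E ?S1 ?S2//; [ring|exact: soft_dom].
have sg g : hmg smU 1 g -> smU (fun x => 1 + g x).
  by move=> /mI_sm gs; apply: smU_D => //; exact: smU_cst.
split.
  exists (fun x => (1 + g1 x) * A1 (soft e x)), (fun x => (1 + g2 x) * A2 (soft e x)).
  by split=> //; apply: mI_mul => //; exact: sg.
exists (fun x => (A1 (soft e x) - A1 x) + g1 x * A1 (soft e x)).
exists (fun x => (A2 (soft e x) - A2 x) + g2 x * A2 (soft e x)).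
split; last by move=> x dx; rewrite ES ?E//; ring.
- by apply: mI_D => //; rewrite -add1n; apply: mI_M.
- by apply: mI_D => //; rewrite -add1n; apply: mI_M.
Qed.

(* The scale is chosen small enough to make Borel's series converge with all derivatives. *)
Lemma soften k A : hmg cfa k.+1 A -> exists2 A', [/\ hmg smU k.+1 A', hmg smU k.+2 (fun x => A' x - A x) &
    indep r0 ia A'] &
  (forall x, `|x| <= r1 -> `|A' x| <= 2^-1 ^+ k.+1 * rho x ^+ k) /\
  forall s x, (size s <= k)%N -> (pickle s <= k)%N -> `|x| <= r1 -> `|pds s A' x| <= 2^-1 ^+ k.+1.
Proof.
move=> hA; have [F tF EF] := hom_soft hA.
have [CA CA0 HA] := mI_bound r10 (cfa_sm hA).
have Hs (s : seq 'I_m) : exists C : R, 0 < C /\ forall e x, 0 < e -> e <= 1 -> `|x| <= r1 ->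
    `|e ^+ size s * pds s (fun x => A (soft e x)) x| <= e ^+ k.+1 * C.
  have [G tG EG] := @tame_pds (fun e x => A (soft e x)) k.+1 F s tF EF.
  have [C C0 HC] := tame_bound tG; exists C; split=> // e x e0 e1 xr.
  rewrite EG//; last exact: le_lt_trans xr r10.
  by rewrite normrM ger0_norm ?exprn_ge0 ?(ltW e0)// ler_pM2l ?exprn_gt0// HC.
have [C HC] := choice Hs.
(* The derivatives to be controlled have codes [pickle s <= k], so the sum of w over j < k.+1
   dominates all their constants; integers that code no sequence contribute 0. *)
pose w (j : nat) : R := if (unpickle j : option (seq 'I_m)) is Some s then C s else 0.
have wE s : w (pickle s) = C s by rewrite /w pickleK.
pose D := CA + \sum_(j < k.+1) w j.
have Cg s : 0 < C s by case: (HC s).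
have pj (j : nat) : 0 <= w j.
  by rewrite /w; case: unpickle => [s|]; [exact: ltW|exact: lexx].
have D0 : 0 < D.
  by apply: ltr_pwDl; [exact: CA0|apply: sumr_ge0 => j _; exact: pj].
have DA : CA <= D.
  by rewrite lerDl; apply: sumr_ge0 => j _; exact: pj.
have DC s : (pickle s <= k)%N -> C s <= D.
  move=> sk; rewrite /D (bigD1 (Ordinal (sk : (pickle s < k.+1)%N)))// -[w (nat_of_ord (Ordinal _))]/(w (pickle s)) wE.
  rewrite addrCA lerDl addr_ge0 ?(ltW CA0)//.
  by apply: sumr_ge0 => j _; exact: pj.
have p2 : 0 < 2^-1 ^+ k.+1 :> R by rewrite exprn_gt0.
pose e := Num.min 1 (2^-1 ^+ k.+1 / D).
have e0 : 0 < e by rewrite lt_min ltr01 divr_gt0.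
have e1 : e <= 1 by rewrite ge_min lexx.
have eD : e * D <= 2^-1 ^+ k.+1 by rewrite -ler_pdivlMr// ge_min lexx orbT.
have [s1 s2] := soft_hom e0 hA.
exists (fun x => A (soft e x)).
  split=> // x dx; rewrite -(hom_inv r0gt0 a1 a2 hA (soft_dom e0 dx)).
  rewrite -(hom_inv r0gt0 a1 a2 hA (soft_dom e0 (dom_zc r0gt0 ia dx))); congr A.
  by apply/rowP => j; rewrite !(zcE, softE); case: eqP.
split.
  move=> x xr; apply: (le_trans (HA _ (le_trans (soft_norm _ e0) xr))).
  have r_rho : rho (soft e x) <= rho x.
    by rewrite /rho ge_max !le_max !soft_le ?orbT.
  have r_e : rho (soft e x) <= e.
    by rewrite /rho !softE !eqxx orbT/= !normrM (gtr0_norm e0) ge_max !ler_piMr ?sin_max// ?(ltW e0).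
  rewrite exprSr mulrA; apply: le_trans (_ : CA * rho x ^+ k * e <= _).
    by rewrite ler_pM ?mulr_ge0 ?exprn_ge0 ?rho_ge0 ?(ltW CA0)// ler_pM2l// lerXn2r ?nnegrE ?rho_ge0.
  rewrite mulrAC [leLHS]mulrC [leRHS]mulrC ler_wpM2l ?exprn_ge0 ?rho_ge0//.
  by rewrite mulrC; apply: le_trans eD; rewrite ler_pM2l.
move=> s x sk pk xr; have [_ /(_ e x e0 e1 xr)] := HC s.
rewrite normrM (ger0_norm (exprn_ge0 _ (ltW e0))) -ler_pdivlMl ?exprn_gt0// => /le_trans; apply.
rewrite mulrA [e ^- _ * _]mulrC -expfB; last by rewrite ltnS.
apply: le_trans eD; rewrite subSn// exprS -mulrA ler_pM2l//.
rewrite -[leRHS]mul1r ler_pM ?exprn_ge0 ?(ltW e0) ?(ltW (Cg _)) ?DC//.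
by rewrite exprn_ile1 ?(ltW e0).
Qed.

End Tame.

(** * The normal form to all finite orders *)

Section Formal.
Variables (R : realType) (m : nat) (ia i1 i2 : 'I_m) (r0 r1 : R).
Hypotheses (r1gt0 : 0 < r1) (r10 : r1 < r0) (r01 : r0 <= 1).
Hypotheses (a1 : ia != i1) (a2 : ia != i2).
Implicit Types (f g h : 'rV[R]_m -> R) (x y : 'rV[R]_m) (k : nat).
Local Notation dom := (@dom R m r0).
Local Notation smU := (@smU R m r0).
Local Notation hmg := (@hmg R m i1 i2 r0).
Local Notation cfa := (@cfa R m ia i1 i2 r0).
Local Notation cf := (@cf R m i1 i2 r0).
Local Notation rho := (@rho R m i1 i2).
Local Notation indep := (@indep R m r0 ia).

Let r0gt0 : 0 < r0. Proof. exact: lt_trans r10. Qed.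

Let rho1 x : `|x| <= r1 -> rho x <= 1.
Proof.
move=> xr; have r11 : r1 <= 1 by rewrite (le_trans (ltW r10)).
by rewrite ge_max !(le_trans (coord_le _ _)) ?(le_trans xr).
Qed.

(** The third clause gives up one power of [rho] in exchange for the factor 2^-(k+1), which makes
    tails summable. In the sum of such terms the first omitted one is estimated through its exact
    order, the first clause, and all later ones through the third. *)
Definition good k D := [/\ hmg smU k.+1 D, indep D,
  (forall x, `|x| <= r1 -> `|D x| <= 2^-1 ^+ k.+1 * rho x ^+ k) &
  forall s x, (size s <= k)%N -> (pickle s <= k)%N -> `|x| <= r1 -> `|pds s D x| <= 2^-1 ^+ k.+1].

Lemma good_sum (D : nat -> 'rV[R]_m -> R) : (forall n, good n.+1 (D n)) ->
  exists f, [/\ Ideals.smU r1 f, Ideals.indep r1 ia f & forall n, exists2 C : R, 0 < C &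
    forall x, `|x| < r1 -> `|f x - \sum_(k < n) D k x| <= C * rho x ^+ n.+2].
Proof.
move=> gD.
have Ds k x : Ideals.dom r1 x -> sm x (D k).
  move=> dx; have [/mI_sm ds _ _ _] := gD k; apply: ds; exact: lt_trans dx r10.
have Db (s : seq 'I_m) : exists n0, forall k x, (n0 <= k)%N -> Ideals.dom r1 x -> `|pds s (D k) x| <= 2^-1 ^+ k.
  exists (maxn (size s) (pickle s)) => k x; rewrite geq_max => /andP[ks kp] dx.
  have [_ _ _ /(_ s x)] := gD k.
  move=> /(_ (leqW ks) (leqW kp) (ltW dx)) /le_trans; apply.
  by apply: ler_wiXn2l; [lra|lra|rewrite -addn2 leq_addr].
have [f fs fl] := uniform_limit (@dom_open R m r1) Ds Db.
exists f; split=> //.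
  move=> x dx; have dz := dom_zc r1gt0 ia dx.
  have E k : D k (zc ia x) = D k x.
    by have [_ + _ _] := gD k; apply; exact: lt_trans dx r10.
  have := fl _ dz; under eq_fun do under eq_bigr do rewrite E.
  by move=> c1; apply: cvg_unique c1 (fl _ dx); exact: norm_hausdorff.
move=> n; have [/(mI_bound r10)[C C0 HC] _ _ _] := gD n.
exists (C + 1); first exact: addr_gt0.
move=> x xr; set p := rho x; have p0 : 0 <= p := rho_ge0 _ _ _; have p1 := rho1 (ltW xr).
have c : (fun j => `|\sum_(k < j) D k x - \sum_(k < n) D k x|) @ \oo --> `|f x - \sum_(k < n) D k x|.
  by apply: cvg_norm; apply: cvgB; [exact: fl|exact: cvg_cst].
rewrite -(cvg_lim _ c)//; apply: limr_le; first by apply/cvg_ex; exists `|f x - \sum_(k < n) D k x|.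
exists n.+1 => // j /= nj; rewrite -(subnKC nj); set l := (j - n.+1)%N.
have -> : \sum_(k < n.+1 + l) D k x - \sum_(k < n) D k x = D n x + \sum_(k < l) D (n.+1 + k)%N x.
  by rewrite big_split_ord/= big_ord_recr/=; ring.
apply: (le_trans (ler_normD _ _)); rewrite mulrDl mul1r lerD ?HC ?(ltW xr)//.
apply: (le_trans (ler_norm_sum _ _ _)).
apply: (@le_trans _ _ (\sum_(k < l) 2^-1 ^+ k.+1 * p ^+ n.+2)).
  apply: ler_sum => k _; have [_ _ /(_ x (ltW xr)) + _] := gD (n.+1 + k)%N.
  move=> /le_trans; apply; rewrite ler_pM ?exprn_ge0//.
    by apply: ler_wiXn2l; [lra|lra|rewrite !ltnS; apply: leqW; rewrite leq_addl].
  by apply: ler_wiXn2l => //; rewrite ltnS leq_addr.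
rewrite -mulr_suml ler_piMl ?exprn_ge0//.
have -> : \sum_(k < l) 2^-1 ^+ k.+1 = 1 - 2^-1 ^+ l :> R.
  elim: l => [|l IH]; first by rewrite big_ord0 subrr.
  by rewrite big_ord_recr/= IH [2^-1 ^+ l.+1]exprS; field.
by rewrite lerBlDr lerDl exprn_ge0.
Qed.

Variable h : 'rV[R]_m -> R.
Hypotheses (hs : smU h) (h_gt0 : forall x, dom x -> 0 < h x).
Hypothesis h_a0 : forall x, dom x -> x ord0 ia = 0 -> h x = 1.
Let U1 x := x ord0 ia * h x.
Let G x := U1 x ^+ 4 + x ord0 i1 * x ord0 ia ^+ 2 + x ord0 i2 * x ord0 ia.
Let h0 := lead i1 i2 h.
Let U0 x := x ord0 ia * h0 x.

Let h0cf : cf h0. Proof. exact: lead_cf. Qed.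
Let h0n x : dom x -> h0 x != 0.
Proof. by move=> dx; rewrite gt_eqF// h_gt0//; apply/dom_zc/dom_zc. Qed.

Let U1s : smU U1. Proof. by apply: smU_M => //; exact: smU_coord. Qed.
Let U0s : smU U0. Proof. by apply: smU_M; [exact: smU_coord|case: h0cf]. Qed.
Let U10 : hmg smU 1 (fun x => U1 x - U0 x).
Proof.
have H := mI_mul (smU_coord (r0 := r0) ia) (lead_sub i1 i2 r0gt0 hs).
apply: (hom_ext H) => x dx.
by rewrite /U1 /U0 /h0; ring.
Qed.

Let state := (('rV[R]_m -> R) * ('rV[R]_m -> R) * ('rV[R]_m -> R) * ('rV[R]_m -> R))%type.
Let J k (t : state) := let: (U, al, be, s) := t in
  [/\ smU U, hmg smU 1 (fun x => U x - U1 x), [/\ hmg smU 1 al, hmg smU 1 be & smU s],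
     [/\ indep al, indep be & indep s] &
     hmg smU k (fun x => G x - (U x ^+ 4 + al x * U x ^+ 2 + be x * U x) - s x)].
Let next k (t t' : state) := let: (U, al, be, s) := t in let: (U', al', be', s') := t' in
  exists A B S, [/\ good k A, good k B, good k S & [/\ forall x, al' x = al x + A x,
     forall x, be' x = be x + B x & forall x, s' x = s x + S x]].

Let step k t : J k.+1 t -> exists t', J k.+2 t' /\ next k t t'.
Proof.
move: t => [[[U al] be] s] [Us UU [al1 be1 ss] [ai bi si] Rk].
have [l lk Rl] := leading r0gt0 Rk.
have [xi [A [B [S [xk Ak Bk Sk lE]]]]] := division r0gt0 a1 a2 h0cf h0n lk.
have [A' [hA dA iA] [bA pA]] := soften r0gt0 r10 a1 a2 Ak.
have [B' [hB dB iB] [bB pB]] := soften r0gt0 r10 a1 a2 Bk.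
have [S' [hS dS iS] [bS pS]] := soften r0gt0 r10 a1 a2 Sk.
have xm := cf_sm xk.
exists (fun x => U x + xi x, fun x => al x + A' x, fun x => be x + B' x, fun x => s x + S' x).
split; last by exists A', B', S'; split=> //; split.
have one f : hmg smU k.+1 f -> hmg smU 1 f by exact: mI_le.
have iD f g : indep f -> indep g -> indep (fun x => f x + g x).
  by move=> fi gi x dx; rewrite fi// gi.
split.
- by apply: smU_D => //; exact: mI_sm xm.
- by apply: (hom_ext (mI_D UU (one _ xm))) => x _; ring.
- by split; [exact: mI_D al1 (one _ hA)|exact: mI_D be1 (one _ hB)|apply: smU_D => //; exact: mI_sm hS].
- by split; exact: iD.
- apply: (normal_step _ _ U0s _ al1 be1 Rl xm (cfa_sm Ak) (cfa_sm Bk) hA hB dA dB dS lE) => //.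
  by apply: (hom_ext (mI_D UU U10)) => x _; ring.
Qed.

(** Degree one is computed by hand, as the differentials of al and be are needed later. Expanding
    x_ia = U0 + kap U0^2 + ... and x_ia^2 = U0^2 + ... in y_1 x_ia^2 + y_2 x_ia gives al = y_1 + kap
    y_2 and be = y_2 to first order. *)
Let first_step : exists kap U, [/\ smU kap, indep kap &
  J 2 (U, fun x => x ord0 i1 + kap x * x ord0 i2, fun x => x ord0 i2, fun=> 0)].
Proof.
have [h0s h01 h02] := h0cf.
have icf : cf (fun x => (h0 x)^-1).
  by split=> [|x dx|x dx]; [exact: smU_V|rewrite h01|rewrite h02].
have i2cf : cf (fun x => (h0 x)^-1 ^+ 2).
  have [is_ v1 v2] := icf.
  by split=> [|x dx|x dx]; [exact: smU_X|rewrite v1|rewrite v2].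
have val x : dom x -> h0 (zc ia x) = 1.
  move=> dx; rewrite /h0 /lead h_a0//; first by do 3!apply: dom_zc => //.
  by rewrite !zcE eqxx (negPf a1) (negPf a2).
have D1 c : cf c -> exists2 c', cf c' & forall x, dom x -> c x = c (zc ia x) + U0 x * c' x.
  move=> cc; have [S [c' [[_ Si] c'c E]]] := divide1 r0gt0 a1 a2 h0cf h0n cc.
  exists c' => // x dx; rewrite E// [c (zc ia x)]E; last exact: dom_zc.
  by rewrite Si// zcE eqxx mul0r mul0r addr0.
have [c1 c1cf E1] := D1 _ icf; have [d dcf Ed] := D1 _ i2cf.
have [kap [c2 [[[ks k1 k2] ki] c2cf E2]]] := divide1 r0gt0 a1 a2 h0cf h0n c1cf.
have aE x : dom x -> x ord0 ia = U0 x + kap x * U0 x ^+ 2 + U0 x ^+ 3 * c2 x.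
  move=> dx; have -> : x ord0 ia = U0 x * (h0 x)^-1 by rewrite /U0 mulfK// h0n.
  by rewrite E1// val// invr1 E2// -/(U0 x); ring.
have a2E x : dom x -> x ord0 ia ^+ 2 = U0 x ^+ 2 + U0 x ^+ 3 * d x.
  move=> dx; have -> : x ord0 ia ^+ 2 = U0 x ^+ 2 * (h0 x)^-1 ^+ 2.
    by rewrite /U0 exprMn -mulrA -exprMn mulfV ?h0n// expr1n mulr1.
  by rewrite Ed// val// invr1 expr1n; ring.
have [[c2s _ _] [ds _ _]] := (c2cf, dcf).
pose xi x := (x ord0 i1 * d x + x ord0 i2 * c2 x) / 4.
have [m1 m2] := @mI_1 R m i1 i2 r0.
have xi1 : hmg smU 1 xi.
  by apply: mI_mulr; [exact: smU_cst|apply: mI_D; apply: mI_mulr].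
have A1 : hmg smU 1 (fun x => x ord0 i1 + kap x * x ord0 i2).
  by apply: mI_D => //; exact: mI_mul.
have z f k : (forall x, f x = 0) -> hmg smU k f.
  move=> f0; elim: k f f0 => [|k IH] f f0; last first.
  by exists (fun=> 0), (fun=> 0); split=> [||x _]; [exact: IH|exact: IH|rewrite f0 !mulr0 addr0].
  apply: mI_0; have -> : f = (fun=> 0) by apply/funext.
  exact: smU_cst.
have Es x : dom x -> x ord0 i1 * x ord0 ia ^+ 2 + x ord0 i2 * x ord0 ia = 4 * U0 x ^+ 3 * xi x +
    (x ord0 i1 + kap x * x ord0 i2) * U0 x ^+ 2 + x ord0 i2 * U0 x + (fun=> 0) x.
  by move=> dx; rewrite a2E// [in LHS]aE// /xi; field.
exists kap, (fun x => U1 x + xi x); split=> //; split.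
- by apply: smU_D => //; exact: mI_sm xi1.
- by apply: (hom_ext xi1) => x _; ring.
- by split=> //; exact: smU_cst.
- split=> // x dx; last by rewrite zcE eq_sym (negPf a2).
  by rewrite ki// !zcE ![_ == ia]eq_sym (negPf a1) (negPf a2).
- have := @normal_step R m i1 i2 r0 1 G U1 U0 (fun=> 0) (fun=> 0) (fun=> 0)
    (fun x => x ord0 i1 * x ord0 ia ^+ 2 + x ord0 i2 * x ord0 ia) xi
    (fun x => x ord0 i1 + kap x * x ord0 i2) (fun x => x ord0 i2) (fun=> 0)
    (fun x => x ord0 i1 + kap x * x ord0 i2) (fun x => x ord0 i2) (fun=> 0) isT U1s U0s U10.
  move=> H; have := H (z _ _ (fun=> erefl)) (z _ _ (fun=> erefl)) (z _ _ _) xi1 A1 m2 A1 m2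
    (z _ _ (fun=> subrr _)) (z _ _ (fun=> subrr _)) (z _ _ (fun=> subrr _)) Es.
  move=> H'; apply: (hom_ext (H' _)) => x; first by rewrite /G; ring.
  by move=> _; ring.
Qed.

(** The functions al, be, s are Borel sums, the same for every order n, whereas U is a finite stage
    depending on n: the value of the quartic does not involve U, so it never has to be summed. *)
Lemma formal_normal_form : exists al be s kap,
  [/\ Ideals.smU r1 al, Ideals.smU r1 be, Ideals.smU r1 s & Ideals.smU r1 kap] /\
  [/\ Ideals.indep r1 ia al, Ideals.indep r1 ia be, Ideals.indep r1 ia s & Ideals.indep r1 ia kap] /\
  (exists2 C : R, 0 < C & forall x, `|x| < r1 -> [/\ `|al x - x ord0 i1 - kap x * x ord0 i2| <= C * rho x ^+ 2,
     `|be x - x ord0 i2| <= C * rho x ^+ 2 & `|s x| <= C * rho x ^+ 2]) /\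
  forall n, exists U, exists2 C : R, 0 < C & Ideals.smU r1 U /\ forall x, `|x| < r1 ->
     `|G x - (U x ^+ 4 + al x * U x ^+ 2 + be x * U x) - s x| <= C * rho x ^+ n /\ `|U x - U1 x| <= C * rho x.
Proof.
have sub x : Ideals.dom r1 x -> dom x by move=> dx; exact: lt_trans dx r10.
have [kap [V0 [ks ki J0]]] := first_step.
pose t0 : state := (V0, fun x => x ord0 i1 + kap x * x ord0 i2, fun x => x ord0 i2, fun=> 0).
(* The default t is not reached along the sequence, since the invariant J guarantees a next
   state. *)
pose nx k t := xget t [set t' | J k.+2 t' /\ next k t t'].
have nxP k t : J k.+1 t -> J k.+2 (nx k t) /\ next k t (nx k t).
  move=> /step[t' Ht']; exact: (@xgetPex _ t [set t' | J k.+2 t' /\ next k t t'] (ex_intro _ t' Ht')).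
pose st := fix st n := if n is n'.+1 then nx n'.+1 (st n') else t0.
have Jst n : J n.+2 (st n).
  by elim: n => [//|n IH]; have [] := nxP n.+1 _ IH.
have Nst n : next n.+1 (st n) (st n.+1) by have [] := nxP n.+1 _ (Jst n).
pose Us n := (st n).1.1.1; pose als n := (st n).1.1.2; pose bes n := (st n).1.2; pose ss n := (st n).2.
have goods n : [/\ good n.+1 (fun x => als n.+1 x - als n x), good n.+1 (fun x => bes n.+1 x - bes n x) &
    good n.+1 (fun x => ss n.+1 x - ss n x)].
  have := Nst n; rewrite /als /bes /ss; case: (st n) => [[[U al] be] s]; case: (st n.+1) => [[[U' al'] be'] s'] /=.
  move=> [A [B [S [gA gB gS [EA EB ES]]]]].
  have e f f' F : (forall x, f' x = f x + F x) -> (fun x => f' x - f x) = F.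
    by move=> E; apply/funext => x; rewrite E addrC addKr.
  by rewrite (e _ _ _ EA) (e _ _ _ EB) (e _ _ _ ES).
have tele (f : nat -> 'rV[R]_m -> R) n x : \sum_(k < n) (f k.+1 x - f k x) = f n x - f 0%N x.
  by rewrite -(big_mkord xpredT (fun k => f k.+1 x - f k x)) telescope_sumr.
have [fa [fas fai fab]] := @good_sum (fun n x => als n.+1 x - als n x) (fun n => let: And3 g _ _ := goods n in g).
have [fb [fbs fbi fbb]] := @good_sum (fun n x => bes n.+1 x - bes n x) (fun n => let: And3 _ g _ := goods n in g).
have [fs [fss fsi fsb]] := @good_sum (fun n x => ss n.+1 x - ss n x) (fun n => let: And3 _ _ g := goods n in g).
have cl (f : nat -> 'rV[R]_m -> R) (F : 'rV[R]_m -> R) : (forall n, exists2 C : R, 0 < C &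
    forall x, `|x| < r1 -> `|F x - \sum_(k < n) (f k.+1 x - f k x)| <= C * rho x ^+ n.+2) ->
    forall n, exists2 C : R, 0 < C & forall x, `|x| < r1 -> `|(f 0%N x + F x) - f n x| <= C * rho x ^+ n.+2.
  move=> H n; have [C C0 HC] := H n; exists C => // x xr.
  by have := HC x xr; rewrite tele; congr (`|_| <= _); ring.
have ca := cl als fa fab; have cb := cl bes fb fbb; have cs := cl ss fs fsb.
exists (fun x => als 0%N x + fa x), (fun x => bes 0%N x + fb x), (fun x => ss 0%N x + fs x), kap.
have res f : smU f -> Ideals.smU r1 f by move=> H x /sub; exact: H.
split; [split|split; [split|split]].
- apply: smU_D => //; apply: res; apply: smU_D; first exact: smU_coord.
  by apply: smU_M => //; exact: smU_coord.
- by apply: smU_D => //; apply: res; exact: smU_coord.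
- by apply: smU_D => //; apply: res; exact: smU_cst.
- exact: res.
- by move=> x dx; rewrite fai// /als /= (ki _ (sub _ dx)) !zcE ![_ == ia]eq_sym (negPf a1) (negPf a2).
- by move=> x dx; rewrite fbi// /bes /= zcE eq_sym (negPf a2).
- by move=> x dx; rewrite fsi.
- by move=> x dx; rewrite (ki _ (sub _ dx)).
- have [[C C0 HC] [C' C0' HC'] [C2 C20 HC2]] := And3 (ca 0%N) (cb 0%N) (cs 0%N).
  exists (C + C' + C2); first by rewrite !addr_gt0.
  move=> x xr; have p0 : 0 <= rho x ^+ 2 by rewrite exprn_ge0 ?rho_ge0.
  have big (D E : R) : `|E| <= D * rho x ^+ 2 -> D <= C + C' + C2 -> `|E| <= (C + C' + C2) * rho x ^+ 2.
    by move=> h1 h2; apply: (le_trans h1); rewrite ler_wpM2r.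
  split.
  + have := HC x xr; rewrite /als/=.
    by rewrite [_ + fa x - _]addrAC [_ - _ + fa x]addrAC; move=> H; apply: (big C); [move: H; congr (`|_| <= _); ring|lra].
  + by apply: (big C'); [exact: HC'|lra].
  + by apply: (big C2); [have := HC2 x xr; rewrite /ss/= subr0|lra].
move=> n; exists (Us n).
have := Jst n; have := ca n; have := cb n; have := cs n; rewrite /Us.
set alf := fun x => als 0%N x + fa x; set bef := fun x => bes 0%N x + fb x; set sf := fun x => ss 0%N x + fs x.
rewrite /als /bes /ss; case: (st n) => [[[U al] be] s] /= [C C0 HC] [C1 C10 HC1] [C2 C20 HC2] [Ums UU _ _ Rn].
have [M M0 HM] := ball_bound r10 Ums.
have [C3 C30 HC3] := mI_bound r10 (mI_le (leqW (leqW (leqnn n))) Rn).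
have [C4 C40 HC4] := mI_bound r10 (UU : hmg smU 1 (fun x => U x - U1 x)).
exists (C + C1 * M + C2 * M ^+ 2 + C3 + C4).
  by rewrite !addr_gt0// mulr_gt0// exprn_gt0.
split; first exact: res.
move=> x xr; have p0 := rho_ge0 i1 i2 x; have p1 := rho1 (ltW xr).
have pn : rho x ^+ n.+2 <= rho x ^+ n by rewrite ler_wiXn2l// -addn2 leq_addr.
have pn0 : 0 <= rho x ^+ n by rewrite exprn_ge0.
have Mx := HM x (ltW xr).
have wk (D E : R) : 0 < D -> `|E| <= D * rho x ^+ n.+2 -> `|E| <= D * rho x ^+ n.
  by move=> D0 h1; apply: (le_trans h1); rewrite ler_pM2l.
have e0 : `|sf x - s x| <= C * rho x ^+ n := wk _ _ C0 (HC x xr).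
have e1 : `|bef x - be x| <= C1 * rho x ^+ n := wk _ _ C10 (HC1 x xr).
have e2 : `|alf x - al x| <= C2 * rho x ^+ n := wk _ _ C20 (HC2 x xr).
have e3 := HC3 x (ltW xr); have e4 := HC4 x (ltW xr).
split; last first.
  apply: (le_trans e4); rewrite expr1 ler_wpM2r// lerDr !addr_ge0 ?mulr_ge0 ?exprn_ge0 ?(ltW C0) ?(ltW C10) ?(ltW C20) ?(ltW C30) ?(ltW M0)//.
have E : G x - (U x ^+ 4 + alf x * U x ^+ 2 + bef x * U x) - sf x =
  (G x - (U x ^+ 4 + al x * U x ^+ 2 + be x * U x) - s x) - (alf x - al x) * U x ^+ 2
    - (bef x - be x) * U x - (sf x - s x) by ring.
rewrite -[X in `|X| <= _]/(G x - (U x ^+ 4 + alf x * U x ^+ 2 + bef x * U x) - sf x) E.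
have q2 : `|(alf x - al x) * U x ^+ 2| <= C2 * M ^+ 2 * rho x ^+ n.
  by rewrite normrM mulrAC ler_pM// normrX lerXn2r ?nnegrE ?(ltW M0).
have q1 : `|(bef x - be x) * U x| <= C1 * M * rho x ^+ n.
  by rewrite normrM mulrAC ler_pM.
rewrite ![in leRHS]mulrDl.
apply: (le_trans (ler_normB _ _)); apply: (le_trans (lerD (ler_normB _ _) (lexx _))).
apply: (le_trans (lerD (lerD (ler_normB _ _) (lexx _)) (lexx _))).
have : 0 <= C4 * rho x ^+ n by rewrite mulr_ge0// ltW.
move: e3 q2 q1 e0; lra.
Qed.

End Formal.

(** * Weighted blow-up *)

Section CompactUniform.
Variables (R : realType) (m : nat).

(** A single integer N serves at once as the threshold in Q and, through 1/(N+1), as the radius of a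
    uniform neighbourhood of K. *)
Lemma compact_uniform (K : set 'rV[R]_m) (Q : nat -> 'rV[R]_m -> Prop) : compact K ->
  (forall z0, K z0 -> exists2 e : R, 0 < e & exists N, forall n z, (N <= n)%N -> `|z - z0| < e -> Q n z) ->
  exists N, forall z0 z, K z0 -> `|z - z0| < N.+1%:R^-1 -> Q N z.
Proof.
move=> /compact_near_coveringP cK H.
have := cK nat \oo (fun n z0 => forall z, `|z - z0| < n.+1%:R^-1 -> Q n z) _.
move=> /(_ _)[z0 Kz0|N _ HN].
  have [e e0 [N HN]] := H z0 Kz0; have e2 : 0 < e / 2 by exact: divr_gt0.
  exists ([set z | `|z - z0| < e / 2], [set n | (N <= n)%N /\ n.+1%:R^-1 < e / 2]).
    split; first exact: near_normlt.
    near=> n; split; near: n; first by exists N.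
    exact: (near_infty_natSinv_lt (PosNum e2)).
  move=> [z1 n] /= [z1e [Nn ne]] z zz; apply: HN => //.
  rewrite -(subrK z1 z) -addrA (le_lt_trans (ler_normD _ _))// (splitr e) ltrD//.
  exact: lt_trans ne.
by exists N => z0 z Kz; exact: (HN N (leqnn N)).
Unshelve. all: by end_near. Qed.

End CompactUniform.

Section BlowDown.
Variables (R : realType) (m : nat) (ia i1 i2 : 'I_m).
Hypotheses (a1 : ia != i1) (a2 : ia != i2) (n12 : i1 != i2).
Implicit Types (e f g : 'rV[R]_m -> R) (x y z : 'rV[R]_m) (k : nat).

(** The blow-up (r, P, Q) |-> (r^2 P, r^3 Q). The functions downstairs do not depend on the
    coordinate ia, which is therefore free to hold the radius r upstairs; r may have either sign. *)
Definition bl z : 'rV[R]_m := \row_j if j == ia then 0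
  else if j == i1 then z ord0 ia ^+ 2 * z ord0 i1
  else if j == i2 then z ord0 ia ^+ 3 * z ord0 i2 else z ord0 j.

Definition unbl (r : R) y : 'rV[R]_m := \row_j if j == ia then r
  else if j == i1 then y ord0 i1 / r ^+ 2
  else if j == i2 then y ord0 i2 / r ^+ 3 else y ord0 j.

Definition wsphere z := [/\ `|z ord0 i1| <= 1, `|z ord0 i2| <= 1 & `|z ord0 i1| = 1 \/ `|z ord0 i2| = 1].

Definition mu_lt (d : R) z := forall j, j != ia -> j != i1 -> j != i2 -> `|z ord0 j| < d.

Definition flat e z0 := forall k, exists C : R, \forall z \near z0, `|e z| <= C * `|z ord0 ia| ^+ k.

Lemma blE z : [/\ bl z ord0 ia = 0, bl z ord0 i1 = z ord0 ia ^+ 2 * z ord0 i1,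
  bl z ord0 i2 = z ord0 ia ^+ 3 * z ord0 i2 &
  forall j, j != ia -> j != i1 -> j != i2 -> bl z ord0 j = z ord0 j].
Proof.
split=> [|||j /negPf ja /negPf j1 /negPf j2]; rewrite mxE ?eqxx ?ja ?j1 ?j2//.
- by rewrite [i1 == ia]eq_sym (negPf a1).
- by rewrite [i2 == ia]eq_sym (negPf a2) [i2 == i1]eq_sym (negPf n12).
Qed.

Lemma bl_smv z : smv z bl.
Proof.
move=> j; under eq_fun do rewrite mxE.
case: (j == ia); first exact: sm_cst.
case: (j == i1); first by apply: smM; [apply: smX; exact: sm_coord|exact: sm_coord].
by case: (j == i2); [apply: smM; [apply: smX; exact: sm_coord|exact: sm_coord]|exact: sm_coord].
Qed.

Lemma unbl_smv r y : smv y (unbl r).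
Proof.
move=> j; under eq_fun do rewrite mxE.
case: (j == ia); first exact: sm_cst.
case: (j == i1); first by apply: smM; [exact: sm_coord|exact: sm_cst].
by case: (j == i2); [apply: smM; [exact: sm_coord|exact: sm_cst]|exact: sm_coord].
Qed.

Lemma unblK r y : r != 0 -> bl (unbl r y) = zc ia y.
Proof.
move=> r0; apply/rowP => j; rewrite zcE; have [b0 b1 b2 b3] := blE (unbl r y).
have [->|ja] := eqVneq j ia; first by rewrite b0.
have [->|j1] := eqVneq j i1.
  by rewrite b1 !mxE eqxx [i1 == ia]eq_sym (negPf a1) eqxx; field.
have [->|j2] := eqVneq j i2.
  by rewrite b2 !mxE eqxx [i2 == ia]eq_sym (negPf a2) [i2 == i1]eq_sym (negPf n12) eqxx; field.
by rewrite b3// mxE (negPf ja) (negPf j1) (negPf j2).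
Qed.

Lemma blK z : z ord0 ia != 0 -> unbl (z ord0 ia) (bl z) = z.
Proof.
move=> z0; apply/rowP => j; rewrite mxE; have [b0 b1 b2 b3] := blE z.
have [->//|ja] := eqVneq j ia.
have [->|j1] := eqVneq j i1; first by rewrite b1; field.
have [->|j2] := eqVneq j i2; first by rewrite b2; field.
by rewrite b3.
Qed.

(** r is the sixth root of max(|y1|^3, |y2|^2), written with exp and ln; 6 is the common multiple of
    the weights. The sphere is the boundary of a square, so no equation has to be solved for r. *)
Lemma polar (y1 y2 : R) : (y1 != 0) || (y2 != 0) -> exists2 r : R, 0 < r &
  [/\ r ^+ 6 = Num.max (`|y1| ^+ 3) (`|y2| ^+ 2), `|y1 / r ^+ 2| <= 1, `|y2 / r ^+ 3| <= 1 &
     `|y1 / r ^+ 2| = 1 \/ `|y2 / r ^+ 3| = 1].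
Proof.
move=> y0; pose M := Num.max (`|y1| ^+ 3) (`|y2| ^+ 2).
have M0 : 0 < M.
  by rewrite /M lt_max; case/orP: y0 => h; apply/orP; [left|right]; rewrite exprn_gt0// normr_gt0.
pose r := expR (ln M / 6); have r0 : 0 < r by exact: expR_gt0.
have r6 : r ^+ 6 = M by rewrite -expRM_natr mulfVK// lnK// posrE.
have [r2 r3] : 0 < r ^+ 2 /\ 0 < r ^+ 3 by rewrite !exprn_gt0.
have e1 : `|y1 / r ^+ 2| = `|y1| / r ^+ 2 by rewrite normrM normfV (gtr0_norm r2).
have e2 : `|y2 / r ^+ 3| = `|y2| / r ^+ 3 by rewrite normrM normfV (gtr0_norm r3).
have eq1 (a b : R) k : (0 < k)%N -> 0 <= a -> 0 <= b -> a ^+ k = b ^+ k -> a = b.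
  by move=> k0 a0 b0 /eqP; rewrite eqrXn2// => /eqP.
exists r => //; split=> //; rewrite ?e1 ?e2.
- rewrite ler_pdivrMr// mul1r -(@ler_pXn2r _ 3) ?nnegrE ?(ltW r2)//.
  by rewrite -exprM r6 le_max lexx.
- rewrite ler_pdivrMr// mul1r -(@ler_pXn2r _ 2) ?nnegrE ?(ltW r3)//.
  by rewrite -exprM r6 le_max lexx orbT.
- have [h|h] := leP (`|y1| ^+ 3) (`|y2| ^+ 2); [right|left].
    have -> : `|y2| = r ^+ 3.
      by apply: (eq1 _ _ 2%N) => //; [exact: ltW|rewrite -exprM r6 /M max_r].
    by rewrite divff// gt_eqF.
  have -> : `|y1| = r ^+ 2.
    by apply: (eq1 _ _ 3%N) => //; [exact: ltW|rewrite -exprM r6 /M max_l// ltW].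
  by rewrite divff// gt_eqF.
Qed.

(** Hadamard's lemma k times. The bound is asked only off r = 0: it forces the successive quotients
    to tend to 0 there, and continuity supplies their value. *)
Lemma rfactor e z0 k : z0 ord0 ia = 0 -> sm z0 e ->
  (exists C : R, \forall z \near z0, (z : 'rV[R]_m) ord0 ia != 0 -> `|e z| <= C * `|z ord0 ia| ^+ k) ->
  exists2 f, sm z0 f & \forall z \near z0, e z = z ord0 ia ^+ k * f z.
Proof.
move=> z00 es; elim: k => [|k IH] [C HC].
  by exists e => //; near=> z; rewrite mul1r.
have [|f fs fE] := IH.
  exists `|C|; move: (near_and HC (near_normlt z0 (ltr01 : 0 < (1 : R)))); apply: filterS => w [Hw w1] /Hw wb.
  apply: (le_trans wb); apply: (@le_trans _ _ (`|C| * `|w ord0 ia| ^+ k.+1)).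
    by rewrite ler_wpM2r ?exprn_ge0// ler_norm.
  rewrite ler_wpM2l// exprS ler_piMl ?exprn_ge0//.
  by have := le_lt_trans (coord_le (w - z0) ia) w1; rewrite !mxE z00 subr0 => /ltW.
have /near_radius[r r0 Hr] := near_and (sm_near fs) (near_and fE HC).
pose U := [set z | `|z - z0| < r].
have oU : open U.
  rewrite openE => z zr; apply/nbhs_ballP; exists (r - `|z - z0|); first by rewrite /= subr_gt0.
  move=> z'; rewrite -ball_normE/= => zz; rewrite /U/= -(subrK z z') -addrA.
  apply: (le_lt_trans (ler_normD _ _)); rewrite distrC; move: zz; rewrite ltrBrDr.
  by [].
have f_cts z : U z -> {for z, continuous f} by move=> /Hr[/sm_cts].
have fb z : U z -> z ord0 ia != 0 -> `|f z| <= C * `|z ord0 ia|.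
  move=> /Hr[_ [E H]] z1; have {}H := H z1; have zk : 0 < `|z ord0 ia| ^+ k by rewrite exprn_gt0// normr_gt0.
  rewrite -(ler_pM2l zk) -normrX -normrM -E normrX mulrCA -exprSr; exact: H.
have f0 z : U z -> z ord0 ia = 0 -> f z = 0.
  move=> Uz z1; apply/eqP; rewrite -normr_le0; apply/ler_addgt0Pl => d d0.
  have d2 : 0 < d / 2 by exact: divr_gt0.
  have /near_radius[r' r'0 Hr'] := near_and (open_near oU Uz) (dist_cts (f_cts z Uz) d2).
  pose t := Num.min (r' / 2) (d / 2 / (`|C| + 1)).
  have C1 : 0 < `|C| + 1 by rewrite ltr_wpDl.
  have t0 : 0 < t by rewrite lt_min !divr_gt0.
  have tr : t < r'.
    have : t <= r' / 2 by rewrite ge_min lexx.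
    by move=> h; apply: le_lt_trans h _; rewrite ltr_pdivrMr// mulr_natr mulr2n ltrDl.
  have : `|z + t *: ev R ia - z| < r'.
    by rewrite addrC addKr; apply: (le_lt_trans (norm_step z ia t)); rewrite gtr0_norm.
  move=> /Hr'[Ut ct].
  have ta : (z + t *: ev R ia) ord0 ia = t by rewrite !mxE !eqxx z1 add0r mulr1.
  have := fb _ Ut; rewrite ta gt_eqF// => /(_ isT); rewrite (gtr0_norm t0) => h.
  have Ct : C * t <= d / 2.
    apply: (@le_trans _ _ ((`|C| + 1) * t)).
      by rewrite ler_pM2r//; have := ler_norm C; lra.
    by rewrite mulrC -ler_pdivlMr// ge_min lexx orbT.
  rewrite addr0 -(subrK (f (z + t *: ev R ia)) (f z)) (splitr d).
  apply: (le_trans (ler_normD _ _)); apply: lerD => //; exact: le_trans Ct.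
have [g gs gE] := hadamard oU (fun z Uz => (Hr z Uz).1) f0.
have Uz0 : U z0 by rewrite /U/= subrr normr0.
exists g; first exact: gs.
move: (open_near oU Uz0); apply: filterS => z Uz.
by have [_ [-> _]] := Hr z Uz; rewrite gE// exprSr mulrA.
Unshelve. all: by end_near. Qed.

Lemma flat_factor e z0 : z0 ord0 ia = 0 -> sm z0 e -> flat e z0 -> forall k, exists2 f, sm z0 f &
  \forall z \near z0, e z = z ord0 ia ^+ k * f z.
Proof.
move=> z00 es ef k; have [C HC] := ef k; apply: rfactor => //; exists C.
by move: HC; apply: filterS => z h _.
Qed.

Lemma flat_off e z0 : z0 ord0 ia = 0 -> sm z0 e ->
  (forall k, exists C : R, \forall z \near z0, (z : 'rV[R]_m) ord0 ia != 0 -> `|e z| <= C * `|z ord0 ia| ^+ k) -> flat e z0.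
Proof.
move=> z00 es H k; have [f fs fE] := rfactor z00 es (H k).
exists (`|f z0| + 1); move: (near_and fE (dist_cts (sm_cts fs) (ltr01 : 0 < (1 : R)))); apply: filterS => z [-> fz].
rewrite normrM normrX mulrC ler_wpM2r ?exprn_ge0//.
have -> : f z = f z0 - (f z0 - f z) by ring.
by rewrite (le_trans (ler_normB _ _))// lerD2l.
Qed.

Definition Kset (c : 'rV[R]_m) (d : R) : set 'rV[R]_m := [set z : 'rV[R]_m | [/\ z ord0 ia = 0, wsphere z &
  forall j, j != ia -> j != i1 -> j != i2 -> `|z ord0 j - c ord0 j| <= d]].

Lemma Kset_compact c d : compact (Kset c d).
Proof.
pose lo (j : 'I_m) : R := if j == ia then 0 else if (j == i1) || (j == i2) then -1 else c ord0 j - d.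
pose hi (j : 'I_m) : R := if j == ia then 0 else if (j == i1) || (j == i2) then 1 else c ord0 j + d.
pose B := [set z : 'rV[R]_m | forall j, `[lo j, hi j]%classic (z ord0 j)].
have cB : compact B by apply: (@rV_compact R m (fun j => `[lo j, hi j]%classic)) => j; exact: segment_compact.
(* Inside the square, vanishing of this polynomial says that one of the two coordinates has modulus
   1, which makes the condition closed. *)
pose g (z : 'rV[R]_m) : R := (1 - z ord0 i1 ^+ 2) * (1 - z ord0 i2 ^+ 2).
have cg : continuous g.
  have ss j (z : 'rV[R]_m) : sm z (fun z : 'rV[R]_m => 1 - z ord0 j ^+ 2).
    by apply: smB; [exact: sm_cst|apply: smX; exact: sm_coord].
  by move=> z; exact: sm_cts (smM (ss i1 z) (ss i2 z)).
have n1 (t : R) : (1 - t ^+ 2 == 0) = (`|t| == 1).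
  rewrite subr_eq0 eq_sym -(@real_normK _ t) ?num_real// sqrf_eq1.
  have -> : (`|t| == -1) = false by apply/negP => /eqP h; have := normr_ge0 t; rewrite h; lra.
  by rewrite orbF.
have cG : closed (g @^-1` [set t | t = 0]).
  by apply: closed_comp; [move=> z _; exact: cg|exact: closed_eq].
have -> : Kset c d = B `&` (g @^-1` [set t | t = 0]).
  apply/seteqP; split=> z /=.
    move=> [z0 [s1 s2 s3] zm]; split.
      move=> j; rewrite /lo /hi /= in_itv/=; have [->|ja] := eqVneq j ia; first by rewrite z0 lexx.
      have [->|j1] /= := eqVneq j i1; first by rewrite -ler_norml.
      have [->|j2] /= := eqVneq j i2; first by rewrite -ler_norml.
      by rewrite -ler_distl zm.
    by apply/eqP; rewrite /g mulf_eq0 !n1; case: s3 => ->; rewrite eqxx ?orbT.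
  move=> [zB /eqP zg]; split.
  - have := zB ia; rewrite /lo /hi /= in_itv/= eqxx => /andP[h1 h2].
    by apply/eqP; rewrite eq_le h1 h2.
  - split.
    + by have := zB i1; rewrite /lo /hi /= in_itv/= [i1 == ia]eq_sym (negPf a1) eqxx/= -ler_norml.
    + by have := zB i2; rewrite /lo /hi /= in_itv/= [i2 == ia]eq_sym (negPf a2) eqxx orbT/= -ler_norml.
    + by move: zg; rewrite /g mulf_eq0 !n1 => /orP[/eqP ->|/eqP ->]; [left|right].
  - move=> j ja j1 j2; have := zB j.
    by rewrite /lo /hi /= in_itv/= (negPf ja) (negPf j1) (negPf j2)/= -ler_distl.
exact: compact_closedI.
Qed.

Notation rho := (@rho R m i1 i2).

(* [unbl r y] with this r lies on the sphere. *)
Lemma polar_unbl y : (y ord0 i1 != 0) || (y ord0 i2 != 0) -> exists2 r : R, 0 < r &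
  wsphere (unbl r y) /\ r ^+ 6 = Num.max (`|y ord0 i1| ^+ 3) (`|y ord0 i2| ^+ 2).
Proof.
move=> /polar[r r0 [r6 s1 s2 s3]]; exists r => //; split=> //; rewrite /wsphere !mxE.
by rewrite ![_ == ia]eq_sym (negPf a1) (negPf a2) [i2 == i1]eq_sym (negPf n12) !eqxx.
Qed.

Lemma polar_small y (r d : R) : 0 < d -> d <= 1 -> 0 < r -> `|y ord0 i1| < d ^+ 6 -> `|y ord0 i2| < d ^+ 6 ->
  r ^+ 6 = Num.max (`|y ord0 i1| ^+ 3) (`|y ord0 i2| ^+ 2) -> r < d.
Proof.
move=> d0 d1 r0 y1 y2 r6; rewrite -(@ltr_pXn2r _ 6) ?nnegrE ?(ltW r0) ?(ltW d0)// r6 gt_max.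
have d61 : d ^+ 6 <= 1 by rewrite exprn_ile1// ltW.
have lt1 k (u : R) : 0 <= u -> u < d ^+ 6 -> u ^+ k.+1 < d ^+ 6.
  move=> u0 ud; have u1 : u <= 1 := ltW (lt_le_trans ud d61).
  by apply: le_lt_trans ud; rewrite exprS ler_piMr// exprn_ile1.
by rewrite !lt1.
Qed.

Definition edge y := y ord0 i1 = 0 /\ y ord0 i2 = 0.

Lemma mu_lt_near d y0 : mu_lt d y0 -> \forall y \near y0, mu_lt d y.
Proof.
move=> y0d.
have : \forall y \near y0, forall j, [&& j != ia, j != i1 & j != i2] ==> (`|(y : 'rV[R]_m) ord0 j| < d).
  apply: near_all => j; have [/and3P[ja j1 j2]|h] := boolP [&& j != ia, j != i1 & j != i2]; last by apply: filterE => y.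
  apply: (@near_preim _ _ (fun y : 'rV[R]_m => `|y ord0 j|) y0 (fun t => true ==> (t < d))).
    apply: (@continuous_comp _ _ _ (fun z : 'rV[R]_m => z ord0 j) (fun t : R => `|t|)); last exact: norm_continuous.
    exact: sm_cts (sm_coord _ _).
  by apply: (@open_near _ [set t | t < d]); [exact: open_lt|exact: y0d].
by apply: filterS => y H j ja j1 j2; have := H j; rewrite ja j1 j2.
Qed.

(** Flatness to order 6, uniform on the compact sphere, gives |e y| <= N r^6 = N max(|y1|^3, |y2|^2)
    <= N rho^2. So e vanishes to second order on the edge and has zero derivative there. *)
Lemma edge_bound e (d : R) y0 : (forall y, e (zc ia y) = e y) ->
  (forall y, edge y -> mu_lt d y -> e y = 0) -> edge y0 -> mu_lt d y0 ->
  (forall z, z ord0 ia = 0 -> wsphere z -> mu_lt d z -> flat (e \o bl) z) ->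
  exists C : R, \forall y \near y0, `|e y| <= C * rho y ^+ 2.
Proof.
move=> ei e0 [y01 y02] y0d ef.
have [|N HN] := @compact_uniform _ _ (Kset y0 0) (fun n z => `|e (bl z)| <= n%:R * `|z ord0 ia| ^+ 6) (@Kset_compact y0 0).
  move=> z [za zs zm]; have zd : mu_lt d z.
    move=> j ja j1 j2; have := zm j ja j1 j2; rewrite normr_le0 subr_eq0 => /eqP ->; exact: y0d.
  have [C /near_radius[r r0 Hr]] := ef z za zs zd 6%N.
  exists r => //; exists (Num.bound `|C|) => n z' Nn zz.
  apply: (le_trans (Hr z' zz)); rewrite ler_wpM2r// (le_trans (ler_norm C))//.
  by rewrite (le_trans (ltW (archi_boundP (normr_ge0 C))))// ler_nat.
pose d0 : R := N.+1%:R^-1; have d0_gt : 0 < d0 by rewrite invr_gt0.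
have d01 : d0 <= 1 by rewrite invf_le1// ler1n.
exists N%:R; have d6 : 0 < d0 ^+ 6 by rewrite exprn_gt0.
have md := mu_lt_near y0d.
move: (near_and md (near_normlt y0 d6)); apply: filterS => y [yd yy].
have [yE|] := boolP ((y ord0 i1 == 0) && (y ord0 i2 == 0)).
  move/andP: yE => [/eqP h1 /eqP h2]; rewrite e0//; first by rewrite normr0 mulr_ge0// exprn_ge0 ?rho_ge0.
rewrite negb_and => /polar_unbl[r r0 [rs r6]].
have ys j : `|y ord0 j - y0 ord0 j| < d0 ^+ 6.
  by apply: le_lt_trans yy; have := coord_le (y - y0) j; rewrite !mxE.
have s1 := ys i1; have s2 := ys i2; rewrite y01 subr0 in s1; rewrite y02 subr0 in s2.
have rd := polar_small d0_gt d01 r0 s1 s2 r6.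
have ra : unbl r y ord0 ia = r by rewrite mxE eqxx.
pose z0 : 'rV[R]_m := \row_j if (j == i1) || (j == i2) then unbl r y ord0 j else zc ia y0 ord0 j.
have z0E j : z0 ord0 j = if (j == i1) || (j == i2) then unbl r y ord0 j
    else if j == ia then 0 else y0 ord0 j by rewrite mxE zcE.
have [z0K zz] : Kset y0 0 z0 /\ `|unbl r y - z0| < d0.
  split.
    split.
    - by rewrite mxE (negPf a1) (negPf a2) zcE eqxx.
    - by move: rs; rewrite /wsphere ![z0 _ _]mxE !eqxx orbT.
    - by move=> j ja j1 j2; rewrite mxE (negPf j1) (negPf j2) zcE (negPf ja) subrr normr0.
  apply: norm_lt_coord => // j.
  have -> : (unbl r y - z0) ord0 j = unbl r y ord0 j - z0 ord0 j by rewrite !mxE.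
  have [->|ja] := eqVneq j ia.
    by rewrite ra z0E (negPf a1) (negPf a2) eqxx subr0 gtr0_norm.
  have [e1|j1] := eqVneq j i1; first by rewrite z0E e1 eqxx/= subrr normr0.
  have [e2|j2] := eqVneq j i2; first by rewrite z0E e2 eqxx orbT subrr normr0.
  rewrite z0E (negPf ja) (negPf j1) (negPf j2) /= mxE (negPf ja) (negPf j1) (negPf j2).
  apply: lt_le_trans (ys j) _.
  by rewrite -[leRHS]expr1 ler_wiXn2l// ltW.
have := HN z0 _ z0K zz; rewrite unblK ?gt_eqF// ei ra (gtr0_norm r0) r6 => /le_trans; apply.
rewrite ler_wpM2l// ge_max.
have q0 : 0 <= rho y by exact: rho_ge0.
have q1 : rho y <= 1.
  by rewrite ge_max; apply/andP; split; apply: ltW; apply: (lt_le_trans _ (exprn_ile1 6 (ltW d0_gt) d01)).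
rewrite [X in _ && X]lerXn2r ?nnegrE ?rho_i2// andbT.
apply: (@le_trans _ _ (rho y ^+ 3)); first by rewrite lerXn2r ?nnegrE ?rho_i1.
by rewrite ler_wiXn2l.
Qed.

(** The family to be closed under partial derivatives: functions downstairs, zero on the edge, whose
    lifts are smooth, and flat at r = 0. *)
Definition blow_class (d eta : R) e := [/\ forall y, e (zc ia y) = e y,
  forall y, edge y -> mu_lt d y -> e y = 0,
  forall z, `|z ord0 ia| < eta -> wsphere z -> mu_lt d z -> sm z (e \o bl) &
  forall z, z ord0 ia = 0 -> wsphere z -> mu_lt d z -> flat (e \o bl) z].

Lemma edge_derive e d eta y0 v : blow_class d eta e -> edge y0 -> mu_lt d y0 -> is_derive y0 v e 0.
Proof.
move=> [ei e0 _ ef] y0e y0d.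
have [C /near_radius[r r0 Hr]] := edge_bound ei e0 y0e y0d ef.
apply: increment_derive => c c0; rewrite e0//.
pose M := (`|v| + 1); have M0 : 0 < M by rewrite ltr_wpDl.
pose q := (`|C| + 1) * M ^+ 2; have q0 : 0 < q by rewrite mulr_gt0 ?exprn_gt0// ltr_wpDl.
exists (Num.min (r / M) (c / q)); first by rewrite lt_min !divr_gt0.
move=> t; rewrite lt_min => /andP[t1 t2]; rewrite mulr0 !subr0.
have tv : `|t *: v| <= `|t| * M by rewrite normrZ ler_wpM2l// /M lerDl.
have : `|y0 + t *: v - y0| < r.
  by rewrite addrC addKr; apply: le_lt_trans tv _; rewrite -ltr_pdivlMr.
move=> /Hr /le_trans; apply.
have cb j : `|(y0 + t *: v) ord0 j - y0 ord0 j| <= `|t| * M.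
  apply: le_trans tv; have := coord_le (t *: v) j; rewrite !mxE.
  by rewrite addrC addKr.
have [h1 h2] := (cb i1, cb i2); case: y0e => E1 E2; rewrite E1 subr0 in h1; rewrite E2 subr0 in h2.
have rb : rho (y0 + t *: v) <= `|t| * M by rewrite ge_max h1 h2.
apply: (@le_trans _ _ ((`|C| + 1) * (`|t| * M) ^+ 2)).
  apply: (@le_trans _ _ ((`|C| + 1) * rho (y0 + t *: v) ^+ 2)).
    by rewrite ler_wpM2r ?exprn_ge0 ?rho_ge0//; have := ler_norm C; lra.
  rewrite ler_wpM2l ?addr_ge0// lerXn2r ?nnegrE ?rho_ge0// mulr_ge0//.
  exact: ltW.
have -> : (`|C| + 1) * (`|t| * M) ^+ 2 = `|t| * (`|t| * q) by rewrite /q; ring.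
by rewrite [leRHS]mulrC ler_wpM2l// -ler_pdivlMr// ltW.
Qed.

Lemma pd_indep e l y : (forall y, e (zc ia y) = e y) -> pd l e (zc ia y) = pd l e y.
Proof.
move=> ei; have [] := @derive_quot _ _ _ _ e e (zc ia y) (ev R l) y (ev R l); last by [].
move=> t; rewrite -ei -[RHS]ei; congr e; apply/rowP => j.
by rewrite !zcE [LHS in if _ then _ else LHS]mxE zcE [RHS in _ = if _ then _ else RHS]mxE; case: (j == ia).
Qed.

Lemma pd_ia e y : (forall y, e (zc ia y) = e y) -> pd ia e y = 0.
Proof.
move=> ei; have [] := @derive_quot _ _ _ _ e (fun=> e y) y (ev R ia) y (ev R ia).
  move=> t; rewrite -ei -[RHS]ei; congr e; apply/rowP => j; rewrite !zcE !mxE eqxx /=.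
  by case: (j == ia); rewrite // mulr0 add0r.
by rewrite /pd => -> _; exact: (pd_cst ia y).
Qed.

Let wt (l : 'I_m) : nat := if l == i1 then 2%N else if l == i2 then 3%N else 0%N.

Lemma off_edge e y (r : R) : (forall y, e (zc ia y) = e y) -> r != 0 -> sm (unbl r y) (e \o bl) ->
  sm y e /\ forall l, l != ia -> pd l e y = r ^- wt l * pd l (e \o bl) (unbl r y).
Proof.
move=> ei r0 es; have E : (fun y => (e \o bl) (unbl r y)) = e.
  by apply/funext => y' /=; rewrite unblK.
have us := unbl_smv r y.
split; first by rewrite -E; exact: (sm_comp us es).
move=> l la; rewrite -[in LHS]E (@pd_comp _ _ _ (unbl r) y (e \o bl) l us es).
rewrite (bigD1 l)//= big1 ?addr0.
  congr (_ * _); under eq_fun do rewrite mxE (negPf la).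
  rewrite /wt; case: (l == i1) / eqP => [->|_].
    under eq_fun do rewrite mulrC.
    by rewrite pdZ ?pd_coord ?eqxx ?mulr1//; exact: sm_coord.
  case: (l == i2) / eqP => [->|_].
    under eq_fun do rewrite mulrC.
    by rewrite pdZ ?pd_coord ?eqxx ?mulr1//; exact: sm_coord.
  by rewrite pd_coord eqxx expr0 invr1.
move=> j jl; suff -> : pd l (fun y => unbl r y ord0 j) y = 0 by rewrite mul0r.
under eq_fun do rewrite mxE.
have [_|ja] := eqVneq j ia; first exact: pd_cst.
have c1 : pd l (fun x : 'rV[R]_m => x ord0 j) y = 0 by rewrite pd_coord (negPf jl).
have [e1|j1] := eqVneq j i1.
  under eq_fun do rewrite mulrC.
  by rewrite pdZ -?e1 ?c1 ?mulr0//; exact: sm_coord.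
have [e2|j2] := eqVneq j i2.
  under eq_fun do rewrite mulrC.
  by rewrite pdZ -?e2 ?c1 ?mulr0//; exact: sm_coord.
exact: c1.
Qed.

(** A derivative along l downstairs is r^(- wt l) times one upstairs. Factoring r^(wt l + k + 1) out
    of the flat lift first pays for this loss and leaves k + 1 powers of r. *)
Lemma blow_class_flat d eta e l z0 : 0 < eta -> blow_class d eta e -> z0 ord0 ia = 0 -> wsphere z0 -> mu_lt d z0 ->
  forall k, exists2 g, sm z0 g & \forall z \near z0, pd l e (bl z) = z ord0 ia ^+ k.+1 * g z.
Proof.
move=> eta0 bc z00 zs zm k; have [ei e0 es ef] := bc.
have [->|la] := eqVneq l ia.
  by exists (fun=> 0); [exact: sm_cst|near=> z; rewrite pd_ia// mulr0].
have Es : sm z0 (e \o bl) by apply: es => //; rewrite z00 normr0.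
have [f fs fE] := flat_factor z00 Es (ef _ z00 zs zm) (wt l + k.+1).
exists (pd l f); first exact: sm_pd.
have /near_open[U [oU Uz HU]] := near_and (sm_near fs) (near_and fE (near_and (sm_near Es) (mu_lt_near zm))).
move: (open_near oU Uz); apply: filterS => z Uz'.
have [fz [_ [Ez zd]]] := HU z Uz'.
have [z1|z1] := eqVneq (z ord0 ia) 0.
  rewrite z1 exprS !mul0r; have [b0 b1 b2 b3] := blE z.
  have eb : edge (bl z) by rewrite /edge b1 b2 z1 !exprS !mul0r.
  have mb : mu_lt d (bl z) by move=> j ja j1 j2; rewrite b3//; exact: zd.
  by have [_] := edge_derive (ev R l) bc eb mb.
have uz : unbl (z ord0 ia) (bl z) = z by exact: blK.
have [|_ ->//] := @off_edge e (bl z) (z ord0 ia) ei z1; first by rewrite uz.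
rewrite uz.
have n : {near z, e \o bl =1 (fun z => z ord0 ia ^+ (wt l + k.+1) * f z)}.
  by move: (open_near oU Uz'); apply: filterS => w /HU[_ [-> _]].
rewrite (pd_near l n) pdM; [|by apply: smX; exact: sm_coord|exact: fz].
have -> : pd l (fun y : 'rV[R]_m => y ord0 ia ^+ (wt l + k.+1)) z = 0.
  by rewrite addnS pdX ?pd_coord 1?eq_sym ?(negPf la) ?mulr0//; exact: sm_coord.
by rewrite mulr0 addr0 exprD; field; rewrite expf_neq0.
Unshelve. all: by end_near. Qed.

Lemma blow_class_pd d eta e l : 0 < eta -> blow_class d eta e -> blow_class d eta (pd l e).
Proof.
move=> eta0 bc; have [ei e0 es ef] := bc; split.
- by move=> y; exact: pd_indep.
- by move=> y ye ym; have [_] := edge_derive (ev R l) bc ye ym.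
- move=> z za zs zm; have [z0|z0] := eqVneq (z ord0 ia) 0.
    have [g gs gE] := blow_class_flat l eta0 bc z0 zs zm 0.
    apply: (@sm_ext _ _ _ (fun z => z ord0 ia ^+ 1 * g z)).
      by move: gE; apply: filterS => w /= ->.
    by apply: smM; [apply: smX; exact: sm_coord|exact: gs].
  have [la|la] := eqVneq l ia.
    have -> : pd l e \o bl = fun=> 0 by apply/funext => w /=; rewrite la pd_ia.
    exact: sm_cst.
  have Es := es z za zs zm.
  apply: (@sm_ext _ _ _ (fun z => z ord0 ia ^- wt l * pd l (e \o bl) z)).
    move: (near_and (sm_near Es) (sm_neq0 (sm_coord _ ia) z0)); apply: filterS => w [Ew w0].
    rewrite /=; have [|_ -> //] := @off_edge e (bl w) (w ord0 ia) ei w0; first by rewrite blK.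
    by rewrite blK.
  apply: smM; last exact: sm_pd.
  by apply: smV; [rewrite expf_neq0|apply: smX; exact: sm_coord].
- move=> z z0 zs zm k; have [g gs gE] := blow_class_flat l eta0 bc z0 zs zm k.
  exists (`|g z| + 1).
  have c1 := dist_cts (sm_cts gs) (ltr01 : 0 < (1 : R)).
  move: (near_and gE (near_and c1 (near_normlt z (ltr01 : 0 < (1 : R))))); apply: filterS => w [/= -> [gw wz]].
  rewrite normrM normrX mulrC ler_pM ?exprn_ge0//.
    have -> : g w = g z - (g z - g w) by ring.
    by rewrite (le_trans (ler_normB _ _))// lerD2l.
  rewrite ler_wiXn2l//; have := le_lt_trans (coord_le (w - z) ia) wz.
  by rewrite !mxE z0 subr0 => /ltW.
Qed.

(** Off the edge e is its lift composed with the smooth map [unbl]; on the edge all derivatives are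
    zero. [blow_class] then certifies smoothness across both. *)
Lemma blow_down e (d : R) : 0 < d -> (forall y, e (zc ia y) = e y) ->
  (forall y, edge y -> mu_lt d y -> e y = 0) ->
  (forall z, z ord0 ia = 0 -> wsphere z -> mu_lt d z -> sm z (e \o bl) /\ flat (e \o bl) z) ->
  sm 0 e /\ forall v, is_derive 0 v e 0.
Proof.
move=> d0 ei e0 H; have d2 : 0 < d / 2 by exact: divr_gt0.
have dd : d / 2 < d by rewrite ltr_pdivrMr// mulr_natr mulr2n ltrDl.
have wk z : mu_lt (d / 2) z -> mu_lt d z.
  by move=> zm j ja j1 j2; apply: lt_trans dd; exact: zm.
have [|N HN] := @compact_uniform _ _ (Kset 0 (d / 2)) (fun n z => sm z (e \o bl)) (@Kset_compact 0 (d / 2)).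
  move=> z [za zs zm]; have zd : mu_lt d z.
    by move=> j ja j1 j2; apply: le_lt_trans dd; have := zm j ja j1 j2; rewrite mxE subr0.
  have [/sm_near/near_radius[r r0 Hr] _] := H z za zs zd.
  by exists r => //; exists 0%N => n z' _; exact: Hr.
pose eta : R := N.+1%:R^-1; have eta0 : 0 < eta by rewrite invr_gt0.
have eta1 : eta <= 1 by rewrite invf_le1// ler1n.
have bc0 : blow_class (d / 2) eta e.
  split=> //; [by move=> y ye /wk; exact: e0| |by move=> z z0 zs /wk zm; have [] := H z z0 zs zm].
  move=> z za zs zm; apply: (HN (zc ia z)).
    split; first by rewrite zcE eqxx.
    - by move: zs; rewrite /wsphere !zcE ![_ == ia]eq_sym (negPf a1) (negPf a2).
    - by move=> j ja j1 j2; rewrite zcE (negPf ja) mxE subr0 ltW// zm.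
  have -> : z - zc ia z = z ord0 ia *: ev R ia by rewrite {1}[z](zc_add ia) addrAC subrr add0r.
  exact: le_lt_trans (norm_step _ _ _) za.
(* The sixth power makes the weighted radius of every point of the ball smaller than eta, where the
   lift is known to be smooth. *)
pose r := Num.min (eta ^+ 6) (d / 2); have r0 : 0 < r by rewrite lt_min exprn_gt0.
have dm y : Ideals.dom r y -> mu_lt (d / 2) y.
  move=> yr j _ _ _; apply: le_lt_trans (coord_le _ _) (lt_le_trans yr _).
  by rewrite ge_min lexx orbT.
have offU f y : blow_class (d / 2) eta f -> Ideals.dom r y -> ~ edge y -> sm y f.
  move=> [fi _ fs _] yr ye.
  have yn : (y ord0 i1 != 0) || (y ord0 i2 != 0).
    by rewrite -negb_and; apply/negP => /andP[/eqP h1 /eqP h2]; apply: ye.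
  have [q q0 [qs q6]] := polar_unbl yn.
  have ye6 j : `|y ord0 j| < eta ^+ 6.
    by apply: le_lt_trans (coord_le _ _) (lt_le_trans yr _); rewrite ge_min lexx.
  have qe := polar_small eta0 eta1 q0 (ye6 i1) (ye6 i2) q6.
  apply: (off_edge fi (lt0r_neq0 q0) _).1; apply: fs => //.
    by rewrite mxE eqxx gtr0_norm.
  by move=> j ja j1 j2; rewrite mxE (negPf ja) (negPf j1) (negPf j2); exact: (dm _ yr).
split; last first.
  move=> v; apply: (edge_derive v bc0); first by rewrite /edge !mxE.
  by move=> j _ _ _; rewrite mxE normr0.
apply: (@sm_coind _ _ (Ideals.dom r) (blow_class (d / 2) eta) (@dom_open R m r) _ _ e 0 bc0); last by rewrite /Ideals.dom/= normr0.
- move=> f bf y yr; have [ye|ye] := pselect (edge y); last exact: sm_cts (offU f y bf yr ye).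
  have [fi f0 _ ff] := bf.
  have [C HC] := edge_bound fi f0 ye (dm _ yr) ff.
  apply: cts_dist => c c0.
  have c1 : 0 < Num.min 1 (c / (`|C| + 1)) by rewrite lt_min ltr01 divr_gt0// ltr_wpDl.
  move: (near_and HC (near_normlt y c1)); apply: filterS => w [Hw]; rewrite lt_min => /andP[w1 w2].
  rewrite f0//; last exact: dm.
  rewrite sub0r normrN; apply: (le_trans Hw).
  have wj j : y ord0 j = 0 -> `|w ord0 j| <= `|w - y|.
    by move=> y0; have := coord_le (w - y) j; rewrite !mxE y0 subr0.
  case: ye => y1 y2; have rw : rho w <= `|w - y| by rewrite ge_max !wj.
  have rho0 : 0 <= rho w by exact: rho_ge0.
  apply: (@le_trans _ _ ((`|C| + 1) * rho w)).
    apply: (@le_trans _ _ ((`|C| + 1) * rho w ^+ 2)).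
      by rewrite ler_wpM2r ?exprn_ge0//; have := ler_norm C; lra.
    rewrite ler_wpM2l ?addr_ge0// expr2 ler_piMr//; exact: le_trans rw (ltW w1).
  rewrite mulrC -ler_pdivlMr ?ltr_wpDl//; exact: le_trans rw (ltW w2).
- move=> f l bf; exists (pd l f); first exact: blow_class_pd.
  move=> y yr; have [ye|ye] := pselect (edge y); last exact: sm_derive (offU f y bf yr ye).
  have dd0 := edge_derive (ev R l) bf ye (dm _ yr).
  by have [_ E] := dd0; rewrite /pd E.
Qed.

End BlowDown.

(** * Minimizers in one variable *)

Section ScalarBranch.
Variables (R : realType) (m : nat).
Implicit Types (F : 'rV[R]_(1 + m) -> R) (z : 'rV[R]_m) (a : R).

Definition pt a z : 'rV[R]_(1 + m) := row_mx a%:M z.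
Definition i0 : 'I_(1 + m) := lshift m ord0.

Lemma pt_i0 a z : pt a z ord0 i0 = a.
Proof. by rewrite /pt row_mxEl mxE eqxx mulr1n. Qed.

Lemma pt_r a z j : pt a z ord0 (rshift 1 j) = z ord0 j.
Proof. by rewrite /pt row_mxEr. Qed.

Lemma pt_cases (P : 'I_(1 + m) -> Prop) : P i0 -> (forall j, P (rshift 1 j)) -> forall j, P j.
Proof. by move=> P0 P1 j; rewrite -[j]splitK; case: (fintype.split j) => l //=; rewrite [l]ord1. Qed.

Lemma pt_add a t z : pt (a + t) z = pt a z + t *: ev R i0.
Proof.
apply/rowP; apply: pt_cases => [|l].
  by rewrite [RHS]mxE !pt_i0 [X in _ = _ + X]mxE ev_coord eqxx mulr1.
by rewrite [RHS]mxE !pt_r [X in _ = _ + X]mxE ev_coord eq_rlshift mulr0 addr0.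
Qed.

Lemma pt_norm a a' z z' (e : R) : `|a - a'| < e -> `|z - z'| < e -> `|pt a z - pt a' z'| < e.
Proof.
move=> ae ze; have e0 : 0 < e by exact: le_lt_trans ae.
apply: norm_lt_coord => //; apply: pt_cases => [|l].
  by rewrite [X in `|X|]mxE [X in _ + X]mxE !pt_i0.
rewrite [X in `|X|]mxE [X in _ + X]mxE !pt_r; apply: le_lt_trans ze.
by have := coord_le (z - z') l; rewrite !mxE.
Qed.

Lemma pt_smv (A : 'rV[R]_m -> R) z : sm z A -> smv z (fun z => pt (A z) z).
Proof.
move=> As; apply: smv_row; last exact: smv_id.
by move=> j; under eq_fun do rewrite [j]ord1 mxE eqxx mulr1n.
Qed.

Lemma comp_pt F (A : 'rV[R]_m -> R) z : sm z A -> sm (pt (A z) z) F -> sm z (fun z => F (pt (A z) z)).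
Proof. by move=> /pt_smv As Fs; exact: (sm_comp As Fs). Qed.

Lemma implicit1 F a0 z0 : sm (pt a0 z0) F -> F (pt a0 z0) = 0 -> pd i0 F (pt a0 z0) != 0 ->
  exists A : 'rV[R]_m -> R, [/\ sm z0 A, A z0 = a0 & \forall z \near z0, F (pt (A z) z) = 0].
Proof.
move=> Fs F0 F1; pose E (w : 'rV[R]_(1 + m)) : 'rV[R]_1 := (F w)%:M.
have EE w j : E w ord0 j = F w by rewrite [j]ord1 mxE eqxx mulr1n.
have [|||A [As A0 AE _]] := @implicit_function R 1 m E a0%:M z0.
- by move=> j; under eq_fun do rewrite EE.
- by apply/rowP => j; rewrite EE -/(pt a0 z0) F0 mxE.
- rewrite unitmxE det_mx11 mxE unitfE; under eq_fun do rewrite EE.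
  exact: F1.
exists (fun z => A z ord0 ord0); split; first exact: As.
  by rewrite A0 mxE eqxx mulr1n.
move: AE; apply: filterS => z /rowP/(_ ord0); rewrite EE /pt -mx11_scalar.
by move=> ->; rewrite mxE.
Qed.

Lemma near_cts_dist (A : 'rV[R]_m -> R) z0 (e : R) : sm z0 A -> 0 < e -> \forall z \near z0, `|A z0 - A z| < e.
Proof.
move=> As e0; have e2 : 0 < e / 2 by exact: divr_gt0.
move: (dist_cts (sm_cts As) e2); apply: filterS => z h; apply: le_lt_trans h _.
by rewrite ltr_pdivrMr// mulr_natr mulr2n ltrDl.
Qed.

Lemma nbhsx_ballx_norm (a q : R) : 0 < q -> \forall a' \near a, `|a' - a| < q.
Proof.
move=> q0; apply/nbhs_ballP; exists q => //= a'; rewrite -ball_normE/= distrC.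
by [].
Qed.

Lemma crit_branch F a0 z0 : sm (pt a0 z0) F -> pd i0 F (pt a0 z0) = 0 -> pd i0 (pd i0 F) (pt a0 z0) != 0 ->
  exists A : 'rV[R]_m -> R, [/\ sm z0 A, A z0 = a0 & \forall z \near z0, pd i0 F (pt (A z) z) = 0].
Proof. by move=> Fs; apply: implicit1; exact: sm_pd. Qed.

(** Subtracting the parabola c/2 t^2 leaves a function with derivative at most c/2 |t|, so the
    increment of F differs from c/2 s^2 by at most c/2 s^2. *)
Lemma convex_min F z (a a' c : R) : 0 <= c -> pd i0 F (pt a z) = 0 ->
  (forall t, `|t| <= `|a' - a| -> sm (pt (a + t) z) F /\ `|pd i0 (pd i0 F) (pt (a + t) z) - c| <= c / 2) ->
  F (pt a z) <= F (pt a' z).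
Proof.
move=> c0 crit H; set s := a' - a.
have d1 (t : R) : `|t| <= `|s| -> `|pd i0 F (pt (a + t) z) - c * t| <= c / 2 * `|t|.
  move=> ts; have := @mvt_dir _ _ (pd i0 F) (pt a z) i0 t c (c / 2).
  rewrite -pt_add crit subr0 [t * c]mulrC; apply=> u ut; rewrite -pt_add.
  by have [s1 s2] := H u (le_trans ut ts); split; [exact: sm_pd|exact: s2].
have := @mvt_increment R (fun t => F (pt (a + t) z) - c / 2 * t ^+ 2)
  (fun t => pd i0 F (pt (a + t) z) - c * t) s 0 (c / 2 * `|s|).
rewrite expr0n mulr0 subr0 addr0 mulr0 subr0.
have -> : a + s = a' by rewrite /s; ring.
move=> /(_ _) K; have {K} : `|F (pt a' z) - c / 2 * s ^+ 2 - F (pt a z)| <= c / 2 * `|s| * `|s|.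
  apply: K => t ts; split; last first.
    by rewrite subr0; apply: (le_trans (d1 t ts)); rewrite ler_wpM2l// divr_ge0.
  have [Fs _] := H t ts.
  have dF : is_derive t 1 (fun t => F (pt (a + t) z)) (pd i0 F (pt (a + t) z)).
    have -> : (fun t => F (pt (a + t) z)) = (fun t => F (pt a z + t *: ev R i0)).
      by apply/funext => u; rewrite pt_add.
    by rewrite pt_add; apply: line_derive; rewrite -pt_add; exact: sm_derive.
  have dq : is_derive t 1 (fun t : R => c / 2 * t ^+ 2) (c * t).
    have h1 := is_deriveX 2 (is_derive_id t (1 : R)).
    have := is_deriveZ (c / 2) h1.
    have -> : (c / 2) \*: (@id R) ^+ 2 = (fun t : R => c / 2 * t ^+ 2) by [].
    suff -> : c * t = (c / 2) *: ((2%:R * id t ^+ 1) *: 1) :> R by [].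
    by rewrite -![_ *: _]/(_ * _) expr1 mulr1 /=; field.
  exact: is_deriveB.
rewrite -[c / 2 * _ * _]mulrA -normrM -expr2 ger0_norm ?sqr_ge0// ler_distl => /andP[+ _].
by move=> h; move: h; rewrite lerBlDr; set q := c / 2 * s ^+ 2; lra.
Qed.

(** Three zones: near a0 convexity makes the critical branch minimal; for |a| <= M away from a0 the
    strict inequality at z0 persists by compactness; beyond M the coercivity hypothesis applies. D
    will be the line or a half line. *)
Lemma min_branch F (D : set R) a0 z0 (M : R) : closed D -> (\forall a \near a0, D a) ->
  (forall a, `|a| <= M -> sm (pt a z0) F) -> `|a0| <= M ->
  pd i0 F (pt a0 z0) = 0 -> 0 < pd i0 (pd i0 F) (pt a0 z0) ->
  (forall a, D a -> a != a0 -> F (pt a0 z0) < F (pt a z0)) ->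
  (\forall z \near z0, forall a, D a -> M < `|a| -> F (pt a0 z) <= F (pt a z)) ->
  exists A : 'rV[R]_m -> R, [/\ sm z0 A, A z0 = a0 & \forall z \near z0,
    D (A z) /\ forall a, D a -> F (pt (A z) z) <= F (pt a z)].
Proof.
move=> cD nD Fs aM F1 F2 Fm Fc; have F0s := Fs _ aM.
have [A [As A0 Ac]] := crit_branch F0s F1 (lt0r_neq0 F2).
set c := pd i0 (pd i0 F) (pt a0 z0) in F2.
have c2 : 0 < c / 2 by exact: divr_gt0.
have /near_radius[e1 e10 H1] := near_and (sm_near F0s) (dist_cts (sm_cts (sm_pd i0 (sm_pd i0 F0s))) c2).
have /nbhs_ballP[e2 /= e20 H2] := nD.
pose e := Num.min e1 e2; have e0 : 0 < e by rewrite lt_min e10.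
have ee1 : e <= e1 by rewrite ge_min lexx.
have ee2 : e <= e2 by rewrite ge_min lexx orbT.
have e3 : 0 < e / 3 by exact: divr_gt0.
have near_in (a : R) z (z' : R) : `|a - a0| < e / 3 -> `|z - z0| < e -> `|z' - a| <= 2 * (e / 3) -> `|pt z' z - pt a0 z0| < e1.
  move=> h1 h2 h3; apply: lt_le_trans ee1; apply: pt_norm => //.
  have -> : z' - a0 = (z' - a) + (a - a0) by ring.
  apply: (le_lt_trans (ler_normD _ _)); move: h1 h3; lra.
have far : \forall z \near z0, [set a | `|a| <= M] `<=` (fun a => D a -> e / 3 <= `|a - a0| -> F (pt a0 z) <= F (pt a z)).
  have cK : compact [set a : R | `|a| <= M].
    have -> : [set a : R | `|a| <= M] = `[- M, M]%classic by apply/seteqP; split=> x /=; rewrite in_itv/= -ler_norml.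
    exact: segment_compact.
  move/compact_near_coveringP: cK => cK.
  have := cK _ (nbhs z0) (fun z a => D a -> e / 3 <= `|a - a0| -> F (pt a0 z) <= F (pt a z)) _.
  move=> /(_ _) K; apply: K => a /= aM'.
  have [Da|nDa] := pselect (D a); last first.
    exists (~` D, setT) => /=.
      by split; [exact: (open_near (closed_openC cD) nDa)|exact: filterT].
    by move=> [a' z] /= [nD' _].
  have [aa|aa] := ltP `|a - a0| (e / 3).
    exists ([set a' | `|a' - a0| < e / 3], setT) => /=.
      split; last exact: filterT.
      apply: (@near_preim _ _ (fun a' : R => `|a' - a0|) a (fun t => t < e / 3)).
        by apply: cvg_norm; apply: cvgB; [exact: cvg_id|exact: cvg_cst].
      by apply: (@open_near _ [set t | t < e / 3]); first exact: open_lt.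
    by move=> [a' z] /= [h _] _; rewrite leNgt h.
  have an : a != a0.
    by apply/eqP => h; move: aa; rewrite h subrr normr0 leNgt e3.
  have lt0 := Fm a Da an; pose v := (F (pt a0 z0) + F (pt a z0)) / 2.
  have [v1 v2] : F (pt a0 z0) < v /\ v < F (pt a z0) by rewrite /v; split; lra.
  have /near_radius[q q0 Hq] := sm_gt (Fs a aM') v2.
  have /near_radius[q' q'0 Hq'] := sm_lt F0s v1.
  exists ([set a' | `|a' - a| < q], [set z | `|z - z0| < q /\ `|z - z0| < q']) => /=.
    split; last exact: (filterI (near_normlt z0 q0) (near_normlt z0 q'0)).
    by apply: nbhsx_ballx_norm.
  move=> [a' z] /= [h1 [h2 h3]] _ _; apply: ltW; apply: (@lt_trans _ _ v).
    by apply: Hq'; apply: pt_norm => //; rewrite subrr normr0.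
  by apply: Hq; exact: pt_norm.
have Anear : \forall z \near z0, `|A z - a0| < e / 3.
  have := near_cts_dist As e3; rewrite A0.
  by apply: filterS => z; rewrite distrC.
exists A; split=> //.
move: (near_and Anear (near_and Ac (near_and Fc (near_and far (near_normlt z0 e0)))));
  apply: filterS => z [Az [cz [Fcz [Fz ze]]]].
have D1 : D (A z).
  by apply: H2; rewrite -ball_normE/= distrC; apply: lt_le_trans ee2; apply: lt_trans Az _; lra.
have loc a : `|a - a0| < e / 3 -> F (pt (A z) z) <= F (pt a z).
  move=> ha; apply: (@convex_min F z (A z) a c (ltW F2) cz) => t ts.
  have /H1[s1 s2] : `|pt (A z + t) z - pt a0 z0| < e1.
    apply: (@near_in (A z)) => //; rewrite addrC addKr; apply: (le_trans ts).
    have -> : a - A z = (a - a0) - (A z - a0) by ring.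
    by apply: (le_trans (ler_normB _ _)); move: ha Az; lra.
  by split; [exact: s1|rewrite distrC].
have locA0 : F (pt (A z) z) <= F (pt a0 z) by apply: loc; rewrite subrr normr0.
split=> // a Da; have [ha|ha] := ltP `|a - a0| (e / 3); first exact: loc.
apply: (le_trans locA0); have [aM'|aM'] := leP `|a| M; first exact: Fz.
exact: Fcz.
Unshelve. all: by end_near. Qed.

End ScalarBranch.

(** * Minima of the quartic x^4 + P x^2 + Q x *)

Section Quartic.
Variable R : realType.
Implicit Types (P Q a x : R).

Definition qN P Q x : R := x ^+ 4 + P * x ^+ 2 + Q * x.

Definition qcrit P Q a := 4 * a ^+ 3 + 2 * P * a + Q = 0.

(** At a critical point the quartic has value - a^2 (3 a^2 + P), so the third hypothesis says that a
    beats the end point 0 of the half line. *)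
Lemma qN_half P Q a x : 0 < a -> qcrit P Q a -> 0 < 3 * a ^+ 2 + P -> 0 <= x ->
  qN P Q a <= qN P Q x ?= iff (x == a).
Proof.
move=> a0 ac aP x0; have E : qN P Q x - qN P Q a = (x - a) ^+ 2 * (x ^+ 2 + 2 * x * a + (3 * a ^+ 2 + P)).
  have -> : Q = - (4 * a ^+ 3 + 2 * P * a) by move: ac; rewrite /qcrit; lra.
  by rewrite /qN; ring.
have q0 : 0 < x ^+ 2 + 2 * x * a + (3 * a ^+ 2 + P).
  by rewrite ltr_wpDl// addr_ge0 ?sqr_ge0// !mulr_ge0// ltW.
split; first by rewrite -subr_ge0 E mulr_ge0 ?sqr_ge0// ltW.
by rewrite eq_sym -subr_eq0 E mulf_eq0 (gt_eqF q0) orbF sqrf_eq0 subr_eq0.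
Qed.

(** The same factorization, with the second factor completed to a square around x = - a. *)
Lemma qN_full P Q a x : qcrit P Q a -> 0 < 2 * a ^+ 2 + P -> qN P Q a <= qN P Q x ?= iff (x == a).
Proof.
move=> ac aP; have E : qN P Q x - qN P Q a = (x - a) ^+ 2 * ((x + a) ^+ 2 + (2 * a ^+ 2 + P)).
  have -> : Q = - (4 * a ^+ 3 + 2 * P * a) by move: ac; rewrite /qcrit; lra.
  by rewrite /qN; ring.
have q0 : 0 < (x + a) ^+ 2 + (2 * a ^+ 2 + P) by rewrite ltr_wpDl// sqr_ge0.
split; first by rewrite -subr_ge0 E mulr_ge0 ?sqr_ge0// ltW.
by rewrite eq_sym -subr_eq0 E mulf_eq0 (gt_eqF q0) orbF sqrf_eq0 subr_eq0.
Qed.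

Lemma qcrit_above P Q (b : R) : 0 <= b -> 4 * b ^+ 3 + 2 * P * b + Q < 0 -> exists2 a, b < a & qcrit P Q a.
Proof.
move=> b0 bn; pose p : {poly R} := 4%:P * 'X^3 + (2 * P)%:P * 'X + Q%:P.
have pE x : p.[x] = 4 * x ^+ 3 + 2 * P * x + Q by rewrite /p !hornerE.
pose c := b + `|P| + `|Q| + 1.
have bc : b <= c by rewrite /c; have := normr_ge0 P; have := normr_ge0 Q; lra.
have c1 : 1 <= c by rewrite /c; have := normr_ge0 P; have := normr_ge0 Q; lra.
have pc : 0 <= p.[c].
  rewrite pE; have h1 : - P <= c by rewrite /c; have := ler_norm (- P); rewrite normrN; have := normr_ge0 Q; lra.
  have h2 : - Q <= c by rewrite /c; have := ler_norm (- Q); rewrite normrN; have := normr_ge0 P; lra.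
  have c2 : c <= c ^+ 2 by rewrite expr2; nra.
  have c3 : c ^+ 2 <= c ^+ 3 by rewrite [c ^+ 3]exprS; nra.
  have h3 : - (c ^+ 2) <= P * c by nra.
  nra.
have [a /andP[ba _] /eqP pa] := @poly_ivt R p b c bc (introT andP (conj (ltW (eq_ind_r (fun t => t < 0) bn (pE b))) pc)).
exists a; last by rewrite /qcrit -pE.
rewrite lt_neqAle ba andbT; apply/eqP => h.
by move: bn; rewrite h -pE pa ltxx.
Qed.

(** The hypothesis is the discriminant condition for x^3 + P x + Q, the quartic divided by x, to
    have three distinct real roots; the quartic is then negative somewhere on both sides of 0. At
    the point b, where 3 b^2 + P = 0, its derivative is negative, so there is a critical point
    beyond b. *)
Lemma half_exists P Q : P < 0 -> 27 * Q ^+ 2 < 4 * (- P) ^+ 3 ->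
  exists a, [/\ 0 < a, qcrit P Q a & 0 < 3 * a ^+ 2 + P].
Proof.
move=> P0 PQ; pose b := Num.sqrt (- P / 3).
have b0 : 0 < b by rewrite sqrtr_gt0; lra.
have b2 : b ^+ 2 = - P / 3 by rewrite sqr_sqrtr//; lra.
have bn : 4 * b ^+ 3 + 2 * P * b + Q < 0.
  have -> : 4 * b ^+ 3 + 2 * P * b + Q = Q - (2 * (- P) / 3) * b.
    have -> : b ^+ 3 = b * b ^+ 2 by rewrite -exprS.
    by rewrite b2; field.
  rewrite subr_lt0; have [Q0|Q0] := ltP Q 0.
    by apply: lt_le_trans Q0 _; rewrite !mulr_ge0 ?(ltW b0)//; lra.
  rewrite -(@ltr_pXn2r _ 2) ?nnegrE//; last by rewrite !mulr_ge0 ?(ltW b0)//; lra.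
  rewrite exprMn b2.
  have -> : (2 * - P / 3) ^+ 2 * (- P / 3) = 4 * (- P) ^+ 3 / 27 by field.
  lra.
have [a ba ac] := qcrit_above (ltW b0) bn.
exists a; split=> //; first exact: lt_trans ba.
have : b ^+ 2 < a ^+ 2 by rewrite ltr_pXn2r ?nnegrE ?(ltW b0)// ltW// (lt_trans b0).
by rewrite b2; lra.
Qed.

Lemma qcrit_opp P Q a : qcrit P Q a -> qcrit P (- Q) (- a).
Proof. by rewrite /qcrit => h; rewrite -[0]oppr0 -h; ring. Qed.

(** Only the closed Maxwell half line Q = 0, P <= 0 is excluded. For Q < 0 one looks beyond the
    point where 2 a^2 + P becomes nonnegative; Q > 0 follows by reflection. *)
Lemma full_exists P Q : 0 < P \/ Q != 0 -> exists2 a, qcrit P Q a & 0 < 2 * a ^+ 2 + P.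
Proof.
have neg P' Q' : Q' < 0 -> exists2 a, qcrit P' Q' a & 0 < 2 * a ^+ 2 + P'.
  move=> Q0; pose b := Num.sqrt (Num.max (- P' / 2) 0).
  have b0 : 0 <= b by exact: sqrtr_ge0.
  have b2 : b ^+ 2 = Num.max (- P' / 2) 0 by rewrite sqr_sqrtr// le_max lexx orbT.
  have b2P : - P' / 2 <= b ^+ 2 by rewrite b2 le_max lexx.
  have bn : 4 * b ^+ 3 + 2 * P' * b + Q' < 0.
    have [hP|hP] := leP 0 P'.
      have b00 : b = 0.
        by rewrite /b max_r ?sqrtr0//; lra.
      by rewrite b00 expr0n/= !mulr0 !add0r.
    have -> : 4 * b ^+ 3 + 2 * P' * b + Q' = Q'.
      have -> : b ^+ 3 = b * b ^+ 2 by rewrite -exprS.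
      by rewrite b2 max_l; [field|lra].
    exact: Q0.
  have [a ba ac] := qcrit_above b0 bn; exists a => //.
  have : b ^+ 2 < a ^+ 2 by rewrite ltr_pXn2r ?nnegrE// (le_trans b0)// ltW.
  lra.
move=> H; have [Q0|Q0|Q0] := ltgtP Q 0.
- exact: neg.
- have [a ac aP] := neg P (- Q) (ltac:(by rewrite oppr_lt0)).
  exists (- a); last by rewrite sqrrN.
  by rewrite -[Q]opprK; exact: qcrit_opp.
- case: H => [P0|]; last by rewrite Q0 eqxx.
  by exists 0; [rewrite /qcrit Q0; ring|rewrite expr0n/=; lra].
Qed.

Lemma inf_attained (D : set R) (f : R -> R) a : D a -> (forall x, D x -> f a <= f x) ->
  inf [set f x | x in D] = f a.
Proof.
move=> Da H; apply/eqP; rewrite eq_le; apply/andP; split.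
  by apply: ge_inf; [exists (f a) => _ [x Dx <-]; exact: H|exists a].
by apply: lb_le_inf; [exists (f a), a|move=> _ [x Dx <-]; exact: H].
Qed.

End Quartic.

(** * A smooth step function *)

Section Step.
Variable R : realType.

(* The derivatives of exp(-1/x), extended by 0 to x <= 0, are combinations of these functions. *)
Definition flat_exp (k : nat) (x : R) : R := if 0 < x then x ^- k * expR (- x^-1) else 0.

Lemma expR_ge_pow (k : nat) (t : R) : 0 <= t -> t ^+ k <= k%:R ^+ k * expR t.
Proof.
move=> t0; case: k => [|k]; first by rewrite !expr0 mul1r -[1]expR0 ler_expR.
have k0 : 0 < k.+1%:R :> R by rewrite ltr0n.
have -> : expR t = expR (t / k.+1%:R) ^+ k.+1 by rewrite -expRM_natr divfK// gt_eqF.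
rewrite -exprMn lerXn2r ?nnegrE ?mulr_ge0 ?expR_ge0// ?ler0n//.
have := expR_ge1Dx (t / k.+1%:R) => h.
by rewrite -ler_pdivrMl// [_^-1 * _]mulrC; apply: le_trans h; rewrite lerDr.
Qed.

Lemma flat_exp_small k : exists2 C : R, 0 < C & forall x, `|flat_exp k x| <= C * x ^+ 2.
Proof.
exists (k.+2%:R ^+ k.+2 + 1); first by rewrite ltr_wpDl// exprn_ge0.
move=> x; rewrite /flat_exp; case: ltP => x0; last by rewrite normr0 mulr_ge0 ?sqr_ge0// addr_ge0// exprn_ge0.
have xk : 0 < x ^+ k by rewrite exprn_gt0.
rewrite expRN gtr0_norm; last by rewrite mulr_gt0 ?invr_gt0 ?expR_gt0.
have t0 : 0 <= x^-1 by rewrite invr_ge0 ltW.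
have := expR_ge_pow k.+2 t0; rewrite exprVn => h.
have e0 : 0 < expR x^-1 by exact: expR_gt0.
rewrite ler_pdivrMr//.
have -> : x ^- k = x ^+ 2 * x ^- k.+2.
  by rewrite !exprS; field; rewrite gt_eqF// gt_eqF.
have -> : (k.+2%:R ^+ k.+2 + 1) * x ^+ 2 * expR x^-1 = x ^+ 2 * ((k.+2%:R ^+ k.+2 + 1) * expR x^-1) by ring.
apply: ler_wpM2l; first exact: sqr_ge0.
apply: (le_trans h).
by rewrite ler_wpM2r ?(ltW e0)// lerDl.
Qed.

Lemma flat_exp_derive k (x : R) : is_derive x 1 (flat_exp k) (- k%:R * flat_exp k.+1 x + flat_exp k.+2 x).
Proof.
have [x0|x0|x0] := ltgtP x 0.
- have -> : - k%:R * flat_exp k.+1 x + flat_exp k.+2 x = 0 by rewrite /flat_exp ltNge (ltW x0)/= mulr0 addr0.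
  have n : {near x, (fun=> 0) =1 flat_exp k}.
    have x1 : 0 < - x by rewrite oppr_gt0.
    move: (nbhsx_ballx_norm x x1); apply: filterS => y; rewrite ltr_norml => /andP[_ yx].
    have y0 : y < 0 by lra.
    by rewrite /flat_exp ltNge (ltW y0).
  by apply: near_eq_is_derive n _; exact: is_derive_cst.
- have xn : x != 0 by rewrite gt_eqF.
  have dV : is_derive x 1 (fun y : R => y^-1) (- x ^- 2).
    by have := is_deriveV xn (is_derive_id x (1 : R)); rewrite -[_ *: _]/(_ * _) mulr1.
  have dE : is_derive x 1 (fun y : R => expR (- y^-1)) (expR (- x^-1) * x ^- 2).
    have dN : is_derive x 1 (fun y : R => - y^-1) (x ^- 2) by rewrite -[x ^- 2]opprK; exact: is_deriveN.
    exact: (is_derive1_comp (is_derive_expR _) dN).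
  have dK : is_derive x 1 (fun y : R => y ^- k) (- k%:R * x ^- k.+1).
    case: k => [|k].
      rewrite oppr0 mul0r; under eq_fun do rewrite expr0 invr1; exact: is_derive_cst.
    have := is_deriveX k.+1 dV; rewrite -[_ *: _]/(_ * _) => h.
    have e1 : (fun y : R => y ^- k.+1) = (fun y : R => y^-1) ^+ k.+1.
      by apply/funext => y; rewrite -exprVn; elim: (k.+1) => [|n IH]; rewrite ?expr0// !exprS IH.
    rewrite e1; suff -> : - k.+1%:R * x ^- k.+2 = k.+1%:R * x^-1 ^+ k.+1.-1 * - x ^- 2 :> R by [].
    by rewrite -[k.+1.-1]/k exprVn !mulNr mulrN -mulrA -invfM -exprD addn2.
  have n : {near x, (fun y => y ^- k * expR (- y^-1)) =1 flat_exp k}.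
    move: (nbhsx_ballx_norm x x0); apply: filterS => y; rewrite ltr_norml => /andP[yx _].
    have y0 : 0 < y by lra.
    by rewrite /flat_exp y0.
  apply: near_eq_is_derive n _.
  rewrite /flat_exp x0.
  have -> : - k%:R * (x ^- k.+1 * expR (- x^-1)) + x ^- k.+2 * expR (- x^-1) =
    x ^- k * (expR (- x^-1) * x ^- 2) + expR (- x^-1) * (- k%:R * x ^- k.+1).
    have -> : x ^- k.+2 = x ^- k * x ^- 2 by rewrite -invfM -exprD addn2.
    by ring.
  exact: is_deriveM.
- rewrite x0 /flat_exp ltxx mulr0 addr0.
  have [C C0 H] := flat_exp_small k.
  suff cv : (fun t : R => t^-1 *: ((flat_exp k \o shift 0) (t *: 1) - flat_exp k 0)) @ 0^' --> (0 : R).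
    by split; [apply/cvg_ex; exists 0|apply: cvg_lim].
  apply/cvgrPdist_le => e e0; near=> t.
  have t0 : t != 0 by near: t; exact: nbhs_dnbhs_neq.
  have tr : `|t| < e / C by near: t; apply: dnbhs0_lt; exact: divr_gt0.
  rewrite /= addr0 sub0r normrN [t *: 1]mulr1 {2}/flat_exp ltxx subr0 -[_ *: _]/(_ * _) normrM normfV.
  rewrite ler_pdivrMl ?normr_gt0//; apply: (le_trans (H t)).
  rewrite -real_normK ?num_real// expr2 mulrCA ler_wpM2l// mulrC -ler_pdivlMr//.
  exact: ltW.
Unshelve. all: by end_near. Qed.

Lemma sm_flat_exp m (f : 'rV[R]_m -> R) x k : sm x f -> sm x (fun y => flat_exp k (f y)).
Proof.
move=> fx; have [U [oU Ux Us]] := sm_open fx.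
pose G h := (exists s, h = pds s f) \/ exists j, h = fun y => flat_exp j (f y).
apply: (@sm_alg _ _ U G) => //; last by apply: alg_gen; right; exists k.
- move=> h [[s ->]|[j ->]] y Uy; first by apply/sm_cts/sm_pds; exact: Us.
  apply: (@continuous_comp _ _ _ f (flat_exp j)); first exact: sm_cts (Us _ Uy).
  by apply/differentiable_continuous/derivable1_diffP; have [] := flat_exp_derive j (f y).
- move=> h i [[s ->]|[j ->]].
    exists (pds (i :: s) f); first by apply: alg_gen; left; exists (i :: s).
    by move=> y Uy; apply/sm_derive/sm_pds; exact: Us.
  exists (fun y => (- j%:R * flat_exp j.+1 (f y) + flat_exp j.+2 (f y)) * pds [:: i] f y).
    apply: alg_mul; last by apply: alg_gen; left; exists [:: i].
    apply: alg_add; last by apply: alg_gen; right; exists j.+2.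
    by apply: (@alg_mul _ _ _ (fun=> - j%:R)); [exact: alg_cst|apply: alg_gen; right; exists j.+1].
  move=> y Uy; exact: comp1_derive (sm_derive i (Us _ Uy)) (flat_exp_derive j (f y)).
Qed.

(** It will be evaluated at t = 27 Q^2 / (- P)^3. Both half lines have interior minima for t < 4,
    and the thresholds 1 and 3 leave room on both sides of the transition. *)
Definition step (t : R) : R := flat_exp 0 (3 - t) / (flat_exp 0 (3 - t) + flat_exp 0 (t - 1)).

Lemma flat_exp_gt0 (t : R) : 0 < t -> 0 < flat_exp 0 t.
Proof. by move=> t0; rewrite /flat_exp t0 expr0 invr1 mul1r expR_gt0. Qed.

Lemma flat_exp_eq0 (t : R) : t <= 0 -> flat_exp 0 t = 0.
Proof. by move=> t0; rewrite /flat_exp ltNge t0. Qed.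

Lemma flat_exp_ge0 (t : R) : 0 <= flat_exp 0 t.
Proof. by case: (ltP 0 t) => h; [exact/ltW/flat_exp_gt0|rewrite flat_exp_eq0]. Qed.

Lemma step_den (t : R) : 0 < flat_exp 0 (3 - t) + flat_exp 0 (t - 1).
Proof.
have [h|h] := ltP t 3; first by rewrite ltr_wpDr ?flat_exp_ge0// flat_exp_gt0// subr_gt0.
by rewrite ltr_wpDl ?flat_exp_ge0// flat_exp_gt0// subr_gt0; lra.
Qed.

Lemma step_eq1 (t : R) : t <= 1 -> step t = 1.
Proof.
move=> t1; have := step_den t; rewrite /step [flat_exp 0 (t - 1)]flat_exp_eq0; last by rewrite subr_le0.
by rewrite addr0 => h; rewrite divff// gt_eqF.
Qed.

Lemma step_eq0 (t : R) : 3 <= t -> step t = 0.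
Proof. by move=> t3; rewrite /step [flat_exp 0 (3 - t)]flat_exp_eq0 ?mul0r// subr_le0. Qed.

Lemma sm_step m (f : 'rV[R]_m -> R) x : sm x f -> sm x (fun y => step (f y)).
Proof.
move=> fs; have s1 : sm x (fun y => flat_exp 0 (3 - f y)).
  by apply: sm_flat_exp; apply: smB; [exact: sm_cst|exact: fs].
have s2 : sm x (fun y => flat_exp 0 (f y - 1)).
  by apply: sm_flat_exp; apply: smB; [exact: fs|exact: sm_cst].
apply: smM; first exact: s1.
by apply: smV; [rewrite gt_eqF// step_den|exact: smD].
Qed.

End Step.

Section Lines.
Variables (R : realType) (m : nat).

Lemma pd_line (F : 'rV[R]_(1 + m) -> R) (g : R -> R) (a : R) z : (forall t, F (pt t z) = g t) ->
  pd (i0 m) F (pt a z) = pd (i0 m) (fun w => g (w ord0 (i0 m))) (pt a z).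
Proof.
move=> Fg; have [] := @derive_quot _ _ _ _ F (fun w : 'rV[R]_(1 + m) => g (w ord0 (i0 m))) (pt a z) (ev R (i0 m))
  (pt a z) (ev R (i0 m)); last by [].
by move=> t; rewrite addrC -pt_add pt_i0 Fg.
Qed.

Lemma pd_quartic_line (F : 'rV[R]_(1 + m) -> R) (P Q a : R) z : (forall t, F (pt t z) = qN P Q t) ->
  pd (i0 m) F (pt a z) = 4 * a ^+ 3 + 2 * P * a + Q /\
  pd (i0 m) (pd (i0 m) F) (pt a z) = 12 * a ^+ 2 + 2 * P.
Proof.
move=> Fg; have sx (w : 'rV[R]_(1 + m)) k : sm w (fun w => w ord0 (i0 m) ^+ k) by apply: smX; exact: sm_coord.
have sc (w : 'rV[R]_(1 + m)) : sm w (fun w => w ord0 (i0 m)) by exact: sm_coord.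
have px (w : 'rV[R]_(1 + m)) k : pd (i0 m) (fun w => w ord0 (i0 m) ^+ k.+1) w = k.+1%:R * w ord0 (i0 m) ^+ k.
  by rewrite pdX// pd_coord eqxx mulr1.
have E1 t : pd (i0 m) F (pt t z) = 4 * t ^+ 3 + 2 * P * t + Q.
  rewrite (pd_line t Fg) /qN pdD; [|by apply: smD; [exact: sx|apply: smM; [exact: sm_cst|exact: sx]]|by apply: smM; [exact: sm_cst|exact: sc]].
  rewrite pdD; [|exact: sx|by apply: smM; [exact: sm_cst|exact: sx]].
  by rewrite !pdZ; [|exact: sc|exact: sx]; rewrite !px pd_coord eqxx mulr1 pt_i0 expr1; ring.
split; first exact: E1.
rewrite (pd_line a E1) pdD; [|by apply: smD; apply: smM; [exact: sm_cst|exact: sx|exact: sm_cst|exact: sc]|exact: sm_cst].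
rewrite pd_cst addr0 pdD; [|by apply: smM; [exact: sm_cst|exact: sx]|by apply: smM; [exact: sm_cst|exact: sc]].
by rewrite !pdZ; [|exact: sc|exact: sx]; rewrite !px pd_coord eqxx mulr1 pt_i0; ring.
Qed.

Lemma coercive_arith (V b W P Q c : R) : 8 + `|V| + c < `|b| -> 0 <= c -> b ^+ 4 / 16 <= W ->
  `|P| <= 2 -> `|Q| <= 2 -> V <= W + P * b ^+ 2 + Q * b.
Proof.
move=> Mb c0 Wb P2 Q2.
have b8 : 8 < `|b| by have := normr_ge0 V; lra.
have bV : `|V| < `|b| by lra.
have e2 : b ^+ 2 = `|b| ^+ 2 by rewrite real_normK ?num_real.
have e4 : b ^+ 4 = `|b| ^+ 2 * `|b| ^+ 2 by rewrite -e2 -exprD.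
have b2 : 64 <= `|b| ^+ 2.
  by rewrite expr2 (_ : 64 = 8 * 8); [rewrite ler_pM// ltW|ring].
have h1 : 4 * `|b| ^+ 2 <= W.
  by apply: le_trans Wb; rewrite e4 -mulrA mulrC -mulrA; nra.
have h2 : - (2 * `|b| ^+ 2) <= P * b ^+ 2.
  by rewrite e2; have : 0 <= `|b| ^+ 2 by []; move: P2; rewrite ler_norml => /andP[]; nra.
have h3 : - (2 * `|b|) <= Q * b.
  have : `|Q * b| <= 2 * `|b| by rewrite normrM ler_wpM2r.
  by rewrite ler_norml => /andP[].
have h4 : 8 * `|b| <= `|b| ^+ 2 by rewrite expr2 ler_wpM2r// ltW.
by have := ler_norm V; lra.
Qed.

Lemma approx_low (F N' Nu NB t X Y : R) : `|F - N' - t| <= X -> `|Nu - N'| <= Y -> NB <= Nu ->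
  - (X + Y) <= F - NB - t.
Proof. by rewrite !ler_norml => /andP[h1 h2] /andP[h3 h4] h5; lra. Qed.

Lemma approx_up (F Ft N' NB t X Y : R) : F <= Ft -> `|Ft - N' - t| <= X -> `|NB - N'| <= Y ->
  F - NB - t <= X + Y.
Proof. by rewrite !ler_norml => h5 /andP[h1 h2] /andP[h3 h4]; lra. Qed.

Lemma ivt_low (u a b e : R) : `|u - (a - 2 * e)| <= e -> `|a - b| < e -> u <= b.
Proof. by rewrite ler_norml ltr_norml => /andP[h1 h2] /andP[h3 h4]; lra. Qed.

Lemma ivt_up (u a b e : R) : `|u - (a + 2 * e)| <= e -> `|a - b| < e -> b <= u.
Proof. by rewrite ler_norml ltr_norml => /andP[h1 h2] /andP[h3 h4]; lra. Qed.

End Lines.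

(** * Minimal values over half lines *)

Section Sides.
Variable R : realType.
Implicit Types (P q a b c V M : R) (D : set R) (f g : R -> R).

(** The half line is given by a real number, of which only the sign matters: multiplication by a
    radius r of either sign carries [side c] to [side (r * c)]. *)
Definition side c : set R := [set b | 0 <= c * b].

Lemma side_scale (r : R) c : 0 < r -> side (r * c) = side c.
Proof.
move=> r0; have E b : (0 <= r * c * b) = (0 <= c * b) by rewrite -mulrA pmulr_rge0.
by apply/funext => b; rewrite /side /mkset E.
Qed.

Lemma side_opp (r : R) c : r < 0 -> side (r * c) = side (- c).
Proof. by move=> r0; rewrite -(@side_scale (- r) (- c)) ?oppr_gt0// mulrNN. Qed.

Lemma side_closed c : closed (side c).
Proof.
have -> : side c = (fun b => c * b) @^-1` [set x | 0 <= x] by [].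
apply: closed_comp; last exact: closed_ge.
by move=> b _; apply: cvgMr; exact: cvg_id.
Qed.

Lemma side_near c a : 0 < c * a -> \forall b \near a, side c b.
Proof.
move=> ca; have k : {for a, continuous (fun b => c * b)} by apply: cvgMr; exact: cvg_id.
have : \forall b \near a, 0 < c * b by exact: (cvgr_gt _ k).
by apply: filterS => b /ltW.
Qed.

Lemma qN_side P q c a x : 0 < c * a -> qcrit P q a -> 0 < 3 * a ^+ 2 + P -> 0 <= c * x ->
  qN P q a <= qN P q x ?= iff (x == a).
Proof.
have [c0|c0|->] := ltgtP c 0; last by rewrite mul0r ltxx.
  rewrite nmulr_rgt0// nmulr_rge0// => a0 ac aP x0.
  have := @qN_half R P (- q) (- a) (- x); rewrite oppr_gt0 oppr_ge0 sqrrN eqr_opp => H.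
  have E y : qN P (- q) (- y) = qN P q y by rewrite /qN; ring.
  by rewrite -!E; apply: H => //; exact: qcrit_opp.
by rewrite pmulr_rgt0// pmulr_rge0// => a0 ac aP x0; exact: qN_half.
Qed.

Lemma qN0 P q : qN P q 0 = 0. Proof. by rewrite /qN; ring. Qed.

Definition ismin D f V := (exists2 a, D a & f a = V) /\ forall b, D b -> V <= f b.

Lemma ismin_inj D f V V' : ismin D f V -> ismin D f V' -> V = V'.
Proof.
move=> [[a Da <-] H] [[b Db <-] H']; apply/le_anti.
by rewrite H// H'.
Qed.

Lemma ismin_scale f g V (r : R) c : r != 0 -> (forall a, g (r * a) = r ^+ 4 * f a) ->
  ismin (side c) f V -> ismin (side (r * c)) g (r ^+ 4 * V).
Proof.
move=> r0 gf [[a /= ca <-] H]; have r4 : 0 <= r ^+ 4 by rewrite -[4%N]/(2 * 2)%N exprM sqr_ge0.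
split.
  exists (r * a) => //; rewrite /side/=; have -> : r * c * (r * a) = r ^+ 2 * (c * a) by ring.
  by rewrite mulr_ge0// sqr_ge0.
move=> b; rewrite /side/= => cb; have -> : b = r * (b / r) by rewrite mulrC divfK.
rewrite gf ler_wpM2l//; apply: H; rewrite /side/=.
have -> : c * (b / r) = r * c * b / r ^+ 2 by field.
by rewrite divr_ge0// sqr_ge0.
Qed.

Lemma ismin_crit P q c a : 0 < c * a -> qcrit P q a -> 0 < 3 * a ^+ 2 + P ->
  ismin (side c) (qN P q) (qN P q a) /\ qN P q a < 0.
Proof.
move=> ca ac aP; split.
  by split=> [|b cb]; [exists a => //; exact: ltW|case: (qN_side ca ac aP cb)].
have := lt_leif (@qN_side P q c a 0 ca ac aP _); rewrite mulr0 lexx => /(_ isT).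
rewrite eq_sym; have -> : (a == 0) = false by apply: contraTF ca => /eqP->; rewrite mulr0 ltxx.
rewrite qN0.
by move=> ->.
Qed.

(** A negative value excludes 0 as minimizer, and at a nonzero point the linear term depends
    strictly on q. *)
Lemma ismin_lt P q q' c M M' : q < q' -> 0 < c -> ismin (side c) (qN P q) M -> ismin (side c) (qN P q') M' ->
  M' < 0 -> M < M'.
Proof.
move=> qq c0 [_ H] [[a]]; rewrite /side/= pmulr_rge0// => ca <- _ M0.
apply: (@le_lt_trans _ _ (qN P q a)); first by apply: H; rewrite /side/= pmulr_rge0.
have a0 : 0 < a.
  rewrite lt_neqAle ca andbT eq_sym; apply: contraTneq M0 => ->.
  by rewrite qN0 ltxx.
by rewrite /qN ltrD2l ltr_pM2r.
Qed.

Lemma ismin_gt P q q' c M M' : q < q' -> c < 0 -> ismin (side c) (qN P q) M -> ismin (side c) (qN P q') M' ->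
  M < 0 -> M' < M.
Proof.
move=> qq c0 [[a]]; rewrite /side/= nmulr_rge0// => ca <- _ [_ H] M0.
apply: (@le_lt_trans _ _ (qN P q' a)); first by apply: H; rewrite /side/= nmulr_rge0.
have a0 : a < 0.
  rewrite lt_neqAle ca andbT; apply: contraTneq M0 => ->.
  by rewrite qN0 ltxx.
by rewrite /qN ltrD2l ltr_nM2r.
Qed.

(** The gap between the two half-line minima has derivative A - B >= d in q. Here this is obtained
    without differentiating, by testing each minimum at the minimizer of the other parameter. It
    converts smallness of a gap difference into smallness of q - q'. *)
Lemma bal_lip P q q' A B A' B' (d : R) : 0 < d -> d <= A -> d <= A' -> B < 0 -> B' < 0 ->
  [/\ qcrit P q A, qcrit P q B, qcrit P q' A' & qcrit P q' B'] ->
  [/\ 0 < 3 * A ^+ 2 + P, 0 < 3 * B ^+ 2 + P, 0 < 3 * A' ^+ 2 + P & 0 < 3 * B' ^+ 2 + P] ->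
  d * `|q - q'| <= `|(qN P q A - qN P q B) - (qN P q' A' - qN P q' B')|.
Proof.
move=> d0; wlog qq : q q' A B A' B' / q <= q'.
  move=> W dA dA' B0 B0' [c1 c2 c3 c4] [p1 p2 p3 p4].
  have [qq|/ltW qq] := leP q q'; first exact: W.
  by rewrite distrC [leRHS]distrC; apply: W.
move=> dA dA' B0 B0' [c1 c2 c3 c4] [p1 p2 p3 p4].
have h1 : qN P q A <= qN P q A'.
  by have [] := @qN_side P q 1 A A' ltac:(by rewrite mul1r (lt_le_trans d0)) c1 p1 ltac:(by rewrite mul1r (le_trans (ltW d0))).
have h2 : qN P q' B' <= qN P q' B.
  by have [] := @qN_side P q' (-1) B' B ltac:(by rewrite mulN1r oppr_gt0) c4 p4 ltac:(by rewrite mulN1r oppr_ge0 ltW).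
have e1 : qN P q A' = qN P q' A' - (q' - q) * A' by rewrite /qN; ring.
have e2 : qN P q' B = qN P q B + (q' - q) * B by rewrite /qN; ring.
rewrite distrC [leRHS]distrC ger0_norm ?subr_ge0//; apply: le_trans (ler_norm _).
have : (q' - q) * (d - B) <= (q' - q) * (A' - B) by rewrite ler_wpM2l ?subr_ge0// lerD2r.
have : 0 <= (q' - q) * - B by rewrite mulr_ge0 ?subr_ge0// oppr_ge0 ltW.
rewrite !mulrBr mulrN.
move: h1 h2; rewrite e1 e2; set x1 := qN _ _ _; set x2 := qN _ _ _; set x3 := qN _ _ _; set x4 := qN _ _ _.
rewrite [d * _]mulrC mulrBl; lra.
Qed.

End Sides.

Section CritBranch.
Variables (R : realType) (m : nat).
Implicit Types (P Q : 'rV[R]_m -> R) (z : 'rV[R]_m).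

Lemma pd_rsub0 (f : 'rV[R]_m -> R) w : pd (i0 m) (fun w => f (rsubmx w)) w = 0.
Proof.
rewrite -[RHS](pd_cst (i0 m) w (f (rsubmx w))).
have [|+ _] := @derive_quot _ _ _ _ (fun w => f (rsubmx w)) (fun _ : 'rV[R]_(1 + m) => f (rsubmx w)) w (ev R (i0 m)) w (ev R (i0 m)); last by [].
move=> t; congr f; apply/rowP => j; rewrite 2!mxE [X in X + _]mxE ev_coord [RHS]mxE.
by rewrite (_ : rshift 1 j == i0 m = false) ?mulr0 ?add0r//; apply/negbTE; rewrite eq_sym eq_lrshift.
Qed.

Lemma sm_rsub (f : 'rV[R]_m -> R) w : sm (rsubmx w) f -> sm w (fun w : 'rV[R]_(1 + m) => f (rsubmx w)).
Proof. by move=> fs; apply: (sm_comp (smv_rsub w)). Qed.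

Lemma crit_smooth P Q z0 a : sm z0 P -> sm z0 Q -> qcrit (P z0) (Q z0) a -> 6 * a ^+ 2 + P z0 != 0 ->
  exists A : 'rV[R]_m -> R, [/\ sm z0 A, A z0 = a & \forall z \near z0, qcrit (P z) (Q z) (A z)].
Proof.
move=> Ps Qs ac aP.
pose F (w : 'rV[R]_(1 + m)) := 4 * w ord0 (i0 m) ^+ 3 + 2 * P (rsubmx w) * w ord0 (i0 m) + Q (rsubmx w).
have rp t z : rsubmx (pt t z) = z :> 'rV[R]_m by exact: row_mxKr.
have Pr : sm (pt a z0) (fun w : 'rV[R]_(1 + m) => P (rsubmx w)) by apply: sm_rsub; rewrite rp.
have Qr : sm (pt a z0) (fun w : 'rV[R]_(1 + m) => Q (rsubmx w)) by apply: sm_rsub; rewrite rp.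
have c : sm (pt a z0) (fun w : 'rV[R]_(1 + m) => w ord0 (i0 m)) by exact: sm_coord.
have T1 : sm (pt a z0) (fun w : 'rV[R]_(1 + m) => 4 * w ord0 (i0 m) ^+ 3) by apply: smM; [exact: sm_cst|exact: smX].
have T2 : sm (pt a z0) (fun w : 'rV[R]_(1 + m) => 2 * P (rsubmx w)) by apply: smM; [exact: sm_cst|].
have T3 : sm (pt a z0) (fun w : 'rV[R]_(1 + m) => 2 * P (rsubmx w) * w ord0 (i0 m)) by exact: smM.
have Fs : sm (pt a z0) F by apply: smD => //; exact: smD.
have [||A [As A0 HA]] := implicit1 Fs.
- by rewrite /F pt_i0 rp.
- rewrite /F (pdD _ (smD T1 T3) Qr) (pdD _ T1 T3) (pdM _ T2 c) (pdZ _ _ Pr) (pdZ _ _ (smX 3 c)) (pdX _ 2 c).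
  rewrite !pd_rsub0 pd_coord eqxx pt_i0 rp.
  have -> : 4 * (3%:R * a ^+ 2 * 1%:R) + (2 * P z0 * 1%:R + a * (2 * 0)) + 0 = 2 * (6 * a ^+ 2 + P z0) by ring.
  by rewrite mulf_neq0// pnatr_eq0.
exists A; split=> //; move: HA; apply: filterS => z.
by rewrite /F pt_i0 rp.
Qed.

Lemma pd_crit_value P (A : 'rV[R]_(1 + m) -> R) w : sm (rsubmx w) P -> sm w A ->
  qcrit (P (rsubmx w)) (w ord0 (i0 m)) (A w) ->
  sm w (fun w => qN (P (rsubmx w)) (w ord0 (i0 m)) (A w)) /\
  pd (i0 m) (fun w => qN (P (rsubmx w)) (w ord0 (i0 m)) (A w)) w = A w.
Proof.
move=> Ps As ac; have Pr := sm_rsub Ps.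
have c : sm w (fun w : 'rV[R]_(1 + m) => w ord0 (i0 m)) by exact: sm_coord.
have A4 : sm w (fun w => A w ^+ 4) by exact: smX.
have A2 : sm w (fun w => A w ^+ 2) by exact: smX.
have PA : sm w (fun w => P (rsubmx w) * A w ^+ 2) by exact: smM.
have QA : sm w (fun w => w ord0 (i0 m) * A w) by exact: smM.
split; first by apply: smD => //; exact: smD.
rewrite /qN (pdD _ (smD A4 PA) QA) (pdD _ A4 PA) (pdM _ Pr A2) (pdM _ c As) (pdX _ 3 As) (pdX _ 1 As) pd_rsub0 pd_coord eqxx mulr1.
transitivity ((4 * A w ^+ 3 + 2 * P (rsubmx w) * A w + w ord0 (i0 m)) * pd (i0 m) A w + A w); first by ring.
by rewrite ac mul0r add0r.
Qed.

End CritBranch.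

Section Balance.
Variables (R : realType) (m : nat).
Implicit Types (P Q V : 'rV[R]_m -> R) (z : 'rV[R]_m).

(** The implicit function theorem in q: by the envelope rule the derivative of the gap in q is a -
    b, positive as the two points lie on opposite sides of 0. *)
Lemma balance P V z0 (Q0 a b : R) : sm z0 P -> sm z0 V -> qcrit (P z0) Q0 a -> qcrit (P z0) Q0 b ->
  0 < 3 * a ^+ 2 + P z0 -> 0 < 3 * b ^+ 2 + P z0 -> 0 < a -> b < 0 ->
  qN (P z0) Q0 a - qN (P z0) Q0 b = V z0 ->
  exists q A B : 'rV[R]_m -> R, [/\ sm z0 q, sm z0 A & sm z0 B] /\ [/\ q z0 = Q0, A z0 = a, B z0 = b &
    \forall z \near z0, [/\ qcrit (P z) (q z) (A z), qcrit (P z) (q z) (B z) &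
      qN (P z) (q z) (A z) - qN (P z) (q z) (B z) = V z]].
Proof.
move=> Ps Vs ac bc aP bP a0 b0 ab.
have rp t z : rsubmx (pt t z) = z :> 'rV[R]_m by exact: row_mxKr.
have Pr : sm (pt Q0 z0) (fun w : 'rV[R]_(1 + m) => P (rsubmx w)) by apply: sm_rsub; rewrite rp.
have Vr : sm (pt Q0 z0) (fun w : 'rV[R]_(1 + m) => V (rsubmx w)) by apply: sm_rsub; rewrite rp.
have c : sm (pt Q0 z0) (fun w : 'rV[R]_(1 + m) => w ord0 (i0 m)) by exact: sm_coord.
have br (u : R) : qcrit (P z0) Q0 u -> 0 < 3 * u ^+ 2 + P z0 ->
  exists A : 'rV[R]_(1 + m) -> R, [/\ sm (pt Q0 z0) A, A (pt Q0 z0) = u &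
    \forall w \near pt Q0 z0, qcrit (P (rsubmx w)) (w ord0 (i0 m)) (A w)].
  move=> uc uP; apply: (crit_smooth Pr c); rewrite ?rp ?pt_i0//.
  by apply: lt0r_neq0; apply: lt_le_trans uP _; rewrite lerD2r ler_wpM2r ?sqr_ge0// ler_nat.
have [A [As A0 HA]] := br _ ac aP; have [B [Bs B0 HB]] := br _ bc bP.
pose E (w : 'rV[R]_(1 + m)) := qN (P (rsubmx w)) (w ord0 (i0 m)) (A w) - qN (P (rsubmx w)) (w ord0 (i0 m)) (B w) - V (rsubmx w).
have Ps' : sm (rsubmx (pt Q0 z0)) P by rewrite rp.
have [s1 d1] := pd_crit_value Ps' As (nbhs_singleton HA).
have [s2 d2] := pd_crit_value Ps' Bs (nbhs_singleton HB).
have s12 : sm (pt Q0 z0) (fun w => qN (P (rsubmx w)) (w ord0 (i0 m)) (A w) - qN (P (rsubmx w)) (w ord0 (i0 m)) (B w)) by exact: smB.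
have [|||q [qs q0 Hq]] := @implicit1 _ _ E Q0 z0.
- exact: smB.
- by rewrite /E rp pt_i0 A0 B0 ab subrr.
- rewrite /E pdB// pdB// d1 d2 pd_rsub0 A0 B0 subr0 gt_eqF// subr_gt0.
  exact: lt_trans a0.
have ps : smv z0 (fun z => pt (q z) z) by exact: pt_smv.
exists q, (fun z => A (pt (q z) z)), (fun z => B (pt (q z) z)); split.
  by split=> //; apply: (comp_pt qs); rewrite q0.
split; rewrite ?q0//.
have nr (T : 'rV[R]_(1 + m) -> Prop) : (\forall w \near pt Q0 z0, T w) -> \forall z \near z0, T (pt (q z) z).
  by move=> H; apply: (@near_preim _ _ (fun z => pt (q z) z) z0 T (smv_cts ps)); rewrite q0.
move: (near_and (nr _ HA) (near_and (nr _ HB) Hq)); apply: filterS => z.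
by rewrite /E !rp !pt_i0 => -[h1 [h2 /eqP]]; rewrite subr_eq0 => /eqP h3; split.
Qed.

End Balance.

(** * Exact normal form *)

Section Outer.
Variable R : realType.

(** Equal gaps mean that the same branch wins in both minima. This is why balancing makes the
    difference of two functions with corners smooth. *)
Lemma min_shift (V W M N : R) : V - W = M - N -> Num.min V W - Num.min M N = V - M.
Proof. by move=> e; case: (leP V W) => v; case: (leP M N) => v'; move: e v v'; lra. Qed.

Lemma outer_arith (d b W P Q : R) : 0 < d -> d <= 1 -> d < `|b| -> b ^+ 4 / 16 <= W ->
  `|P| <= d ^+ 3 / 32 -> `|Q| <= d ^+ 3 / 32 -> 0 <= W + P * b ^+ 2 + Q * b.
Proof.
move=> d0 d1 db Wb; have t0 := lt_trans d0 db.
have e2 : b ^+ 2 = `|b| ^+ 2 by rewrite real_normK ?num_real.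
have e4 : b ^+ 4 = `|b| ^+ 4 by rewrite -[4%N]/(2 * 2)%N !exprM e2.
have d3 : d ^+ 3 <= `|b| ^+ 3 by rewrite lerXn2r ?nnegrE// ltW.
have d2 : d ^+ 3 <= `|b| ^+ 2.
  apply: (@le_trans _ _ (d ^+ 2)); first by rewrite exprS ler_piMl// exprn_ge0 ?ltW.
  by rewrite lerXn2r ?nnegrE// ltW.
rewrite e4 in Wb; move: Wb; set t := `|b| in t0 d3 d2 e2 *; move=> Wb P1 Q1.
have h2 : - (t ^+ 4 / 32) <= P * b ^+ 2.
  have : `|P * b ^+ 2| <= t ^+ 2 / 32 * t ^+ 2.
    have t2 : 0 <= t ^+ 2 by exact: sqr_ge0.
    rewrite normrM e2 [`|t ^+ 2|]ger0_norm//; apply: ler_wpM2r => //.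
    by apply: (le_trans P1); rewrite ler_pM2r ?invr_gt0.
  have -> : t ^+ 2 / 32 * t ^+ 2 = t ^+ 4 / 32 by field.
  by rewrite ler_norml => /andP[].
have h3 : - (t ^+ 4 / 32) <= Q * b.
  have : `|Q * b| <= t ^+ 3 / 32 * t.
    rewrite normrM; apply: ler_wpM2r; first exact: ltW.
    by apply: (le_trans Q1); rewrite ler_pM2r ?invr_gt0.
  have -> : t ^+ 3 / 32 * t = t ^+ 4 / 32 by field.
  by rewrite ler_norml => /andP[].
move: h2 h3 Wb; lra.
Qed.

End Outer.

Section Core.
Variables (R : realType) (m : nat) (ia i1 i2 : 'I_m) (r0 r1 : R).
Hypotheses (r1gt0 : 0 < r1) (r10 : r1 < r0) (r01 : r0 <= 1).
Hypotheses (a1 : ia != i1) (a2 : ia != i2) (n12 : i1 != i2).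
Implicit Types (f g : 'rV[R]_m -> R) (x y z : 'rV[R]_m) (k : nat).
Local Notation dom := (@dom R m).
Local Notation rho := (@rho R m i1 i2).
Local Notation bl := (@bl R m ia i1 i2).
Local Notation flat := (@flat R m ia).
Local Notation wsphere := (@wsphere R m i1 i2).
Local Notation mu_lt := (@mu_lt R m ia i1 i2).
Variable h : 'rV[R]_m -> R.
Hypotheses (hs : smU r0 h) (h_ge : forall x, dom r0 x -> 1 / 2 <= h x).
Hypothesis h_a0 : forall x, dom r0 x -> x ord0 ia = 0 -> h x = 1.
Variables (al be s kap : 'rV[R]_m -> R).
Hypotheses (als : smU r1 al) (bes : smU r1 be) (ss : smU r1 s) (kaps : smU r1 kap).
Hypotheses (ali : forall y, al (zc ia y) = al y) (bei : forall y, be (zc ia y) = be y)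
  (si : forall y, s (zc ia y) = s y).
Variable C0 : R.
Hypothesis near1 : forall x, dom r1 x -> [/\ `|al x - x ord0 i1 - kap x * x ord0 i2| <= C0 * rho x ^+ 2,
     `|be x - x ord0 i2| <= C0 * rho x ^+ 2 & `|s x| <= C0 * rho x ^+ 2].
Let G x := (x ord0 ia * h x) ^+ 4 + x ord0 i1 * x ord0 ia ^+ 2 + x ord0 i2 * x ord0 ia.
Hypothesis formal : forall n, exists U, exists2 C : R, 0 < C & smU r1 U /\ forall x, dom r1 x ->
     `|G x - (U x ^+ 4 + al x * U x ^+ 2 + be x * U x) - s x| <= C * rho x ^+ n /\
     `|U x - x ord0 ia * h x| <= C * rho x.

Definition sa (a : R) y : 'rV[R]_m := zc ia y + a *: ev R ia.

Let dl : R := r1 / 2.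
Let dl0 : 0 < dl. Proof. exact: divr_gt0. Qed.
Let dlr : dl < r1. Proof. by rewrite ltr_pdivrMr// mulr_natr mulr2n ltrDl. Qed.

Lemma saE a y j : sa a y ord0 j = if j == ia then a else y ord0 j.
Proof. by rewrite mxE zcE [X in _ + X]mxE ev_coord; case: eqP => _; rewrite ?mulr1 ?add0r ?mulr0 ?addr0. Qed.

Lemma sa_zc a y : sa a (zc ia y) = sa a y.
Proof. by apply/rowP => j; rewrite !saE zcE; case: (j == ia). Qed.

Lemma sa_dom a y (r : R) : `|a| < r -> `|y| < r -> dom r (sa a y).
Proof.
move=> ar yr; apply: norm_lt_coord; first exact: le_lt_trans ar.
by move=> j; rewrite saE; case: eqP => _ //; exact: le_lt_trans (coord_le _ _) yr.
Qed.

(* The cutoff makes the minimization over all real a homogeneous under the blow-up. *)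
Let h1 x := if `|x ord0 ia| <= dl then h x else 1.
Definition Gx (a : R) y : R := (a * h1 (sa a y)) ^+ 4 + y ord0 i1 * a ^+ 2 + y ord0 i2 * a.
(** [Gx] at the blown-up point and at r a, divided by r^4. This extends smoothly across r = 0, where
    it is the exact quartic with parameters P, Q. *)
Definition Fz (w : 'rV[R]_(1 + m)) : R :=
  let a := w ord0 (i0 m) in let z := rsubmx w in
  (a * h1 (sa (z ord0 ia * a) (bl z))) ^+ 4 + z ord0 i1 * a ^+ 2 + z ord0 i2 * a.

Lemma rsub_pt (a : R) z : rsubmx (pt a z) = z.
Proof. exact: row_mxKr. Qed.

Lemma FzE (a : R) z : Fz (pt a z) = (a * h1 (sa (z ord0 ia * a) (bl z))) ^+ 4 + z ord0 i1 * a ^+ 2 + z ord0 i2 * a.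
Proof. by rewrite /Fz pt_i0 rsub_pt. Qed.

Lemma Gx_bl (a : R) z : Gx (z ord0 ia * a) (bl z) = z ord0 ia ^+ 4 * Fz (pt a z).
Proof. by rewrite FzE /Gx; have [_ -> -> _] := blE a1 a2 n12 z; ring. Qed.

Let Kz z0 := [/\ z0 ord0 ia = 0, wsphere z0 & mu_lt dl z0].

Let bl_edge z0 : Kz z0 -> `|bl z0| < dl.
Proof.
move=> [za zs zm]; have [b0 b1 b2 b3] := blE a1 a2 n12 z0.
apply: norm_lt_coord => // j; have [->|ja] := eqVneq j ia; first by rewrite b0 normr0.
have [->|j1] := eqVneq j i1; first by rewrite b1 za exprS !mul0r normr0.
have [->|j2] := eqVneq j i2; first by rewrite b2 za exprS !mul0r normr0.
by rewrite b3//; exact: zm.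
Qed.

Let near_Kz z0 (e : R) : Kz z0 -> 0 < e -> \forall z \near z0,
  [/\ `|bl z| < dl, `|z ord0 ia| < e, `|z ord0 i1| <= 2 & `|z ord0 i2| <= 2].
Proof.
move=> K e0; have [za [s1 s2 _] _] := K.
have n1 : \forall z \near z0, `|bl z| < dl.
  have cb : {for z0, continuous bl} by apply: smv_cts; exact: bl_smv.
  apply: (@near_preim _ _ bl z0 (fun y => `|y| < dl) cb).
  have d : 0 < dl - `|bl z0| by rewrite subr_gt0 bl_edge.
  move: (near_normlt (bl z0) d); apply: filterS => y yd.
  by rewrite -(subrK (bl z0) y); apply: (le_lt_trans (ler_normD _ _)); rewrite -ltrBrDr.
have e1 : 0 < Num.min e 1 by rewrite lt_min e0 ltr01.
move: (near_and n1 (near_normlt z0 e1)); apply: filterS => z [bz]; rewrite lt_min => /andP[z1 z2].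
have cj j : `|z ord0 j - z0 ord0 j| <= `|z - z0| by have := coord_le (z - z0) j; rewrite !mxE.
split=> //.
- by have := le_lt_trans (cj ia) z1; rewrite za subr0.
- have := le_lt_trans (cj i1) z2; have := ler_normD (z ord0 i1 - z0 ord0 i1) (z0 ord0 i1); rewrite subrK; lra.
- have := le_lt_trans (cj i2) z2; have := ler_normD (z ord0 i2 - z0 ord0 i2) (z0 ord0 i2); rewrite subrK; lra.
Qed.

Let Fz_sm z0 (a : R) : Kz z0 -> sm (pt a z0) Fz.
Proof.
move=> K; have [za _ _] := K.
have rz : smv (pt a z0) (fun w : 'rV[R]_(1 + m) => rsubmx w) by exact: smv_rsub.
have sz j : sm (pt a z0) (fun w : 'rV[R]_(1 + m) => rsubmx w ord0 j) by exact: rz.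
have sa0 : sm (pt a z0) (fun w : 'rV[R]_(1 + m) => w ord0 (i0 m)) by exact: sm_coord.
pose pth (w : 'rV[R]_(1 + m)) := sa (rsubmx w ord0 ia * w ord0 (i0 m)) (bl (rsubmx w)).
have ps : smv (pt a z0) pth.
  move=> j; under eq_fun do rewrite /pth saE; case: (j == ia); first by apply: smM; [exact: sz|exact: sa0].
  have b1 : smv (rsubmx (pt a z0)) bl by exact: bl_smv.
  exact: (smv_comp rz b1 j).
have pE : pth (pt a z0) = sa 0 (bl z0) by rewrite /pth rsub_pt za mul0r.
have hp : sm (pt a z0) (fun w => h (pth w)).
  apply: (sm_comp ps); rewrite pE; apply: hs; apply: sa_dom; first by rewrite normr0 (lt_trans r1gt0).
  by apply: lt_trans (bl_edge K) _; exact: lt_trans dlr r10.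
have n : {near pt a z0, (fun w : 'rV[R]_(1 + m) => (w ord0 (i0 m) * h (pth w)) ^+ 4 + rsubmx w ord0 i1 * w ord0 (i0 m) ^+ 2
     + rsubmx w ord0 i2 * w ord0 (i0 m)) =1 Fz}.
  have sr : sm (pt a z0) (fun w : 'rV[R]_(1 + m) => rsubmx w ord0 ia * w ord0 (i0 m)) by exact: smM.
  have l1 : rsubmx (pt a z0) ord0 ia * pt a z0 ord0 (i0 m) < dl by rewrite rsub_pt za mul0r.
  have l2 : - dl < rsubmx (pt a z0) ord0 ia * pt a z0 ord0 (i0 m) by rewrite rsub_pt za mul0r oppr_lt0.
  move: (near_and (sm_lt sr l1) (sm_gt sr l2)); apply: filterS.
  by move=> w [w1 w2]; rewrite /Fz /h1 saE eqxx ler_norml (ltW w1) (ltW w2).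
apply: sm_ext n _.
by apply: smD; [apply: smD; [apply: smX|apply: smM => //; exact: smX]|]; exact: smM.
Qed.

Let Fz_edge z0 (a : R) : Kz z0 -> Fz (pt a z0) = qN (z0 ord0 i1) (z0 ord0 i2) a.
Proof.
move=> K; have [za _ _] := K; rewrite FzE za mul0r /h1 saE eqxx normr0 (ltW dl0) h_a0 ?mulr1 ?saE ?eqxx//.
apply: sa_dom; first by rewrite normr0 (lt_trans r1gt0).
by apply: lt_trans (bl_edge K) _; exact: lt_trans dlr r10.
Qed.

Let h1_ge (a : R) y : `|y| < dl -> 1 / 2 <= h1 (sa a y).
Proof.
move=> yd; rewrite /h1 saE eqxx; case: ifP => ad; last lra.
apply/h_ge/sa_dom; first exact: le_lt_trans ad (lt_trans dlr r10).
exact: lt_trans yd (lt_trans dlr r10).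
Qed.

Let quartic_low (a t : R) : 1 / 2 <= t -> a ^+ 4 / 16 <= (a * t) ^+ 4.
Proof.
move=> t1; have -> : a ^+ 4 / 16 = a ^+ 4 * (1 / 2) ^+ 4 by field.
rewrite [(a * t) ^+ 4]exprMn; apply: ler_wpM2l.
  by rewrite -[4%N]/(2 * 2)%N exprM sqr_ge0.
by apply: lerXn2r; rewrite ?nnegrE //; lra.
Qed.

Let F_branch z0 (D : set R) (a : R) : Kz z0 -> closed D -> (\forall a \near a, D a) ->
  qcrit (z0 ord0 i1) (z0 ord0 i2) a -> 0 < 6 * a ^+ 2 + z0 ord0 i1 ->
  (forall b, D b -> b != a -> qN (z0 ord0 i1) (z0 ord0 i2) a < qN (z0 ord0 i1) (z0 ord0 i2) b) ->
  exists A : 'rV[R]_m -> R, [/\ sm z0 A, A z0 = a & \forall z \near z0,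
    D (A z) /\ forall b, D b -> Fz (pt (A z) z) <= Fz (pt b z)].
Proof.
move=> K cD nD ac aP am.
pose V := Fz (pt a z0) + 1; pose M := 8 + `|V| + `|a|.
have [p1 p2] : pd (i0 m) Fz (pt a z0) = 0 /\ 0 < pd (i0 m) (pd (i0 m) Fz) (pt a z0).
  have [E1 E2] := @pd_quartic_line R m Fz _ _ a z0 (fun t => Fz_edge t K).
  rewrite E1 E2; split; first exact: ac.
  by rewrite (_ : _ + _ = 2 * (6 * a ^+ 2 + z0 ord0 i1)); [rewrite mulr_gt0|ring].
apply: (@min_branch _ _ Fz D a z0 M cD nD) => //.
- by move=> t _; exact: Fz_sm.
- by rewrite /M; have := normr_ge0 V; lra.
- by move=> b Db ba; rewrite !Fz_edge//; exact: am.
have Fa : sm z0 (fun z => Fz (pt a z)).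
  by apply: (@comp_pt _ _ Fz (fun=> a)); [exact: sm_cst|exact: Fz_sm].
have V1 : Fz (pt a z0) < V by rewrite /V ltrDl.
move: (near_and (sm_lt Fa V1) (near_Kz K (ltr01 : 0 < (1 : R)))); apply: filterS => z [zV [bz _ z1 z2]] b _ Mb.
apply: (le_trans (ltW zV)); rewrite FzE.
have := quartic_low b (h1_ge (z ord0 ia * b) bz); set W := (b * _) ^+ 4 => Wb.
exact: (coercive_arith Mb (normr_ge0 a) Wb z1 z2).
Qed.

Let rho_bl z : `|z ord0 ia| <= 1 -> `|z ord0 i1| <= 2 -> `|z ord0 i2| <= 2 -> rho (bl z) <= 2 * `|z ord0 ia| ^+ 2.
Proof.
move=> za z1 z2; have [_ b1 b2 _] := blE a1 a2 n12 z.
rewrite /Ideals.rho b1 b2 ge_max [`|_ * z ord0 i1|]normrM [`|_ * z ord0 i2|]normrM !normrX; apply/andP; split.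
  by rewrite mulrC ler_wpM2r// exprn_ge0.
have h23 : `|z ord0 ia| ^+ 3 <= `|z ord0 ia| ^+ 2 by rewrite [leLHS]exprS ler_piMl// exprn_ge0.
by rewrite [leRHS]mulrC; apply: ler_pM; rewrite ?exprn_ge0.
Qed.

(** The lifts of al, be, s divided by their weights r^2, r^3, r^4: the parameters of the comparison
    quartic in the rescaled problem. *)
Definition hats z0 (alh beh sh : 'rV[R]_m -> R) := [/\ [/\ sm z0 alh, sm z0 beh & sm z0 sh],
  alh z0 = z0 ord0 i1, beh z0 = z0 ord0 i2 & \forall z \near z0,
  [/\ al (bl z) = z ord0 ia ^+ 2 * alh z, be (bl z) = z ord0 ia ^+ 3 * beh z & s (bl z) = z ord0 ia ^+ 4 * sh z]].

(** Errors of size rho^2 lift to O(r^4), which covers all three weights. The linear term kap y_2 of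
    al has weight 3, one more than al, so it contributes a multiple of r and disappears at r = 0. *)
Let hats_exist z0 : Kz z0 -> exists alh beh sh, hats z0 alh beh sh.
Proof.
move=> K; have [za _ _] := K.
have db : dom r1 (bl z0) by apply: lt_trans (bl_edge K) dlr.
have cmp f : smU r1 f -> sm z0 (fun z => f (bl z)).
  by move=> fs; apply: (sm_comp (bl_smv ia i1 i2 z0)); exact: fs.
have sz j : sm z0 (fun z : 'rV[R]_m => z ord0 j) by exact: sm_coord.
have sk j k : sm z0 (fun z : 'rV[R]_m => z ord0 ia ^+ k * z ord0 j) by apply: smM; [exact: smX|exact: sz].
have F4 e : sm z0 e -> (\forall z \near z0, dom r1 (bl z) -> `|e z| <= C0 * rho (bl z) ^+ 2) ->
    exists2 f, sm z0 f & \forall z \near z0, e z = z ord0 ia ^+ 4 * f z.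
  move=> es eb; apply: (rfactor za es); exists (`|C0| * 4).
  move: (near_and eb (near_Kz K (ltr01 : 0 < (1 : R)))); apply: filterS => z [H [bz z0' z1 z2]] _.
  apply: (le_trans (H (lt_trans bz dlr))); apply: (@le_trans _ _ (`|C0| * rho (bl z) ^+ 2)).
    by rewrite ler_wpM2r ?exprn_ge0 ?rho_ge0// ler_norm.
  rewrite -mulrA ler_wpM2l//.
  have -> : 4 * `|z ord0 ia| ^+ 4 = (2 * `|z ord0 ia| ^+ 2) ^+ 2 by ring.
  by rewrite lerXn2r ?nnegrE ?rho_ge0 ?mulr_ge0 ?exprn_ge0//; exact: rho_bl (ltW z0') z1 z2.
have [||fa fas faE] := F4 (fun z => al (bl z) - z ord0 ia ^+ 2 * z ord0 i1 - kap (bl z) * (z ord0 ia ^+ 3 * z ord0 i2)).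
- exact: smB (smB (cmp _ als) (sk _ _)) (smM (cmp _ kaps) (sk _ _)).
- apply: filterE => z d; have [q _ _] := near1 d; have [_ b1 b2 _] := blE a1 a2 n12 z.
  by rewrite -b1 -b2.
have [||fb fbs fbE] := F4 (fun z => be (bl z) - z ord0 ia ^+ 3 * z ord0 i2).
- exact: smB (cmp _ bes) (sk _ _).
- apply: filterE => z d; have [_ q _] := near1 d; have [_ b1 b2 _] := blE a1 a2 n12 z.
  by rewrite -b2.
have [||fs fss fsE] := F4 (fun z => s (bl z)); first exact: cmp.
  by apply: filterE => z d; have [_ _ q] := near1 d.
exists (fun z => z ord0 i1 + z ord0 ia * (kap (bl z) * z ord0 i2) + z ord0 ia ^+ 2 * fa z).
exists (fun z => z ord0 i2 + z ord0 ia * fb z), fs; split.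
- split; last exact: fss.
    apply: smD; last by apply: smM => //; exact: smX.
    by apply: smD => //; apply: smM => //; apply: smM => //; exact: cmp.
  by apply: smD => //; exact: smM.
- by rewrite za expr0n/= !mul0r !addr0.
- by rewrite za mul0r addr0.
- move: (near_and faE (near_and fbE fsE)); apply: filterS => z [Ea [Eb Es]]; split; last exact: Es.
    have -> : al (bl z) = (al (bl z) - z ord0 ia ^+ 2 * z ord0 i1 - kap (bl z) * (z ord0 ia ^+ 3 * z ord0 i2)) +
      z ord0 ia ^+ 2 * z ord0 i1 + kap (bl z) * (z ord0 ia ^+ 3 * z ord0 i2) by ring.
    by rewrite Ea; ring.
  have -> : be (bl z) = (be (bl z) - z ord0 ia ^+ 3 * z ord0 i2) + z ord0 ia ^+ 3 * z ord0 i2 by ring.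
  by rewrite Eb; ring.
Qed.

Let qN_sm z0 (P Q A : 'rV[R]_m -> R) : sm z0 P -> sm z0 Q -> sm z0 A -> sm z0 (fun z => qN (P z) (Q z) (A z)).
Proof.
move=> Ps Qs As; apply: smD; last exact: smM.
by apply: smD; [exact: smX|apply: smM => //; exact: smX].
Qed.

(** In rescaled form U becomes nearly the identity: U - a h is O(rho) = O(r^2), small even after
    division by r, and h tends to 1 at r = 0. *)
Let U_approx z0 (U : 'rV[R]_m -> R) (C L e : R) : Kz z0 -> 0 < C -> 0 < L -> 0 < e ->
  (forall x, dom r1 x -> `|U x - x ord0 ia * h x| <= C * rho x) ->
  \forall z \near z0, (z : 'rV[R]_m) ord0 ia != 0 -> forall t : R, `|t| <= L ->
    `|z ord0 ia * t| <= dl /\ `|U (sa (z ord0 ia * t) (bl z)) / z ord0 ia - t| <= e.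
Proof.
move=> K C0' L0 e0 HU; have [za _ _] := K.
pose x0 := sa 0 (bl z0).
have d0 : dom r0 x0.
  apply: sa_dom; first by rewrite normr0 (lt_trans r1gt0).
  by apply: lt_trans (bl_edge K) _; exact: lt_trans dlr r10.
have hx0 : h x0 = 1 by rewrite h_a0// saE eqxx.
have eL : 0 < e / 2 / L by rewrite !divr_gt0.
have /near_radius[q q0 Hq] := dist_cts (sm_cts (hs d0)) eL.
have cb : {for z0, continuous bl} by apply: smv_cts; exact: bl_smv.
have nb : \forall z \near z0, `|bl z - bl z0| < q.
  by apply: (@near_preim _ _ bl z0 (fun y => `|y - bl z0| < q) cb); exact: near_normlt.
pose eta := Num.min 1 (Num.min (dl / L) (Num.min (q / 2 / L) (e / (4 * C)))).
have eta0 : 0 < eta by rewrite !lt_min ltr01 !divr_gt0// mulr_gt0.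
move: (near_and nb (near_Kz K eta0)); apply: filterS => z [bq [bz]].
rewrite !lt_min => /andP[r1' /andP[rL /andP[rq rC]]] z1 z2 rn t tL.
set r := z ord0 ia in r1' rL rq rC rn *.
have rt (u : R) : `|r| < u / L -> `|r * t| <= u.
  move=> rL'; rewrite normrM; apply: (@le_trans _ _ (`|r| * L)); first by rewrite ler_wpM2l.
  by rewrite -ler_pdivlMr// ltW.
have rtd := rt _ rL; split=> //.
pose x := sa (r * t) (bl z).
have dx : dom r1 x by apply: sa_dom; [exact: le_lt_trans rtd dlr|exact: lt_trans bz dlr].
have xq : `|x - x0| < q.
  apply: norm_lt_coord => // j; have -> : (x - x0) ord0 j = x ord0 j - x0 ord0 j by rewrite !mxE.
  rewrite !saE; case: (j == ia).
    by rewrite subr0; apply: le_lt_trans (rt _ rq) _; rewrite ltr_pdivrMr// mulr_natr mulr2n ltrDl.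
  by apply: le_lt_trans bq; have := coord_le (bl z - bl z0) j; rewrite !mxE.
have := Hq x xq; rewrite hx0 => hx.
have rp : 0 < `|r| by rewrite normr_gt0.
have xr : rho x <= 2 * `|r| ^+ 2.
  apply: le_trans (rho_bl (ltW r1') z1 z2).
  by rewrite /Ideals.rho !saE ![_ == ia]eq_sym (negPf a1) (negPf a2).
have := HU x dx; rewrite saE eqxx => u1.
have -> : U x / r - t = (U x - r * t * h x) / r - t * (1 - h x) by field.
apply: (le_trans (ler_normB _ _)); rewrite (splitr e) lerD//.
  rewrite normrM normfV ler_pdivrMr//; apply: (le_trans u1).
  apply: (@le_trans _ _ (C * (2 * `|r| ^+ 2))); first by rewrite ler_pM2l.
  rewrite (_ : C * (2 * `|r| ^+ 2) = (`|r| * (4 * C)) / 2 * `|r|); last by field.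
  rewrite ler_pM2r// ler_pM2r ?invr_gt0// -ler_pdivlMr ?mulr_gt0//; exact: ltW.
rewrite normrM; apply: (@le_trans _ _ (L * (e / 2 / L))); first by rewrite ler_pM.
by rewrite mulrC divfK// gt_eqF.
Qed.

Let sa_ivt (U : 'rV[R]_m -> R) (r : R) y (lo hi v : R) : lo <= hi ->
  (forall t, lo <= t <= hi -> sm (sa (r * t) y) U) ->
  U (sa (r * lo) y) / r <= v -> v <= U (sa (r * hi) y) / r ->
  exists2 t, lo <= t <= hi & U (sa (r * t) y) / r = v.
Proof.
move=> lh Us vl vh.
have [||t tI tv] := @IVT R (fun t => U (sa (r * t) y) / r) lo hi v lh.
- apply: continuous_in_subspaceT => t; rewrite inE/= in_itv/= => tI.
  apply: (@cvgMl R R); apply: (@continuous_comp _ _ _ (fun t => sa (r * t) y) U); last exact: sm_cts (Us t tI).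
  apply: row_cts => j.
  have -> : (fun t => sa (r * t) y ord0 j) = (fun t => if j == ia then r * t else y ord0 j).
    by apply/funext => u; rewrite saE.
  case: (j == ia); last exact: cvg_cst.
  by apply: cvgMr; exact: cvg_id.
- by rewrite ge_min vl /= le_max vh orbT.
- by exists t => //; move: tI; rewrite in_itv.
Qed.

(** With u t = U(r t)/r, the formal identity to order k + 4 gives Fz(t) - qN(u t) - sh = O(r^k), the
    4 compensating the division by r^4. The minimizer A, transported to u(A), bounds the quartic
    minimum from above; conversely a t with u t = B bounds the minimum of Fz. Replacing beh by q
    costs a flat error only. *)
Let FL z0 (D : set R) (a : R) (alh beh sh q A B : 'rV[R]_m -> R) : Kz z0 -> (\forall a \near a, D a) ->
  hats z0 alh beh sh -> sm z0 q -> flat (fun z => q z - beh z) z0 ->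
  sm z0 A -> A z0 = a -> (\forall z \near z0, D (A z) /\ forall b, D b -> Fz (pt (A z) z) <= Fz (pt b z)) ->
  sm z0 B -> B z0 = a -> (\forall z \near z0, forall b, D b -> qN (alh z) (q z) (B z) <= qN (alh z) (q z) b) ->
  sm z0 (fun z => Fz (pt (A z) z) - qN (alh z) (q z) (B z) - sh z) /\
  flat (fun z => Fz (pt (A z) z) - qN (alh z) (q z) (B z) - sh z) z0.
Proof.
move=> K nD [[alhs behs shs] _ _ hE] qs qf As A0 AD Bs B0 BD; have [za _ _] := K.
have Es : sm z0 (fun z => Fz (pt (A z) z) - qN (alh z) (q z) (B z) - sh z).
  apply: smB; last exact: shs.
  by apply: smB; [apply: (comp_pt As); exact: Fz_sm|exact: qN_sm].
split=> //; apply: flat_off => // k.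
have /nbhs_ballP[eta /= eta0 Heta] := nD.
(* All points used lie within 3 e of a: eta/4 keeps them in D, and 1/4 keeps them in the range |t|
   <= L = |a| + 1. *)
pose e := Num.min (eta / 4) (1 / 4); have e0 : 0 < e by rewrite lt_min !divr_gt0.
have e1 : e <= eta / 4 by rewrite ge_min lexx.
have e2 : e <= 1 / 4 by rewrite ge_min lexx orbT.
pose L := `|a| + 1; have L0 : 0 < L by rewrite ltr_wpDl.
have [U [C C0' [Us HU]]] := formal (k + 4).
have near_U := U_approx K C0' L0 e0 (fun x d => (HU x d).2).
have [Cq Hq] := qf k.
pose C' := C * 2 ^+ (k + 4).
exists (C' + `|Cq| * L).
have nA := near_cts_dist As e0; have nB := near_cts_dist Bs e0.
move: (near_and nA (near_and nB (near_and AD (near_and BD (near_and hE (near_and near_U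
  (near_and Hq (near_Kz K (ltr01 : 0 < (1 : R)))))))))).
apply: filterS => z [Az [Bz [[DA Amin] [Bmin [[alE beE sE] [HUz [qz [bz rz z1 z2]]]]]]]] rn.
rewrite A0 in Az; rewrite B0 in Bz.
set r := z ord0 ia in alE beE sE HUz qz rz rn *.
have rp : 0 < `|r| by rewrite normr_gt0.
pose u t := U (sa (r * t) (bl z)) / r.
have near_a t : `|a - t| <= 3 * e -> `|t| <= L /\ D t.
  move=> ht; split.
    have -> : t = a - (a - t) by ring.
    by rewrite (le_trans (ler_normB _ _))// lerD2l; move: ht e2; lra.
  by apply: Heta; rewrite -ball_normE/=; apply: le_lt_trans ht _; move: e1; lra.
have key t : `|t| <= L -> `|Fz (pt t z) - qN (alh z) (beh z) (u t) - sh z| <= C' * `|r| ^+ k.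
  move=> tL; have [rt _] := HUz rn t tL.
  pose x := sa (r * t) (bl z).
  have dx : dom r1 x by apply: sa_dom; [exact: le_lt_trans rt dlr|exact: lt_trans bz dlr].
  have [+ _] := HU x dx; rewrite -[al x]ali -[be x]bei -[s x]si.
  have xz : zc ia x = bl z.
    by apply/rowP => j; rewrite zcE saE; case: eqP => // ->; have [-> _ _ _] := blE a1 a2 n12 z.
  rewrite xz alE beE sE.
  have -> : G x = r ^+ 4 * Fz (pt t z).
    rewrite -Gx_bl /G /Gx -/x /h1 !saE eqxx rt ![_ == ia]eq_sym (negPf a1) (negPf a2).
    by [].
  have -> : U x = r * u t by rewrite /u mulrC divfK.
  have -> : r ^+ 4 * Fz (pt t z) - ((r * u t) ^+ 4 + r ^+ 2 * alh z * (r * u t) ^+ 2 + r ^+ 3 * beh z * (r * u t)) - r ^+ 4 * sh z =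
    r ^+ 4 * (Fz (pt t z) - qN (alh z) (beh z) (u t) - sh z) by rewrite /qN; ring.
  move=> H; have r4 : 0 < `|r| ^+ 4 by rewrite exprn_gt0.
  rewrite -(ler_pM2l r4) -normrX -normrM normrX; apply: (le_trans H).
  have xr : rho x <= 2 * `|r| ^+ 2.
    apply: le_trans (rho_bl (ltW rz) z1 z2).
    by rewrite /Ideals.rho !saE ![_ == ia]eq_sym (negPf a1) (negPf a2).
  apply: (@le_trans _ _ (C * (2 * `|r| ^+ 2) ^+ (k + 4))).
    by rewrite ler_pM2l// lerXn2r ?nnegrE ?rho_ge0// mulr_ge0// exprn_ge0.
  rewrite [(2 * _) ^+ _]exprMn /C'.
  have -> : `|r| ^+ 4 * (C * 2 ^+ (k + 4) * `|r| ^+ k) = C * (2 ^+ (k + 4) * `|r| ^+ (k + 4)).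
    by rewrite [`|r| ^+ (k + 4)]exprD; ring.
  rewrite ler_pM2l// ler_pM2l ?exprn_gt0//.
  by apply: lerXn2r; rewrite ?nnegrE ?exprn_ge0// expr2 ler_piMl// ltW.
have uA t : `|t| <= L -> `|u t - t| <= e by move=> tL; have [_] := HUz rn t tL.
have qdiff t : `|t| <= L -> `|qN (alh z) (q z) t - qN (alh z) (beh z) t| <= `|Cq| * L * `|r| ^+ k.
  move=> tL; have -> : qN (alh z) (q z) t - qN (alh z) (beh z) t = (q z - beh z) * t by rewrite /qN; ring.
  rewrite normrM mulrAC ler_pM//; apply: (le_trans qz).
  by rewrite ler_wpM2r ?exprn_ge0// ler_norm.
have rk : 0 <= `|r| ^+ k by rewrite exprn_ge0.
rewrite ler_norml mulrDl; apply/andP; split.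
  have [AL _] : `|A z| <= L /\ D (A z) by apply: near_a; apply: (le_trans (ltW Az)); move: e0; lra.
  have [uL uD] : `|u (A z)| <= L /\ D (u (A z)).
    apply: near_a; have -> : a - u (A z) = (a - A z) - (u (A z) - A z) by ring.
    by apply: (le_trans (ler_normB _ _)); have := uA _ AL; move: (ltW Az) e0; lra.
  have k1 := key _ AL; have k2 := qdiff _ uL; have k3 := Bmin _ uD.
  exact: (approx_low k1 k2 k3).
have in2 t : a - 2 * e <= t <= a + 2 * e -> `|a - t| <= 3 * e.
  by move=> /andP[h3 h4]; rewrite distrC ler_distl; apply/andP; split; move: h3 h4 e0; lra.
(* The intermediate value theorem between a - 2e and a + 2e, as u moves points by at most e and B z
   is within e of a; u need not be invertible. *)
have [t [t1 t2]] : exists t, `|a - t| <= 3 * e /\ u t = B z.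
  have ends : a - 2 * e <= a + 2 * e by move: e0; lra.
  have [lL _] : `|a - 2 * e| <= L /\ D (a - 2 * e) by apply/near_a/in2; rewrite lexx ends.
  have [hL _] : `|a + 2 * e| <= L /\ D (a + 2 * e) by apply/near_a/in2; rewrite lexx ends.
  have [t tI tB] := sa_ivt ends (fun t tI => Us _ (sa_dom (le_lt_trans (HUz rn t (near_a t (in2 t tI)).1).1 dlr) (lt_trans bz dlr)))
    (ivt_low (uA _ lL) Bz) (ivt_up (uA _ hL) Bz).
  by exists t; split; [exact: in2|exact: tB].
have [tL tD] := near_a _ t1.
have k1 := key _ tL; have k2 := Amin _ tD.
have BL : `|B z| <= L by have [] : `|B z| <= L /\ D (B z) by apply: near_a; apply: (le_trans (ltW Bz)); move: e0; lra.
have k3 := qdiff _ BL; rewrite t2 in k1.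
exact: (approx_up k2 k1 k3).
Qed.

Let Dside (z0 : 'rV[R]_m) (c a : R) : Kz z0 -> 0 < c * a -> qcrit (z0 ord0 i1) (z0 ord0 i2) a -> 0 < 3 * a ^+ 2 + z0 ord0 i1 ->
  exists A : 'rV[R]_m -> R, [/\ sm z0 A, A z0 = a & \forall z \near z0,
    side c (A z) /\ forall b, side c b -> Fz (pt (A z) z) <= Fz (pt b z)].
Proof.
move=> K ca ac aP; apply: (@F_branch z0 (side c) a K (@side_closed R c) (side_near ca) ac).
  by apply: lt_le_trans aP _; rewrite lerD2r ler_wpM2r ?sqr_ge0// ler_nat.
by move=> b cb /negPf ba; rewrite (lt_leif (qN_side ca ac aP cb)) ba.
Qed.

(** The quartic with linear coefficient q has the same gap between its two half-line minima as [Gx].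
    Negativity of its minima makes that gap strictly increasing in q, so q is unique and local
    smooth choices agree. *)
Definition balanced y (q : R) := exists Vp Vm Mp Mm : R,
  [/\ ismin (side 1) (fun a => Gx a y) Vp, ismin (side (-1)) (fun a => Gx a y) Vm,
      ismin (side 1) (qN (al y) q) Mp, ismin (side (-1)) (qN (al y) q) Mm &
      [/\ Mp < 0, Mm < 0 & Vp - Vm = Mp - Mm]].

Lemma balanced_inj y (q q' : R) : balanced y q -> balanced y q' -> q = q'.
Proof.
wlog qq : q q' / q <= q'.
  by move=> W; have [|/ltW] := leP q q'; [exact: W|move=> j1 h2 h3; rewrite (W q' q)].
move=> [Vp [Vm [Mp [Mm [j1 h2 h3 h4 [n1 n2 e]]]]]] [Vp' [Vm' [Mp' [Mm' [j1' h2' h3' h4' [n1' n2' e']]]]]].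
move: qq; rewrite le_eqVlt => /orP[/eqP //|qq]; exfalso.
rewrite -(ismin_inj j1 j1') -(ismin_inj h2 h2') e in e'.
have u1 := ismin_lt qq ltr01 h3 h3' n1'.
have u2 := ismin_gt qq (ltrN10 R) h4 h4' n2.
by move: e' u1 u2; lra.
Qed.

Let bal_bl z (P q Vp Vm Mp Mm : R) : z ord0 ia != 0 -> al (bl z) = z ord0 ia ^+ 2 * P ->
  ismin (side 1) (fun a => Fz (pt a z)) Vp -> ismin (side (-1)) (fun a => Fz (pt a z)) Vm ->
  ismin (side 1) (qN P q) Mp -> ismin (side (-1)) (qN P q) Mm -> Mp < 0 -> Mm < 0 -> Vp - Vm = Mp - Mm ->
  balanced (bl z) (z ord0 ia ^+ 3 * q).
Proof.
move=> rn alE j1 h2 h3 h4 n1 n2 e; set r := z ord0 ia in rn alE *.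
have GF a : Gx (r * a) (bl z) = r ^+ 4 * Fz (pt a z) by exact: Gx_bl.
have NF a : qN (al (bl z)) (r ^+ 3 * q) (r * a) = r ^+ 4 * qN P q a by rewrite alE /qN; ring.
have k1 := @ismin_scale _ _ (fun a => Gx a (bl z)) _ _ _ rn GF j1; have k2 := @ismin_scale _ _ (fun a => Gx a (bl z)) _ _ _ rn GF h2.
have k3 := ismin_scale rn NF h3; have k4 := ismin_scale rn NF h4.
have r4 : 0 < r ^+ 4 by rewrite -[4%N]/(2 * 2)%N exprM exprn_even_gt0// sqrf_eq0.
have [rp|rp|rp] := ltgtP r 0; last by rewrite rp eqxx in rn.
  (* A negative radius exchanges the two half lines, hence the exchanged witnesses. *)
  rewrite !(side_opp _ rp) opprK in k1 k2 k3 k4.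
  exists (r ^+ 4 * Vm), (r ^+ 4 * Vp), (r ^+ 4 * Mm), (r ^+ 4 * Mp); split=> //; split; rewrite ?pmulr_rlt0//.
  by rewrite -!mulrBr -[Vm - Vp]opprB e opprB.
rewrite !(side_scale _ rp) in k1 k2 k3 k4.
exists (r ^+ 4 * Vp), (r ^+ 4 * Vm), (r ^+ 4 * Mp), (r ^+ 4 * Mm); split=> //; split; rewrite ?pmulr_rlt0//.
by rewrite -!mulrBr e.
Qed.

Let crit_value_side z0 (P Q A : 'rV[R]_m -> R) (c : R) : sm z0 P -> sm z0 A -> 0 < c * A z0 -> 0 < 3 * A z0 ^+ 2 + P z0 ->
  (\forall z \near z0, qcrit (P z) (Q z) (A z)) ->
  \forall z \near z0, [/\ 0 < c * A z, qcrit (P z) (Q z) (A z) & 0 < 3 * A z ^+ 2 + P z].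
Proof.
move=> Ps As ca aP cr.
have s1 : sm z0 (fun z => c * A z) by apply: smM => //; exact: sm_cst.
have s2 : sm z0 (fun z => 3 * A z ^+ 2 + P z) by apply: smD => //; apply: smM; [exact: sm_cst|exact: smX].
by move: (near_and (sm_gt s1 ca) (near_and (sm_gt s2 aP) cr)); apply: filterS => z [? [? ?]].
Qed.

Let half_pair z0 : z0 ord0 i1 < 0 -> 27 * z0 ord0 i2 ^+ 2 < 4 * (- z0 ord0 i1) ^+ 3 ->
  exists a b, [/\ 0 < a, qcrit (z0 ord0 i1) (z0 ord0 i2) a & 0 < 3 * a ^+ 2 + z0 ord0 i1] /\
    [/\ b < 0, qcrit (z0 ord0 i1) (z0 ord0 i2) b & 0 < 3 * b ^+ 2 + z0 ord0 i1].
Proof.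
move=> P0 PQ; have [a [a0 ac aP]] := half_exists P0 PQ.
have [|b [b0 bc bP]] := @half_exists R (z0 ord0 i1) (- z0 ord0 i2) P0; first by rewrite sqrrN.
exists a, (- b); split=> //; rewrite oppr_lt0 sqrrN; split=> //.
by have := qcrit_opp bc; rewrite opprK.
Qed.

(** By [FL] taken with q = beh on both half lines, the gap of Fz is that of the quartic at beh up to
    a flat error; at q the two gaps agree, and [bal_lip] turns this into flatness of q - beh. *)
Let bal_flat z0 (alh beh sh q A B Ap Am : 'rV[R]_m -> R) (a b : R) : Kz z0 -> hats z0 alh beh sh ->
  [/\ 0 < a, qcrit (z0 ord0 i1) (z0 ord0 i2) a & 0 < 3 * a ^+ 2 + z0 ord0 i1] ->
  [/\ b < 0, qcrit (z0 ord0 i1) (z0 ord0 i2) b & 0 < 3 * b ^+ 2 + z0 ord0 i1] ->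
  sm z0 Ap -> Ap z0 = a ->
  (\forall z \near z0, side 1 (Ap z) /\ forall b, side 1 b -> Fz (pt (Ap z) z) <= Fz (pt b z)) ->
  sm z0 Am -> Am z0 = b ->
  (\forall z \near z0, side (-1) (Am z) /\ forall b, side (-1) b -> Fz (pt (Am z) z) <= Fz (pt b z)) ->
  sm z0 A -> A z0 = a -> sm z0 B -> B z0 = b ->
  (\forall z \near z0, [/\ qcrit (alh z) (q z) (A z), qcrit (alh z) (q z) (B z) &
     qN (alh z) (q z) (A z) - qN (alh z) (q z) (B z) = Fz (pt (Ap z) z) - Fz (pt (Am z) z)]) ->
  flat (fun z => q z - beh z) z0.
Proof.
move=> K hh [a0 ac aP] [b0 bc bP] Aps Ap0 Apm Ams Am0 Amm As A0 Bs B0 bal.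
have [[alhs behs shs] al0 be0 _] := hh.
have six u : 0 < 3 * u ^+ 2 + z0 ord0 i1 -> 6 * u ^+ 2 + z0 ord0 i1 != 0.
  by move=> h3; apply: lt0r_neq0; apply: lt_le_trans h3 _; rewrite lerD2r ler_wpM2r ?sqr_ge0// ler_nat.
have f0 : flat (fun z => beh z - beh z) z0.
  by move=> k; exists 0; apply: filterE => z; rewrite subrr normr0 mul0r.
have ca : 0 < 1 * a by rewrite mul1r.
have cb : 0 < (-1) * b by rewrite mulN1r oppr_gt0.
have br (c u : R) : 0 < c * u -> qcrit (z0 ord0 i1) (z0 ord0 i2) u -> 0 < 3 * u ^+ 2 + z0 ord0 i1 ->
    exists W : 'rV[R]_m -> R, [/\ sm z0 W, W z0 = u &
      \forall z \near z0, [/\ 0 < c * W z, qcrit (alh z) (beh z) (W z) & 0 < 3 * W z ^+ 2 + alh z]].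
  move=> cu uc uP; have [||W [Ws W0 Wc]] := @crit_smooth R m alh beh z0 u alhs behs; rewrite ?al0 ?be0//; first exact: six.
  by exists W; split=> //; apply: crit_value_side; rewrite ?W0 ?al0.
have [W1 [W1s W10 W1c]] := br _ _ ca ac aP; have [W2 [W2s W20 W2c]] := br _ _ cb bc bP.
have mn c (W : 'rV[R]_m -> R) : (\forall z \near z0, [/\ 0 < c * W z, qcrit (alh z) (beh z) (W z) & 0 < 3 * W z ^+ 2 + alh z]) ->
    \forall z \near z0, forall b, side c b -> qN (alh z) (beh z) (W z) <= qN (alh z) (beh z) b.
  by apply: filterS => z [j1 h2 h3] t ct; case: (qN_side j1 h2 h3 ct).
have [_ F1] := FL K (side_near ca) hh behs f0 Aps Ap0 Apm W1s W10 (mn _ _ W1c).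
have [_ F2] := FL K (side_near cb) hh behs f0 Ams Am0 Amm W2s W20 (mn _ _ W2c).
have A1 : \forall z \near z0, [/\ 0 < 1 * A z, qcrit (alh z) (q z) (A z) & 0 < 3 * A z ^+ 2 + alh z].
  by apply: crit_value_side; rewrite ?A0 ?al0//; move: bal; apply: filterS => z [].
have B1 : \forall z \near z0, [/\ 0 < (-1) * B z, qcrit (alh z) (q z) (B z) & 0 < 3 * B z ^+ 2 + alh z].
  by apply: crit_value_side; rewrite ?B0 ?al0//; move: bal; apply: filterS => z [].
have a2' : a / 2 < a by rewrite ltr_pdivrMr// mulr_natr mulr2n ltrDl.
have gA : \forall z \near z0, a / 2 < A z by apply: sm_gt => //; rewrite A0.
have gW : \forall z \near z0, a / 2 < W1 z by apply: sm_gt => //; rewrite W10.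
move=> k; have [C1 H1] := F1 k; have [C2 H2] := F2 k.
exists ((C1 + C2) / (a / 2)).
move: (near_and H1 (near_and H2 (near_and A1 (near_and B1 (near_and gA (near_and gW (near_and bal (near_and W1c W2c)))))))).
apply: filterS => z [k1 [k2 [[_ c1 p1] [[nB c2 p2] [g1 [g2 [[_ _ bz] [[_ c3 p3] [nW c4 p4]]]]]]]]].
rewrite mulN1r oppr_gt0 in nB; rewrite mulN1r oppr_gt0 in nW.
have a20 : 0 < a / 2 by exact: divr_gt0.
have L := bal_lip a20 (ltW g1) (ltW g2) nB nW (And4 c1 c2 c3 c4) (And4 p1 p2 p3 p4).
rewrite mulrAC ler_pdivlMr// mulrC; apply: (le_trans L); rewrite bz.
move: k1 k2; set x1 := Fz _; set x2 := Fz _; set x3 := qN _ _ _; set x4 := qN _ _ _ => k1 k2.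
have -> : x1 - x2 - (x3 - x4) = (x1 - x3 - sh z) - (x2 - x4 - sh z) by ring.
by rewrite mulrDl; apply: (le_trans (ler_normB _ _)); exact: lerD.
Qed.

(** One excess X serves both half lines, since the balance makes Vm - Mm equal to Vp - Mp. *)
Let half_data z0 (alh beh sh : 'rV[R]_m -> R) : Kz z0 -> hats z0 alh beh sh ->
  z0 ord0 i1 < 0 -> 27 * z0 ord0 i2 ^+ 2 < 4 * (- z0 ord0 i1) ^+ 3 ->
  exists q X : 'rV[R]_m -> R, [/\ sm z0 q, sm z0 X, flat (fun z => q z - beh z) z0, flat X z0 &
    \forall z \near z0, exists Vp Vm Mp Mm : R,
      [/\ ismin (side 1) (fun a => Fz (pt a z)) Vp, ismin (side (-1)) (fun a => Fz (pt a z)) Vm,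
      ismin (side 1) (qN (alh z) (q z)) Mp, ismin (side (-1)) (qN (alh z) (q z)) Mm &
      [/\ Mp < 0, Mm < 0, Vp - Vm = Mp - Mm & X z = Vp - Mp - sh z]]].
Proof.
move=> K hh P0 PQ; have [[alhs behs shs] al0 be0 _] := hh.
have [a [b [[a0 ac aP] [b0 bc bP]]]] := half_pair P0 PQ.
have ca : 0 < 1 * a by rewrite mul1r.
have cb : 0 < (-1) * b by rewrite mulN1r oppr_gt0.
have [Ap [Aps Ap0 Apm]] := Dside K ca ac aP; have [Am [Ams Am0 Amm]] := Dside K cb bc bP.
have [||||||||q [A [B [[qs As Bs] [q0 A0 B0 bal]]]]] := @balance R m alh (fun z => Fz (pt (Ap z) z) - Fz (pt (Am z) z)) z0 (z0 ord0 i2) a b alhs; rewrite ?al0//.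
- by apply: smB; [apply: (comp_pt Aps)|apply: (comp_pt Ams)]; exact: Fz_sm.
- by rewrite Ap0 Am0 !Fz_edge.
have qf : flat (fun z => q z - beh z) z0.
  exact: (bal_flat K hh (And3 a0 ac aP) (And3 b0 bc bP) Aps Ap0 Apm Ams Am0 Amm As A0 Bs B0 bal).
have A1 : \forall z \near z0, [/\ 0 < 1 * A z, qcrit (alh z) (q z) (A z) & 0 < 3 * A z ^+ 2 + alh z].
  by apply: crit_value_side; rewrite ?A0 ?al0//; move: bal; apply: filterS => z [].
have B1 : \forall z \near z0, [/\ 0 < (-1) * B z, qcrit (alh z) (q z) (B z) & 0 < 3 * B z ^+ 2 + alh z].
  by apply: crit_value_side; rewrite ?B0 ?al0//; move: bal; apply: filterS => z [].
have [|Xs Xf] := FL K (side_near ca) hh qs qf Aps Ap0 Apm As A0.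
  by move: A1; apply: filterS => z [j1 h2 h3] t ct; case: (qN_side j1 h2 h3 ct).
exists q, (fun z => Fz (pt (Ap z) z) - qN (alh z) (q z) (A z) - sh z); split=> //.
move: (near_and A1 (near_and B1 (near_and bal (near_and Apm Amm)))); apply: filterS.
move=> z [[j1 h2 h3] [[h4 h5 h6] [[_ _ e] [[h7 h8] [h9 h10]]]]].
have [m1 n1] := ismin_crit j1 h2 h3; have [m2 n2] := ismin_crit h4 h5 h6.
exists (Fz (pt (Ap z) z)), (Fz (pt (Am z) z)), (qN (alh z) (q z) (A z)), (qN (alh z) (q z) (B z)).
by split=> //; split=> //; [exists (Ap z)|exists (Am z)].
Qed.

Let flat_mul z0 c f : sm z0 c -> flat f z0 -> flat (fun z => c z * f z) z0.
Proof.
move=> cs ff k; have [C HC] := ff k.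
exists ((`|c z0| + 1) * `|C|).
move: (near_and (near_cts_dist cs (ltr01 : 0 < (1 : R))) HC); apply: filterS => z [cz fz].
rewrite normrM -mulrA ler_pM//.
  have := ler_normB (c z0) (c z0 - c z); rewrite subKr; move: (ltW cz); lra.
by apply: (le_trans fz); rewrite ler_wpM2r ?exprn_ge0// ler_norm.
Qed.

Let flat_ext z0 f g : {near z0, f =1 g} -> flat f z0 -> flat g z0.
Proof.
by move=> fg ff k; have [C HC] := ff k; exists C; move: (near_and fg HC); apply: filterS => z [<-].
Qed.

(* Cuts off to the sector where the minima over both half lines are interior. *)
Definition chi y : R := if 27 * y ord0 i2 ^+ 2 < 3 * (- y ord0 i1) ^+ 3
  then step (27 * y ord0 i2 ^+ 2 / (- y ord0 i1) ^+ 3) else 0.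
(** The correction taking be to the balancing value near the Maxwell half line and fading out away
    from it. [xget] selects the balancing value pointwise; its uniqueness identifies this choice
    with the smooth local one. *)
Definition e1 y := chi y * (xget 0 [set q : R | balanced y q] - be y).
Definition phi y : R := inf [set Gx a y | a in setT].
Definition e2 y := phi y - qmin (al y) (be y + e1 y) - s y.

Let zc1 y : zc ia y ord0 i1 = y ord0 i1. Proof. by rewrite zcE eq_sym (negPf a1). Qed.
Let zc2 y : zc ia y ord0 i2 = y ord0 i2. Proof. by rewrite zcE eq_sym (negPf a2). Qed.

Let Gx_zc y : (fun a => Gx a (zc ia y)) = (fun a => Gx a y).
Proof. by apply/funext => a; rewrite /Gx sa_zc zc1 zc2. Qed.

Let e1_zc y : e1 (zc ia y) = e1 y.
Proof. by rewrite /e1 /chi /balanced zc1 zc2 bei ali Gx_zc. Qed.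

Let e2_zc y : e2 (zc ia y) = e2 y.
Proof. by rewrite /e2 /phi e1_zc bei ali si Gx_zc. Qed.

Let chi_bl z : z ord0 ia != 0 -> chi (bl z) = if 27 * z ord0 i2 ^+ 2 < 3 * (- z ord0 i1) ^+ 3
  then step (27 * z ord0 i2 ^+ 2 / (- z ord0 i1) ^+ 3) else 0.
Proof.
move=> rn; rewrite /chi; have [_ -> -> _] := blE a1 a2 n12 z.
set r := z ord0 ia in rn *; set P := z ord0 i1; set Q := z ord0 i2.
have r6 : 0 < r ^+ 6 by rewrite -[6%N]/(2 * 3)%N exprM exprn_gt0// exprn_even_gt0.
have -> : 27 * (r ^+ 3 * Q) ^+ 2 = r ^+ 6 * (27 * Q ^+ 2) by ring.
have -> : (- (r ^+ 2 * P)) ^+ 3 = r ^+ 6 * (- P) ^+ 3 by ring.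
have -> : 3 * (r ^+ 6 * (- P) ^+ 3) = r ^+ 6 * (3 * (- P) ^+ 3) by ring.
rewrite ltr_pM2l//; case: ifP => // _.
by rewrite -mulf_div divff ?mul1r// gt_eqF.
Qed.

Let chi_edge y : y ord0 i1 = 0 -> y ord0 i2 = 0 -> chi y = 0.
Proof. by move=> y1 y2; rewrite /chi y1 y2 oppr0 !expr0n/= !mulr0 ltxx. Qed.

Let bl0 z : z ord0 ia = 0 -> bl z ord0 i1 = 0 /\ bl z ord0 i2 = 0.
Proof. by move=> z0; have [_ -> -> _] := blE a1 a2 n12 z; rewrite z0 !expr0n/= !mul0r. Qed.

Let e2_edge y : y ord0 i1 = 0 -> y ord0 i2 = 0 -> `|zc ia y| < dl -> e2 y = 0.
Proof.
move=> y1 y2 yd; rewrite -e2_zc; set y' := zc ia y in yd *.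
have [y1' y2'] : y' ord0 i1 = 0 /\ y' ord0 i2 = 0 by rewrite /y' zc1 zc2.
have [] := near1 (lt_trans yd dlr : dom r1 y').
have -> : rho y' = 0 by rewrite /Ideals.rho y1' y2' normr0 maxxx.
rewrite y1' y2' expr0n/= !mulr0 !subr0 !normr_le0 => /eqP al0 /eqP be0 /eqP s0.
have p4 (u : R) : 0 <= u ^+ 4 by rewrite -[4%N]/(2 * 2)%N exprM sqr_ge0.
have -> : e2 y' = phi y' - qmin 0 0 by rewrite /e2 al0 be0 s0 /e1 chi_edge// mul0r addr0 subr0.
rewrite /phi (@inf_attained _ setT (fun a => Gx a y') 0) //; last first.
  by move=> a _; rewrite /Gx y1' y2' !mul0r !addr0 expr0n.
rewrite /qmin (@inf_attained _ setT (fun u : R => u ^+ 4 + 0 * u ^+ 2 + 0 * u) 0) //; last first.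
  by move=> a _; rewrite !mul0r !addr0 expr0n.
by rewrite /Gx y1' y2' !mul0r !addr0 expr0n/= subrr.
Qed.

Let get_balanced y q : balanced y q -> xget 0 [set q : R | balanced y q] = q.
Proof.
move=> b; have B : balanced y (xget 0 [set q : R | balanced y q]).
  by apply: (@xgetPex _ 0 [set q : R | balanced y q]); exists q.
exact: balanced_inj B b.
Qed.

(** A point of the sphere outside the region with two interior minima is strictly beyond the ratio
    3, so the cutoff vanishes in a whole neighbourhood and the two local descriptions of [e1] fit
    together. *)
Let disc_lt z0 : wsphere z0 -> ~ (z0 ord0 i1 < 0 /\ 27 * z0 ord0 i2 ^+ 2 < 4 * (- z0 ord0 i1) ^+ 3) ->
  3 * (- z0 ord0 i1) ^+ 3 < 27 * z0 ord0 i2 ^+ 2.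
Proof.
move=> [_ _ w] H; have [P0|P0] := ltP (z0 ord0 i1) 0.
  have [|Q0] := ltP (27 * z0 ord0 i2 ^+ 2) (4 * (- z0 ord0 i1) ^+ 3); first by move=> Q0; case: H.
  apply: lt_le_trans Q0; rewrite ltr_pM2r ?ltr_nat//.
  by rewrite exprn_gt0// oppr_gt0.
have P3 : (- z0 ord0 i1) ^+ 3 = - (z0 ord0 i1 ^+ 3) by ring.
have p3 : 0 <= z0 ord0 i1 ^+ 3 by exact: exprn_ge0.
have q2 : 0 <= z0 ord0 i2 ^+ 2 by exact: sqr_ge0.
rewrite P3; case: w => [w|w].
  have : 0 < z0 ord0 i1 by rewrite lt_neqAle P0 andbT eq_sym -normr_gt0 w.
  by move=> /(exprn_gt0 3); lra.
have -> : z0 ord0 i2 ^+ 2 = 1 by rewrite -real_normK ?num_real// w expr1n.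
by lra.
Qed.

Let near_disc z0 (k l : R) : k * (- z0 ord0 i1) ^+ 3 < l * z0 ord0 i2 ^+ 2 ->
  \forall z \near z0, k * (- (z : 'rV[R]_m) ord0 i1) ^+ 3 < l * z ord0 i2 ^+ 2.
Proof.
move=> H.
have c j : sm z0 (fun z : 'rV[R]_m => z ord0 j) by exact: sm_coord.
have s1 : sm z0 (fun z : 'rV[R]_m => l * z ord0 i2 ^+ 2 - k * (- z ord0 i1) ^+ 3).
  by apply: smB; apply: smM; [exact: sm_cst|exact: smX|exact: sm_cst|apply: smX; exact: smN].
have : 0 < l * z0 ord0 i2 ^+ 2 - k * (- z0 ord0 i1) ^+ 3 by rewrite subr_gt0.
by move=> /(sm_gt s1); apply: filterS => z; rewrite subr_gt0.
Qed.

Let e1_out z0 : Kz z0 -> ~ (z0 ord0 i1 < 0 /\ 27 * z0 ord0 i2 ^+ 2 < 4 * (- z0 ord0 i1) ^+ 3) ->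
  \forall z \near z0, e1 (bl z) = 0.
Proof.
move=> [za zs _] H; move: (near_disc (disc_lt zs H)); apply: filterS => z zd.
rewrite /e1; have [z0'|zn] := eqVneq (z ord0 ia) 0.
  by have [b1 b2] := bl0 z0'; rewrite chi_edge// mul0r.
by rewrite chi_bl// ltNge (ltW zd) mul0r.
Qed.

Let step_sm z0 : z0 ord0 i1 < 0 ->
  sm z0 (fun z : 'rV[R]_m => step (27 * z ord0 i2 ^+ 2 / (- z ord0 i1) ^+ 3)).
Proof.
move=> P0; have c j : sm z0 (fun z : 'rV[R]_m => z ord0 j) by exact: sm_coord.
apply: sm_step; apply: smM; first by apply: smM; [exact: sm_cst|exact: smX].
by apply: smV; [rewrite expf_neq0// oppr_eq0 lt_eqF|apply: smX; exact: smN].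
Qed.

Let e1_in z0 (alh beh sh q X : 'rV[R]_m -> R) : Kz z0 -> hats z0 alh beh sh -> z0 ord0 i1 < 0 ->
  (\forall z \near z0, exists Vp Vm Mp Mm : R,
      [/\ ismin (side 1) (fun a => Fz (pt a z)) Vp, ismin (side (-1)) (fun a => Fz (pt a z)) Vm,
      ismin (side 1) (qN (alh z) (q z)) Mp, ismin (side (-1)) (qN (alh z) (q z)) Mm &
      [/\ Mp < 0, Mm < 0, Vp - Vm = Mp - Mm & X z = Vp - Mp - sh z]]) ->
  \forall z \near z0, e1 (bl z) =
    step (27 * z ord0 i2 ^+ 2 / (- z ord0 i1) ^+ 3) * (z ord0 ia ^+ 3 * (q z - beh z)).
Proof.
move=> K [_ _ _ hE] P0 HB.
have c1 : sm z0 (fun z : 'rV[R]_m => z ord0 i1) by exact: sm_coord.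
move: (near_and HB (near_and hE (sm_lt c1 P0))); apply: filterS => z [[Vp [Vm [Mp [Mm [m1 m2 m3 m4 [n1 n2 e _]]]]]] [[alE beE _] zP]].
have [z0'|zn] := eqVneq (z ord0 ia) 0.
  by have [b1 b2] := bl0 z0'; rewrite /e1 chi_edge// !mul0r z0' expr0n/= !mul0r mulr0.
have B := bal_bl zn alE m1 m2 m3 m4 n1 n2 e.
rewrite /e1 (get_balanced B) beE -mulrBr chi_bl//; case: ltP => // zd.
rewrite step_eq0// ler_pdivlMr//; first by rewrite exprn_gt0// oppr_gt0.
Qed.

Let e1_bl z0 : Kz z0 -> sm z0 (e1 \o bl) /\ flat (e1 \o bl) z0.
Proof.
move=> K; have [za zs _] := K.
have [[P0 PQ]|H] := pselect (z0 ord0 i1 < 0 /\ 27 * z0 ord0 i2 ^+ 2 < 4 * (- z0 ord0 i1) ^+ 3); last first.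
  have n := e1_out K H; split.
    by apply: (@sm_ext _ _ _ (fun=> 0)); [move: n; apply: filterS => z /= ->|exact: sm_cst].
  by move=> k; exists 0; move: n; apply: filterS => z /= ->; rewrite normr0 mul0r.
have [alh [beh [sh hh]]] := hats_exist K.
have [q [X [qs Xs qf Xf HB]]] := half_data K hh P0 PQ.
have [[alhs behs shs] al0 be0 _] := hh.
have n : {near z0, (fun z : 'rV[R]_m => step (27 * z ord0 i2 ^+ 2 / (- z ord0 i1) ^+ 3) * (z ord0 ia ^+ 3 * (q z - beh z))) =1 e1 \o bl}.
  by move: (e1_in K hh P0 HB); apply: filterS => z /= ->.
have zs3 : sm z0 (fun z : 'rV[R]_m => z ord0 ia ^+ 3) by apply: smX; exact: sm_coord.
split.
  apply: sm_ext n _; apply: smM; first exact: step_sm.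
  by apply: smM => //; exact: smB.
apply: flat_ext n _; apply: flat_mul; first exact: step_sm.
exact: flat_mul.
Qed.

Let inf_min (f g : R -> R) (V r : R) : r != 0 -> (forall a, g (r * a) = r ^+ 4 * f a) -> ismin setT f V ->
  inf [set g a | a in setT] = r ^+ 4 * V.
Proof.
move=> rn gf [[a _ <-] H]; rewrite -gf; apply: inf_attained => // b _.
have -> : b = r * (b / r) by rewrite mulrC divfK.
by rewrite !gf ler_wpM2l ?H// -[4%N]/(2 * 2)%N exprM sqr_ge0.
Qed.

Let sides_min (f : R -> R) (V W : R) : ismin (side 1) f V -> ismin (side (-1)) f W -> ismin setT f (Num.min V W).
Proof.
move=> [[a _ fa] H] [[b _ fb] H']; split.
  by case: leP => _; [exists a|exists b].
move=> t _; rewrite ge_min; have [t0|t0] := leP 0 t.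
  by rewrite H// /side/= mul1r.
by rewrite H' ?orbT// /side/= mulN1r oppr_ge0 ltW.
Qed.

Let e2_scale z (P q S V M : R) : z ord0 ia != 0 -> al (bl z) = z ord0 ia ^+ 2 * P ->
  be (bl z) + e1 (bl z) = z ord0 ia ^+ 3 * q -> s (bl z) = z ord0 ia ^+ 4 * S ->
  ismin setT (fun a => Fz (pt a z)) V -> ismin setT (qN P q) M -> e2 (bl z) = z ord0 ia ^+ 4 * (V - M - S).
Proof.
move=> rn alE beE sE mF mN; rewrite /e2 /phi /qmin beE alE sE.
have GF a : Gx (z ord0 ia * a) (bl z) = z ord0 ia ^+ 4 * Fz (pt a z) by exact: Gx_bl.
rewrite (@inf_min _ (fun a => Gx a (bl z)) _ _ rn GF mF) (@inf_min _ _ _ (z ord0 ia) rn _ mN); first by ring.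
by move=> a; rewrite /qN; ring.
Qed.

Let e2_bl0 z : z ord0 ia = 0 -> `|bl z| < dl -> e2 (bl z) = 0.
Proof.
move=> z0 bz; have [b1 b2] := bl0 z0; apply: e2_edge => //.
by rewrite zc_id//; have [-> _ _ _] := blE a1 a2 n12 z.
Qed.

Let e2_finish z0 (X : 'rV[R]_m -> R) : sm z0 X -> flat X z0 -> {near z0, (fun z => z ord0 ia ^+ 4 * X z) =1 e2 \o bl} ->
  sm z0 (e2 \o bl) /\ flat (e2 \o bl) z0.
Proof.
move=> Xs Xf n; have z4 : sm z0 (fun z : 'rV[R]_m => z ord0 ia ^+ 4) by apply: smX; exact: sm_coord.
by split; [apply: sm_ext n _; exact: smM|apply: flat_ext n _; exact: flat_mul].
Qed.

(** Here the cutoff is 1, so be + e1 is exactly balanced and [min_shift] reduces the difference of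
    the full minima to the flat smooth excess of one half line. *)
Let e2_in z0 : Kz z0 -> z0 ord0 i1 < 0 -> 27 * z0 ord0 i2 ^+ 2 < (- z0 ord0 i1) ^+ 3 ->
  sm z0 (e2 \o bl) /\ flat (e2 \o bl) z0.
Proof.
move=> K P0 PQ; have [za zs _] := K.
have PQ4 : 27 * z0 ord0 i2 ^+ 2 < 4 * (- z0 ord0 i1) ^+ 3.
  by apply: lt_trans PQ _; rewrite ltr_pMl ?ltr1n// exprn_gt0// oppr_gt0.
have [alh [beh [sh hh]]] := hats_exist K.
have [q [X [qs Xs qf Xf HB]]] := half_data K hh P0 PQ4.
have [_ _ _ hE] := hh.
apply: e2_finish Xs Xf _.
have c j : sm z0 (fun z : 'rV[R]_m => z ord0 j) by exact: sm_coord.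
have PQs : sm z0 (fun z : 'rV[R]_m => 27 * z ord0 i2 ^+ 2 - (- z ord0 i1) ^+ 3).
  by apply: smB; [apply: smM; [exact: sm_cst|exact: smX]|apply: smX; exact: smN].
have PQ0 : 27 * z0 ord0 i2 ^+ 2 - (- z0 ord0 i1) ^+ 3 < 0 by rewrite subr_lt0.
move: (near_and HB (near_and hE (near_and (e1_in K hh P0 HB) (near_and (sm_lt (c i1) P0)
  (near_and (sm_lt PQs PQ0) (near_Kz K (ltr01 : 0 < (1 : R)))))))); apply: filterS.
move=> z [[Vp [Vm [Mp [Mm [m1 m2 m3 m4 [n1 n2 e XE]]]]]] [[alE beE sE] [e1E [zP [zPQ [bz _ _ _]]]]]] /=.
have [z0'|zn] := eqVneq (z ord0 ia) 0; first by rewrite e2_bl0// z0' expr0n/= mul0r.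
rewrite subr_lt0 in zPQ.
have e1E' : be (bl z) + e1 (bl z) = z ord0 ia ^+ 3 * q z.
  rewrite e1E step_eq1 ?mul1r ?beE; last by rewrite ler_pdivrMr ?mul1r ?(ltW zPQ)// exprn_gt0// oppr_gt0.
  by ring.
rewrite (e2_scale zn alE e1E' sE (sides_min m1 m2) (sides_min m3 m4)) XE; congr (_ * (_ - _)).
by rewrite (min_shift e).
Qed.

(** Away from the Maxwell half line the quartic has a single nondegenerate global minimizer, so [FL]
    applies with D the whole line and q = beh + f, where f = e1 / r^3 is again flat, whatever the
    cutoff does. *)
Let e2_out z0 : Kz z0 -> ~ (z0 ord0 i1 < 0 /\ 27 * z0 ord0 i2 ^+ 2 < (- z0 ord0 i1) ^+ 3) ->
  sm z0 (e2 \o bl) /\ flat (e2 \o bl) z0.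
Proof.
move=> K H; have [za zs _] := K.
have PQ : 0 < z0 ord0 i1 \/ z0 ord0 i2 != 0.
  have [P0|P0|P0] := ltgtP (z0 ord0 i1) 0; [right|by left|right].
    apply/eqP => Q0; apply: H; split=> //.
    by rewrite Q0 expr0n/= mulr0 exprn_gt0// oppr_gt0.
  by case: zs => _ _ [|]; rewrite ?P0 -normr_gt0; [rewrite normr0 => /eqP; rewrite eq_sym oner_eq0|move=> ->].
have [a ac aP] := full_exists PQ.
have a6 : 0 < 6 * a ^+ 2 + z0 ord0 i1.
  by apply: lt_le_trans aP _; rewrite lerD2r ler_wpM2r ?sqr_ge0// ler_nat.
have cT : closed (setT : set R) by exact: closedT.
have nT : \forall a \near a, (setT : set R) a by apply: filterE.
have [|A [As A0 AD]] := F_branch K cT nT ac a6.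
  by move=> b _ /negPf ba; rewrite (lt_leif (qN_full b ac aP)) ba.
have [e1s e1f] := e1_bl K.
have [f fs fE] := flat_factor za e1s e1f 3.
have ff : flat f z0.
  apply: flat_off => // k; have [C HC] := e1f (k + 3)%N.
  exists C; move: (near_and fE HC); apply: filterS => z [fz]; rewrite fz => h3 zn.
  have r3 : 0 < `|z ord0 ia| ^+ 3 by rewrite exprn_gt0// normr_gt0.
  rewrite -(ler_pM2l r3); apply: (le_trans _ (le_trans h3 _)); first by rewrite normrM normrX.
  have -> : C * `|z ord0 ia| ^+ (k + 3) = `|z ord0 ia| ^+ 3 * (C * `|z ord0 ia| ^+ k); last by [].
  by rewrite exprD; ring.
have f0 : f z0 = 0.
  by have [C /nbhs_singleton] := ff 1%N; rewrite za normr0 expr1 mulr0 normr_le0 => /eqP.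
have [alh [beh [sh hh]]] := hats_exist K.
have [[alhs behs shs] al0 be0 hE] := hh.
pose q z := beh z + f z; have qs : sm z0 q by exact: smD.
have qf : flat (fun z => q z - beh z) z0.
  by apply: flat_ext ff; apply: filterE => z; rewrite /q addrAC subrr add0r.
have [||B [Bs B0 Bc]] := @crit_smooth R m alh q z0 a alhs qs.
- by rewrite /q al0 be0 f0 addr0.
- by rewrite al0 gt_eqF.
have BP : \forall z \near z0, 0 < 2 * B z ^+ 2 + alh z.
  apply: sm_gt; last by rewrite B0 al0.
  by apply: smD => //; apply: smM; [exact: sm_cst|exact: smX].
have Bm : \forall z \near z0, forall b, setT b -> qN (alh z) (q z) (B z) <= qN (alh z) (q z) b.
  by move: (near_and Bc BP); apply: filterS => z [h2 h3] b _; case: (qN_full b h2 h3).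
have [Xs Xf] := FL K nT hh qs qf As A0 AD Bs B0 Bm.
apply: e2_finish Xs Xf _.
move: (near_and AD (near_and Bm (near_and hE (near_and fE (near_Kz K (ltr01 : 0 < (1 : R))))))); apply: filterS.
move=> z [[_ Az] [Bz [[alE beE sE] [e1E [bz _ _ _]]]]] /=.
have [z0'|zn] := eqVneq (z ord0 ia) 0; first by rewrite e2_bl0// z0' expr0n/= mul0r.
have e1E' : be (bl z) + e1 (bl z) = z ord0 ia ^+ 3 * q z by have -> : e1 (bl z) = z ord0 ia ^+ 3 * f z by []; rewrite beE /q; ring.
have mF : ismin setT (fun a => Fz (pt a z)) (Fz (pt (A z) z)) by split; [exists (A z)|].
have mN : ismin setT (qN (alh z) (q z)) (qN (alh z) (q z) (B z)) by split; [exists (B z)|].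
by rewrite (e2_scale zn alE e1E' sE mF mN).
Qed.

(** The cutoff [h1] is undone: beyond dl the quartic term dominates and [Gx] is nonnegative, hence
    not below its value 0 at a = 0. *)
Let Gx_zc_min : \forall y \near (0 : 'rV[R]_m), exists2 a, `|a| <= dl & G (sa a y) = phi y /\
  forall b, `|b| <= dl -> phi y <= G (sa b y).
Proof.
have d2 : 0 < dl ^+ 3 / 32 by rewrite divr_gt0// exprn_gt0.
have dm : 0 < Num.min dl (dl ^+ 3 / 32) by rewrite lt_min dl0.
have := near_normlt (0 : 'rV[R]_m) dm; apply: filterS => y.
rewrite subr0 lt_min => /andP[y1 y2].
have dl1 : dl <= 1 by apply: ltW; apply: lt_le_trans (lt_trans dlr r10) r01.
have GxE a : `|a| <= dl -> Gx a y = G (sa a y).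
  by move=> ad; rewrite /Gx /G /h1 !saE eqxx ad ![_ == ia]eq_sym (negPf a1) (negPf a2).
have sg a : `|a| <= dl -> sm (sa a y) G.
  move=> ad; have c j : sm (sa a y) (fun x : 'rV[R]_m => x ord0 j) by exact: sm_coord.
  have hh : sm (sa a y) h by apply: hs; apply: sa_dom; [exact: le_lt_trans ad (lt_trans dlr r10)|exact: lt_trans y1 (lt_trans dlr r10)].
  by apply: smD; [apply: smD; [apply: smX|apply: smM => //; exact: smX]|]; exact: smM.
have ct : {within `[- dl, dl], continuous (fun a => G (sa a y))}.
  apply: continuous_in_subspaceT => t; rewrite inE/= in_itv/= -ler_norml => tI.
  apply: (@continuous_comp _ _ _ (fun t => sa t y) G); last exact: sm_cts (sg t tI).
  apply: row_cts => j.
  have -> : (fun t => sa t y ord0 j) = (fun t => if j == ia then t else y ord0 j).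
    by apply/funext => u; rewrite saE.
  by case: (j == ia); [exact: cvg_id|exact: cvg_cst].
have [|a aI Ha] := EVT_min _ ct; first by rewrite ge0_cp// ltW.
rewrite in_itv/= -ler_norml in aI.
have out b : dl < `|b| -> G (sa a y) <= Gx b y.
  move=> db; apply: (@le_trans _ _ (G (sa 0 y))); first by apply: Ha; rewrite in_itv/= oppr_le0 (ltW dl0).
  rewrite -GxE ?normr0 ?(ltW dl0)// /Gx mul0r !expr0n/= !mulr0 !addr0.
  have := quartic_low b (h1_ge b y1); set W := (b * _) ^+ 4 => Wb.
  have c1 := le_lt_trans (coord_le y i1) y2; have c2 := le_lt_trans (coord_le y i2) y2.
  exact: outer_arith dl0 dl1 db Wb (ltW c1) (ltW c2).
have pE : phi y = G (sa a y).
  rewrite /phi -GxE//; apply: inf_attained => // b _; rewrite GxE//.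
  have [bd|bd] := leP `|b| dl; last exact: out.
  by rewrite GxE//; apply: Ha; rewrite in_itv/= -ler_norml.
exists a => //; split=> // b bd; rewrite pE; apply: Ha.
by rewrite in_itv/= -ler_norml.
Qed.

Lemma exact_normal_form : exists e f : 'rV[R]_m -> R,
  [/\ sm 0 e, sm 0 f, forall v, is_derive 0 v e 0 & forall v, is_derive 0 v f 0] /\
  [/\ forall y, e (zc ia y) = e y, forall y, f (zc ia y) = f y, e 0 = 0 & f 0 = 0] /\
  \forall y \near (0 : 'rV[R]_m), let V := qmin (al y) (be y + e y) + (s y + f y) in
    (exists2 a, `|a| <= dl & G (sa a y) = V) /\ forall a, `|a| <= dl -> V <= G (sa a y).
Proof.
have e1_0 y : edge i1 i2 y -> e1 y = 0 by move=> [y1 y2]; rewrite /e1 chi_edge// mul0r.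
have e2_0 y : edge i1 i2 y -> mu_lt dl y -> e2 y = 0.
  move=> [y1 y2] ym; apply: e2_edge => //; apply: norm_lt_coord => // j; rewrite zcE.
  case: eqP => [_|/eqP ja]; first by rewrite normr0.
  have [->|j1] := eqVneq j i1; first by rewrite y1 normr0.
  have [->|j2] := eqVneq j i2; first by rewrite y2 normr0.
  exact: ym.
have [s1 d1] := blow_down a1 a2 n12 dl0 e1_zc (fun y ye _ => e1_0 y ye)
  (fun z zz zw zm => @e1_bl z (And3 zz zw zm)).
have [|s2 d2] := blow_down a1 a2 n12 dl0 e2_zc e2_0.
  move=> z za zw zm; have K : Kz z by split.
  by have [[P0 PQ]|H] := pselect (z ord0 i1 < 0 /\ 27 * z ord0 i2 ^+ 2 < (- z ord0 i1) ^+ 3);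
    [exact: e2_in|exact: e2_out].
have o0 : edge i1 i2 (0 : 'rV[R]_m) by split; rewrite mxE.
exists e1, e2; split=> //; split.
  split=> //; [exact: e1_0|apply: e2_0 => // j _ _ _; by rewrite mxE normr0].
move: Gx_zc_min; apply: filterS => y [a ad [aE aH]] /=.
have -> : qmin (al y) (be y + e1 y) + (s y + e2 y) = phi y by rewrite /e2; ring.
by split; [exists a|].
Qed.

End Core.

(** * Germs with a quartic minimum *)

Section QuarticNormalForm.
Variables (R : realType) (m : nat) (ia i1 i2 : 'I_m) (r0 : R).
Hypotheses (r0gt0 : 0 < r0) (r01 : r0 <= 1).
Hypotheses (a1 : ia != i1) (a2 : ia != i2) (n12 : i1 != i2).

Lemma pd_small (f : 'rV[R]_m -> R) (C : R) l : f 0 = 0 -> (\forall y \near (0 : 'rV[R]_m), `|f y| <= C * `|y| ^+ 2) ->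
  pd l f 0 = 0.
Proof.
move=> f0 /near_radius[r rgt0 Hr]; suff H : is_derive 0 (ev R l) f 0 by rewrite /pd derive_val.
apply: increment_derive => c c0; rewrite f0.
have C1 : 0 < `|C| + 1 by rewrite ltr_wpDl.
exists (Num.min r (c / (`|C| + 1))); first by rewrite lt_min rgt0 divr_gt0.
move=> t; rewrite lt_min => /andP[t1 t2]; rewrite mulr0 !subr0 add0r.
have tv : `|t *: ev R l| <= `|t| by rewrite normrZ ler_piMr// norm_ev.
have := Hr (t *: ev R l); rewrite subr0 => /(_ (le_lt_trans tv t1)) /le_trans; apply.
apply: (@le_trans _ _ ((`|C| + 1) * `|t| ^+ 2)).
  apply: (@le_trans _ _ ((`|C| + 1) * `|t *: ev R l| ^+ 2)).
    apply: ler_wpM2r; first exact: exprn_ge0.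
    by apply: (le_trans (ler_norm C)); rewrite lerDl.
  by rewrite ler_pM2l// lerXn2r ?nnegrE.
rewrite expr2 mulrA ler_wpM2r//.
by rewrite mulrC -ler_pdivlMr// ltW.
Qed.

Variable h : 'rV[R]_m -> R.
Hypotheses (hs : smU r0 h) (h_ge : forall x, dom r0 x -> 1 / 2 <= h x).
Hypothesis h_a0 : forall x, dom r0 x -> x ord0 ia = 0 -> h x = 1.

Lemma quartic_normal_form : exists (al be s : 'rV[R]_m -> R) (k : R),
  [/\ sm 0 al, sm 0 be & sm 0 s] /\ [/\ al 0 = 0, be 0 = 0 & s 0 = 0] /\
  (forall l, [/\ pd l al 0 = (i1 == l)%:R + k * (i2 == l)%:R, pd l be 0 = (i2 == l)%:R & pd l s 0 = 0]) /\
  \forall y \near (0 : 'rV[R]_m), let V := qmin (al y) (be y) + s y in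
    let F a := (a * h (sa ia a y)) ^+ 4 + y ord0 i1 * a ^+ 2 + y ord0 i2 * a in
    (exists2 a, `|a| <= r0 / 4 & F a = V) /\ forall a, `|a| <= r0 / 4 -> V <= F a.
Proof.
pose r1 := r0 / 2; have r1gt0 : 0 < r1 by exact: divr_gt0.
have r10 : r1 < r0 by rewrite ltr_pdivrMr// mulr_natr mulr2n ltrDl.
have h_gt0 x : dom r0 x -> 0 < h x by move=> /h_ge; apply: lt_le_trans; rewrite divr_gt0.
have [al [be [s [k [[als bes ss ks] [[ali bei si ki] [[C C0 near1] formal]]]]]]] :=
  formal_normal_form r1gt0 r10 r01 a1 a2 hs h_gt0 h_a0.
(* Independence of ia is known on the ball only; composing with [zc] makes it hold everywhere
   without changing the functions on the ball. *)
pose al' y := al (zc ia y); pose be' y := be (zc ia y); pose s' y := s (zc ia y).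
have als' : smU r1 al' by exact: smU_zc.
have bes' : smU r1 be' by exact: smU_zc.
have ss' : smU r1 s' by exact: smU_zc.
have zz (f : 'rV[R]_m -> R) y : f (zc ia (zc ia y)) = f (zc ia y) by rewrite zc_zc.
have near1' x : dom r1 x -> [/\ `|al' x - x ord0 i1 - k x * x ord0 i2| <= C * rho i1 i2 x ^+ 2,
     `|be' x - x ord0 i2| <= C * rho i1 i2 x ^+ 2 & `|s' x| <= C * rho i1 i2 x ^+ 2].
  by move=> dx; rewrite /al' /be' /s' ali// bei// si//; exact: near1.
have formal' q : exists U, exists2 C : R, 0 < C & smU r1 U /\ forall x, dom r1 x ->
     `|(x ord0 ia * h x) ^+ 4 + x ord0 i1 * x ord0 ia ^+ 2 + x ord0 i2 * x ord0 ia
       - (U x ^+ 4 + al' x * U x ^+ 2 + be' x * U x) - s' x| <= C * rho i1 i2 x ^+ q /\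
     `|U x - x ord0 ia * h x| <= C * rho i1 i2 x.
  have [U [C' C0' [Us H]]] := formal q; exists U, C' => //; split=> // x dx.
  by rewrite /al' /be' /s' ali// bei// si//; exact: H.
have [e [f [[es fs ed fd] [[ei fi e0 f0] H]]]] :=
  exact_normal_form r1gt0 r10 r01 a1 a2 n12 hs h_ge h_a0 als' bes' ss' ks (zz al) (zz be) (zz s) near1' formal'.
have d0 : dom r1 (0 : 'rV[R]_m) by rewrite /dom /mkset normr0.
have rho0 : rho i1 i2 (0 : 'rV[R]_m) = 0 by rewrite /rho !mxE normr0 maxxx.
have sc j : sm 0 (fun y : 'rV[R]_m => y ord0 j) by exact: sm_coord.
have := near1' 0 d0; rewrite rho0 !mxE expr0n/= !mulr0 !subr0 !normr_le0 => -[/eqP al0 /eqP be0 /eqP s0].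
have small (F : 'rV[R]_m -> R) l : (forall x, dom r1 x -> `|F x| <= C * rho i1 i2 x ^+ 2) -> pd l F 0 = 0.
  move=> FH; apply: (@pd_small F C).
    by apply/eqP; rewrite -normr_le0; have := FH 0 d0; rewrite rho0 expr0n/= mulr0.
  move: (near_normlt (0 : 'rV[R]_m) r1gt0); apply: filterS => y; rewrite subr0 => dy.
  apply: (le_trans (FH y dy)); rewrite ler_pM2l// lerXn2r ?nnegrE ?rho_ge0//.
  by rewrite /rho ge_max !coord_le.
have kx2 : sm 0 (fun y : 'rV[R]_m => k y * y ord0 i2) by apply: smM => //; exact: ks.
have xk : sm 0 (fun y : 'rV[R]_m => y ord0 i1 + k y * y ord0 i2) by exact: smD.
have pal l : pd l al' 0 = (i1 == l)%:R + k 0 * (i2 == l)%:R.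
  have := small (fun x => al' x - (x ord0 i1 + k x * x ord0 i2)) l.
  rewrite pdB//; last exact: als'.
  rewrite pdD// pdM//; last exact: ks.
  rewrite !pd_coord mxE mul0r addr0 => Z.
  by apply/eqP; rewrite -subr_eq0 Z// => x dx; rewrite opprD addrA; have [] := near1' x dx.
have pbe l : pd l be' 0 = (i2 == l)%:R.
  have := small (fun x => be' x - x ord0 i2) l; rewrite pdB//; last exact: bes'.
  rewrite pd_coord => Z; apply/eqP; rewrite -subr_eq0 Z// => x dx; by have [] := near1' x dx.
have ps l : pd l s' 0 = 0 by apply: small => x dx; have [] := near1' x dx.
have al0s : sm 0 al' by exact: als'.
have be0s : sm 0 be' by exact: bes'.
have s0s : sm 0 s' by exact: ss'.
exists al', (fun y => be' y + e y), (fun y => s' y + f y), (k 0); split.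
  by split=> //; exact: smD.
split; first by rewrite be0 e0 s0 f0 addr0.
split.
  move=> l; rewrite !pdD// pal pbe ps.
  have -> : pd l e 0 = 0 by have := ed (ev R l) => H1; rewrite /pd derive_val.
  have -> : pd l f 0 = 0 by have := fd (ev R l) => H1; rewrite /pd derive_val.
  by rewrite !addr0.
have r4 : r0 / 4 = r1 / 2 by rewrite /r1; field.
have r1r : r1 / 2 < r0 by apply: lt_trans r10; rewrite ltr_pdivrMr// mulr_natr mulr2n ltrDl.
rewrite r4; move: H; apply: filterS => y /=.
have GE a : (sa ia a y ord0 ia * h (sa ia a y)) ^+ 4 + sa ia a y ord0 i1 * sa ia a y ord0 ia ^+ 2 +
    sa ia a y ord0 i2 * sa ia a y ord0 ia =
    (a * h (sa ia a y)) ^+ 4 + y ord0 i1 * a ^+ 2 + y ord0 i2 * a.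
  by rewrite !saE eqxx ![_ == ia]eq_sym (negPf a1) (negPf a2).
move=> [[a ad aE] aH]; split; first by exists a => //; rewrite -GE.
by move=> b bd; rewrite -GE; exact: aH.
Qed.

End QuarticNormalForm.

Section Taylor.
Variables (R : realType) (m : nat) (r : R) (i : 'I_m).
Hypothesis r0 : 0 < r.
Implicit Types (f g : 'rV[R]_m -> R) (x : 'rV[R]_m).
Local Notation D k f := (iter k (pd i) f).

Lemma iter_pd_sm x k f : sm x f -> sm x (D k f).
Proof. by move=> fs; elim: k => [//|k IH]; exact: sm_pd. Qed.

(** The last clause is Leibniz for x_i g; on x_i = 0 it reads the derivatives of the quotient g off
    those of f, so that iterating the step yields Taylor coefficients. *)
Lemma hadamard_step f : smU r f -> exists g, [/\ smU r g, forall x, dom r x -> f x = f (zc i x) + x ord0 i * g x &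
  forall k x, dom r x -> D k.+1 f x = x ord0 i * D k.+1 g x + k.+1%:R * D k g x].
Proof.
move=> fs; have [g gs gE] := hadamardU r0 i fs; exists g; split=> //.
have c x : sm x (fun x : 'rV[R]_m => x ord0 i) by exact: sm_coord.
have nb x (P : 'rV[R]_m -> Prop) : dom r x -> (forall y, dom r y -> P y) -> \forall y \near x, P y.
  by move=> dx H; move: (open_near (@dom_open R m r) dx); apply: filterS.
elim=> [|k IH] x dx.
  have -> : D 1 f x = pd i (fun x => f (zc i x) + x ord0 i * g x) x by apply: pd_near; exact: (nb x _ dx gE).
  have zs : sm x (fun x => f (zc i x)) by exact: (smU_zc r0 i fs).
  have gx : sm x g by exact: gs.
  rewrite pdD//; last exact: smM.
  rewrite pdM// pd_coord eqxx (@pd_ia R m i (fun x => f (zc i x))) ?add0r /=; first by ring.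
  by move=> y; rewrite zc_zc.
have -> : D k.+2 f x = pd i (fun x => x ord0 i * D k.+1 g x + k.+1%:R * D k g x) x.
  rewrite -[LHS]/(pd i (D k.+1 f) x); apply: pd_near; exact: (nb x _ dx IH).
have gk j : sm x (D j g) by apply: iter_pd_sm; exact: gs.
rewrite pdD//; last by apply: smM => //; exact: sm_cst.
  rewrite pdM// pdZ// pd_coord eqxx -[pd i (D k g) x]/(D k.+1 g x) -[pd i (D k.+1 g) x]/(D k.+2 g x) -[k.+2%:R]natr1.
  by rewrite mulr1; move: (D k.+1 g x) (D k.+2 g x) => X Y; ring.
exact: smM.
Qed.

Lemma taylor4 f : smU r f -> exists H, [/\ smU r H,
  forall x, dom r x -> f x = f (zc i x) + x ord0 i * D 1 f (zc i x) + x ord0 i ^+ 2 * (D 2 f (zc i x) / 2)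
    + x ord0 i ^+ 3 * (D 3 f (zc i x) / 6) + x ord0 i ^+ 4 * H x &
  forall x, dom r x -> x ord0 i = 0 -> H x = D 4 f x / 24].
Proof.
move=> fs; have [g1 [g1s E1 D1]] := hadamard_step fs; have [g2 [g2s E2 D2]] := hadamard_step g1s.
have [g3 [g3s E3 D3]] := hadamard_step g2s; have [g4 [g4s E4 D4]] := hadamard_step g3s.
have [k1 k2 k3 k4] : [/\ forall z, dom r z -> z ord0 i = 0 -> g1 z = D 1 f z,
  forall z, dom r z -> z ord0 i = 0 -> g2 z = D 2 f z / 2,
  forall z, dom r z -> z ord0 i = 0 -> g3 z = D 3 f z / 6 &
  forall z, dom r z -> z ord0 i = 0 -> g4 z = D 4 f z / 24].
  have s k g g' : (forall k x, dom r x -> D k.+1 g x = x ord0 i * D k.+1 g' x + k.+1%:R * D k g' x) ->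
      forall z, dom r z -> z ord0 i = 0 -> D k g' z = D k.+1 g z / k.+1%:R.
    by move=> H z dz z0; rewrite H// z0 mul0r add0r mulrC mulKf// pnatr_eq0.
  split=> z dz z0.
  - by have := s 0%N _ _ D1 z dz z0; rewrite divr1.
  - by have := s 0%N _ _ D2 z dz z0; have := s 1%N _ _ D1 z dz z0 => /= -> ->; rewrite divr1.
  - have := s 0%N _ _ D3 z dz z0; have := s 1%N _ _ D2 z dz z0; have := s 2%N _ _ D1 z dz z0 => /= -> -> ->.
    by field.
  - have q4 : g4 z = D 1 g3 z / 1 := s 0%N _ _ D4 z dz z0.
    have q3 : D 1 g3 z = D 2 g2 z / 2 := s 1%N _ _ D3 z dz z0.
    have q2 : D 2 g2 z = D 3 g1 z / 3 := s 2%N _ _ D2 z dz z0.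
    have q1 : D 3 g1 z = D 4 f z / 4 := s 3%N _ _ D1 z dz z0.
    by rewrite q4 q3 q2 q1; move: (D 4 f z) => X; field.
exists g4; split=> // x dx; have dz : dom r (zc i x) by exact: dom_zc.
have z0 : zc i x ord0 i = 0 by rewrite zcE eqxx.
have T : f x = f (zc i x) + x ord0 i * g1 (zc i x) + x ord0 i ^+ 2 * g2 (zc i x) + x ord0 i ^+ 3 * g3 (zc i x) + x ord0 i ^+ 4 * g4 x.
  rewrite (E1 x dx) (E2 x dx) (E3 x dx) (E4 x dx).
  by move: (g1 _) (g2 _) (g3 _) (g4 _) (f _) (x _ _) => G1 G2 G3 G4 F t; ring.
by rewrite (k1 _ dz z0) (k2 _ dz z0) (k3 _ dz z0) in T.
Qed.

End Taylor.

(** * Reduction of a one-variable germ to the form a^4 h^4 + y_1 a^2 + y_2 a *)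

Section Germ.
Variables (R : realType).

Lemma pt00 k : pt 0 0 = 0 :> 'rV[R]_(1 + k).
Proof. by rewrite /pt (raddf0 (@scalar_mx R 1)) row_mx0. Qed.

Lemma sum_pt k (F : 'I_(1 + k) -> R) : \sum_j F j = F (i0 k) + \sum_j F (rshift 1 j).
Proof. by rewrite big_split_ord/= big_ord1. Qed.

Lemma rsub_pt' k (a : R) (z : 'rV[R]_k) : rsubmx (pt a z) = z.
Proof. exact: row_mxKr. Qed.

Lemma pt_lt k (a : R) (z : 'rV[R]_k) (e : R) : `|a| < e -> `|z| < e -> `|pt a z| < e.
Proof.
move=> ae ze; apply: norm_lt_coord; first exact: le_lt_trans ae.
by apply: pt_cases => [|j]; rewrite ?pt_i0 ?pt_r//; exact: le_lt_trans (coord_le _ _) ze.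
Qed.

Lemma sm_sqrt m (f : 'rV[R]_m -> R) x : 0 < f x -> sm x f -> sm x (fun y => Num.sqrt (f y)).
Proof.
move=> f0 fs; pose F (w : 'rV[R]_(1 + m)) := w ord0 (i0 m) ^+ 2 - f (rsubmx w).
have c : sm (pt (Num.sqrt (f x)) x) (fun w : 'rV[R]_(1 + m) => w ord0 (i0 m)) by exact: sm_coord.
have c2 : sm (pt (Num.sqrt (f x)) x) (fun w : 'rV[R]_(1 + m) => w ord0 (i0 m) ^+ 2) by exact: smX.
have fr : sm (pt (Num.sqrt (f x)) x) (fun w : 'rV[R]_(1 + m) => f (rsubmx w)) by apply: sm_rsub; rewrite rsub_pt'.
have [|||A [As A0 HA]] := @implicit1 _ _ F (Num.sqrt (f x)) x.
- exact: smB.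
- by rewrite /F pt_i0 rsub_pt' sqr_sqrtr ?subrr// ltW.
- rewrite /F pdB// (pdX _ 1 c) pd_rsub0 pd_coord eqxx pt_i0 subr0 mulr1 expr1.
  by rewrite mulf_neq0 ?pnatr_eq0// gt_eqF// sqrtr_gt0.
apply: (sm_ext _ As).
have A1 : 0 < A x by rewrite A0 sqrtr_gt0.
move: (near_and HA (sm_gt As A1)); apply: filterS => y [].
rewrite /F pt_i0 rsub_pt' => /eqP; rewrite subr_eq0 => /eqP <- Ay.
by rewrite sqrtr_sqr gtr0_norm.
Qed.

Definition root4 (x : R) := Num.sqrt (Num.sqrt x).

Lemma root4K x : 0 <= x -> root4 x ^+ 4 = x.
Proof. by move=> x0; rewrite -[4%N]/(2 * 2)%N exprM !sqr_sqrtr ?sqrtr_ge0. Qed.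

Lemma sm_root4 m (f : 'rV[R]_m -> R) x : 0 < f x -> sm x f -> sm x (fun y => root4 (f y)).
Proof. by move=> f0 fs; apply: sm_sqrt; [rewrite sqrtr_gt0|exact: sm_sqrt]. Qed.

Lemma root4_ge x : 1 / 16 <= x -> 1 / 2 <= root4 x.
Proof.
have h1 : 1 / 2 = Num.sqrt ((1 / 2) ^+ 2) :> R by rewrite sqrtr_sqr ger0_norm.
have h2 : (1 / 2) ^+ 2 = Num.sqrt ((1 / 4) ^+ 2) :> R by rewrite sqrtr_sqr ger0_norm//; field.
move=> x1; rewrite h1 /root4 ler_sqrt ?sqrtr_ge0// h2 ler_sqrt; last by apply: le_trans x1.
by apply: le_trans x1; rewrite (_ : (1 / 4) ^+ 2 = 1 / 16 :> R)//; field.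
Qed.

Lemma root4_1 : root4 1 = 1.
Proof. by rewrite /root4 !sqrtr1. Qed.

Variables (k : nat).
Local Notation D j f := (iter j (pd (i0 k)) f).

(** A shift and a dilation of the distinguished variable, both depending on the parameters. *)
Definition fib (sg e : 'rV[R]_k -> R) (w : 'rV[R]_(1 + k)) :=
  pt (sg (rsubmx w) + w ord0 (i0 k) * e (rsubmx w)) (rsubmx w).

Lemma fib_smv sg e w : sm (rsubmx w) sg -> sm (rsubmx w) e -> smv w (fib sg e).
Proof.
move=> ss es; apply: pt_cases => [|j].
  under eq_fun do rewrite /fib pt_i0; apply: smD; first exact: sm_rsub.
  by apply: smM; [exact: sm_coord|exact: sm_rsub].
by under eq_fun do rewrite /fib pt_r; exact: smv_rsub.
Qed.

Lemma fib_pd sg e w (f : 'rV[R]_(1 + k) -> R) : sm (rsubmx w) sg -> sm (rsubmx w) e -> sm (fib sg e w) f ->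
  pd (i0 k) (fun w => f (fib sg e w)) w = e (rsubmx w) * pd (i0 k) f (fib sg e w).
Proof.
move=> ss es fs; rewrite (@pd_comp _ _ _ (fib sg e) w f (i0 k) (fib_smv ss es) fs).
have es' := sm_rsub es; have ss' := sm_rsub ss.
have c : sm w (fun w : 'rV[R]_(1 + k) => w ord0 (i0 k)) by exact: sm_coord.
rewrite big_split_ord/= big_ord1 big1 ?addr0.
  have -> : lshift k ord0 = i0 k by [].
  under eq_fun do rewrite /fib pt_i0.
  rewrite pdD//; last exact: smM.
  by rewrite pdM// !pd_rsub0 pd_coord eqxx mulr0 !add0r mulr1.
move=> j _; under eq_fun do rewrite /fib pt_r.
by rewrite (@pd_rsub0 R k (fun z => z ord0 j)) mul0r.
Qed.

Lemma fib_iter sg e w0 (f : 'rV[R]_(1 + k) -> R) j : sm (rsubmx w0) sg -> sm (rsubmx w0) e -> sm (fib sg e w0) f ->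
  \forall w \near w0, D j (fun w => f (fib sg e w)) w = e (rsubmx w) ^+ j * D j f (fib sg e w).
Proof.
move=> ss es fs; elim: j => [|j IH]; first by apply: filterE => w; rewrite expr0 mul1r.
have rc : {for w0, continuous (fun w : 'rV[R]_(1 + k) => rsubmx w)} by apply: smv_cts; exact: smv_rsub.
have fc := smv_cts (fib_smv ss es).
have [U [oU Ux HU]] := near_open IH.
move: (near_and (open_near oU Ux) (near_and (near_preim rc (sm_near ss)) (near_and (near_preim rc (sm_near es)) (near_preim fc (sm_near fs))))).
apply: filterS => w [wU [ws [we wf]]].
have -> : D j.+1 (fun w => f (fib sg e w)) w = pd (i0 k) (fun w => e (rsubmx w) ^+ j * D j f (fib sg e w)) w.
  by rewrite -[LHS]/(pd (i0 k) (D j (fun w => f (fib sg e w))) w); apply: pd_near; move: (open_near oU wU); apply: filterS => y /HU.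
have Df : sm (fib sg e w) (D j f) by exact: iter_pd_sm.
rewrite pdM; last first.
- exact: (sm_comp (fib_smv ws we) Df).
- by apply: smX; exact: sm_rsub.
rewrite (@pd_rsub0 R k (fun z => e z ^+ j)) mulr0 addr0 fib_pd// exprSr -mulrA.
by [].
Qed.

Variable G : 'rV[R]_(1 + k) -> R.
Hypothesis Gs : sm 0 G.
Hypotheses (G1 : D 1 G 0 = 0) (G2 : D 2 G 0 = 0) (G3 : D 3 G 0 = 0) (G4 : D 4 G 0 = 24).

(** The shift removes the cubic Taylor coefficient, by the implicit function theorem as the fourth
    derivative is 24 at 0; the dilation then sets the quartic coefficient to 1. *)
Let shift_scale : exists sg e : 'rV[R]_k -> R, [/\ sm 0 sg, sm 0 e, sg 0 = 0 & e 0 = 1] /\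
  \forall z \near (0 : 'rV[R]_k), [/\ D 3 G (pt (sg z) z) = 0, e z ^+ 4 * D 4 G (pt (sg z) z) = 24 & 0 < e z].
Proof.
have D3s : sm (pt 0 0) (D 3 G) by rewrite pt00; exact: iter_pd_sm.
have D4s : sm (pt 0 0) (D 4 G) by rewrite pt00; exact: iter_pd_sm.
have [||sg [ss s0 Hs]] := implicit1 D3s; first by rewrite pt00.
  have -> : pd (i0 k) (D 3 G) (pt 0 0) = 24 by rewrite pt00; exact: G4.
  by rewrite pnatr_eq0.
pose c z := root4 (D 4 G (pt (sg z) z) / 24).
have Ds : sm 0 (fun z => D 4 G (pt (sg z) z) / 24).
  by apply: smM; [apply: (comp_pt ss); rewrite s0|exact: sm_cst].
have D0 : D 4 G (pt (sg 0) 0) / 24 = 1 by rewrite s0 pt00 G4 divff// pnatr_eq0.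
have c0 : c 0 = 1 by rewrite /c D0 root4_1.
have cs : sm 0 c by apply: sm_root4 => //; rewrite D0.
exists sg, (fun z => (c z)^-1); split.
  by split=> //; [apply: smV => //; rewrite c0 oner_neq0|rewrite c0 invr1].
have c1 : 0 < c 0 by rewrite c0.
have D1 : 0 < D 4 G (pt (sg 0) 0) / 24 by rewrite D0.
move: (near_and Hs (near_and (sm_gt cs c1) (sm_gt Ds D1))); apply: filterS => z [h1 [h2 h3]].
split=> //; last by rewrite invr_gt0.
have := root4K (ltW h3); rewrite -/(c z) => E.
have -> : D 4 G (pt (sg z) z) = c z ^+ 4 * 24 by rewrite E divfK// pnatr_eq0.
by rewrite mulrA exprVn mulVf ?mul1r// expf_neq0// gt_eqF.
Qed.

Let pd_along (sg : 'rV[R]_k -> R) f l : sm 0 sg -> sg 0 = 0 -> sm 0 f -> pd (i0 k) f 0 = 0 ->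
  pd l (fun z => f (pt (sg z) z)) 0 = pd (rshift 1 l) f 0.
Proof.
move=> ss s0 fs f0; have e0 : row_mx (sg 0)%:M 0 = 0 :> 'rV[R]_(1 + k) by rewrite s0; exact: pt00.
have := @pd_envelope R 1 k f (fun z => (sg z)%:M) 0 l; rewrite /= e0; apply=> //.
  by move=> j; rewrite (_ : (fun y => _) = sg)//; apply/funext => y; rewrite !ord1 mxE eqxx mulr1n.
by move=> i; rewrite (_ : lshift k i = i0 k)// ord1.
Qed.

(** To first order al and be are the Taylor coefficients of a^2, up to a multiple of be, and of a.
    Shift and dilation do not disturb these differentials, because the derivatives of G of orders 1
    to 3 vanish at 0. *)
Lemma germ_normal_form : exists al be s : 'rV[R]_k -> R, exists kap : R,
  [/\ sm 0 al, sm 0 be & sm 0 s] /\ [/\ al 0 = 0, be 0 = 0 & s 0 = G 0] /\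
  (forall l, [/\ pd l al 0 = pd (rshift 1 l) (D 2 G) 0 / 2 + kap * pd (rshift 1 l) (D 1 G) 0,
     pd l be 0 = pd (rshift 1 l) (D 1 G) 0 & pd l s 0 = pd (rshift 1 l) G 0]) /\
  exists2 d : R, 0 < d & \forall z \near (0 : 'rV[R]_k), let V := qmin (al z) (be z) + s z in
    (exists a, G (pt a z) = V) /\ forall a, `|a| < d -> V <= G (pt a z).
Proof.
have [sg [e [[ss es s0 e0] He]]] := shift_scale.
have ss' : sm (rsubmx (0 : 'rV[R]_(1 + k))) sg by rewrite -pt00 rsub_pt'.
have es' : sm (rsubmx (0 : 'rV[R]_(1 + k))) e by rewrite -pt00 rsub_pt'.
have rs0 : rsubmx (0 : 'rV[R]_(1 + k)) = 0 by rewrite -pt00 rsub_pt'.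
have f0 : fib sg e 0 = 0 by rewrite /fib rs0 mxE mul0r addr0 s0 pt00.
pose Gh w := G (fib sg e w).
have Ghs : sm 0 Gh by apply: (sm_comp (fib_smv ss' es')); rewrite f0.
have GhD j : \forall w \near (0 : 'rV[R]_(1 + k)), D j Gh w = e (rsubmx w) ^+ j * D j G (fib sg e w).
  by apply: fib_iter => //; rewrite f0.
have [r2 r20 H2] := near_radius He.
have [r3 r30 H3] := near_radius (near_and (sm_near Ghs) (near_and (GhD 1%N) (near_and (GhD 2%N) (near_and (GhD 3%N) (GhD 4%N))))).
have [r [r0 rr2 rr3]] : exists r : R, [/\ 0 < r, r <= r2 & r <= r3].
  by exists (Num.min r2 r3); rewrite lt_min r20 r30 !ge_min !lexx orbT.
have sub (x : 'rV[R]_(1 + k)) : dom r x -> `|x - 0| < r3 by rewrite /dom /mkset subr0 => /lt_le_trans; apply.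
have Ghr : smU r Gh by move=> x /sub /H3[].
have [H [Hs HE H0]] := taylor4 (i0 k) r0 Ghr.
have zpt (a : R) z : zc (i0 k) (pt a z) = pt 0 z.
  apply/rowP; apply: pt_cases => [|j]; rewrite zcE ?eqxx ?pt_i0//.
  by rewrite (_ : rshift 1 j == i0 k = false) ?pt_r//; apply/negbTE; rewrite eq_sym eq_lrshift.
have fz z : fib sg e (pt 0 z) = pt (sg z) z by rewrite /fib rsub_pt' pt_i0 mul0r addr0.
have dz (z : 'rV[R]_k) : `|z| < r -> dom r (pt 0 z) by move=> zr; apply: pt_lt; rewrite ?normr0.
have Dz z : `|z| < r -> [/\ D 1 Gh (pt 0 z) = e z * D 1 G (pt (sg z) z), D 2 Gh (pt 0 z) = e z ^+ 2 * D 2 G (pt (sg z) z),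
    D 3 Gh (pt 0 z) = 0 & D 4 Gh (pt 0 z) = 24].
  move=> zr; have [_ [q1 [q2 [q3 q4]]]] := H3 _ (sub _ (dz z zr)).
  have tr j : D j Gh (pt 0 z) = e (rsubmx (pt 0 z)) ^+ j * D j G (fib sg e (pt 0 z)) ->
      D j Gh (pt 0 z) = e z ^+ j * D j G (pt (sg z) z) by rewrite rsub_pt' fz.
  have [] := H2 z; first by rewrite subr0; exact: lt_le_trans zr rr2.
  move=> e3 e4 _; split; [exact: tr 1%N q1|exact: tr 2%N q2| |exact: etrans (tr 4%N q4) e4].
  exact: etrans (tr 3%N q3) (etrans (congr1 _ e3) (mulr0 _)).
have H01 z : `|z| < r -> H (pt 0 z) = 1.
  move=> zr; rewrite H0 ?pt_i0//; last exact: dz.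
  by have [_ _ _ ->] := Dz z zr; rewrite divff// pnatr_eq0.
have H00 : 1 / 16 < H 0.
  by have := H01 0; rewrite normr0 pt00 => ->//; rewrite ltr_pdivrMr// mul1r ltr1n.
have H0s : sm 0 H by apply: Hs; rewrite /dom /mkset normr0.
have [r4 r40 H4] := near_radius (sm_gt H0s H00).
have [rr [rr0 rrr rr4' rr1]] : exists rr : R, [/\ 0 < rr, rr <= r, rr <= r4 & rr <= 1].
  by exists (Num.min (Num.min r r4) 1); rewrite !lt_min r0 r40 ltr01 !ge_min !lexx !orbT.
(* Coordinates (a, y_1, y_2, z): the lower coefficients become independent variables, as the normal
   form of the quartic requires, and are specialized afterwards. *)
pose M := (1 + (1 + (1 + k)))%N.
pose ia : 'I_M := i0 _; pose i1 : 'I_M := rshift 1 (i0 _); pose i2 : 'I_M := rshift 1 (rshift 1 (i0 k)).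
have a1 : ia != i1 by rewrite eq_lrshift.
have a2 : ia != i2 by rewrite eq_lrshift.
have n12 : i1 != i2 by rewrite eq_rshift eq_lrshift.
pose mu (x : 'rV[R]_M) : 'rV[R]_k := rsubmx (rsubmx (rsubmx x)).
have muE x j : mu x ord0 j = x ord0 (rshift 1 (rshift 1 (rshift 1 j))) by rewrite !mxE.
pose P (x : 'rV[R]_M) := pt (x ord0 ia) (mu x).
(* H is the fourth order Taylor remainder, equal to 1 at a = 0, so a^4 H = (a h)^4. *)
pose h x := root4 (H (P x)).
have Pd x (q : R) : `|x| < q -> `|P x| < q.
  move=> xq; have q0 : 0 < q by exact: le_lt_trans xq.
  apply: norm_lt_coord => //; apply: pt_cases => [|j]; rewrite /P ?pt_i0 ?pt_r ?muE; exact: le_lt_trans (coord_le _ _) xq.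
have Ps x : smv x P.
  by apply: pt_cases => [|j]; [under eq_fun do rewrite /P pt_i0|under eq_fun do rewrite /P pt_r muE]; exact: sm_coord.
have Hge x : dom rr x -> 1 / 16 < H (P x).
  by move=> /Pd dx; apply: H4; rewrite subr0; exact: lt_le_trans dx rr4'.
have Pr x : dom rr x -> dom r (P x) by move=> /Pd dx; exact: lt_le_trans dx rrr.
have hs : smU rr h.
  move=> x dx; apply: (@sm_root4 _ (fun x => H (P x))); first by apply: lt_trans (Hge x dx); rewrite divr_gt0.
  by apply: (sm_comp (Ps x)); apply: Hs; exact: Pr.
have h_ge x : dom rr x -> 1 / 2 <= h x by move=> /Hge /ltW; exact: root4_ge.
have h_a0 x : dom rr x -> x ord0 ia = 0 -> h x = 1.
  move=> dx x0; rewrite /h /P x0 H01 ?root4_1//.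
  have := Pr x dx; rewrite /dom /mkset; apply: le_lt_trans; apply: norm_le_coord => // j.
  by have := coord_le (P x) (rshift 1 j); rewrite pt_r.
have [al [be [s [kap [[als bes sss] [[al0 be0 ss0] [pds H5]]]]]]] := quartic_normal_form rr0 rr1 a1 a2 n12 hs h_ge h_a0.
(* The actual coefficients of a^2 and a after shift and dilation, to be substituted for y_1 and y_2
   through [Phi]. *)
pose Y1 z := e z ^+ 2 * D 2 G (pt (sg z) z) / 2; pose Y2 z := e z * D 1 G (pt (sg z) z).
pose Phi (z : 'rV[R]_k) : 'rV[R]_M := pt 0 (pt (Y1 z) (pt (Y2 z) z)).
have Dgs j : sm 0 (fun z => D j G (pt (sg z) z)).
  by apply: (comp_pt ss); rewrite s0 pt00; exact: iter_pd_sm.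
have e2s : sm 0 (fun z => e z ^+ 2) by exact: smX.
have eD2 : sm 0 (fun z => e z ^+ 2 * D 2 G (pt (sg z) z)) by exact: (smM e2s (Dgs 2%N)).
have Y1s : sm 0 Y1 by apply: smM; [exact: eD2|exact: sm_cst].
have Y2s : sm 0 Y2 by exact: (smM es (Dgs 1%N)).
have Y10 : Y1 0 = 0 by rewrite /Y1 s0 pt00 G2 mulr0 mul0r.
have Y20 : Y2 0 = 0 by rewrite /Y2 s0 pt00 G1 mulr0.
have Phi0 : Phi 0 = 0 by rewrite /Phi Y10 Y20 !pt00.
have Phis : smv 0 Phi.
  apply: pt_cases => [|j]; first by under eq_fun do rewrite /Phi pt_i0; exact: sm_cst.
  under eq_fun do rewrite /Phi pt_r.
  move: j; apply: pt_cases => [|j]; first by under eq_fun do rewrite pt_i0.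
  under eq_fun do rewrite pt_r.
  move: j; apply: pt_cases => [|j]; first by under eq_fun do rewrite pt_i0.
  by under eq_fun do rewrite pt_r; exact: sm_coord.
have pdPhi f l : sm 0 f -> (forall j, pd (rshift 1 (rshift 1 (rshift 1 j))) f 0 = 0) ->
    pd l (fun z => f (Phi z)) 0 = pd l Y1 0 * pd i1 f 0 + pd l Y2 0 * pd i2 f 0.
  move=> fs fj; have fs' : sm (Phi 0) f by rewrite Phi0.
  rewrite (@pd_comp _ _ _ Phi 0 f l Phis fs') Phi0 3!sum_pt.
  have -> : pd l (fun z => Phi z ord0 (i0 _)) 0 = 0 by under eq_fun do rewrite /Phi pt_i0; exact: pd_cst.
  have -> : (fun z => Phi z ord0 (rshift 1 (i0 _))) = Y1 by apply/funext => z; rewrite /Phi pt_r pt_i0.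
  have -> : (fun z => Phi z ord0 (rshift 1 (rshift 1 (i0 _)))) = Y2 by apply/funext => z; rewrite /Phi !pt_r pt_i0.
  by rewrite big1 ?addr0 ?mul0r ?add0r// => j _; rewrite fj mulr0.
have pDj l j : D j.+1 G 0 = 0 -> pd l (fun z => D j G (pt (sg z) z)) 0 = pd (rshift 1 l) (D j G) 0.
  by move=> Dj; apply: pd_along => //; exact: iter_pd_sm.
have pY1 l : pd l Y1 0 = pd (rshift 1 l) (D 2 G) 0 / 2.
  rewrite /Y1 pdM//; last exact: sm_cst.
  rewrite pd_cst mulr0 add0r (pdM l e2s (Dgs 2%N)) s0 pt00 G2 mul0r addr0 e0 expr1n mul1r (pDj l 2%N G3).
  by rewrite mulrC.
have pY2 l : pd l Y2 0 = pd (rshift 1 l) (D 1 G) 0.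
  by rewrite /Y2 (pdM l es (Dgs 1%N)) s0 pt00 G1 mul0r addr0 e0 mul1r (pDj l 1%N G2).
have mu1 j : (i1 == rshift 1 (rshift 1 (rshift 1 j))) = false by rewrite eq_rshift eq_lrshift.
have mu2 j : (i2 == rshift 1 (rshift 1 (rshift 1 j))) = false by rewrite !eq_rshift eq_lrshift.
have pal l : pd l (fun z => al (Phi z)) 0 = pd (rshift 1 l) (D 2 G) 0 / 2 + kap * pd (rshift 1 l) (D 1 G) 0.
  rewrite pdPhi//; last by move=> j; have [-> _ _] := pds (rshift 1 (rshift 1 (rshift 1 j))); rewrite mu1 mu2 mulr0 addr0.
  have [-> _ _] := pds i1; have [-> _ _] := pds i2.
  by rewrite !eqxx (negPf n12) [i2 == i1]eq_sym (negPf n12) pY1 pY2/= !mulr0 !addr0 add0r !mulr1 [kap * _]mulrC.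
have pbe l : pd l (fun z => be (Phi z)) 0 = pd (rshift 1 l) (D 1 G) 0.
  rewrite pdPhi//; last by move=> j; have [_ -> _] := pds (rshift 1 (rshift 1 (rshift 1 j))); rewrite mu2.
  have [_ -> _] := pds i1; have [_ -> _] := pds i2.
  by rewrite eqxx [i2 == i1]eq_sym (negPf n12) pY2/= mulr0 add0r mulr1.
have ps l : pd l (fun z => s (Phi z)) 0 = 0.
  rewrite pdPhi//; last by move=> j; have [_ _ ->] := pds (rshift 1 (rshift 1 (rshift 1 j))).
  by have [_ _ ->] := pds i1; have [_ _ ->] := pds i2; rewrite !mulr0 addr0.
have cmp f : sm 0 f -> sm 0 (fun z => f (Phi z)) by move=> fs; apply: (sm_comp Phis); rewrite Phi0.
have S0s : sm 0 (fun z => G (pt (sg z) z)) by exact: (Dgs 0%N).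
exists (fun z => al (Phi z)), (fun z => be (Phi z)), (fun z => s (Phi z) + G (pt (sg z) z)), kap; split.
  by split; [exact: cmp|exact: cmp|apply: smD => //; exact: cmp].
split; first by rewrite Phi0 al0 be0 ss0 s0 pt00 add0r.
split.
  move=> l; split=> //; rewrite pdD//; last exact: cmp.
  by rewrite ps add0r (pDj l 0%N G1).
(* With |sg z| < rr/16 and e z > 1/2, any |b| < rr/16 has (b - sg z)/e z of modulus at most rr/4. *)
exists (rr / 4 / 4); first by rewrite !divr_gt0.
have rr4 : 0 < rr / 4 by exact: divr_gt0.
have rr44 : 0 < rr / 4 / 4 by exact: divr_gt0.
have Pc : {for 0, continuous Phi} by exact: smv_cts.
have {}H5 : \forall z \near (0 : 'rV[R]_k), (let y := Phi z in let V := qmin (al y) (be y) + s y in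
    let F a := (a * h (sa ia a y)) ^+ 4 + y ord0 i1 * a ^+ 2 + y ord0 i2 * a in
    (exists2 a, `|a| <= rr / 4 & F a = V) /\ forall a, `|a| <= rr / 4 -> V <= F a).
  apply: (@near_preim _ _ Phi 0 (fun y => let V := qmin (al y) (be y) + s y in
    let F a := (a * h (sa ia a y)) ^+ 4 + y ord0 i1 * a ^+ 2 + y ord0 i2 * a in
    (exists2 a, `|a| <= rr / 4 & F a = V) /\ forall a, `|a| <= rr / 4 -> V <= F a) Pc).
  by rewrite Phi0.
have e12 : 1 / 2 < e 0 by rewrite e0 ltr_pdivrMr// mul1r ltr1n.
have sga : \forall z \near (0 : 'rV[R]_k), `|sg 0 - sg z| < rr / 4 / 4 by exact: near_cts_dist.
move: (near_and H5 (near_and (sm_gt es e12) (near_and sga (near_normlt (0 : 'rV[R]_k) rr4)))); apply: filterS.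
move=> z [[[a ad aE] aH] [ez [sz]]]; rewrite subr0 => zr.
rewrite s0 sub0r normrN in sz.
have rr4r : rr / 4 < rr by rewrite ltr_pdivrMr// ltr_pMr// ltr1n.
have zr' : `|z| < r by apply: lt_le_trans (lt_trans zr rr4r) rrr.
have key b : `|b| <= rr / 4 -> G (pt (sg z + b * e z) z) =
    (b * h (sa ia b (Phi z))) ^+ 4 + Phi z ord0 i1 * b ^+ 2 + Phi z ord0 i2 * b + G (pt (sg z) z).
  move=> bd; have dw : dom r (pt b z) by apply: pt_lt => //; apply: lt_le_trans rrr; exact: le_lt_trans bd rr4r.
  have Pw : P (sa ia b (Phi z)) = pt b z.
    apply/rowP; apply: pt_cases => [|j]; rewrite /P ?pt_i0 ?pt_r ?muE ?saE ?eqxx//.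
    rewrite (_ : rshift 1 (rshift 1 (rshift 1 j)) == ia = false); first by rewrite /Phi !pt_r.
    by apply/negbTE; rewrite eq_sym eq_lrshift.
  have -> : G (pt (sg z + b * e z) z) = Gh (pt b z) by rewrite /Gh /fib rsub_pt' pt_i0.
  rewrite HE// zpt pt_i0; have [-> -> -> _] := Dz z zr'.
  have -> : Gh (pt 0 z) = G (pt (sg z) z) by rewrite /Gh fz.
  rewrite exprMn /h Pw root4K; last first.
    apply: ltW; apply: lt_trans (H4 (pt b z) _); first by rewrite divr_gt0.
    rewrite subr0; apply: pt_lt.
      exact: lt_le_trans (le_lt_trans bd rr4r) rr4'.
    exact: lt_le_trans (lt_trans zr rr4r) rr4'.
  have -> : Phi z ord0 i1 = Y1 z by rewrite /Phi pt_r pt_i0.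
  have -> : Phi z ord0 i2 = Y2 z by rewrite /Phi !pt_r pt_i0.
  rewrite /Y1 /Y2; move: (H _) (G _) (D 2 G _) (D 1 G _) (e z) => X1 X2 X3 X4 X5; ring.
split; first by exists (sg z + a * e z); rewrite key// aE addrA.
move=> b bd; have ez0 : 0 < e z by apply: lt_trans ez; rewrite divr_gt0.
pose t := (b - sg z) / e z.
have -> : b = sg z + t * e z by rewrite /t divfK ?gt_eqF// addrC subrK.
have td : `|t| <= rr / 4.
  rewrite /t normrM normfV (gtr0_norm ez0) ler_pdivrMr//.
  apply: (le_trans (ler_normB _ _)); apply: (@le_trans _ _ (rr / 4 / 4 + rr / 4 / 4)); first by rewrite lerD// ltW.
  rewrite (_ : rr / 4 / 4 + rr / 4 / 4 = rr / 4 * (1 / 2)); last by field.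
  by rewrite ler_pM2l// ltW.
by rewrite key// addrA lerD2r; exact: aH.
Qed.

End Germ.

(** * A_3 minima *)

Section Valley.
Variables (R : realType) (n : nat).
Local Notation pl t := (pt t (0 : 'rV[R]_n.+1)).

(** Passage to the limit t -> 0 in an inequality from which a power of t has been divided out. *)
Lemma line_le0 (f : 'rV[R]_(1 + n.+1) -> R) (d : R) : 0 < d -> sm 0 f ->
  (forall t, `|t| < d -> t != 0 -> f (pl t) <= 0) -> f 0 <= 0.
Proof.
move=> d0 fs H; rewrite leNgt; apply/negP => f0.
have [r r0 Hr] := near_radius (sm_gt fs f0).
have m0 : 0 < Num.min d r / 2 by rewrite divr_gt0// lt_min d0.
have m1 : Num.min d r / 2 < Num.min d r by rewrite ltr_pdivrMr// ltr_pMr ?ltr1n// lt_min d0.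
have td : `|Num.min d r / 2| < Num.min d r by rewrite gtr0_norm.
have := H (Num.min d r / 2); rewrite gt_eqF// => /(_ _ isT) H1.
have : f (pl (Num.min d r / 2)) <= 0 by apply: H1; apply: lt_le_trans td _; rewrite ge_min lexx.
apply/negP; rewrite -ltNge; apply: Hr; rewrite subr0; apply: pt_lt; last by rewrite normr0.
by apply: lt_le_trans td _; rewrite ge_min lexx orbT.
Qed.

Lemma pow4_le0 (x : R) : x ^+ 4 <= 0 -> x = 0.
Proof.
move=> x4; have : x ^+ 4 == 0 by rewrite eq_le x4 -[4%N]/(2 * 2)%N exprM sqr_ge0.
by rewrite expf_eq0 => /eqP.
Qed.

Variables (w : 'rV[R]_n.+1 -> R) (p : 'rV[R]_n.+1) (Q : 'M[R]_n.+1) (C : 'rV[R]_n.+1).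
Hypothesis form : A3_form w p Q C.
Variables (g1 : 'rV[R]_n.+1) (e : 'rV[R]_(1 + n.+1) -> 'rV[R]_n.+1).
Hypothesis es : smv 0 e.
Hypothesis curve : exists2 d : R, 0 < d &
  forall t : R, `|t| < d -> w (p + t *: g1 + t ^+ 2 *: e (pl t)) = t ^+ 4 + w p.
Hypothesis lower : forall (c : 'rV[R]_n.+1) (del : R), 0 < del -> exists2 d : R, 0 < d &
  forall t : R, `|t| < d -> (1 - del) * t ^+ 4 <= w (p + t *: g1 + t ^+ 2 *: c) - w p.

Let r1 := g1 *m Q.

(** Along the curve w - w p is exactly t^4. In the bound of the A_3 form, the leading order t^8
    shows that g1 has no transversal part, and the order t^16 gives 1 = K r^4 + sum om_i ze_i^2,
    where ze_i is the transversal part of e(0) - r^2 C. The lower bound gives K r^4 >= 1, so every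
    ze_i vanishes. *)
Lemma valley : exists r E0 : R, [/\ r != 0, g1 *m Q = r *: (\row_i (i == ord0)%:R) &
  e 0 *m Q = E0 *: (\row_i (i == ord0)%:R) + r ^+ 2 *: C].
Proof.
have [QQ [C0 [K [om [M [K0 [om0 near_p]]]]]]] := form.
have QtQ : Q^T *m Q = 1%:M by rewrite mulmx1C.
have [d0 d00 cv] := curve.
pose E i w := (e w *m Q) ord0 i.
have Es i : sm 0 (E i).
  have -> : E i = fun w => \sum_j e w ord0 j * Q j i by apply/funext => u; rewrite /E mxE.
  apply: sm_sum => j _.
  by apply: smM; [exact: es|exact: sm_cst].
have c0 : sm 0 (fun w : 'rV[R]_(1 + n.+1) => w ord0 (i0 n.+1)) by exact: sm_coord.
pose T (w : 'rV[R]_(1 + n.+1)) := w ord0 (i0 n.+1).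
pose A w := r1 ord0 ord0 + T w * E ord0 w.
have As : sm 0 A by apply: smD; [exact: sm_cst|exact: smM].
have Tpl t : T (pl t) = t by exact: pt_i0.
have T0 : T 0 = 0 by rewrite /T mxE.
have A0 : A 0 = r1 ord0 ord0 by rewrite /A T0 mul0r addr0.
(* The bound of A3_form along the curves p + t g1 + t^2 c. *)
have bound (c : 'rV[R]_(1 + n.+1) -> 'rV[R]_n.+1) : smv 0 c -> exists2 d : R, 0 < d & forall t, `|t| < d ->
    let a := t * (r1 ord0 ord0 + t * (c (pl t) *m Q) ord0 ord0) in
    let z i := t * (r1 ord0 i + t * (c (pl t) *m Q) ord0 i) - C ord0 i * a ^+ 2 in
    (w (p + t *: g1 + t ^+ 2 *: c (pl t)) - (K * a ^+ 4 + \sum_(i < n.+1 | i != ord0) om ord0 i * z i ^+ 2 + w p)) ^+ 4 <=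
      M * (a ^+ 20 + (\sum_(i < n.+1 | i != ord0) z i ^+ 2) ^+ 5).
  move=> cs; pose X (u : 'rV[R]_(1 + n.+1)) := p + T u *: g1 + T u ^+ 2 *: c u.
  have Xs : smv 0 X.
    move=> j; have -> : (fun u => X u ord0 j) = (fun u => p ord0 j + T u * g1 ord0 j + T u ^+ 2 * c u ord0 j).
      by apply/funext => u; rewrite !mxE.
    by apply: smD; [apply: smD; [exact: sm_cst|apply: smM; [exact: c0|exact: sm_cst]]|apply: smM; [exact: smX|exact: cs]].
  have X0 : X 0 = p by rewrite /X T0 expr0n/= !scale0r !addr0.
  have nX := near_p; rewrite -X0 in nX.
  have [d dgt0 Hd] := near_radius (near_preim (smv_cts Xs) nX).
  exists d => // t td; have := Hd (pl t); rewrite subr0 => /(_ _)/=.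
  have -> : X (pl t) = p + t *: g1 + t ^+ 2 *: c (pl t) by rewrite /X Tpl.
  have Y i : ((p + t *: g1 + t ^+ 2 *: c (pl t) - X 0) *m Q) ord0 i = t * (r1 ord0 i + t * (c (pl t) *m Q) ord0 i).
    have -> : p + t *: g1 + t ^+ 2 *: c (pl t) - X 0 = t *: g1 + t ^+ 2 *: c (pl t).
      by rewrite X0; apply/rowP => j; rewrite !mxE; ring.
    rewrite mulmxDl -!scalemxAl -/r1 mxE [X in X + _]mxE [X in _ + X]mxE; ring.
  move=> H; have {H} := H (pt_lt td _); rewrite normr0 => /(_ (le_lt_trans (normr_ge0 t) td)).
  rewrite X0 in Y *; rewrite !Y; under eq_bigr do rewrite Y.
  by under [X in _ <= _ * (_ + X ^+ 5) -> _]eq_bigr do rewrite Y.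
have [d1 d10 b1] := bound e es.
have dm : 0 < Num.min d0 d1 by rewrite lt_min d00.
pose Z i w := r1 ord0 i + T w * E i w - C ord0 i * T w * A w ^+ 2.
have Zs i : sm 0 (Z i).
  apply: smB; first by apply: smD; [exact: sm_cst|exact: smM].
  by apply: smM; [apply: smM => //; exact: sm_cst|exact: smX].
have Z0 i : Z i 0 = r1 ord0 i by rewrite /Z T0 mulr0 !mul0r subr0 addr0.
have b1' t : `|t| < Num.min d0 d1 ->
    (t ^+ 4 - (K * (t * A (pl t)) ^+ 4 + \sum_(i < n.+1 | i != ord0) om ord0 i * (t * Z i (pl t)) ^+ 2)) ^+ 4 <=
    M * ((t * A (pl t)) ^+ 20 + (\sum_(i < n.+1 | i != ord0) (t * Z i (pl t)) ^+ 2) ^+ 5).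
  rewrite lt_min => /andP[t0 t1]; have /= := b1 t t1; rewrite cv//.
  have Zt i : t * (r1 ord0 i + t * (e (pl t) *m Q) ord0 i) - C ord0 i * (t * A (pl t)) ^+ 2 = t * Z i (pl t).
    by rewrite -[(e (pl t) *m Q) ord0 i]/(E i (pl t)) /Z Tpl; ring.
  have At : t * (r1 ord0 ord0 + t * (e (pl t) *m Q) ord0 ord0) = t * A (pl t) by rewrite /A Tpl.
  rewrite At; under eq_bigr do rewrite Zt.
  under [X in _ <= _ * (_ + X ^+ 5) -> _]eq_bigr do rewrite Zt.
  by rewrite [X in (t ^+ 4 + _ - X) ^+ 4 <= _ -> _]addrC [t ^+ 4 + _]addrC opprD addrACA subrr add0r.
have sumM (F : 'I_n.+1 -> R) (c : R) : \sum_(i < n.+1 | i != ord0) (c * F i) ^+ 2 = c ^+ 2 * \sum_(i < n.+1 | i != ord0) F i ^+ 2.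
  by rewrite mulr_sumr; apply: eq_bigr => i _; rewrite exprMn.
have sumO (F : 'I_n.+1 -> R) (c : R) : \sum_(i < n.+1 | i != ord0) om ord0 i * (c * F i) ^+ 2 =
    c ^+ 2 * \sum_(i < n.+1 | i != ord0) om ord0 i * F i ^+ 2.
  by rewrite mulr_sumr; apply: eq_bigr => i _; rewrite exprMn mulrCA.
have om_eq0 (F : 'I_n.+1 -> R) : \sum_(i < n.+1 | i != ord0) om ord0 i * F i ^+ 2 <= 0 -> forall i, i != ord0 -> F i = 0.
  move=> s0 i in0; have : \sum_(i < n.+1 | i != ord0) om ord0 i * F i ^+ 2 == 0.
    rewrite eq_le s0/=; apply: sumr_ge0 => j j0; by rewrite mulr_ge0 ?sqr_ge0// ltW// om0.
  rewrite psumr_eq0; last by move=> j j0; rewrite mulr_ge0 ?sqr_ge0// ltW// om0.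
  by move=> /allP /(_ i (mem_index_enum i)); rewrite in0/= mulf_eq0 gt_eqF ?om0//= sqrf_eq0 => /eqP.
have Sms (F : 'I_n.+1 -> 'rV[R]_(1 + n.+1) -> R) : (forall i, sm 0 (F i)) -> sm 0 (fun u => \sum_(i < n.+1 | i != ord0) F i u ^+ 2).
  by move=> Fs; apply: sm_sum => i _; exact: smX.
have Oms (F : 'I_n.+1 -> 'rV[R]_(1 + n.+1) -> R) : (forall i, sm 0 (F i)) -> sm 0 (fun u => \sum_(i < n.+1 | i != ord0) om ord0 i * F i u ^+ 2).
  by move=> Fs; apply: sm_sum => i _; apply: smM; [exact: sm_cst|exact: smX].
have r1i i : i != ord0 -> r1 ord0 i = 0.
  pose P1 u := T u ^+ 2 - K * T u ^+ 2 * A u ^+ 4 - \sum_(i < n.+1 | i != ord0) om ord0 i * Z i u ^+ 2.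
  pose f u := P1 u ^+ 4 - M * (T u ^+ 12 * A u ^+ 20 + T u ^+ 2 * (\sum_(i < n.+1 | i != ord0) Z i u ^+ 2) ^+ 5).
  have P1s : sm 0 P1.
    apply: smB; last exact: Oms.
    apply: smB; first exact: smX.
    by apply: smM; [apply: smM; [exact: sm_cst|exact: smX]|exact: smX].
  have fs : sm 0 f.
    apply: smB; first exact: smX.
    apply: smM; first exact: sm_cst.
    by apply: smD; apply: smM; [exact: smX|exact: smX|exact: smX|apply: smX; exact: Sms].
  have := line_le0 dm fs; rewrite /f /P1 T0 !expr0n/= !(mulr0, mul0r) !addr0 !subr0 sub0r.
  under eq_bigr do rewrite Z0.
  move=> H; apply: (@om_eq0 (fun i => r1 ord0 i)); rewrite le_eqVlt; apply/orP; left.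
  rewrite -oppr_eq0; apply/eqP/pow4_le0; rewrite mulr0 subr0 in H.
  apply: H => t td tn0; have := b1' t td; rewrite sumM sumO Tpl subr_le0.
  set S1 := \sum_(i < n.+1 | i != ord0) om ord0 i * _; set S2 := \sum_(i < n.+1 | i != ord0) _ ^+ 2; set a := A _.
  have t8 : 0 < t ^+ 8 by rewrite -[8%N]/(2 * 4)%N exprM exprn_gt0// exprn_even_gt0.
  have -> : (t ^+ 4 - (K * (t * a) ^+ 4 + t ^+ 2 * S1)) ^+ 4 = t ^+ 8 * (t ^+ 2 - K * t ^+ 2 * a ^+ 4 - S1) ^+ 4 by ring.
  have -> : M * ((t * a) ^+ 20 + (t ^+ 2 * S2) ^+ 5) = t ^+ 8 * (M * (t ^+ 12 * a ^+ 20 + t ^+ 2 * S2 ^+ 5)) by ring.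
  by rewrite ler_pM2l.
pose ze i u := E i u - C ord0 i * A u ^+ 2.
have zes i : sm 0 (ze i) by apply: smB => //; apply: smM; [exact: sm_cst|exact: smX].
have Zze i t : i != ord0 -> Z i (pl t) = t * ze i (pl t) by move=> in0; rewrite /Z /ze r1i// Tpl; ring.
have sum1 : 1 = K * r1 ord0 ord0 ^+ 4 + \sum_(i < n.+1 | i != ord0) om ord0 i * ze i 0 ^+ 2.
  pose P2 u := 1 - K * A u ^+ 4 - \sum_(i < n.+1 | i != ord0) om ord0 i * ze i u ^+ 2.
  pose f u := P2 u ^+ 4 - M * (T u ^+ 4 * A u ^+ 20 + T u ^+ 4 * (\sum_(i < n.+1 | i != ord0) ze i u ^+ 2) ^+ 5).
  have P2s : sm 0 P2.
    apply: smB; last exact: Oms.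
    by apply: smB; [exact: sm_cst|apply: smM; [exact: sm_cst|exact: smX]].
  have fs : sm 0 f.
    apply: smB; first exact: smX.
    apply: smM; first exact: sm_cst.
    by apply: smD; apply: smM; [exact: smX|exact: smX|exact: smX|apply: smX; exact: Sms].
  have := line_le0 dm fs; rewrite /f T0 !expr0n/= !mul0r addr0 mulr0 subr0 => H.
  suff : P2 0 = 0 by rewrite /P2 A0 => /eqP; rewrite -addrA -opprD subr_eq0 => /eqP.
  apply: pow4_le0; apply: H => t td tn0; have := b1' t td.
  rewrite (eq_bigr (fun i => om ord0 i * (t ^+ 2 * ze i (pl t)) ^+ 2)); last by move=> i in0; rewrite Zze//; ring.
  rewrite [X in _ <= _ * (_ + X ^+ 5) -> _](eq_bigr (fun i => (t ^+ 2 * ze i (pl t)) ^+ 2)); last by move=> i in0; rewrite Zze//; ring.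
  rewrite sumM sumO Tpl subr_le0 /P2.
  set S1 := \sum_(i < n.+1 | i != ord0) om ord0 i * _; set S2 := \sum_(i < n.+1 | i != ord0) _ ^+ 2; set a := A _.
  have t16 : 0 < t ^+ 16 by rewrite -[16%N]/(2 * 8)%N exprM exprn_gt0// exprn_even_gt0.
  have -> : (t ^+ 4 - (K * (t * a) ^+ 4 + (t ^+ 2) ^+ 2 * S1)) ^+ 4 = t ^+ 16 * (1 - K * a ^+ 4 - S1) ^+ 4 by ring.
  have -> : M * ((t * a) ^+ 20 + ((t ^+ 2) ^+ 2 * S2) ^+ 5) = t ^+ 16 * (M * (t ^+ 4 * a ^+ 20 + t ^+ 4 * S2 ^+ 5)) by ring.
  by rewrite ler_pM2l.
pose r := r1 ord0 ord0.
have Kr : 1 <= K * r ^+ 4.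
  rewrite leNgt; apply/negP => Kr.
  (* The parabola with this c has z = 0 in the A_3 form, so w - w p there is K r^4 t^4 up to higher
     order; the lower bound (1 - del) t^4 then contradicts K r^4 < 1. *)
  pose c := (r ^+ 2 *: C) *m Q^T.
  have cQ i : (c *m Q) ord0 i = r ^+ 2 * C ord0 i by rewrite /c -mulmxA QtQ mulmx1 mxE.
  have [d2 d20 b2] := bound (fun=> c) (fun j => sm_cst _ (c ord0 j)).
  pose del := (1 - K * r ^+ 4) / 2.
  have del0 : 0 < del by rewrite divr_gt0// subr_gt0.
  have [d3 d30 lo] := lower c del0.
  have dm' : 0 < Num.min d2 d3 by rewrite lt_min d20.
  pose f u := del ^+ 4 - M * (T u ^+ 4 * r ^+ 20).
  have fs : sm 0 f by apply: smB; [exact: sm_cst|apply: smM; [exact: sm_cst|apply: smM; [exact: smX|exact: sm_cst]]].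
  have := line_le0 dm' fs; rewrite /f T0 expr0n/= mul0r mulr0 subr0 leNgt exprn_gt0//= => H.
  suff : false by []; apply: H => t; rewrite lt_min => /andP[t2 t3] tn0.
  have /= := b2 t t2; rewrite !cQ C0 !mulr0 addr0 -/r.
  have z0 i : i != ord0 -> t * (r1 ord0 i + t * (r ^+ 2 * C ord0 i)) - C ord0 i * (t * r) ^+ 2 = 0.
    by move=> in0; rewrite r1i//; ring.
  rewrite big1; last by move=> i in0; rewrite cQ z0// expr0n/= mulr0.
  rewrite big1; last by move=> i in0; rewrite cQ z0// expr0n.
  rewrite addr0 expr0n/= addr0 Tpl subr_le0 => H1.
  have H2 := lo t t3.
  have t4 : 0 < t ^+ 4 by rewrite -[4%N]/(2 * 2)%N exprM exprn_gt0// exprn_even_gt0.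
  have t16 : 0 < t ^+ 16 by rewrite -[16%N]/(4 * 4)%N exprM exprn_gt0.
  rewrite -(ler_pM2l t16); have -> : t ^+ 16 * (M * (t ^+ 4 * r ^+ 20)) = M * (t * r) ^+ 20 by ring.
  apply: le_trans H1; have -> : t ^+ 16 * del ^+ 4 = (t ^+ 4 * del) ^+ 4 by ring.
  have tdel : 0 <= t ^+ 4 * del by rewrite mulr_ge0 ?ltW.
  have : t ^+ 4 * del <= w (p + t *: g1 + t ^+ 2 *: c) - (K * (t * r) ^+ 4 + w p).
    have -> : K * (t * r) ^+ 4 = K * r ^+ 4 * t ^+ 4 by ring.
    have e2 : 1 - del = K * r ^+ 4 + del by rewrite /del; field.
    by move: H2; rewrite e2 mulrDl [del * _]mulrC; lra.
  by move=> H3; apply: lerXn2r; rewrite ?nnegrE// (le_trans tdel).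
have rn0 : r != 0.
  by apply: contraTneq Kr => ->; rewrite expr0n/= mulr0 -ltNge ltr01.
have ze0 : forall i, i != ord0 -> ze i 0 = 0.
  by apply: om_eq0; move: sum1 Kr; rewrite -/r; lra.
exists r, (E ord0 0); split=> //.
  apply/rowP => i; rewrite -/r1 [RHS]mxE [X in _ * X]mxE; have [->|in0] := eqVneq i ord0; first by rewrite mulr1.
  by rewrite r1i// mulr0.
apply/rowP => i; rewrite -[LHS]/(E i 0) [RHS]mxE [X in X + _]mxE [X in _ * X + _]mxE [X in _ + X]mxE; have [->|in0] := eqVneq i ord0; first by rewrite C0 mulr0 addr0 mulr1.
by have /eqP := ze0 i in0; rewrite /ze A0 subr_eq0 => /eqP ->; rewrite mulr0 add0r mulrC.
Qed.

End Valley.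

Section AlongLine.
Variables (R : realType) (m : nat).
Local Notation D j f := (iter j (pd (i0 m)) f).

Lemma pd_line_eq (F F' : 'rV[R]_(1 + m) -> R) z (d : R) : (forall t, `|t| < d -> F (pt t z) = F' (pt t z)) ->
  forall t, `|t| < d -> pd (i0 m) F (pt t z) = pd (i0 m) F' (pt t z).
Proof.
move=> H t td; have lin (f : 'rV[R]_(1 + m) -> R) : pd (i0 m) f (pt t z) = 'D_1 (fun s : R => f (pt s z)) t.
  rewrite /pd; have [|-> //] := @derive_quot _ _ _ _ f (fun s : R => f (pt s z)) (pt t z) (ev R (i0 m)) t (1 : R).
  by move=> h; rewrite addrC -pt_add; congr (f (pt _ _)); rewrite addrC [_ *: 1]mulr1.
rewrite !lin; apply: near_eq_derive.
have d0 : 0 < d - `|t| by rewrite subr_gt0.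
move: (nbhsx_ballx_norm t d0); apply: filterS => s sd; apply: H.
by rewrite -(subrK t s); apply: (le_lt_trans (ler_normD _ _)); rewrite -ltrBrDr.
Qed.

Lemma iter_pd_quartic (F : 'rV[R]_(1 + m) -> R) (c d : R) : 0 < d ->
  (forall t, `|t| < d -> F (pt t 0) = t ^+ 4 + c) -> [/\ D 1 F 0 = 0, D 2 F 0 = 0, D 3 F 0 = 0 & D 4 F 0 = 24].
Proof.
move=> d0 H; pose x (w : 'rV[R]_(1 + m)) := w ord0 (i0 m).
have xs w k : sm w (fun w => x w ^+ k) by apply: smX; exact: sm_coord.
have xc w : sm w x by exact: sm_coord.
have px w : pd (i0 m) x w = 1 by rewrite pd_coord eqxx.
have pk k (a : R) w : pd (i0 m) (fun w => a * x w ^+ k.+1) w = a * (k.+1%:R * x w ^+ k).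
  by rewrite pdZ// pdX// px mulr1.
have E0 t : `|t| < d -> F (pt t 0) = x (pt t 0) ^+ 4 + c by move=> /H ->; rewrite /x pt_i0.
have E1 t : `|t| < d -> D 1 F (pt t 0) = 4 * x (pt t 0) ^+ 3.
  move=> td; rewrite -[LHS]/(pd (i0 m) F (pt t 0)) (@pd_line_eq _ (fun w => x w ^+ 4 + c) 0 d E0 t td) pdD//; last exact: sm_cst.
  by rewrite pd_cst addr0 pdX// px mulr1.
have E2 t : `|t| < d -> D 2 F (pt t 0) = 12 * x (pt t 0) ^+ 2.
  move=> td; rewrite -[LHS]/(pd (i0 m) (D 1 F) (pt t 0)) (@pd_line_eq _ (fun w => 4 * x w ^+ 3) 0 d E1 t td) pk.
  by move: (x _) => u; ring.
have E3 t : `|t| < d -> D 3 F (pt t 0) = 24 * x (pt t 0) ^+ 1.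
  move=> td; rewrite -[LHS]/(pd (i0 m) (D 2 F) (pt t 0)) (@pd_line_eq _ (fun w => 12 * x w ^+ 2) 0 d E2 t td) pk.
  by move: (x _) => u; ring.
have E4 t : `|t| < d -> D 4 F (pt t 0) = 24.
  move=> td; rewrite -[LHS]/(pd (i0 m) (D 3 F) (pt t 0)) (@pd_line_eq _ (fun w => 24 * x w ^+ 1) 0 d E3 t td) pk.
  by move: (x _) => u; ring.
have n0 : `|0 : R| < d by rewrite normr0.
have x0 : x (pt 0 0) = 0 by rewrite /x pt_i0.
rewrite -pt00 (E1 _ n0) (E2 _ n0) (E3 _ n0) (E4 _ n0) x0 expr1 !expr0n/= !mulr0.
by split.
Qed.

End AlongLine.

Section DirectionalScaling.
Variables (R : realType) (m : nat).

Lemma derive_scale (f : 'rV[R]_m -> R) x (c : R) (i : 'I_m) : sm x f -> 'D_(c *: ev R i) f x = c * pd i f x.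
Proof.
move=> fs; have D1 := sm_dir (c *: ev R i) fs; have D2 := sm_dir (ev R i) fs.
rewrite /pd (@derive_val _ _ _ _ _ _ _ D1) (@derive_val _ _ _ _ _ _ _ D2) /dirsum mulr_sumr.
by apply: eq_bigr => j _; rewrite mxE mulrA.
Qed.

End DirectionalScaling.

Section QuarticClose.
Variable R : realType.

Lemma solve_coord (xl gl pl t u v : R) : xl - gl = xl - pl + t * (u + t * v) -> gl = pl + t * - u + t ^+ 2 * - v.
Proof. by move=> E; rewrite -[LHS](subKr xl) E; ring. Qed.

Lemma norm_diff3 m (a b a' b' : 'rV[R]_m) (e t : R) : `|a' - b'| <= e / 2 * t -> `|b - b'| <= e / 4 * t ->
  `|a - a'| <= e / 4 * t -> `|a - b| <= e * t.
Proof.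
move=> k1 k2 k3; have -> : a - b = (a - a') - (b - b') + (a' - b') by apply/rowP => k; rewrite !mxE; ring.
apply: (le_trans (ler_normD _ _)); have := ler_normB (a - a') (b - b').
lra.
Qed.

Lemma quartic_close (del t x : R) : 0 < Num.min (del / 4) (1 / 2) -> `|x - t| <= Num.min (del / 4) (1 / 2) * `|t| ->
  (1 - del) * t ^+ 4 <= x ^+ 4.
Proof.
set eta := Num.min _ _ => eta0 xt.
have e1 : eta <= del / 4 by rewrite ge_min lexx.
have e2 : eta <= 1 / 2 by rewrite ge_min lexx orbT.
have xl : (1 - eta) * `|t| <= `|x|.
  by have := ler_normB x (x - t); rewrite subKr; lra.
have x2 : (1 - eta) ^+ 2 * t ^+ 2 <= x ^+ 2.
  have -> : (1 - eta) ^+ 2 * t ^+ 2 = ((1 - eta) * `|t|) ^+ 2 by rewrite exprMn real_normK ?num_real.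
  by rewrite -[x ^+ 2]real_normK ?num_real// lerXn2r ?nnegrE// mulr_ge0//; lra.
have k2 : 1 - 2 * eta <= (1 - eta) ^+ 2 by rewrite expr2; nra.
have x2' : (1 - 2 * eta) * t ^+ 2 <= x ^+ 2 by apply: le_trans x2; rewrite ler_wpM2r ?sqr_ge0.
have h0 : 0 <= (1 - 2 * eta) * t ^+ 2 by rewrite mulr_ge0 ?sqr_ge0//; lra.
have -> : x ^+ 4 = (x ^+ 2) ^+ 2 by rewrite -exprM.
apply: (@le_trans _ _ (((1 - 2 * eta) * t ^+ 2) ^+ 2)); last by rewrite lerXn2r ?nnegrE ?sqr_ge0.
rewrite exprMn -exprM ler_wpM2r//; first exact: exprn_even_ge0.
by rewrite expr2; nra.
Qed.

End QuarticClose.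

(** * The branch of the value near an A_3 minimum *)

Section DegenerateBranch.
Variables (R : realType) (n : nat) (phi0 : 'rV[R]_n.+1 -> R) (xs : 'rV[R]_n.+1) (ts : R).
Hypothesis phi0_smooth : smooth_on [set: 'rV[R]_n.+1] phi0.
Hypothesis ts0 : 0 < ts.
Local Notation N := n.+1.
Local Notation D j f := (iter j (pd (i0 N)) f).
Let w a := phi0 a + sqdist a xs / (2 * ts).
Local Notation act := (act phi0).
Variable p : 'rV[R]_N.

Lemma quartic_coords : min_type_A 2 w p -> exists (h : 'rV[R]_N -> 'rV[R]_N) (g : 'rV[R]_(1 + n) -> 'rV[R]_N) (d : R),
  [/\ 0 < d, smv p h & h p = 0] /\ [/\ g 0 = p, forall u, `|u| < d -> smv u g,
    forall u, `|u| < d -> h (g u) = u &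
    forall u, `|u| < d -> w (g u) = u ord0 (i0 n) ^+ 4 + \sum_j u ord0 (rshift 1 j) ^+ 2 + w p] /\
  exists2 e : R, 0 < e & forall a, `|a - p| < e -> g (h a) = a /\ h a ord0 ord0 ^+ 4 + w p <= w a.
Proof.
move=> [h [[U [W [g [Up [h0 [Us [Ws [gh hg]]]]]]]] hw]].
have [oU _] := Us; have [oW _] := Ws.
have g0 : g 0 = p by have [_] := gh _ Up; rewrite h0.
have W0 : W 0 by have [] := gh _ Up; rewrite h0.
have gs0 : smv 0 g by exact: smooth_on_smv Ws W0.
have hw' := hw; rewrite -g0 in hw'.
have [d d0 Hd] := near_radius (near_and (open_near oW W0) (near_preim (smv_cts gs0) hw')).
have sumE (u : 'rV[R]_N) : \sum_(i < n.+1 | i != ord0) u ord0 i ^+ 2 = \sum_(j < n) u ord0 (rshift 1 j) ^+ 2.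
  rewrite big_mkcond/= big_ord_recl eqxx/= add0r; apply: eq_bigr => j _.
  by rewrite (_ : lift ord0 j = rshift 1 j :> 'I_(1 + n))//; exact: val_inj.
exists h, g, d; split; first by split=> //; exact: smooth_on_smv Us Up.
split; first split=> // u ud.
- by have [Wu _] := Hd u (ltac:(by rewrite subr0)); exact: smooth_on_smv Ws Wu.
- by have [Wu _] := Hd u (ltac:(by rewrite subr0)); have [_] := hg _ Wu.
- have [Wu] := Hd u (ltac:(by rewrite subr0)); have [_ ->] := hg _ Wu.
  rewrite g0 sumE => ->; congr (_ ^+ _ + _ + _); congr (u ord0 _); exact: val_inj.
have [e e0 He] := near_radius (near_and (open_near oU Up) hw).
exists e => // a ae; have [Ua E] := He a ae; split; first by have [_] := gh _ Ua.
by rewrite [leRHS]E lerD2r lerDl; apply: sumr_ge0 => i _; rewrite sqr_ge0.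
Qed.

Variables (h : 'rV[R]_N -> 'rV[R]_N) (g : 'rV[R]_(1 + n) -> 'rV[R]_N) (d : R).
Hypotheses (d0 : 0 < d) (g0 : g 0 = p) (gs : forall u, `|u| < d -> smv u g).
Hypothesis gw : forall u, `|u| < d -> w (g u) = u ord0 (i0 n) ^+ 4 + \sum_j u ord0 (rshift 1 j) ^+ 2 + w p.

(* The variables are the quadratic coordinates b, the quartic coordinate, and y = (x - xs) / ts. *)
Definition actg (z : 'rV[R]_(n + (1 + N))) : R :=
  act (row_mx (g (pt (rsubmx z ord0 (i0 N)) (lsubmx z))) (stime (xs + ts *: rsubmx (rsubmx z)) ts)).

Lemma actgE b (t : R) y : actg (row_mx b (pt t y)) = act (row_mx (g (pt t b)) (stime (xs + ts *: y) ts)).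
Proof. by rewrite /actg row_mxKl row_mxKr pt_i0 rsub_pt'. Qed.

Lemma actg_sm b (t : R) y : `|b| < d -> `|t| < d -> sm (row_mx b (pt t y)) actg.
Proof.
move=> bd td; pose P (z : 'rV[R]_(n + (1 + N))) := pt (rsubmx z ord0 (i0 N)) (lsubmx z).
pose X (z : 'rV[R]_(n + (1 + N))) := xs + ts *: rsubmx (rsubmx z).
have rr z j : sm z (fun z : 'rV[R]_(n + (1 + N)) => rsubmx z ord0 j) by exact: smv_rsub.
have Ps z : smv z P.
  apply: pt_cases => [|j]; first by under eq_fun do rewrite /P pt_i0; exact: rr.
  by under eq_fun do rewrite /P pt_r; exact: smv_lsub.
have Xs z : smv z X.
  move=> j; have -> : (fun z => X z ord0 j) = (fun z => xs ord0 j + ts * rsubmx z ord0 (rshift 1 j)).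
    by apply/funext => u; rewrite !mxE.
  by apply: smD; [exact: sm_cst|apply: smM; [exact: sm_cst|exact: rr]].
have P0 : P (row_mx b (pt t y)) = pt t b by rewrite /P row_mxKr row_mxKl pt_i0.
have gP : smv (row_mx b (pt t y)) (fun z => g (P z)).
  by apply: (smv_comp (Ps _)); rewrite P0; apply: gs; exact: pt_lt.
have st : smv (row_mx b (pt t y)) (fun z => stime (X z) ts) by apply: smv_row; [exact: Xs|exact: smv_cst].
apply: (sm_comp (smv_row gP st)); apply: (act_sm phi0_smooth).
by rewrite row_mxKr row_mxKr mxE eqxx mulr1n gt_eqF.
Qed.

Lemma actg_0 b (t : R) : `|b| < d -> `|t| < d ->
  actg (row_mx b (pt t 0)) = \sum_j b ord0 j ^+ 2 + (t ^+ 4 + w p).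
Proof.
move=> bd td; rewrite actgE scaler0 addr0 actE -/(w _) gw ?pt_lt// pt_i0 [X in X + w p = _]addrC -addrA.
by congr (_ + _); apply: eq_bigr => j _; rewrite pt_r.
Qed.

Lemma pd_actg_b b (t : R) i j : `|b| < d -> `|t| < d ->
  pd (lshift _ j) actg (row_mx b (pt t 0)) = 2 * b ord0 j /\
  pd (lshift _ i) (pd (lshift _ j) actg) (row_mx b (pt t 0)) = 2 * (j == i)%:R.
Proof.
move=> bd td; have xsm k (x : 'rV[R]_n) : sm x (fun x : 'rV[R]_n => x ord0 k) by exact: sm_coord.
have near_b (x : 'rV[R]_n) : `|x| < d -> \forall y \near x, `|y| < d.
  move=> xd; have e0 : 0 < d - `|x| by rewrite subr_gt0.
  move: (near_normlt x e0); apply: filterS => y yd.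
  by rewrite -(subrK x y); apply: (le_lt_trans (ler_normD _ _)); rewrite -ltrBrDr.
have E1 k x : `|x| < d -> pd k (fun b => actg (row_mx b (pt t 0))) x = 2 * x ord0 k.
  move=> xd; have -> : pd k (fun b => actg (row_mx b (pt t 0))) x = pd k (fun b => \sum_j b ord0 j ^+ 2 + (t ^+ 4 + w p)) x.
    by apply: pd_near; move: (near_b _ xd); apply: filterS => y yd; exact: actg_0.
  rewrite pdD; [|by apply: sm_sum => l _; exact: smX|exact: sm_cst].
  rewrite pd_cst addr0 pd_sum; last by move=> l _; exact: smX.
  rewrite (bigD1 k)//= big1 ?addr0; first by rewrite pdX// pd_coord eqxx mulr1 expr1.
  by move=> l /negPf lk; rewrite pdX// pd_coord lk mulr0.
have e1 := pds_lrow actg (pt t 0) [:: j]; have e2 := pds_lrow actg (pt t 0) [:: i; j].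
split; first by rewrite -[LHS]/((fun b => pds (map (lshift _) [:: j]) actg (row_mx b (pt t 0))) b) -e1; exact: E1.
rewrite -[LHS]/((fun b => pds (map (lshift _) [:: i; j]) actg (row_mx b (pt t 0))) b) -e2.
have -> : pds [:: i; j] (fun b => actg (row_mx b (pt t 0))) b = pd i (fun b => 2 * b ord0 j) b.
  by apply: pd_near; move: (near_b _ bd); apply: filterS => y yd; exact: E1.
by rewrite (pdZ i 2 (xsm j b)) pd_coord.
Qed.

Lemma pd_actg_y b (t : R) l : `|b| < d -> `|t| < d ->
  pd (rshift n (rshift 1 l)) actg (row_mx b (pt t 0)) = xs ord0 l - g (pt t b) ord0 l.
Proof.
move=> bd td; have tn : ts != 0 by rewrite gt_eqF.
pose z0 := row_mx (g (pt t b)) (stime xs ts).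
have as0 : sm z0 act by apply: (act_sm phi0_smooth); rewrite row_mxKr row_mxKr mxE eqxx mulr1n.
rewrite /pd; have [|-> _] := @derive_quot _ _ _ _ actg act (row_mx b (pt t 0)) (ev R (rshift n (rshift 1 l))) z0
  (ts *: ev R (rshift N (lshift 1 l))).
  move=> c; have -> : c *: ev R (rshift n (rshift 1 l)) + row_mx b (pt t 0) = row_mx b (pt t (c *: ev R l)).
    rewrite /ev !delta_mx_rshift /pt !scale_row_mx !add_row_mx !scaler0 !add0r.
    by rewrite addr0.
  rewrite actgE; congr (act _); rewrite /z0 /stime.
  rewrite /ev delta_mx_rshift delta_mx_lshift !scale_row_mx !add_row_mx !scaler0 !add0r.
  by rewrite addrC scalerA mulrC -scalerA.
rewrite derive_scale// act_gradx//; by rewrite mulrC divfK.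
Qed.

Hypotheses (hs : smv p h) (h0 : h p = 0) (hg : forall u, `|u| < d -> h (g u) = u).
Hypothesis near_h : exists2 e : R, 0 < e & forall a, `|a - p| < e -> g (h a) = a /\ h a ord0 ord0 ^+ 4 + w p <= w a.

Let rowp0 : row_mx 0 0 = row_mx 0 (pt 0 0) :> 'rV[R]_(n + (1 + N)).
Proof. by rewrite pt00. Qed.

Let d00 k : `|0 : 'rV[R]_k| < d. Proof. by rewrite normr0. Qed.
Let dt0 : `|0 : R| < d. Proof. by rewrite normr0. Qed.

(** The Hessian in the quadratic coordinates is twice the identity. For y = 0 these coordinates
    separate from t, so b = 0 is critical for every small t, and uniqueness makes it the branch. *)
Lemma reduced_germ : exists (A : 'rV[R]_(1 + N) -> 'rV[R]_n), [/\ smv 0 A, A 0 = 0,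
  \forall t \near (0 : 'rV[R]_(1 + N)), forall i, pd (lshift _ i) actg (row_mx (A t) t) = 0,
  exists2 e : R, 0 < e & forall b (t : 'rV[R]_(1 + N)), `|b| < e -> `|t| < e ->
    (forall i, pd (lshift _ i) actg (row_mx b t) = 0) -> b = A t &
  exists2 e : R, 0 < e & forall t : R, `|t| < e -> A (pt t 0) = 0].
Proof.
have F0 : sm (row_mx 0 0) actg by rewrite rowp0; exact: actg_sm.
have F1 i : pd (lshift _ i) actg (row_mx 0 0) = 0.
  by rewrite rowp0; have [-> _] := @pd_actg_b 0 0 i i (d00 _) dt0; rewrite mxE mulr0.
have [|A [As A0 Ac Au]] := critical_branch F0 F1.
  have -> : \matrix_(i, j) pd (lshift (1 + N) i) (pd (lshift (1 + N) j) actg) (row_mx 0 0) = 2%:M.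
    apply/matrixP => i j; rewrite mxE rowp0; have [_ ->] := @pd_actg_b 0 0 i j (d00 _) dt0.
    by rewrite !mxE eq_sym mulr_natr.
  by rewrite unitmxE det_scalar unitfE expf_neq0// pnatr_eq0.
exists A; have [e e0 He] := near_row Au; split=> //.
  exists e => // b t be te cr; have := He b t; rewrite !subr0 => /(_ be te cr).
  by rewrite row_mxKl row_mxKr.
exists (Num.min e d); first by rewrite lt_min e0.
move=> t; rewrite lt_min => /andP[te td].
have te' : `|pt t (0 : 'rV[R]_N) - 0| < e by rewrite subr0; apply: pt_lt; rewrite ?normr0.
have z0 : `|(0 : 'rV[R]_n) - 0| < e by rewrite subr0 normr0.
have := He 0 (pt t 0) z0 te'; rewrite row_mxKl row_mxKr => H; symmetry; apply: H.
by move=> i; have [-> _] := @pd_actg_b 0 t i i (d00 _) td; rewrite mxE mulr0.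
Qed.

(** Near p, w - w p is at least the fourth power of the quartic coordinate. That coordinate equals t
    on the given curve, and replacing e by c moves the point by O(t^2) only, so it remains t +
    o(t). *)
Lemma lower_bound (g1 : 'rV[R]_N) (e : 'rV[R]_(1 + N) -> 'rV[R]_N) (r : R) : 0 < r -> smv 0 e ->
  (forall t, `|t| < r -> h (p + t *: g1 + t ^+ 2 *: e (pt t 0)) ord0 ord0 = t) ->
  forall (c : 'rV[R]_N) (del : R), 0 < del -> exists2 r' : R, 0 < r' &
  forall t : R, `|t| < r' -> (1 - del) * t ^+ 4 <= w (p + t *: g1 + t ^+ 2 *: c) - w p.
Proof.
move=> r0 es he c del del0; have [eh eh0 Hh] := near_h.
pose eta := Num.min (del / 4) (1 / 2).
have eta0 : 0 < eta by rewrite lt_min !divr_gt0.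
pose B := `|c| + `|e 0| + 1; have B0 : 0 < B by rewrite ltr_wpDl// addr_ge0.
pose M := `|g1| + B; have M0 : 0 < M by rewrite ltr_wpDl.
have [J J0 HJ] := mulmx_bound (jac h p).
have ep0 : 0 < eta / (4 * M) by rewrite divr_gt0// mulr_gt0.
have [rv rv0 Hv] := near_radius (smv_expand hs ep0).
have [re re0 He] := near_radius (dist_cts (smv_cts es) ltr01).
pose q := Num.min (Num.min r re) (Num.min (Num.min 1 (rv / M)) (Num.min (eh / M) (eta / (4 * J * B)))).
have q0 : 0 < q by rewrite !lt_min r0 re0 ltr01 !divr_gt0// !mulr_gt0.
exists q => // t; rewrite !lt_min => /andP[/andP[tr tre] /andP[/andP[t1 trv] /andP[teh tB]]].
have eB : `|e (pt t 0)| <= B.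
  have := He (pt t 0); rewrite subr0 => /(_ (pt_lt tre _)); rewrite normr0 => /(_ re0) H.
  have := ler_normB (e 0) (e 0 - e (pt t 0)); rewrite subKr; have := normr_ge0 c; rewrite /B; lra.
have cB : `|c| <= B by rewrite /B -addrA lerDl addr_ge0.
have tt : `|t ^+ 2| = `|t| * `|t| by rewrite expr2 normrM.
have vb (u : 'rV[R]_N) : `|u| <= B -> `|t *: g1 + t ^+ 2 *: u| <= `|t| * M.
  move=> uB; apply: (le_trans (ler_normD _ _)); rewrite !normrZ /M mulrDr lerD//.
  rewrite ?tt -mulrA ler_wpM2l//; apply: le_trans uB.
  by rewrite ler_piMl// ltW.
have vs (u : 'rV[R]_N) (l : R) : `|u| <= B -> `|t| < l / M -> `|t *: g1 + t ^+ 2 *: u| < l.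
  by move=> uB tl; apply: le_lt_trans (vb u uB) _; rewrite -ltr_pdivlMr.
have Ev (u : 'rV[R]_N) : `|u| <= B -> `|h (p + (t *: g1 + t ^+ 2 *: u)) - (t *: g1 + t ^+ 2 *: u) *m jac h p| <= eta / 4 * `|t|.
  move=> uB; have := Hv (t *: g1 + t ^+ 2 *: u); rewrite subr0 => /(_ (vs u rv uB trv)).
  rewrite h0 subr0 => /le_trans; apply.
  apply: (@le_trans _ _ (eta / (4 * M) * (`|t| * M))); first by rewrite ler_pM2l//; exact: vb.
  by rewrite (_ : eta / (4 * M) * (`|t| * M) = eta / 4 * `|t|)//; field; rewrite gt_eqF.
have dJ : `|(t *: g1 + t ^+ 2 *: c) *m jac h p - (t *: g1 + t ^+ 2 *: e (pt t 0)) *m jac h p| <= eta / 2 * `|t|.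
  have -> : (t *: g1 + t ^+ 2 *: c) *m jac h p - (t *: g1 + t ^+ 2 *: e (pt t 0)) *m jac h p = (t ^+ 2 *: (c - e (pt t 0))) *m jac h p.
    by rewrite -mulmxBl; congr (_ *m _); rewrite scalerBr opprD addrACA subrr add0r.
  apply: (le_trans (HJ _)); rewrite normrZ tt -mulrA mulrCA [leRHS]mulrC ler_wpM2l//.
  apply: (@le_trans _ _ (J * (`|t| * (2 * B)))).
    rewrite ler_pM2l// ler_wpM2l//; apply: (le_trans (ler_normB _ _)); lra.
  have : `|t| * (4 * J * B) <= eta by rewrite -ler_pdivlMr ?mulr_gt0// ltW.
  lra.
have key : `|h (p + t *: g1 + t ^+ 2 *: c) ord0 ord0 - t| <= eta * `|t|.
  rewrite -[X in _ - X](he t tr) -!addrA.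
  have := coord_le (h (p + (t *: g1 + t ^+ 2 *: c)) - h (p + (t *: g1 + t ^+ 2 *: e (pt t 0)))) ord0.
  rewrite mxE [X in _ + X]mxE => /le_trans; apply.
  exact: norm_diff3 dJ (Ev _ eB) (Ev c cB).
have ball_c : `|p + t *: g1 + t ^+ 2 *: c - p| < eh.
  have -> : p + t *: g1 + t ^+ 2 *: c - p = t *: g1 + t ^+ 2 *: c by rewrite [LHS]addrC -addrA addKr.
  exact: vs.
have [ga] := Hh _ ball_c.
rewrite -lerBrDr; apply: le_trans.
exact: quartic_close eta0 key.
Qed.

(** The x-gradient of the action is affine in the minimizer a, so the differentials of the Taylor
    coefficients of the reduced germ are those of the curve g(t, 0) = p + t g1 + t^2 e(t): the order
    t gives g1, the order t^2 gives e(0). *)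
Lemma degenerate_branch : exists (al be s : 'rV[R]_N -> R) (kap : R) (g1 : 'rV[R]_N) (e : 'rV[R]_(1 + N) -> 'rV[R]_N),
  [/\ branch_at phi0 xs ts p (fun x => qmin (al x) (be x) + s x), sm xs al, sm xs be & sm xs s] /\
  [/\ al xs = 0, be xs = 0 & s xs = w p] /\
  (forall l, [/\ pd l al xs = - (e 0 ord0 l + kap * g1 ord0 l) / ts, pd l be xs = - g1 ord0 l / ts &
     pd l s xs = (xs ord0 l - p ord0 l) / ts]) /\
  [/\ smv 0 e, exists2 r : R, 0 < r & forall t, `|t| < r -> w (p + t *: g1 + t ^+ 2 *: e (pt t 0)) = t ^+ 4 + w p &
  forall (c : 'rV[R]_N) (del : R), 0 < del -> exists2 r : R, 0 < r &
    forall t : R, `|t| < r -> (1 - del) * t ^+ 4 <= w (p + t *: g1 + t ^+ 2 *: c) - w p].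
Proof.
have [A [As A0 Ac [ea ea0 Au] [e1 e10 A1]]] := reduced_germ; have [eh eh0 Hh] := near_h.
pose G z := actg (row_mx (A z) z).
have rs : smv 0 (fun z => row_mx (A z) z) by apply: smv_row => //; exact: smv_id.
have F0 : sm (row_mx (A 0) 0) actg by rewrite A0 rowp0; exact: actg_sm.
have Gs : sm 0 G by exact: (sm_comp rs F0).
pose d1 := Num.min e1 d; have d10 : 0 < d1 by rewrite lt_min e10.
have sub t : `|t| < d1 -> `|t| < e1 /\ `|t| < d by rewrite lt_min => /andP[].
have G4 t : `|t| < d1 -> G (pt t 0) = t ^+ 4 + w p.
  move=> /sub[te td]; rewrite /G A1// actg_0// big1 ?add0r// => j _.
  by rewrite mxE expr0n.
have [D1 D2 D3 D4] := iter_pd_quartic d10 G4.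
have [al [be [s [kap [[als bes ss] [[al0 be0 s0] [pds' [dG dG0 HG]]]]]]]] := germ_normal_form Gs D1 D2 D3 D4.
(* Schwarz: the y-derivatives of the Taylor coefficients of G are those of the curve t |-> g (pt t 0). *)
pose X l := pd (rshift 1 l) G.
have Xs l : sm 0 (X l) by exact: sm_pd.
have XE : exists2 r : R, 0 < r & forall l t, `|t| < r -> X l (pt t 0) = xs ord0 l - g (pt t 0) ord0 l.
  have [r r0 Hr] := near_radius (near_and (smv_near As) Ac).
  exists (Num.min r d1); first by rewrite lt_min r0.
  move=> l t; rewrite lt_min => /andP[tr /sub[te td]].
  have [|As' Ac'] := Hr (pt t 0); first by rewrite subr0; apply: pt_lt; rewrite ?normr0.
  rewrite /X pd_envelope//; last by rewrite A1//; exact: actg_sm.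
  by rewrite A1// pd_actg_y.
have [r0 r00 Xr0] := XE.
have [rr rr0 Hrr] := near_radius (near_all (fun l => sm_near (Xs l))).
have Xsm l : smU rr (X l) by move=> x dx; apply: Hrr; rewrite subr0.
have d0r : dom rr (0 : 'rV[R]_(1 + N)) by rewrite /dom /mkset normr0.
have step l : exists x2 : 'rV[R]_(1 + N) -> R, [/\ sm 0 x2, x2 0 = D 2 (X l) 0 / 2 &
    forall t, `|t| < rr -> X l (pt t 0) = X l 0 + t * (D 1 (X l) 0 + t * x2 (pt t 0))].
  have [x1 [x1s E1 H1]] := hadamard_step (i0 N) rr0 (Xsm l); have [x2 [x2s E2 H2]] := hadamard_step (i0 N) rr0 x1s.
  have c0 : (0 : 'rV[R]_(1 + N)) ord0 (i0 N) = 0 by rewrite mxE.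
  have e1' : x1 0 = D 1 (X l) 0 by have := H1 0%N 0 d0r; rewrite c0 mul0r add0r mul1r => ->.
  have e2' : x2 0 = D 2 (X l) 0 / 2.
    have q1 : D 2 (X l) 0 = 2 * D 1 x1 0 by have := H1 1%N 0 d0r; rewrite c0 mul0r add0r.
    have q2 : D 1 x1 0 = x2 0 by have := H2 0%N 0 d0r; rewrite c0 mul0r add0r mul1r.
    by rewrite q1 q2 mulrAC divff ?mul1r// pnatr_eq0.
  exists x2; split=> //; first exact: x2s.
  move=> t tr; have dt : dom rr (pt t (0 : 'rV[R]_N)) by apply: pt_lt; rewrite ?normr0.
  have z0 : zc (i0 N) (pt t 0) = 0 :> 'rV[R]_(1 + N).
    apply/rowP; apply: pt_cases => [|j]; rewrite zcE ?eqxx [RHS]mxE//.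
    by rewrite pt_r mxE.
  by rewrite (E1 _ dt) (E2 _ dt) z0 pt_i0 e1'.
have [x2 Hx2] := choice step.
pose g1 : 'rV[R]_N := \row_l - D 1 (X l) 0.
pose e (z : 'rV[R]_(1 + N)) : 'rV[R]_N := \row_l - x2 l z.
have es : smv 0 e.
  by move=> l; under eq_fun do rewrite /e mxE; apply: smN; have [] := Hx2 l.
have X0 l : X l 0 = xs ord0 l - p ord0 l.
  by have := Xr0 l 0; rewrite normr0 !pt00 g0; exact.
pose r2 := Num.min (Num.min r0 rr) d; have r20 : 0 < r2 by rewrite !lt_min r00 rr0.
have gE t : `|t| < r2 -> g (pt t 0) = p + t *: g1 + t ^+ 2 *: e (pt t 0).
  rewrite !lt_min => /andP[/andP[tr trr] _]; apply/rowP => l.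
  have [_ _ /(_ t trr)] := Hx2 l; rewrite Xr0// X0 !mxE; exact: solve_coord.
have td t : `|t| < r2 -> `|pt t (0 : 'rV[R]_n)| < d.
  by rewrite !lt_min => /andP[_ td]; apply: pt_lt; rewrite ?normr0.
have wE t : `|t| < r2 -> w (p + t *: g1 + t ^+ 2 *: e (pt t 0)) = t ^+ 4 + w p.
  move=> tr; rewrite -gE// gw ?td// pt_i0 big1 ?addr0// => j _.
  by rewrite pt_r mxE expr0n.
have hE t : `|t| < r2 -> h (p + t *: g1 + t ^+ 2 *: e (pt t 0)) ord0 ord0 = t.
  move=> tr; rewrite -gE// hg ?td// -[RHS](@pt_i0 R n t 0); congr (pt _ _ ord0 _); exact: val_inj.
pose Y (x : 'rV[R]_N) : 'rV[R]_N := ts^-1 *: (x - xs).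
have Y0 : Y xs = 0 by rewrite /Y subrr scaler0.
have tn : ts != 0 by rewrite gt_eqF.
have YK x : xs + ts *: Y x = x by rewrite /Y scalerA divff// scale1r addrC subrK.
have Ys x : smv x Y.
  move=> j; have -> : (fun x => Y x ord0 j) = (fun x : 'rV[R]_N => ts^-1 * (x ord0 j - xs ord0 j)).
    by apply/funext => u; rewrite !mxE.
  by apply: smM; [exact: sm_cst|apply: smB; [exact: sm_coord|exact: sm_cst]].
have cY f : sm 0 f -> sm xs (fun x => f (Y x)) by move=> fs; apply: (sm_comp (Ys xs)); rewrite Y0.
have pY f l : sm 0 f -> pd l (fun x => f (Y x)) xs = pd l f 0 / ts.
  move=> fs; rewrite [RHS]mulrC -derive_scale// /pd.
  have [|-> //] := @derive_quot _ _ _ _ (fun x => f (Y x)) f xs (ev R l) 0 (ts^-1 *: ev R l).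
  by move=> c; congr f; rewrite /Y addrK addr0 scalerA mulrC -scalerA.
have sch l : D 1 (X l) 0 = pd (rshift 1 l) (D 1 G) 0 by exact: schwarz.
have sch2 l : D 2 (X l) 0 = pd (rshift 1 l) (D 2 G) 0.
  have -> : pd (rshift 1 l) (D 2 G) 0 = pd (i0 N) (pd (rshift 1 l) (D 1 G)) 0.
    by apply: schwarz; exact: (@iter_pd_sm _ _ (i0 N) _ 1%N).
  by apply: pd_near; move: (sm_near Gs); apply: filterS => z zs; exact: schwarz.
exists (fun x => al (Y x)), (fun x => be (Y x)), (fun x => s (Y x)), kap, g1, e.
split; last first.
  split; first by rewrite Y0 al0 be0 s0 -pt00 G4 ?normr0// expr0n/= add0r.
  split.
    move=> l; rewrite !pY//; have [-> -> ->] := pds' l.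
    have [_ e20 _] := Hx2 l; rewrite /g1 /e !mxE e20 -sch -sch2 -/(X l) X0.
    split; last by [].
      by rewrite mulrN opprD !opprK.
    by rewrite opprK.
  split=> //; first by exists r2.
  exact: (lower_bound r20 es hE).
split; [|exact: cY|exact: cY|exact: cY].
have m0 : 0 < Num.min (Num.min (Num.min ea d) dG) eh by rewrite !lt_min ea0 d0 dG0.
have hm0 : 0 < Num.min (Num.min (Num.min ea d) dG) eh / 2 by exact: divr_gt0.
have [rh rh0 Hrh] := near_radius (dist_cts (smv_cts hs) hm0).
exists (Num.min rh eh); first by rewrite lt_min rh0.
have Yc : {for xs, continuous Y} by exact: smv_cts.
have nV : \forall x \near xs, (let z := Y x in let V := qmin (al z) (be z) + s z in
    (exists a, G (pt a z) = V) /\ forall a, `|a| < dG -> V <= G (pt a z)).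
  apply: (@near_preim _ _ Y xs (fun z => let V := qmin (al z) (be z) + s z in
    (exists a, G (pt a z) = V) /\ forall a, `|a| < dG -> V <= G (pt a z)) Yc).
  by rewrite Y0.
have nY : \forall x \near xs, `|Y x| < ea.
  apply: (@near_preim _ _ Y xs (fun z => `|z| < ea) Yc); rewrite Y0.
  by move: (near_normlt (0 : 'rV[R]_N) ea0); apply: filterS => z; rewrite subr0.
move: (near_and nV nY); apply: filterS => x [[[t tV] lb] Yx] /=.
have att : exists a, act (row_mx a (stime x ts)) = qmin (al (Y x)) (be (Y x)) + s (Y x).
  by exists (g (pt t (A (pt t (Y x))))); rewrite -tV /G actgE YK.
split=> // a; rewrite lt_min => /andP[ap aeh] am; have [a' a'E] := att.
have [ga _] := Hh a aeh.
have : `|h a| < Num.min (Num.min (Num.min ea d) dG) eh.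
  have := Hrh a ap; rewrite h0 sub0r normrN => H; apply: le_lt_trans H _.
  by rewrite ltr_pdivrMr// ltr_pMr ?ltr1n.
rewrite !lt_min => /andP[/andP[/andP[hea hd] hdG] _].
pose u : 'rV[R]_(1 + n) := h a; pose u0 := u ord0 (i0 n); pose b := rsubmx u.
have uE : pt u0 b = u by apply/rowP; apply: pt_cases => [|j]; rewrite ?pt_i0 ?pt_r// mxE.
have u0l (c : R) : `|h a| < c -> `|u0| < c by exact: le_lt_trans (coord_le u _).
have bl (c : R) : 0 < c -> `|h a| < c -> `|b| < c.
  move=> c0 hc; apply: norm_lt_coord => // j; rewrite mxE; exact: le_lt_trans (coord_le u _) hc.
have aE : act (row_mx a (stime x ts)) = actg (row_mx b (pt u0 (Y x))) by rewrite actgE YK uE ga.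
(* A minimizer is critical in the quadratic coordinates, so by uniqueness it lies on the branch A,
   and the lower bound for the reduced germ G applies to it. *)
have bA : b = A (pt u0 (Y x)).
  apply: Au; [exact: bl|by apply: pt_lt => //; exact: u0l|] => i.
  have bs : sm b (fun b => actg (row_mx b (pt u0 (Y x)))).
    apply: (@sm_comp _ _ _ (fun b => row_mx b (pt u0 (Y x))) b actg).
      by apply: smv_row; [exact: smv_id|exact: smv_cst].
    by apply: actg_sm; [exact: bl|exact: u0l].
  have E := pds_lrow actg (pt u0 (Y x)) [:: i].
  rewrite -[LHS]/((fun b => pds (map (lshift _) [:: i]) actg (row_mx b (pt u0 (Y x)))) b) -E.
  apply: (@pd_min _ _ (fun b => actg (row_mx b (pt u0 (Y x)))) b i bs); apply: filterE => b'.
  by rewrite -aE actgE YK; exact: am.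
apply/le_anti/andP; split; first by rewrite -a'E; exact: am.
by rewrite aE {1}bA; apply: lb; exact: u0l.
Qed.

End DegenerateBranch.

(** * The singularities A_3 and A_1A_3 *)

Section A3Singularities.
Variables (R : realType) (n : nat) (phi0 : 'rV[R]_n.+1 -> R) (xs : 'rV[R]_n.+1) (ts : R).
Hypothesis phi0_smooth : smooth_on [set: 'rV[R]_n.+1] phi0.
Hypothesis attained : forall (x : 'rV[R]_n.+1) (t : R), 0 < t ->
  exists a, forall b, phi0 a + sqdist a x / (2 * t) <= phi0 b + sqdist b x / (2 * t).
Hypothesis ts0 : 0 < ts.
Local Notation N := n.+1.
Let w a := phi0 a + sqdist a xs / (2 * ts).
Local Notation e0 := (\row_(i < n.+1) (i == ord0)%:R : 'rV[R]_n.+1).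

Lemma A3_branch_at p Q C : min_type_A 2 w p -> A3_form w p Q C ->
  exists (al be s : 'rV[R]_N -> R) (r r' k : R),
  [/\ branch_at phi0 xs ts p (fun x => qmin (al x) (be x) + s x), sm xs al, sm xs be & sm xs s] /\
  [/\ al xs = 0, be xs = 0 & s xs = w p] /\
  [/\ r != 0, r' != 0, forall l, pd l be xs = (r *: (e0 *m Q^T)) ord0 l,
     forall l, pd l al xs = ((k *: e0 + r' *: C) *m Q^T) ord0 l &
     forall l, pd l s xs = (xs ord0 l - p ord0 l) / ts].
Proof.
move=> pA2 form; have [h [g [d [[d0 hs h0] [[g0 gs hg gw] near_h]]]]] := quartic_coords pA2.
have [al [be [s [kap [g1 [e [[br als bes ss] [v0 [dv [es curve lower]]]]]]]]]] :=
  degenerate_branch phi0_smooth ts0 d0 g0 gs gw hs h0 hg near_h.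
have [r [E0 [rn0 g1Q eQ]]] := valley form es curve lower.
have [QQ _] := form.
have g1E : g1 = r *: (e0 *m Q^T) by rewrite scalemxAl -g1Q -mulmxA QQ mulmx1.
have eE : e 0 = (E0 *: e0 + r ^+ 2 *: C) *m Q^T by rewrite -eQ -mulmxA QQ mulmx1.
have tn : ts != 0 by rewrite gt_eqF.
exists al, be, s, (- r / ts), (- r ^+ 2 / ts), (- (E0 + kap * r) / ts); split=> //; split=> //; split.
- by rewrite mulf_neq0// ?oppr_eq0// invr_eq0.
- by rewrite mulf_neq0// ?invr_eq0// oppr_eq0 expf_neq0.
- move=> l; have [_ -> _] := dv l; rewrite g1E mxE [RHS]mxE; ring.
- move=> l; have [-> _ _] := dv l; rewrite g1E eE !mulmxDl -!scalemxAl.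
  rewrite mxE [X in - (X + _ + _)]mxE [X in - (_ + X + _)]mxE [X in - (_ + _ * X)]mxE [RHS]mxE [X in _ = X + _]mxE [X in _ = _ + X]mxE; ring.
- by move=> l; have [_ _ ->] := dv l.
Qed.

Let cancelQ (Q : 'M[R]_N) (u : 'rV[R]_N) : orthogonal_mx Q -> u *m Q^T = 0 -> u = 0.
Proof. by move=> QQ uQ; rewrite -[u]mulmx1 -(mulmx1C QQ) mulmxA uQ mul0mx. Qed.

Let e0C_free (C : 'rV[R]_N) (a b : R) : C ord0 ord0 = 0 -> C != 0 -> a *: e0 + b *: C = 0 -> a = 0 /\ b = 0.
Proof.
move=> C0 Cn E; have a0 : a = 0.
  by have := congr1 (fun u : 'rV[R]_N => u ord0 ord0) E; rewrite !mxE eqxx C0 mulr1 mulr0 addr0.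
split=> //; move: E; rewrite a0 scale0r add0r => /eqP; rewrite scaler_eq0 (negPf Cn) orbF.
by move=> /eqP.
Qed.

Lemma A3_shock p Q C : glob_minset w = [set p]%classic -> min_type_A 2 w p -> A3_form w p Q C -> C != 0 ->
  shock_point_type phi0 (@NF_A3 R n) xs ts.
Proof.
move=> pm pA2 form Cn; have pmin : glob_minset w p by rewrite pm.
have [QQ [C0 _]] := form.
have [al [be [s [r [r' [k [[br als bes ss] [[al0 be0 s0] [rn rn' dbe dal ds]]]]]]]]] := A3_branch_at pA2 form.
pose f i := if i is 0%N then al else be.
apply: (@shock_of R n phi0 xs ts 2 f s _ (fun y => qmin (y 0%N) (y 1%N))).
- by move=> y z yz; rewrite !yz.
- by [].
- by move=> [|[|i]].
- exact: ss.
- apply: linear_comb_free => c cE.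
  have : (c ord0 *: (k *: e0 + r' *: C) + c (lift ord0 ord0) *: (r *: e0)) *m Q^T = 0.
    rewrite -[RHS]cE big_ord_recl big_ord1 mulmxDl -!scalemxAl; congr (_ *: _ + _ *: _); apply/rowP => l.
      by rewrite [RHS]mxE [RHS]mxE -dal.
    by rewrite [RHS]mxE [RHS]mxE -dbe.
  move=> /(cancelQ QQ); rewrite scalerDr !scalerA addrAC -scalerDl => /(e0C_free C0 Cn)[E1 E2].
  have c0 : c ord0 = 0 by move/eqP: E2; rewrite mulf_eq0 (negPf rn') orbF => /eqP.
  have c1 : c (lift ord0 ord0) = 0 by move/eqP: E1; rewrite c0 mul0r add0r mulf_eq0 (negPf rn) orbF => /eqP.
  by move=> [[|[|i]]//= i2]; [rewrite -c0|rewrite -c1]; congr c; exact: val_inj.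
pose l := [:: (p, fun x => qmin (al x) (be x) + s x)].
have cov : forall q, glob_minset w q -> exists2 pv, List.In pv l & pv.1 = q.
  by move=> q; rewrite pm => ->; exists (p, fun x => qmin (al x) (be x) + s x) => //=; left.
have brs : forall pv, List.In pv l -> branch_at phi0 xs ts pv.1 pv.2 by move=> pv [<-|[]].
move: (@burgers_branches R n phi0 xs ts phi0_smooth attained ts0 l cov brs).
by apply: filterS => x [_ [pv [<-|[]] ->]].
Qed.

Lemma A1_A3_shock p q Q C : glob_minset w = [set p; q]%classic -> min_type_A 2 w p -> min_type_A 1 w q ->
  A3_form w p Q C -> C != 0 -> ~ kernel_plane p Q C q -> shock_point_type phi0 (@NF_A1A3 R n) xs ts.
Proof.
move=> pm pA2 qA1 form Cn nk.
have pmin : glob_minset w p by rewrite pm; left.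
have qmin' : glob_minset w q by rewrite pm; right.
have [QQ [C0 _]] := form.
have [al [be [s [r [r' [k [[br als bes ss] [[al0 be0 s0] [rn rn' dbe dal ds]]]]]]]]] := A3_branch_at pA2 form.
have [v [brv vs v0 dv]] := A1_branch_at phi0_smooth ts0 qmin' qA1.
have wpq : w p = w q by apply/le_anti/andP; split; [exact: pmin|exact: qmin'].
have vss : sm xs (fun x => v x - s x) by exact: smB.
pose f i := if i is 0%N then fun x => v x - s x else if i is 1%N then al else be.
have tn : ts != 0 by rewrite gt_eqF.
apply: (@shock_of R n phi0 xs ts 3 f s _ (fun y => Num.min (y 0%N) (qmin (y 1%N) (y 2%N)))).
- by move=> y z yz; rewrite !yz.
- by [].
- by move=> [|[|[|i]]] //= _; rewrite v0 s0 wpq subrr.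
- exact: ss.
- apply: linear_comb_free => c cE; set i1 : 'I_3 := lift ord0 ord0; set i2 : 'I_3 := lift ord0 (lift ord0 ord0).
  have : - (c ord0 / ts) *: (q - p) + (c i1 *: (k *: e0 + r' *: C) + c i2 *: (r *: e0)) *m Q^T = 0.
    rewrite -[RHS]cE !big_ord_recl big_ord0 addr0 mulmxDl -!scalemxAl; congr (_ + (_ *: _ + _ *: _)); apply/rowP => l.
    + by rewrite !mxE/= pdB// dv ds; field.
    + by rewrite [RHS]mxE [RHS]mxE -dal.
    + by rewrite [RHS]mxE [RHS]mxE -dbe.
  have -> : c i1 *: (k *: e0 + r' *: C) + c i2 *: (r *: e0) = (c i1 * k + c i2 * r) *: e0 + (c i1 * r') *: C.
    by rewrite scalerDr !scalerA addrAC -scalerDl.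
  (* A dependence with nonzero coefficient on q - p, divided by that coefficient, would exhibit q as
     a point of the kernel plane. *)
  have [c0|c0] := eqVneq (c ord0) 0; last first.
    move=> E; exfalso; apply: nk.
    have cn : c ord0 / ts != 0 by rewrite mulf_neq0// invr_eq0.
    exists ((c ord0 / ts)^-1 * (c i1 * k + c i2 * r)), ((c ord0 / ts)^-1 * (c i1 * r')).
    rewrite -!(scalerA (c ord0 / ts)^-1) -scalerDr -scalemxAl.
    move/eqP: E; rewrite addrC scaleNr subr_eq0 => /eqP ->.
    by rewrite scalerA mulVf// scale1r addrC subrK.
  rewrite c0 mul0r oppr0 scale0r add0r => /(cancelQ QQ)/(e0C_free C0 Cn)[E1 E2].
  have c1 : c i1 = 0 by move/eqP: E2; rewrite mulf_eq0 (negPf rn') orbF => /eqP.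
  have c2 : c i2 = 0 by move/eqP: E1; rewrite c1 mul0r add0r mulf_eq0 (negPf rn) orbF => /eqP.
  by move=> [[|[|[|i]]]//= i3]; [rewrite -c0|rewrite -c1|rewrite -c2]; congr c; exact: val_inj.
pose V x := qmin (al x) (be x) + s x.
pose l := [:: (p, V); (q, v)].
have cov : forall a, glob_minset w a -> exists2 pv, List.In pv l & pv.1 = a.
  by move=> a; rewrite pm => -[->|->]; [exists (p, V)|exists (q, v)] => //=; auto.
have brs : forall pv, List.In pv l -> branch_at phi0 xs ts pv.1 pv.2 by move=> pv [<-|[<-|[]]].
move: (@burgers_branches R n phi0 xs ts phi0_smooth attained ts0 l cov brs).
apply: filterS => x [lb [pv pvs E]].
have l1 := lb (p, V) (or_introl erefl); have l2 := lb (q, v) (or_intror (or_introl erefl)).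
move: pvs E l1 l2 => /= [<-|[<-|[]]] /= ->; rewrite /V.
- by move=> _ H; rewrite min_r// lerBrDr.
- by move=> H _; rewrite min_l ?subrK// lerBlDr.
Qed.

End A3Singularities.

Unset Implicit Arguments.

(* d = n.+1 is the space dimension *)
Theorem theorem2 (R : realType) (n : nat) (phi0 : 'rV[R]_n.+1 -> R)
  (xs : 'rV[R]_n.+1) (ts : R) :
  smooth_on [set: 'rV[R]_n.+1] phi0 ->
  (* standing assumption: the minimum defining phi is attained *)
  (forall (x : 'rV[R]_n.+1) (t : R), 0 < t ->
     exists a, forall b, phi0 a + sqdist a x / (2 * t) <= phi0 b + sqdist b x / (2 * t)) ->
  0 < ts ->
  let w := fun a => phi0 a + sqdist a xs / (2 * ts) in
  (* (i) *)
  ((n <= 2)%N ->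
     (exists p, glob_minset w = [set p]%classic /\ min_type_A 1 w p) ->
     ~ in_shock phi0 xs ts) /\
  (* (ii) *)
  ((n <= 2)%N ->
     (exists p1 p2, p1 <> p2 /\ glob_minset w = [set p1; p2]%classic /\
        min_type_A 1 w p1 /\ min_type_A 1 w p2) ->
     shock_point_type phi0 (@NF_A1_2 R n) xs ts) /\
  (* (iii) *)
  ((1 <= n <= 2)%N ->
     (exists p1 p2 p3, [/\ p1 <> p2, p1 <> p3 & p2 <> p3] /\
        glob_minset w = [set p1; p2; p3]%classic /\
        [/\ min_type_A 1 w p1, min_type_A 1 w p2 & min_type_A 1 w p3] /\
        not_collinear p1 p2 p3) ->
     shock_point_type phi0 (@NF_A1_3 R n) xs ts) /\
  (* (iv) *)
  (n = 2%N ->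
     (exists p1 p2 p3 p4,
        [/\ p1 <> p2, p1 <> p3 & p1 <> p4] /\ [/\ p2 <> p3, p2 <> p4 & p3 <> p4] /\
        glob_minset w = [set p1; p2; p3; p4]%classic /\
        [/\ min_type_A 1 w p1, min_type_A 1 w p2, min_type_A 1 w p3
          & min_type_A 1 w p4] /\
        not_coplanar p1 p2 p3 p4) ->
     shock_point_type phi0 (@NF_A1_4 R n) xs ts) /\
  (* (v) *)
  ((1 <= n <= 2)%N ->
     (exists p, glob_minset w = [set p]%classic /\ min_type_A 2 w p /\
        exists Q C, A3_form w p Q C /\ C != 0) ->
     shock_point_type phi0 (@NF_A3 R n) xs ts) /\
  (* (vi) *)
  (n = 2%N ->
     (exists p q, p <> q /\ glob_minset w = [set p; q]%classic /\
        min_type_A 2 w p /\ min_type_A 1 w q /\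
        exists Q C, A3_form w p Q C /\ C != 0 /\ ~ kernel_plane p Q C q) ->
     shock_point_type phi0 (@NF_A1A3 R n) xs ts).
Proof.
move=> phis att ts0 w; split; [|split; [|split; [|split; [|split]]]].
- by move=> _ [p [pm pA]]; exact: (A1_regular phis att ts0 pm pA).
- by move=> _ [p1 [p2 [p12 [pm [A1 A2]]]]]; exact: (A1_2_shock phis att ts0 p12 pm A1 A2).
- by move=> _ [p1 [p2 [p3 [_ [pm [As nc]]]]]]; exact: (A1_3_shock phis att ts0 pm As nc).
- by move=> _ [p1 [p2 [p3 [p4 [_ [_ [pm [As nc]]]]]]]]; exact: (A1_4_shock phis att ts0 pm As nc).
- by move=> _ [p [pm [pA [Q [C [form Cn]]]]]]; exact: (A3_shock phis att ts0 pm pA form Cn).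
- move=> _ [p [q [_ [pm [pA [qA [Q [C [form [Cn nk]]]]]]]]]].
  exact: (A1_A3_shock phis att ts0 pm pA qA form Cn nk).
Qed.
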